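(* Let $f\in\mathcal{X}$, i.e. $f:\mathbb{R}\to[0,\infty)$ is measurable with $\int_{\mathbb{R}}(1+f)\log(1+f)\,dx<\infty$. Then there exists a unique strong solution to the problem $$\partial_t u+(-\Delta)^{1/2}\log(1+u)=0 \ \ (x\in\mathbb{R},\ t>0),\qquad u(x,0)=f(x)\ \ (x\in\mathbb{R}).$$
   Context: $(-\Delta)^{\sigma/2}$ is the operator with Fourier symbol $|\xi|^\sigma$. The space $\dot H^{1/2}(\mathbb{R})$ is the completion of $C_0^\infty(\mathbb{R})$ in the norm $\|\psi\|_{\dot H^{1/2}}=\|(-\Delta)^{1/4}\psi\|_2$. Solutions are nonnegative functions. A function $u\ge 0$ is a weak ($L^1$-energy) solution of the problem with datum $f\in L^1(\mathbb{R})$, $f\ge0$, if: (a) $u\in C([0,\infty):L^1(\mathbb{R}))$ and $\log(1+u)\in L^2((0,T):\dot H^{1/2}(\mathbb{R}))$ for every $T>0$; (b) $\int_0^\infty\int_{\mathbb{R}}u\,\partial_t\varphi\,dx\,dt-\int_0^\infty\int_{\mathbb{R}}(-\Delta)^{1/4}\log(1+u)\,(-\Delta)^{1/4}\varphi\,dx\,dt=0$ for every $\varphi\in C_0^1(\mathbb{R}\times(0,\infty))$; (c) $u(\cdot,0)=f$ a.e. A strong solution is a weak solution with $\partial_t u\in L^1_{\rm loc}((0,\infty)\times\mathbb{R})$. *)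

(* Defs.v *)
From HB Require Import structures.
From mathcomp Require Import all_boot all_order all_algebra.
From mathcomp Require Import all_classical all_reals all_analysis.

Set Implicit Arguments.
Unset Strict Implicit.
Unset Printing Implicit Defensive.

Import Order.TTheory GRing.Theory Num.Theory.
Import numFieldNormedType.Exports.

Local Open Scope classical_set_scope.
Local Open Scope ring_scope.

(* Functions of (x, t) are maps u : R * R -> R with u (x, t); a function on
   R x [0, oo) is such a map, and its values for t < 0 are never used. *)
Section FractionalLogDiffusion.
Context {R : realType}.
Local Notation mu := (@lebesgue_measure R).

(* Real and imaginary parts of \int v(x) exp(- i x xi) dx, for v in L^1. *)
Definition fourier_re (v : R -> R) (xi : R) : R :=
  \int[mu]_x (v x * cos (x * xi)).

Definition fourier_im (v : R -> R) (xi : R) : R :=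
  - \int[mu]_x (v x * sin (x * xi)).

Definition truncate (g : R -> R) (n : nat) (x : R) : R :=
  \1_(`[- n%:R, n%:R]) x * g x.

(* g = (-Delta)^(sigma/2) v, for real-valued v in L^1 and g in L^2: the Fourier
   transform of g is |xi|^sigma times that of v. As g is only in L^2, its
   Fourier transform is the L^2-limit of the Fourier transforms of its
   truncations to [-n, n] (Plancherel), and g is determined a.e. by v. *)
Definition is_fracLap (sigma : R) (v g : R -> R) : Prop :=
  [/\ v \in Lfun mu 1%E,
      g \in Lfun mu 2%:E &
      (\int[mu]_xi
         ((`|xi| `^ sigma * fourier_re v xi - fourier_re (truncate g n) xi) ^+ 2
          + (`|xi| `^ sigma * fourier_im v xi - fourier_im (truncate g n) xi)
             ^+ 2)%:E)%E @[n --> \oo] --> 0%E].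

Definition fracLap_dom (sigma : R) (v : R -> R) : Prop :=
  exists g, is_fracLap sigma v g.

(* (-Delta)^(sigma/2) v; the value is 0 if v is not in the domain. *)
Definition fracLap (sigma : R) (v : R -> R) : R -> R :=
  xget (cst 0) (is_fracLap sigma v).

Definition C0infty (psi : R -> R) : Prop :=
  (forall (n : nat) (x : R), derivable (derive1n n psi) x 1) /\
  (exists2 K : set R, compact K & forall x : R, ~ K x -> psi x = 0).

Definition Hdot_norm (v : R -> R) : \bar R :=
  'N[mu]_2%:E [EFin \o fracLap 2^-1 v]%E.

(* In dimension one the completion of C_0^oo for Hdot_norm is not a space of
   distributions (constants have norm 0). A function v in L^1 is in it when
   (-Delta)^(1/4) v is in L^2 and v is a Hdot_norm-limit of C_0^oo functions.
   Only L^1 functions occur below, since 0 <= log (1 + u) <= u. *)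
Definition in_Hdot (v : R -> R) : Prop :=
  fracLap_dom 2^-1 v /\
  exists psi : nat -> R -> R, (forall n, C0infty (psi n)) /\
    Hdot_norm (v \- psi n) @[n --> \oo] --> 0%E.

Definition Hdot_simple (s : R -> R -> R) : Prop :=
  exists (k : nat) (A : 'I_k -> set R) (psi : 'I_k -> R -> R),
    [/\ (forall i, measurable (A i)), (forall i, in_Hdot (psi i)) &
        s = fun t x => \sum_(i < k) \1_(A i) t * psi i x].

(* The Bochner space L^2((0,T) : Hdot^(1/2)). *)
Definition in_L2_Hdot (T : R) (v : R -> R -> R) : Prop :=
  [/\ {ae mu, forall t, 0 < t < T -> in_Hdot (v t)},
      (exists2 s : nat -> R -> R -> R, (forall n, Hdot_simple (s n)) &
         {ae mu, forall t, 0 < t < T ->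
            Hdot_norm (v t \- s n t) @[n --> \oo] --> 0%E}) &
      (\int[mu]_(t in `]0%R, T[) (Hdot_norm (v t) ^+ 2) < +oo)%E].

Definition in_C_L1 (u : R * R -> R) : Prop :=
  (forall t : R, 0 <= t -> (fun x => u (x, t)) \in Lfun mu 1%E) /\
  (forall t0 : R, 0 <= t0 ->
     ('N[mu]_1%E [(fun x => (u (x, t) - u (x, t0))%:E)])%E
       @[t --> within `[0, +oo[ (nbhs t0)] --> 0%E).

Definition half_plane : set (R * R) := [set p : R * R | 0 < p.2].

Definition dx (phi : R * R -> R) : R * R -> R := 'D_((1, 0) : R * R) phi.
Definition dt (phi : R * R -> R) : R * R -> R := 'D_((0, 1) : R * R) phi.

Fixpoint class_C (k : nat) (phi : R * R -> R) : Prop :=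
  if k is k'.+1 then
    [/\ (forall p : R * R, derivable phi p (1, 0)),
        (forall p : R * R, derivable phi p (0, 1)),
        class_C k' (dx phi) & class_C k' (dt phi)]
  else continuous phi.

(* Compactly supported functions on R x (0, oo) are extended by 0. *)
Definition supported_in_half_plane (phi : R * R -> R) : Prop :=
  exists K : set (R * R),
    [/\ compact K, K `<=` half_plane & forall p, ~ K p -> phi p = 0].

Definition C01_half_plane (phi : R * R -> R) : Prop :=
  class_C 1 phi /\ supported_in_half_plane phi.

Definition C0infty_half_plane (phi : R * R -> R) : Prop :=
  (forall k, class_C k phi) /\ supported_in_half_plane phi.

Definition log1p (u : R * R -> R) (t x : R) : R := ln (1 + u (x, t)).

(* Iterated extended-real integrals; oo - oo = -oo, so the identity below forces
   both of them to be finite. *)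
Definition weak_solution (f : R -> R) (u : R * R -> R) : Prop :=
  [/\ (forall x t : R, 0 <= t -> 0 <= u (x, t)) /\
        measurable_fun [set p : R * R | 0 <= p.2] u,
      in_C_L1 u /\ (forall T : R, 0 < T -> in_L2_Hdot T (log1p u)),
      (forall phi, C01_half_plane phi ->
        \int[mu]_(t in `]0%R, +oo[) \int[mu]_x (u (x, t) * dt phi (x, t))%:E
        - \int[mu]_(t in `]0%R, +oo[) \int[mu]_x
            (fracLap 2^-1 (log1p u t) x
             * fracLap 2^-1 (fun y => phi (y, t)) x)%:E = 0)%E &
      {ae mu, forall x, u (x, 0) = f x}].

Definition L1loc_half_plane (w : R * R -> R) : Prop :=
  measurable_fun half_plane w /\
  forall K : set (R * R), compact K -> K `<=` half_plane ->
    (\int[(mu \x mu)%E]_(p in K) `|w p|%:E < +oo)%E.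

(* The time derivative of u is w in the sense of distributions on
   R x (0, oo). *)
Definition is_weak_dt (u w : R * R -> R) : Prop :=
  forall phi, C0infty_half_plane phi ->
    (\int[mu]_(t in `]0%R, +oo[) \int[mu]_x (u (x, t) * dt phi (x, t))%:E
     = - \int[mu]_(t in `]0%R, +oo[) \int[mu]_x (w (x, t) * phi (x, t))%:E)%E.

Definition strong_solution (f : R -> R) (u : R * R -> R) : Prop :=
  weak_solution f u /\ exists2 w, L1loc_half_plane w & is_weak_dt u w.

Definition in_X (f : R -> R) : Prop :=
  [/\ (forall x, 0 <= f x), measurable_fun setT f &
      (\int[mu]_x ((1 + f x) * ln (1 + f x))%:E < +oo)%E].

End FractionalLogDiffusion.

(* Main.v *)
(* Existence. With w = log (1 + u) and P_h the Poisson semigroup, the scheme u^(n+1) = u^n - (w^n - P_h w^n) / 2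
   has time step h / 2; it is an order-preserving L^1 contraction and dissipates the entropy of the equation.
   For two dyadic step lengths, summation in time on the Fourier side bounds the space-time integral of
   (u_1 - u_2) (w_1 - w_2) by a quantity which vanishes with the steps, so the discrete solutions are Cauchy in
   L^1, uniformly on bounded time intervals: first for bounded data for which the scheme is Lipschitz in time,
   then for all data by contraction. The entropy bound gives w in L^2 (0, T; H^(1/2)), and the weak identity
   passes to the limit. The discrete dissipation of the energy bounds sqrt t times the difference quotient of u,
   divided by sqrt (1 + u), in L^2, uniformly in the step; hence the time derivative of the limit is a function.

   Uniqueness (Oleinik). If z is the difference of two solutions and D that of their logarithms, then
   z (t) = - (-Delta)^(1/2) of the time integral of D up to t. Pairing with D (t) and integrating over (0, T)
   gives minus half the energy of that time integral at T, while z D >= 0; so both sides vanish. *)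

Require Import Defs.
From HB Require Import structures.
From mathcomp Require Import all_boot all_order all_algebra.
From mathcomp Require Import all_classical all_reals all_analysis.
From mathcomp Require Import measurable_realfun ring lra.
Import Order.TTheory GRing.Theory Num.Theory.
Import numFieldNormedType.Exports.
Local Open Scope classical_set_scope.
Local Open Scope ring_scope.

Set Implicit Arguments.
Unset Strict Implicit.
Unset Printing Implicit Defensive.

(** The diffusivity 1 / (1 + u) degenerates where u is large, and data in X need not be bounded.
    Bounds that must hold for all data therefore come from the L^1 contraction and from the entropy.
    The P_h have positive kernels, and the forms [Eh h] built from them increase when h is halved: a
    bound at a fine dyadic level bounds all coarser ones, so that limits in h and in the function
    can be taken one after the other. Written through increments, these forms decrease under
    contractions. Strict monotonicity of the logarithm is quantitative only for bounded u on bounded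
    intervals, hence the weights that control mass near infinity. For the time derivative, sqrt (1 +
    u) is locally in L^2, so its product with a weak L^2 limit is locally integrable. [fracLap] is a
    choice made separately at each time; it is handled through pairings and norms, which the Fourier
    form [EE] expresses. In the uniqueness proof D (t) is neither smooth nor bounded nor compactly
    supported, and has finite energy only at almost every time: it is clipped, cut off, mollified,
    and set to zero at the exceptional times. *)

Local Notation mfun := (measurable_fun setT).

(** * Integrable and square-integrable real functions *)

Section L1L2.
Context d (T : measurableType d) (R : realType).
Variable mu : {measure set T -> \bar R}.
Implicit Types f g : T -> R.

Definition L1 f := mu.-integrable setT (EFin \o f).

Definition L2 f := mfun f /\ L1 (fun x => f x ^+ 2).

Lemma L1_meas f : L1 f -> mfun f.
Proof. by move=> /measurable_int/measurable_EFinP. Qed.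

Lemma L2_meas f : L2 f -> mfun f.
Proof. by case. Qed.

Lemma L1_ext f g : f =1 g -> L1 f -> L1 g.
Proof. by move=> /funext ->. Qed.

Lemma L1_0 : L1 (fun=> 0).
Proof. exact: integrable0. Qed.

Lemma L1D f g : L1 f -> L1 g -> L1 (fun x => f x + g x).
Proof. by move=> hf hg; have := integrableD measurableT hf hg. Qed.

Lemma L1B f g : L1 f -> L1 g -> L1 (fun x => f x - g x).
Proof. by move=> hf hg; have := integrableB measurableT hf hg. Qed.

Lemma L1Z (c : R) f : L1 f -> L1 (fun x => c * f x).
Proof. by move=> hf; have := integrableZl measurableT c hf. Qed.

Lemma L1N f : L1 f -> L1 (fun x => - f x).
Proof. by move=> hf; apply: L1_ext (L1Z (-1) hf) => x; rewrite mulN1r. Qed.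

Lemma L1_le f g : mfun f -> L1 g ->
  (forall x, `|f x| <= g x) -> L1 f.
Proof.
move=> mf ig fg; apply: le_integrable ig => //; first exact/measurable_EFinP.
by move=> x _ /=; rewrite lee_fin (le_trans (fg x))// ler_norm.
Qed.

Lemma L1_abs f : L1 f -> L1 (fun x => `|f x|).
Proof. by move=> h; exact: integrable_norm. Qed.

Lemma L1_sum (I : Type) (r : seq I) (h : I -> T -> R) :
  (forall i, L1 (h i)) -> L1 (fun x => \sum_(i <- r) h i x).
Proof.
move=> hi; elim: r => [|i r ih].
  by apply: L1_ext L1_0 => x; rewrite big_nil.
by apply: L1_ext (L1D (hi i) ih) => x; rewrite big_cons.
Qed.

Lemma I_D f g : L1 f -> L1 g ->
  \int[mu]_x (f x + g x) = \int[mu]_x f x + \int[mu]_x g x.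
Proof. exact: RintegralD. Qed.

Lemma I_B f g : L1 f -> L1 g ->
  \int[mu]_x (f x - g x) = \int[mu]_x f x - \int[mu]_x g x.
Proof. exact: RintegralB. Qed.

Lemma I_Z c f : L1 f -> \int[mu]_x (c * f x) = c * \int[mu]_x f x.
Proof. exact: RintegralZl. Qed.

Lemma I_N f : L1 f -> \int[mu]_x (- f x) = - \int[mu]_x f x.
Proof.
by move=> hf; rewrite -mulN1r -I_Z//; apply: eq_Rintegral => x _; rewrite mulN1r.
Qed.

Lemma I_ext f g : f =1 g -> \int[mu]_x f x = \int[mu]_x g x.
Proof. by move=> fg; apply: eq_Rintegral => x _. Qed.

Lemma I_0 : \int[mu]_x (0 : R) = 0.
Proof. by rewrite /Rintegral integral0. Qed.

Lemma I_zero f : (forall x, f x = 0) -> \int[mu]_x f x = 0.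
Proof. by move=> h; rewrite (I_ext h) I_0. Qed.

Lemma I_sum (I : Type) (r : seq I) (h : I -> T -> R) :
  (forall i, L1 (h i)) ->
  \int[mu]_x (\sum_(i <- r) h i x) = \sum_(i <- r) \int[mu]_x h i x.
Proof.
move=> hi; elim: r => [|i r ih].
  by rewrite big_nil -[RHS]I_0; apply: I_ext => x; rewrite big_nil.
rewrite big_cons -ih -I_D//; last exact: L1_sum.
by apply: I_ext => x; rewrite big_cons.
Qed.

Lemma I_le f g : L1 f -> L1 g -> (forall x, f x <= g x) ->
  \int[mu]_x f x <= \int[mu]_x g x.
Proof. by move=> *; apply: le_Rintegral. Qed.

Lemma I_ge0 f : (forall x, 0 <= f x) -> 0 <= \int[mu]_x f x.
Proof. by move=> h; apply: Rintegral_ge0. Qed.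

Lemma I_abs f : L1 f -> `|\int[mu]_x f x| <= \int[mu]_x `|f x|.
Proof. by move=> h; apply: le_normr_Rintegral. Qed.

Lemma I_abs_le f g : L1 f -> L1 g -> (forall x, `|f x| <= g x) ->
  `|\int[mu]_x f x| <= \int[mu]_x g x.
Proof.
by move=> hf hg fg; apply: le_trans (I_abs hf) _; apply: I_le => //; exact: L1_abs.
Qed.

Lemma L1_integralE f : L1 f -> (\int[mu]_x (f x)%:E)%E = (\int[mu]_x f x)%:E.
Proof. by move=> hf; rewrite fineK//; exact: integrable_fin_num. Qed.

Lemma L1_ge0P f : mfun f -> (forall x, 0 <= f x) ->
  L1 f <-> (\int[mu]_x (f x)%:E < +oo)%E.
Proof.
move=> mf f0; split=> [hf|h]; first by rewrite L1_integralE// ltry.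
apply/integrableP; split; first exact/measurable_EFinP.
by under eq_integral do rewrite /= ger0_norm//.
Qed.

Lemma L1_ge0_le f C : mfun f -> (forall x, 0 <= f x) ->
  (\int[mu]_x (f x)%:E <= C%:E)%E -> L1 f /\ \int[mu]_x f x <= C.
Proof.
move=> mf f0 h; have hf : L1 f by apply/L1_ge0P => //; apply: le_lt_trans h (ltry _).
by split => //; rewrite -lee_fin -L1_integralE.
Qed.

Lemma L2_mul f g : L2 f -> L2 g -> L1 (fun x => f x * g x).
Proof.
move=> [mf hf] [mg hg]; apply: (@L1_le _ (fun x => f x ^+ 2 + g x ^+ 2)).
- exact: measurable_funM.
- exact: L1D.
- move=> x; rewrite ler_norml; apply/andP; split; nra.
Qed.

Lemma L2Z c f : L2 f -> L2 (fun x => c * f x).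
Proof.
move=> [mf hf]; split; first by apply: measurable_funM => //; exact: measurable_cst.
by apply: L1_ext (L1Z (c ^+ 2) hf) => x; rewrite exprMn.
Qed.

Lemma L2D f g : L2 f -> L2 g -> L2 (fun x => f x + g x).
Proof.
move=> hf hg; have [[mf hf2] [mg hg2]] := (hf, hg).
split; first exact: measurable_funD.
apply: L1_ext (L1D (L1D hf2 hg2) (L1Z 2 (L2_mul hf hg))) => x /=; ring.
Qed.

Lemma L2B f g : L2 f -> L2 g -> L2 (fun x => f x - g x).
Proof.
move=> hf hg; have := L2D hf (L2Z (-1) hg).
by congr L2; apply/funext => x; rewrite mulN1r.
Qed.

Lemma L2_le f g : mfun f -> L2 g ->
  (forall x, `|f x| <= `|g x|) -> L2 f.
Proof.
move=> mf [mg hg] fg; split=> //; apply: L1_le hg _.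
  by apply: measurable_funX.
move=> x; rewrite normrX -[leRHS]real_normK ?num_real//.
by rewrite lerXn2r ?nnegrE// normr_ge0.
Qed.

Lemma L2_bounded f M : L1 f -> (forall x, `|f x| <= M) -> L2 f.
Proof.
move=> hf fM; split; first exact: L1_meas.
apply: L1_le (L1Z M (L1_abs hf)) _; first exact/measurable_funX/L1_meas.
by move=> x; rewrite normrX expr2 ler_wpM2r.
Qed.

(** The quadratic polynomial t -> int (f - t g)^2 is nonnegative, so its discriminant is not
    positive. *)
Lemma CS f g : L2 f -> L2 g ->
  (\int[mu]_x (f x * g x)) ^+ 2 <=
  (\int[mu]_x (f x ^+ 2)) * (\int[mu]_x (g x ^+ 2)).
Proof.
move=> hf hg; have [[mf hf2] [mg hg2]] := (hf, hg).
set A := \int[mu]_x (f x ^+ 2); set C := \int[mu]_x (g x ^+ 2).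
set B := \int[mu]_x (f x * g x).
have q t : 0 <= A - 2 * t * B + t ^+ 2 * C.
  rewrite -[X in _ <= X](_ : \int[mu]_x ((f x - t * g x) ^+ 2) = _).
    by apply: I_ge0 => x; rewrite sqr_ge0.
  rewrite -!I_Z//; last exact: L2_mul.
  rewrite -I_B//; last by apply: L1Z; exact: L2_mul.
  rewrite -I_D//; last 2 first.
  - by apply: L1B => //; apply: L1Z; exact: L2_mul.
  - exact: L1Z.
  by apply: I_ext => x; ring.
have A0 : 0 <= A by apply: I_ge0 => x; exact: sqr_ge0.
have C0 : 0 <= C by apply: I_ge0 => x; exact: sqr_ge0.
have [C00|Cneq0] := eqVneq C 0.
  have [->|B0] := eqVneq B 0; first by rewrite expr0n mulr_ge0.
  (* When C = 0 the polynomial is affine in t, and this t would give it the value -1. *)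
  have := q ((A + 1) / (2 * B)).
  have -> : A - 2 * ((A + 1) / (2 * B)) * B = -1 by field.
  by rewrite C00; nra.
have := q (B / C).
have -> : A - 2 * (B / C) * B + (B / C) ^+ 2 * C = (A * C - B ^+ 2) / C by field.
by rewrite pmulr_lge0 ?subr_ge0// invr_gt0 lt_neqAle eq_sym Cneq0.
Qed.

Lemma CS_abs f g : L2 f -> L2 g ->
  `|\int[mu]_x (f x * g x)| <=
  Num.sqrt (\int[mu]_x (f x ^+ 2)) * Num.sqrt (\int[mu]_x (g x ^+ 2)).
Proof.
move=> hf hg; rewrite -sqrtrM; last by apply: I_ge0 => x; exact: sqr_ge0.
by rewrite -sqrtr_sqr ler_wsqrtr// CS.
Qed.

Lemma I_sqrD f g : L2 f -> L2 g ->
  \int[mu]_x ((f x + g x) ^+ 2) = \int[mu]_x (f x ^+ 2)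
    + 2 * \int[mu]_x (f x * g x) + \int[mu]_x (g x ^+ 2).
Proof.
move=> hf hg; have [[mf hf2] [mg hg2]] := (hf, hg); have fg := L2_mul hf hg.
rewrite -I_Z// -!I_D//; [by apply: I_ext => x; ring|by apply: L1D => //; exact: L1Z|exact: L1Z].
Qed.

Lemma I_sqrD_le f g : L2 f -> L2 g ->
  \int[mu]_x ((f x + g x) ^+ 2) <= 2 * \int[mu]_x (f x ^+ 2)
    + 2 * \int[mu]_x (g x ^+ 2).
Proof.
move=> hf hg; have [[mf hf2] [mg hg2]] := (hf, hg).
rewrite -!I_Z// -I_D//; try exact: L1Z.
apply: I_le; first by have [] := L2D hf hg.
  by apply: L1D; exact: L1Z.
move=> x; rewrite -subr_ge0.
have -> : 2 * f x ^+ 2 + 2 * g x ^+ 2 - (f x + g x) ^+ 2 = (f x - g x) ^+ 2 by ring.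
exact: sqr_ge0.
Qed.

Lemma ae_I f g : mfun f -> mfun g ->
  {ae mu, forall x, f x = g x} -> \int[mu]_x f x = \int[mu]_x g x.
Proof.
move=> mf mg fg; congr fine; apply: ae_eq_integral => //; try exact/measurable_EFinP.
by apply: filterS fg => x -> _.
Qed.

Lemma I_eq0 f : L1 f -> (forall x, 0 <= f x) -> \int[mu]_x f x = 0 ->
  {ae mu, forall x, f x = 0}.
Proof.
move=> hf f0 h; have mf := L1_meas hf.
have : (\int[mu]_x `|(f x)%:E| = 0)%E.
  under eq_integral do rewrite /= ger0_norm//.
  by rewrite L1_integralE// h.
rewrite (ae_eq_integral_abs mu measurableT); last exact/measurable_EFinP.
by apply: filterS => x /(_ I) [].
Qed.

End L1L2.

(** * Limit theorems and completeness *)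

Section convergence.
Context d (T : measurableType d) (R : realType).
Variable mu : {measure set T -> \bar R}.
Implicit Types f g : T -> R.

Lemma DCT (f_ : nat -> T -> R) f g :
  (forall n, mfun (f_ n)) -> mfun f ->
  {ae mu, forall x, f_ ^~ x @ \oo --> f x} -> L1 mu g ->
  (forall n x, `|f_ n x| <= g x) ->
  [/\ L1 mu f, \int[mu]_x f_ n x @[n --> \oo] --> \int[mu]_x f x &
      \int[mu]_x `|f_ n x - f x| @[n --> \oo] --> (0 : R)].
Proof.
move=> mf_ mf cf hg fg.
have [] := @dominated_convergence _ T R mu setT measurableT
  (fun n x => (f_ n x)%:E) (EFin \o f) (EFin \o g).
- by move=> n; apply/measurable_EFinP.
- exact/measurable_EFinP.
- by apply: filterS cf => x h _; apply: cvg_EFin => //; exact: nearW.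
- by [].
- by apply: aeW => x n _; rewrite lee_fin.
move=> hf h0 h1; have hfn n : L1 mu (f_ n) by apply: L1_le hg _.
split=> //.
  have /fine_cvgP[_] : (\int[mu]_x (f_ n x)%:E)%E @[n --> \oo] --> (\int[mu]_x f x)%:E.
    by rewrite -L1_integralE.
  by apply: cvg_trans; apply: near_eq_cvg; apply: nearW => n.
have /fine_cvgP[_] : (\int[mu]_x `|f_ n x - f x|%:E)%E @[n --> \oo] --> (0%:E : \bar R).
  by apply: cvg_trans h0; apply: near_eq_cvg; apply: nearW => n; apply: eq_integral.
by apply: cvg_trans; apply: near_eq_cvg; apply: nearW => n.
Qed.

(** The bound concerns extended integrals, so that integrability of the limit comes out together
    with the estimate. *)
Lemma Fatou (f_ : nat -> T -> R) f C :
  (forall n, mfun (f_ n)) -> mfun f ->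
  (forall n x, 0 <= f_ n x) -> (forall x, 0 <= f x) ->
  {ae mu, forall x, f_ ^~ x @ \oo --> f x} ->
  (forall n, (\int[mu]_x (f_ n x)%:E <= C%:E)%E) ->
  L1 mu f /\ \int[mu]_x f x <= C.
Proof.
move=> mf_ mf f_0 f0 cf IC; apply: L1_ge0_le => //.
have mE n : mfun (EFin \o f_ n) by apply/measurable_EFinP.
have -> : (\int[mu]_x (f x)%:E = \int[mu]_x limn_einf (fun n => (f_ n x)%:E))%E.
  apply: ae_eq_integral => //; first exact/measurable_EFinP.
    rewrite /limn_einf; apply: measurableT_comp => //.
    by apply: measurable_fun_limn_esup => n; apply: measurableT_comp => //; exact: mE.
  apply: filterS cf => x cx _ /=; apply/esym.
  have cE : (f_ n x)%:E @[n --> \oo] --> (f x)%:E.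
    by apply: cvg_EFin => //; exact: nearW.
  by rewrite is_cvg_limn_einfE; [apply/cvg_lim => //|apply/cvg_ex; exists (f x)%:E].
apply: le_trans (fatou mu measurableT mE _) _.
  by move=> n x _ /=; rewrite lee_fin.
apply: le_trans (limn_einf_sup _) _.
rewrite limn_esup_lim; apply: lime_le; first exact: is_cvg_esups.
by apply: nearW => n; apply: ge_ereal_sup => _ [k _ <-]; exact: IC.
Qed.

(** By monotone convergence the sum of the series has integral at most [B], so it is finite almost
    everywhere. *)
Lemma Fatou_series (f_ : nat -> T -> R) (C : nat -> R) B :
  (forall n, L1 mu (f_ n)) -> (forall n x, 0 <= f_ n x) ->
  (forall n, \int[mu]_x f_ n x <= C n) ->
  (forall n, \sum_(k < n) C k <= B) ->
  {ae mu, forall x, cvgn (series (f_ ^~ x))}.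
Proof.
move=> hf f0 IC CB.
have mE n : mfun (EFin \o f_ n) by apply/measurable_EFinP/(L1_meas (hf n)).
have key : (\int[mu]_x (\sum_(n <oo) (f_ n x)%:E) <= B%:E)%E.
  rewrite integral_nneseries//; last by move=> n x _; rewrite lee_fin.
  apply: lime_le.
    by apply: is_cvg_nneseries => n _ _; apply: integral_ge0 => x _; rewrite lee_fin.
  apply: nearW => n; apply: le_trans (_ : ((\sum_(k < n) C k)%:E <= _)%E); last by rewrite lee_fin.
  rewrite -sumEFin big_mkord; apply: lee_sum => k _.
  by rewrite L1_integralE// lee_fin.
have mS : mfun (fun x => \sum_(n <oo) (f_ n x)%:E)%E.
  by apply: ge0_emeasurable_sum => [n x _ _|n _]; rewrite ?lee_fin//; exact: mE.
have S0 x : (0 <= \sum_(n <oo) (f_ n x)%:E)%E.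
  by apply: nneseries_ge0 => n _ _; rewrite lee_fin.
have iS : mu.-integrable setT (fun x => \sum_(n <oo) (f_ n x)%:E)%E.
  apply/integrableP; split => //.
  under eq_integral do rewrite gee0_abs//.
  exact: le_lt_trans key (ltry _).
have := integrable_ae measurableT iS.
apply: filterS => x /(_ I) fx.
apply: nondecreasing_is_cvgn.
  apply/nondecreasing_seqP => n; rewrite /series/= big_nat_recr//= lerDl; exact: f0.
exists (fine (\sum_(n <oo) (f_ n x)%:E)%E) => _ [n _ <-].
rewrite -lee_fin fineK// /series/= -sumEFin.
by apply: nneseries_lim_ge => k _; rewrite lee_fin.
Qed.

(** Defined by the upper limit, hence measurable without any convergence, and computed pointwise: on
    a product space its sections are the [limfun] of the sections. *)
Definition limfun (f_ : nat -> T -> R) (x : T) : R :=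
  fine (limn_esup (fun n => (f_ n x)%:E)).

Lemma measurable_limfun (f_ : nat -> T -> R) : (forall n, mfun (f_ n)) ->
  mfun (limfun f_).
Proof.
move=> mf; apply: (measurableT_comp (f := fine)) => //.
by apply: measurable_fun_limn_esup => n; apply/measurable_EFinP.
Qed.

Lemma limfunE (f_ : nat -> T -> R) x (l : R) : f_ ^~ x @ \oo --> l -> limfun f_ x = l.
Proof.
move=> h; rewrite /limfun.
have cE : (f_ n x)%:E @[n --> \oo] --> l%:E by apply: cvg_EFin => //; exact: nearW.
by have [_ ->] := cvg_limn_einf_sup cE.
Qed.

Lemma cvg_of_series (u : nat -> R) :
  cvgn (series (fun n => `|u n.+1 - u n|)) -> cvgn u.
Proof.
move=> h; have := @normed_cvg R R^o (fun n => u n.+1 - u n) h.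
move/cvg_ex => [l hl]; apply/cvg_ex; exists (u 0%N + l).
have E : u = (fun n => u 0%N + series (fun n => u n.+1 - u n) n).
  apply/funext => n; rewrite /series/= telescope_sumr// addrC subrK//.
rewrite [X in X @ _]E.
by apply: cvgD => //; exact: cvg_cst.
Qed.

Lemma sum_half_le n : \sum_(k < n) ((2 : R)^-1) ^+ k <= 2.
Proof.
have -> : \sum_(k < n) ((2 : R)^-1) ^+ k = 2 - 2 * 2^-1 ^+ n.
  elim: n => [|n ih]; first by rewrite big_ord0 expr0; ring.
  by rewrite big_ord_recr/= ih exprS; field.
by rewrite gerBl mulr_ge0// exprn_ge0// invr_ge0.
Qed.

Lemma L1_rapid_ae (f_ : nat -> T -> R) k0 :
  (forall n, L1 mu (f_ n)) ->
  (forall n, (k0 <= n)%N -> \int[mu]_x `|f_ n.+1 x - f_ n x| <= 2^-1 ^+ n) ->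
  {ae mu, forall x, f_ ^~ x @ \oo --> limfun f_ x}.
Proof.
move=> hf hd.
have := @Fatou_series (fun n x => `|f_ (n + k0).+1 x - f_ (n + k0)%N x|)
  (fun n => 2^-1 ^+ n) 2.
case/(_ _ _ _ _)/Wrap => //.
- by move=> n; apply: L1_abs; exact: L1B.
- move=> n; apply: le_trans (hd _ _) _; first exact: leq_addl.
  by rewrite exprD ler_piMr ?exprn_ge0 ?exprn_ile1 ?invr_ge0// invf_le1// ler1n.
- exact: sum_half_le.
apply: filterS => x.
move=> /(@cvg_of_series (fun n => f_ (n + k0)%N x)) /cvg_ex [l hl].
have {}hl : f_ ^~ x @ \oo --> l by rewrite -(cvg_shiftn k0).
by rewrite (limfunE hl).
Qed.

(** Decay is asked only from [k0] on because the approximations of the solution at time t are close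
    to each other only at levels above t. *)
Lemma L1_rapid (f_ : nat -> T -> R) k0 :
  (forall n, L1 mu (f_ n)) ->
  (forall n, (k0 <= n)%N -> \int[mu]_x `|f_ n.+1 x - f_ n x| <= 2^-1 ^+ n) ->
  L1 mu (limfun f_) /\
  forall n, (k0 <= n)%N -> \int[mu]_x `|f_ n x - limfun f_ x| <= 2 * 2^-1 ^+ n.
Proof.
move=> hf hd; have ae := L1_rapid_ae hf hd.
have mf n := L1_meas (hf n).
have ml : mfun (limfun f_) by exact: measurable_limfun.
have step n p : (k0 <= n)%N ->
    \int[mu]_x `|f_ n x - f_ (n + p)%N x| <= (2 - 2 * 2^-1 ^+ p) * 2^-1 ^+ n.
  move=> kn; elim: p => [|p ih].
    rewrite expr0 mulr1 subrr mul0r addn0 le_eqVlt; apply/orP; left; apply/eqP.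
    by rewrite -[RHS](I_0 mu); apply: I_ext => x; rewrite subrr normr0.
  have h : \int[mu]_x `|f_ n x - f_ (n + p.+1)%N x| <=
      \int[mu]_x (`|f_ n x - f_ (n + p)%N x| + `|f_ (n + p).+1 x - f_ (n + p)%N x|).
    apply: I_le; try (by apply: L1_abs; exact: L1B).
      by apply: L1D; apply: L1_abs; exact: L1B.
    move=> x; rewrite addnS [in leRHS](distrC (f_ (n + p).+1 x)); exact: ler_distD.
  apply: le_trans h _; rewrite I_D; try (by apply: L1_abs; exact: L1B).
  have := hd (n + p)%N (leq_trans kn (leq_addr _ _)).
  move=> h; apply: le_trans (lerD ih h) _; rewrite exprD exprS le_eqVlt; apply/orP; left.
  by apply/eqP; field.
have main n : (k0 <= n)%N -> L1 mu (fun x => `|f_ n x - limfun f_ x|) /\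
   \int[mu]_x `|f_ n x - limfun f_ x| <= 2 * 2^-1 ^+ n.
  move=> kn; apply: (@Fatou (fun p x => `|f_ n x - f_ (n + p)%N x|)) => //.
  - by move=> p; apply: measurableT_comp => //; exact: measurable_funB.
  - by apply: measurableT_comp => //; exact: measurable_funB.
  - apply: filterS ae => x h; apply: cvg_norm; apply: cvgB; first exact: cvg_cst.
    by move: h; rewrite -(cvg_shiftn n) => h; under eq_fun do rewrite addnC.
  - move=> p; rewrite L1_integralE; last by apply: L1_abs; exact: L1B.
    rewrite lee_fin; apply: le_trans (step n p kn) _.
    rewrite ler_wpM2r ?exprn_ge0 ?invr_ge0//.
    by rewrite gerBl mulr_ge0// exprn_ge0// invr_ge0.
split; last by move=> n kn; have [] := main n kn.
have [h _] := main k0 (leqnn _).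
have h2 : L1 mu (fun x => f_ k0 x - limfun f_ x).
  by apply: L1_le h _ => //; exact: measurable_funB.
apply: L1_ext (L1B (hf k0) h2) => x; ring.
Qed.

(** Riesz-Fischer: a subsequence with squared distances at most 4^-k converges almost everywhere,
    and Fatou transfers the Cauchy bounds to its limit. *)
Lemma L2_complete (f_ : nat -> T -> R) :
  (forall n, L2 mu (f_ n)) ->
  (forall e : R, 0 < e -> exists N, forall n m, (N <= n)%N -> (N <= m)%N ->
     \int[mu]_x ((f_ n x - f_ m x) ^+ 2) <= e) ->
  exists f, L2 mu f /\ \int[mu]_x ((f_ n x - f x) ^+ 2) @[n --> \oo] --> (0 : R).
Proof.
move=> hf hC.
have [s hs] : exists s : nat -> nat, forall k,
    (s k < s k.+1)%N /\ forall n, (s k <= n)%N ->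
     \int[mu]_x ((f_ n x - f_ (s k) x) ^+ 2) <= 4^-1 ^+ k.
  have ex k : exists N, forall n m, (N <= n)%N -> (N <= m)%N ->
     \int[mu]_x ((f_ n x - f_ m x) ^+ 2) <= 4^-1 ^+ k.
    by apply: hC; rewrite exprn_gt0.
  have [N hN] := choice ex.
  pose s := fix s k := if k is k'.+1 then (maxn (s k').+1 (N k)) else N 0%N.
  exists s => k; split; first by rewrite /= leq_max leqnn.
  have Ns : (N k <= s k)%N by case: k => //= k; rewrite leq_maxr.
  by move=> n sn; apply: hN => //; exact: leq_trans Ns sn.
have smono k p : (s k <= s (k + p)%N)%N.
  elim: p => [|p ih]; first by rewrite addn0.
  by rewrite addnS; apply: leq_trans ih (ltnW _); have [] := hs (k + p)%N.
have hB n m := L2B (hf n) (hf m).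
have ae : {ae mu, forall x, (fun k => f_ (s k) x) @ \oo --> limfun (fun k => f_ (s k)) x}.
  (* The weight 2^k leaves integrals at most 2^-k, and |a| <= 2^k a^2 + 2^-k then makes the
     increments themselves summable. *)
  have := @Fatou_series (fun k x => 2 ^+ k * (f_ (s k.+1) x - f_ (s k) x) ^+ 2)
    (fun n => 2^-1 ^+ n) 2.
  case/(_ _ _ _ _)/Wrap => //.
  - by move=> n; apply: L1Z; have [] := hB (s n.+1) (s n).
  - by move=> n x; apply: mulr_ge0; [exact: exprn_ge0|exact: sqr_ge0].
  - move=> n; rewrite I_Z; last by have [] := hB (s n.+1) (s n).
    have [_ /(_ (s n.+1))] := hs n; have := smono n 1%N; rewrite addn1 => -> /(_ isT) h.
    apply: le_trans (ler_wpM2l _ h) _; first exact: exprn_ge0.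
    rewrite -exprMn le_eqVlt; apply/orP; left; apply/eqP; congr (_ ^+ _); by field.
  - exact: sum_half_le.
  apply: filterS => x h.
  suff /cvg_ex [l hl] : cvgn (fun k => f_ (s k) x) by rewrite (limfunE hl).
  apply: cvg_of_series.
  have h2 : cvgn (series (fun k => (2^-1 : R) ^+ k)).
    by rewrite exprn_geometric; apply: is_cvg_geometric_series; rewrite ger0_norm ?invr_ge0// invf_lt1// ltr1n.
  apply: (@series_le_cvg _ _ (fun k => 2 ^+ k * (f_ (s k.+1) x - f_ (s k) x) ^+ 2 + 2^-1 ^+ k)).
  - by [].
  - move=> n; apply: addr_ge0; last by rewrite exprn_ge0// invr_ge0.
    by apply: mulr_ge0; [exact: exprn_ge0|exact: sqr_ge0].
  - move=> n; set a := `| _ |.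
    have -> : (f_ (s n.+1) x - f_ (s n) x) ^+ 2 = a ^+ 2 by rewrite real_normK// num_real.
    have a0 : 0 <= a by exact: normr_ge0.
    have c0 : 0 < (2 : R) ^+ n by rewrite exprn_gt0.
    rewrite exprVn -subr_ge0.
    have -> : 2 ^+ n * a ^+ 2 + (2 ^+ n)^-1 - a =
      2^-1 * ((2 ^+ n * a - 1) ^+ 2 + (2 ^+ n * a) ^+ 2 + 1) / 2 ^+ n.
      by field; rewrite gt_eqF.
    apply: divr_ge0; last exact: ltW.
    apply: mulr_ge0; first by rewrite invr_ge0.
    by apply: addr_ge0 => //; apply: addr_ge0; exact: sqr_ge0.
  - exact: is_cvg_seriesD.
set f := limfun _ in ae.
have mf : mfun f by apply: measurable_limfun => k; exact: L2_meas.
have main n k : (s k <= n)%N -> L1 mu (fun x => (f_ n x - f x) ^+ 2) /\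
   \int[mu]_x ((f_ n x - f x) ^+ 2) <= 4 * 4^-1 ^+ k.
  move=> sn; apply: (@Fatou (fun p x => (f_ n x - f_ (s (p + k)%N) x) ^+ 2)).
  - by move=> p; apply: measurable_funX; exact: L2_meas.
  - by apply: measurable_funX; apply: measurable_funB => //; exact: L2_meas.
  - by move=> p x; exact: sqr_ge0.
  - by move=> x; exact: sqr_ge0.
  - apply: filterS ae => x h.
    have h' : (fun p => f_ n x - f_ (s (p + k)%N) x) @ \oo --> f_ n x - f x.
      apply: cvgB; first exact: cvg_cst.
      by move: h; rewrite -(cvg_shiftn k).
    by under eq_fun do rewrite expr2; rewrite expr2; exact: cvgM.
  - move=> p; have [_ h] := hB n (s (p + k)%N); rewrite L1_integralE// lee_fin.
    have -> : \int[mu]_x ((f_ n x - f_ (s (p + k)%N) x) ^+ 2) =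
       \int[mu]_x (((f_ n x - f_ (s k) x) + (f_ (s k) x - f_ (s (p + k)%N) x)) ^+ 2).
      by apply: I_ext => x; congr (_ ^+ 2); ring.
    apply: le_trans (I_sqrD_le (hB _ _) (hB _ _)) _.
    have h1 := (hs k).2 n sn.
    have h2 : \int[mu]_x ((f_ (s k) x - f_ (s (p + k)%N) x) ^+ 2) <= 4^-1 ^+ k.
      rewrite -[leLHS](_ : \int[mu]_x ((f_ (s (p + k)%N) x - f_ (s k) x) ^+ 2) = _).
        by apply: (hs k).2; rewrite addnC.
      by apply: I_ext => x; rewrite -sqrrN opprB.
    lra.
have fL2 : L2 mu f.
  have [h _] := main (s 0%N) 0%N (leqnn _).
  have h2 : L2 mu (fun x => f_ (s 0%N) x - f x).
    by split => //; apply: measurable_funB => //; exact: L2_meas.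
  have := L2B (hf (s 0%N)) h2; congr L2; apply/funext => x; ring.
exists f; split => //.
apply/cvgrPdist_le => e e0.
have : (4 * 4^-1 ^+ k : R) @[k --> \oo] --> (0 : R).
  rewrite -[X in _ --> X](mulr0 4); apply: cvgM; first exact: cvg_cst.
  by apply: cvg_expr; rewrite ger0_norm ?invr_ge0// invf_lt1// ltr1n.
move/cvgrPdist_le => /(_ e e0) [K _ hK].
exists (s K) => // n /= sn; rewrite sub0r normrN ger0_norm; last by apply: I_ge0 => x; exact: sqr_ge0.
apply: le_trans (main n K sn).2 _.
by have := hK K (leqnn _); rewrite sub0r normrN ger0_norm// mulr_ge0// exprn_ge0// invr_ge0.
Qed.

Lemma L1_subseq_ae (f_ : nat -> T -> R) f :
  (forall n, L1 mu (f_ n)) -> L1 mu f ->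
  \int[mu]_x `|f_ n x - f x| @[n --> \oo] --> (0 : R) ->
  exists s : nat -> nat, (forall k, (k <= s k)%N) /\
    {ae mu, forall x, (fun k => f_ (s k) x) @ \oo --> f x}.
Proof.
move=> hf hf0 hc.
have ex k : exists n, (k <= n)%N /\ \int[mu]_x `|f_ n x - f x| <= 2^-1 ^+ k.
  have : (0 : R) < 2^-1 ^+ k by rewrite exprn_gt0.
  move/cvgrPdist_le : hc => /[apply] -[N _ hN].
  exists (maxn k N); split; first exact: leq_maxl.
  have := hN (maxn k N) (leq_maxr _ _); rewrite sub0r normrN ger0_norm//.
  by apply: I_ge0 => x.
have [s hs] := choice ex; exists s; split; first by move=> k; have [] := hs k.
have := @Fatou_series (fun k x => `|f_ (s k) x - f x|) (fun n => 2^-1 ^+ n) 2.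
case/(_ _ _ _ _)/Wrap => //.
- by move=> n; apply: L1_abs; exact: L1B.
- by move=> n; have [] := hs n.
- exact: sum_half_le.
apply: filterS => x /cvg_series_cvg_0 h.
apply/cvgrPdist_le => e e0; move/cvgrPdist_le : h => /(_ e e0) [N _ hN].
by exists N => // n /hN; rewrite sub0r normrN normr_id distrC.
Qed.

End convergence.

(** * Fubini theorems for real-valued integrals *)

Section fubini_real.
Context d1 d2 (T1 : measurableType d1) (T2 : measurableType d2) (R : realType).
Variable m1 : {sigma_finite_measure set T1 -> \bar R}.
Variable m2 : {sigma_finite_measure set T2 -> \bar R}.
Implicit Types F : T1 * T2 -> R.

Lemma emeasurable_int2 (f : T1 * T2 -> \bar R) : mfun f ->
  mfun (fun x => \int[m2]_y f (x, y))%E.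
Proof.
move=> mf.
have -> : (fun x => \int[m2]_y f (x, y))%E =
   (fun x => \int[m2]_y (f^\+ (x, y)) - \int[m2]_y (f^\- (x, y)))%E.
  apply/funext => x; rewrite [LHS]integralE.
  under eq_integral do rewrite funepos_comp/=.
  by under [X in (_ - X)%E = _]eq_integral do rewrite funeneg_comp/=.
apply: emeasurable_funB.
  by apply: (measurable_fun_fubini_tonelli_F (f^\+)%E) => //; exact: measurable_funepos.
by apply: (measurable_fun_fubini_tonelli_F (f^\-)%E) => //; exact: measurable_funeneg.
Qed.

Lemma emeasurable_int1 (f : T1 * T2 -> \bar R) : mfun f ->
  mfun (fun y => \int[m1]_x f (x, y))%E.
Proof.
move=> mf.
have -> : (fun y => \int[m1]_x f (x, y))%E =
   (fun y => \int[m1]_x (f^\+ (x, y)) - \int[m1]_x (f^\- (x, y)))%E.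
  apply/funext => y; rewrite [LHS]integralE.
  congr (_ - _)%E; apply: eq_integral => x _.
    by rewrite !unlock.
  by rewrite !unlock.
apply: emeasurable_funB.
  by apply: (measurable_fun_fubini_tonelli_G (f^\+)%E) => //; exact: measurable_funepos.
by apply: (measurable_fun_fubini_tonelli_G (f^\-)%E) => //; exact: measurable_funeneg.
Qed.

Lemma measurable_I2 F : mfun F ->
  mfun (fun x => \int[m2]_y F (x, y)).
Proof.
move=> mF; apply: (measurableT_comp (f := fine)) => //.
by apply: (@emeasurable_int2 (EFin \o F)); exact/measurable_EFinP.
Qed.

Lemma measurable_I1 F : mfun F ->
  mfun (fun y => \int[m1]_x F (x, y)).
Proof.
move=> mF; apply: (measurableT_comp (f := fine)) => //.
by apply: (@emeasurable_int1 (EFin \o F)); exact/measurable_EFinP.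
Qed.

Lemma L1_prod1 F (g : T1 -> R) : mfun F ->
  (forall x, L1 m2 (fun y => F (x, y))) ->
  (forall x, \int[m2]_y `|F (x, y)| <= g x) -> L1 m1 g ->
  L1 (m1 \x m2)%E F.
Proof.
move=> mF hF Fg hg; have mE : mfun (EFin \o F) by exact/measurable_EFinP.
apply/integrable12ltyP => //=.
have /integrableP[mg hg2] := hg; apply: le_lt_trans hg2.
apply: ge0_le_integral => //.
- by move=> x _; apply: integral_ge0.
- apply: (measurable_fun_fubini_tonelli_F (abse \o (EFin \o F))) => //=.
  exact: measurableT_comp.
- exact: measurableT_comp.
- move=> x _ /=; rewrite (L1_integralE (L1_abs (hF x))) lee_fin.
  exact: le_trans (Fg x) (ler_norm _).
Qed.

Lemma L1_prod2 F (g : T2 -> R) : mfun F ->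
  (forall y, L1 m1 (fun x => F (x, y))) ->
  (forall y, \int[m1]_x `|F (x, y)| <= g y) -> L1 m2 g ->
  L1 (m1 \x m2)%E F.
Proof.
move=> mF hF Fg hg; have mE : mfun (EFin \o F) by exact/measurable_EFinP.
apply/integrable21ltyP => //=.
have /integrableP[mg hg2] := hg; apply: le_lt_trans hg2.
apply: ge0_le_integral => //.
- by move=> x _; apply: integral_ge0.
- apply: (measurable_fun_fubini_tonelli_G (abse \o (EFin \o F))) => //=.
  exact: measurableT_comp.
- exact: measurableT_comp.
- move=> x _ /=; rewrite (L1_integralE (L1_abs (hF x))) lee_fin.
  exact: le_trans (Fg x) (ler_norm _).
Qed.

Lemma L1_sect1 F : L1 (m1 \x m2)%E F -> {ae m1, forall x, L1 m2 (fun y => F (x, y))}.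
Proof. by move=> hF; have := ae_integrable1 hF. Qed.

(** Where the extended inner integral is infinite, [fine] gives 0, so the real inner integral is
    dominated by the extended one at every point. *)
Lemma L1_I2 F : L1 (m1 \x m2)%E F -> L1 m1 (fun x => \int[m2]_y F (x, y)).
Proof.
move=> hF; have hG := integrable_fubini_F hF.
have mI := measurable_I2 (L1_meas hF).
apply: le_integrable hG => //; first exact/measurable_EFinP.
move=> x _ /=; rewrite /fubini_F /Rintegral /=.
by case: (\int[m2]_y (F (x, y))%:E)%E => //=; rewrite normr0 leey.
Qed.

Lemma I_prod1 F : L1 (m1 \x m2)%E F ->
  \int[(m1 \x m2)%E]_z F z = \int[m1]_x \int[m2]_y F (x, y).
Proof.
move=> hF; have hG := integrable_fubini_F hF.
rewrite /Rintegral -(integral12_prod_meas1 hF); congr fine.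
apply: ae_eq_integral => //.
- exact: measurable_int hG.
- by apply/measurable_EFinP; apply: measurable_I2; exact: L1_meas hF.
- have := integrable_ae measurableT hG; apply: filterS => x /(_ I) fx _.
  by rewrite fineK.
Qed.

Lemma L1_I1 F : L1 (m1 \x m2)%E F -> L1 m2 (fun y => \int[m1]_x F (x, y)).
Proof.
move=> hF; have mF := L1_meas hF; have mI := measurable_I1 mF.
have mE : mfun (EFin \o F) by exact/measurable_EFinP.
have /(integrable21ltyP _ _ mE) h := hF.
apply/integrableP; split; first exact/measurable_EFinP.
apply: le_lt_trans h; apply: ge0_le_integral => //.
- by do 2 apply: measurableT_comp => //.
- apply: (measurable_fun_fubini_tonelli_G (abse \o (EFin \o F))) => //=.
  exact: measurableT_comp.
- move=> y _ /=; apply: (@le_trans _ _ `|\int[m1]_x (F (x, y))%:E|%E).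
    rewrite /Rintegral; case: (\int[m1]_x (F (x, y))%:E)%E => //=; rewrite normr0 leey//.
  apply: le_abse_integral => //; apply/measurable_EFinP.
  by apply: (measurableT_comp mF); exact: measurable_pair2.
Qed.

Lemma I_prod2 F : L1 (m1 \x m2)%E F ->
  \int[(m1 \x m2)%E]_z F z = \int[m2]_y \int[m1]_x F (x, y).
Proof.
move=> hF; have mE := L1_meas hF.
rewrite /Rintegral -(integral21_prod_meas1 hF); congr fine.
apply: ae_eq_integral => //.
- by apply: (@emeasurable_int1 (EFin \o F)); exact/measurable_EFinP.
- by apply/measurable_EFinP; apply: measurable_I1; exact: L1_meas hF.
- have := ae_integrable2 hF; apply: filterS => y fx _.
  by rewrite /fubini_G fineK//; exact: integrable_fin_num.
Qed.

Lemma I_swap F : L1 (m1 \x m2)%E F ->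
  \int[m1]_x \int[m2]_y F (x, y) = \int[m2]_y \int[m1]_x F (x, y).
Proof. by move=> hF; rewrite -I_prod1// I_prod2. Qed.

End fubini_real.

Lemma halves_le (R : realType) (a b e : R) : a <= e / 2 -> b <= e / 2 -> a + b <= e.
Proof. lra. Qed.

Section squeeze.
Context {R : realType}.

Lemma cvg0_le (T : Type) (F : set_system T) (FF : Filter F) (f g : T -> R) :
  (forall x, `|f x| <= g x) -> g x @[x --> F] --> (0 : R) -> f x @[x --> F] --> (0 : R).
Proof.
move=> fg g0; apply: (@squeeze_cvgr _ _ FF _ (fun x => - g x) g).
- by apply: nearW => x; rewrite -ler_norml.
- by rewrite -oppr0; exact: cvgN.
- exact: g0.
Qed.

Lemma cvg_le (T : Type) (F : set_system T) (FF : Filter F) (f g : T -> R) (l : R) :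
  (forall x, `|f x - l| <= g x) -> g x @[x --> F] --> (0 : R) -> f x @[x --> F] --> l.
Proof.
move=> fg g0; have h := cvg0_le FF fg g0.
have -> : f = (fun x => (f x - l) + l) by apply/funext => x; rewrite subrK.
by rewrite -[X in _ --> X]add0r; apply: cvgD; [exact: h|exact: cvg_cst].
Qed.

Lemma cvg0_Zl (T : Type) (F : set_system T) (FF : Filter F) (k : R) (f : T -> R) :
  f x @[x --> F] --> (0 : R) -> k * f x @[x --> F] --> (0 : R).
Proof. by move=> h; rewrite -[X in _ --> X](mulr0 k); apply: cvgM => //; exact: cvg_cst. Qed.

Lemma cvg0_Zr (T : Type) (F : set_system T) (FF : Filter F) (k : R) (f : T -> R) :
  f x @[x --> F] --> (0 : R) -> f x * k @[x --> F] --> (0 : R).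
Proof. by move=> h; rewrite -[X in _ --> X](mul0r k); apply: cvgM => //; exact: cvg_cst. Qed.

Lemma cvg0_sqr (T : Type) (F : set_system T) (FF : Filter F) (f : T -> R) :
  f x @[x --> F] --> (0 : R) -> f x ^+ 2 @[x --> F] --> (0 : R).
Proof.
move=> h; have h2 := cvgM h h; rewrite mulr0 in h2; exact: h2.
Qed.

Lemma cvg0P (u : nat -> R) : u @ \oo --> (0 : R) <->
  forall e, 0 < e -> exists N, forall n, (N <= n)%N -> `|u n| <= e.
Proof.
split=> [/cvgrPdist_le h e e0|h].
  by have [N _ hN] := h e e0; exists N => n /hN; rewrite sub0r normrN.
apply/cvgrPdist_le => e e0; have [N hN] := h e e0.
by exists N => // n /hN; rewrite sub0r normrN.
Qed.

End squeeze.
(** * Convolution and the Poisson kernel *)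

Section line.
Context {R : realType}.
Local Notation mu := (@lebesgue_measure R).
Implicit Types f g v w k : R -> R.

Lemma measurable_shift (c : R) : mfun (fun x : R => x + c).
Proof. by apply: measurable_funD. Qed.

Lemma measurable_opp : mfun (fun x : R => - x).
Proof. exact: oppr_measurable. Qed.

Lemma lebesgue_shift (c : R) (A : set R) : measurable A ->
  pushforward mu ((fun x => x + c) : _ -> measurableTypeR R) A = mu A.
Proof.
move=> mA; apply/esym/lebesgue_measure_unique => //; first exact: measurable_shift.
move=> mm _ [[a b]] _ <-.
have E : (fun x : R => x + c) @^-1` `]a, b]%classic = `](a - c), (b - c)]%classic.
  by apply/seteqP; split => x /=; rewrite !in_itv/= ltrBlDr lerBrDr.
rewrite [RHS](_ : _ = mu ((fun x : R => x + c) @^-1` `]a, b]%classic))// E.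
rewrite !lebesgue_measure_itv/= !lte_fin ltrD2r; case: ifP => // _.
by rewrite -!EFinD; congr EFin; ring.
Qed.

Section invariance.
Variable p : R -> R.
Hypothesis mp : mfun p.
Hypothesis hp : forall A, measurable A -> mu (p @^-1` A) = mu A.

(** Applied to translations and to the reflection, through the image measure. *)
Lemma ge0_int_inv (f : R -> \bar R) : mfun f ->
  (forall x, 0 <= f x)%E -> (\int[mu]_x f (p x) = \int[mu]_x f x)%E.
Proof.
move=> mf f0; have := @ge0_integral_pushforward _ _ (measurableTypeR R) (measurableTypeR R) R
  p mp mu setT f measurableT mf (fun x _ => f0 x).
rewrite preimage_setT => <-; by apply: eq_measure_integral => A mA _; exact: hp.
Qed.

Lemma L1_inv f : L1 mu f -> L1 mu (fun x => f (p x)).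
Proof.
move=> hf; have mf := L1_meas hf; have /integrableP[mE h] := hf.
apply/integrableP; split; first by apply/measurable_EFinP; exact: (measurableT_comp mf).
rewrite (_ : (\int[mu]_x _ = \int[mu]_x `|(f x)%:E|)%E)//.
by apply: (@ge0_int_inv (fun x => `|(f x)%:E|%E)) => //; exact: measurableT_comp.
Qed.

Lemma I_inv f : L1 mu f -> \int[mu]_x f (p x) = \int[mu]_x f x.
Proof.
move=> hf; have mf : mfun (EFin \o f) by exact: measurable_int hf.
rewrite /Rintegral; congr fine; rewrite [LHS]integralE [RHS]integralE; congr (_ - _)%E.
  rewrite -(@ge0_int_inv ((EFin \o f)^\+)%E)//; last exact: measurable_funepos.
  by apply: eq_integral => x _; rewrite !unlock.
rewrite -(@ge0_int_inv ((EFin \o f)^\-)%E)//; last exact: measurable_funeneg.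
by apply: eq_integral => x _; rewrite !unlock.
Qed.

End invariance.

Lemma ge0_int_opp (f : R -> \bar R) : mfun f ->
  (forall x, 0 <= f x)%E -> (\int[mu]_x f (- x)%R = \int[mu]_x f x)%E.
Proof. exact: ge0_int_inv measurable_opp (@lebesgue_measureN R) f. Qed.

Lemma L1_shift c f : L1 mu f -> L1 mu (fun x => f (x + c)).
Proof. exact: L1_inv (measurable_shift c) (@lebesgue_shift c) f. Qed.

Lemma L1_opp f : L1 mu f -> L1 mu (fun x => f (- x)).
Proof. exact: L1_inv measurable_opp (@lebesgue_measureN R) f. Qed.

Lemma I_shift c f : L1 mu f -> \int[mu]_x f (x + c) = \int[mu]_x f x.
Proof. exact: I_inv (measurable_shift c) (@lebesgue_shift c) f. Qed.

Lemma I_opp f : L1 mu f -> \int[mu]_x f (- x) = \int[mu]_x f x.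
Proof. exact: I_inv measurable_opp (@lebesgue_measureN R) f. Qed.

Lemma I_to g f : f =1 g -> \int[mu]_x f x = \int[mu]_x g x.
Proof. by move=> h; apply: eq_Rintegral => x _; exact: h. Qed.

Lemma L1_shiftl c f : L1 mu f -> L1 mu (fun x => f (c - x)).
Proof.
move=> hf; have := L1_opp (L1_shift c hf); apply: L1_ext => x.
by rewrite addrC.
Qed.

Lemma I_shiftl c f : L1 mu f -> \int[mu]_x f (c - x) = \int[mu]_x f x.
Proof.
move=> hf; rewrite -(I_shift c hf) -(I_opp (L1_shift c hf)).
by apply: I_ext => x; rewrite addrC.
Qed.

Lemma I_odd f : L1 mu f -> (forall x, f (- x) = - f x) -> \int[mu]_x f x = 0.
Proof.
move=> hf fo; have := I_opp hf.
under I_ext do rewrite fo.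
by rewrite I_N// => h; lra.
Qed.

Definition conv k v (x : R) := \int[mu]_y (k (x - y) * v y).

Lemma measurable_sub2 : mfun (fun p : R * R => p.1 - p.2).
Proof. by apply: measurable_funB; [exact: measurable_fst|exact: measurable_snd]. Qed.

Lemma measurable_mul2 : mfun (fun p : R * R => p.1 * p.2).
Proof. by apply: measurable_funM; [exact: measurable_fst|exact: measurable_snd]. Qed.

Lemma measurable_fst_comp f : mfun f ->
  mfun (fun p : R * R => f p.1).
Proof. by move=> mf; apply: (measurableT_comp mf); exact: measurable_fst. Qed.

Lemma measurable_snd_comp f : mfun f ->
  mfun (fun p : R * R => f p.2).
Proof. by move=> mf; apply: (measurableT_comp mf); exact: measurable_snd. Qed.

(** Boundedness makes the convolution with an L^1 function defined at every point; positivity and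
    unit mass give Jensen and contraction; evenness makes the convolution self-adjoint and diagonal
    for the Hartley transform. Poisson kernels and mollifiers are the instances. *)
Record kernel k := Kernel {
  kernel_L1 : L1 mu k;
  kernel_ge0 : forall x, 0 <= k x;
  kernel_bnd : exists K, forall x, k x <= K;
  kernel_I : \int[mu]_x k x = 1;
  kernel_even : forall x, k (- x) = k x }.

Section conv_theory.
Variable k : R -> R.
Hypothesis kk : kernel k.

Let mk : mfun k. Proof. exact: L1_meas (kernel_L1 kk). Qed.

Let k0 := kernel_ge0 kk.

Lemma kernel_sym x y : k (x - y) = k (y - x).
Proof. by rewrite -(kernel_even kk) opprB. Qed.

Lemma kernel_shift_L1 x : L1 mu (fun y => k (x - y)).
Proof. exact: L1_shiftl (kernel_L1 kk). Qed.

Lemma kernel_shift_I x : \int[mu]_y k (x - y) = 1.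
Proof. by rewrite I_shiftl ?(kernel_I kk)//; exact: kernel_L1. Qed.

Lemma measurable_kernel2 : mfun (fun p : R * R => k (p.1 - p.2)).
Proof. by apply: (measurableT_comp mk); exact: measurable_sub2. Qed.

Lemma kernel_mul_L1 x v : L1 mu v -> L1 mu (fun y => k (x - y) * v y).
Proof.
move=> hv; have [K hK] := kernel_bnd kk.
apply: (@L1_le _ _ _ mu _ (fun y => K * `|v y|)).
- by apply: measurable_funM; [exact: L1_meas (kernel_shift_L1 x)|exact: L1_meas hv].
- by apply: L1Z; exact: L1_abs.
- by move=> y; rewrite normrM (ger0_norm (k0 _)) ler_wpM2r.
Qed.

Lemma measurable_conv v : mfun v -> mfun (conv k v).
Proof.
move=> mv; apply: (@measurable_I2 _ _ _ _ _ mu (fun p : R * R => k (p.1 - p.2) * v p.2)).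
by apply: measurable_funM; [exact: measurable_kernel2|exact: measurable_snd_comp].
Qed.

Lemma conv_prod_L1 v (g : R -> R) (M : R) : L1 mu v -> mfun g ->
  (forall x, `|g x| <= M) ->
  L1 (mu \x mu)%E (fun p : R * R => k (p.1 - p.2) * v p.2 * g p.1).
Proof.
move=> hv mg gM; have mv := L1_meas hv.
have h y : L1 mu (fun x => k (x - y) * v y * g x).
  apply: (@L1_le _ _ _ mu _ (fun x => `|v y| * M * k (x - y))).
  - apply: measurable_funM => //; apply: measurable_funM => //.
    by apply: (measurableT_comp mk); exact: measurable_shift.
  - by apply: L1Z; exact: (L1_shift (- y) (kernel_L1 kk)).
  - move=> x; rewrite !normrM (ger0_norm (k0 _)) mulrC mulrA -mulrA.
    rewrite [leRHS](_ : _ = M * (k (x - y) * `|v y|)); last ring.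
    by rewrite ler_wpM2r// mulr_ge0.
apply: (@L1_prod2 _ _ _ _ _ mu mu _ (fun y => M * `|v y|)) => //.
- apply: measurable_funM; last exact: measurable_fst_comp.
  by apply: measurable_funM; [exact: measurable_kernel2|exact: measurable_snd_comp].
- move=> y.
  have -> : M * `|v y| = \int[mu]_x (M * `|v y| * k (x - y)).
    rewrite I_Z; last exact: (L1_shift (- y) (kernel_L1 kk)).
    by rewrite (I_shift (- y) (kernel_L1 kk)) (kernel_I kk) mulr1.
  apply: I_le => /=; first exact: (L1_abs (h y)).
    by apply: L1Z; exact: (L1_shift (- y) (kernel_L1 kk)).
  move=> x; rewrite !normrM (ger0_norm (k0 _)).
  rewrite [leLHS](_ : _ = `|g x| * (k (x - y) * `|v y|)); last ring.
  rewrite [leRHS](_ : _ = M * (k (x - y) * `|v y|)); last ring.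
  by rewrite ler_wpM2r// mulr_ge0.
- by apply: L1Z; exact: L1_abs.
Qed.

(** Fubini, the bound on [g] giving integrability on the product. As [k] is even, the inner integral
    on the right is the convolution of [k] with [g]. *)
Lemma conv_dual v (g : R -> R) (M : R) : L1 mu v -> mfun g ->
  (forall x, `|g x| <= M) ->
  L1 mu (fun x => conv k v x * g x) /\
  \int[mu]_x (conv k v x * g x) = \int[mu]_y (v y * \int[mu]_x (k (x - y) * g x)).
Proof.
move=> hv mg gM; have hp := conv_prod_L1 hv mg gM.
have E x : conv k v x * g x = \int[mu]_y (k (x - y) * v y * g x).
  rewrite /conv mulrC -I_Z; last exact: kernel_mul_L1.
  by apply: I_ext => y; rewrite mulrC.
split; first by apply: L1_ext (L1_I2 hp) => x; rewrite E.
under I_ext do rewrite E.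
rewrite (I_swap hp); apply: I_ext => y /=.
rewrite -I_Z; first by apply: I_ext => x; ring.
apply: (@L1_le _ _ _ mu _ (fun x => M * k (x - y))).
- by apply: measurable_funM => //; apply: (measurableT_comp mk); exact: measurable_shift.
- by apply: L1Z; exact: (L1_shift (- y) (kernel_L1 kk)).
- by move=> x; rewrite normrM (ger0_norm (k0 _)) mulrC ler_wpM2r.
Qed.

Lemma conv_L1 v : L1 mu v -> L1 mu (conv k v).
Proof.
move=> hv; have [|h _] := @conv_dual v (fun=> 1) 1 hv (measurable_cst _).
  by move=> x; rewrite normr1.
by apply: L1_ext h => x; rewrite mulr1.
Qed.

Lemma conv_I v : L1 mu v -> \int[mu]_x conv k v x = \int[mu]_x v x.
Proof.
move=> hv; have [] := @conv_dual v (fun=> 1) 1 hv (measurable_cst _).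
  by move=> _; rewrite normr1.
move=> _; under I_ext do rewrite mulr1.
move=> ->; apply: I_ext => y; rewrite -[RHS]mulr1; congr (_ * _).
rewrite -[RHS](kernel_shift_I y); by apply: I_ext => x; rewrite [in RHS]kernel_sym mulr1.
Qed.

Lemma convB v w : L1 mu v -> L1 mu w ->
  conv k (fun x => v x - w x) =1 (fun x => conv k v x - conv k w x).
Proof.
move=> hv hw x; rewrite /conv -I_B; try exact: kernel_mul_L1.
by apply: I_ext => y; ring.
Qed.

Lemma conv_ge0 v x : (forall y, 0 <= v y) -> 0 <= conv k v x.
Proof. by move=> v0; apply: I_ge0 => y; rewrite mulr_ge0. Qed.

Lemma conv_leM v M x : L1 mu v -> (forall y, v y <= M) -> conv k v x <= M.
Proof.
move=> hv vM; rewrite -[leRHS]mulr1 -(kernel_shift_I x) -I_Z; last exact: kernel_shift_L1.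
apply: I_le; [exact: kernel_mul_L1|by apply: L1Z; exact: kernel_shift_L1|].
by move=> y; rewrite mulrC ler_wpM2r.
Qed.

Lemma conv_abs v x : L1 mu v -> `|conv k v x| <= conv k (fun y => `|v y|) x.
Proof.
move=> hv; apply: I_abs_le; try exact: kernel_mul_L1.
  by apply: kernel_mul_L1; exact: L1_abs.
by move=> y; rewrite normrM (ger0_norm (k0 _)).
Qed.

Lemma conv_absM v M x : L1 mu v -> (forall y, `|v y| <= M) -> `|conv k v x| <= M.
Proof.
move=> hv vM; apply: le_trans (conv_abs _ hv) _.
by apply: conv_leM => //; exact: L1_abs.
Qed.

Lemma conv_bounded v : L1 mu v -> exists M, forall x, `|conv k v x| <= M.
Proof.
move=> hv; have [K hK] := kernel_bnd kk.
exists (K * \int[mu]_x `|v x|) => x; rewrite -I_Z; last exact: L1_abs.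
apply: I_abs_le; [exact: kernel_mul_L1|by apply: L1Z; exact: L1_abs|].
by move=> y; rewrite normrM (ger0_norm (k0 _)) ler_wpM2r.
Qed.

(** The variance of [v] under the probability density [k (x - y)] in y is nonnegative. *)
Lemma conv_sqr v x : L1 mu v -> L2 mu v ->
  conv k v x ^+ 2 <= conv k (fun y => v y ^+ 2) x.
Proof.
move=> hv [mv hv2]; have h1 := kernel_mul_L1 x hv; have h2 := kernel_mul_L1 x hv2.
set c := conv k v x.
have : 0 <= \int[mu]_y (k (x - y) * (v y - c) ^+ 2).
  by apply: I_ge0 => y; rewrite mulr_ge0 ?sqr_ge0.
rewrite (@I_ext _ _ _ mu _ (fun y => (k (x - y) * v y ^+ 2 - 2 * c * (k (x - y) * v y))
    + c ^+ 2 * k (x - y))); last by move=> y; ring.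
have h3 := kernel_shift_L1 x.
rewrite I_D; [|by apply: L1B => //; exact: L1Z|exact: L1Z].
rewrite I_B//; last exact: L1Z.
rewrite !I_Z// kernel_shift_I -/(conv k v x) -/c -/(conv k _ x).
nra.
Qed.

Lemma conv_L2 v : L1 mu v -> L2 mu v ->
  L2 mu (conv k v) /\ \int[mu]_x (conv k v x ^+ 2) <= \int[mu]_x (v x ^+ 2).
Proof.
move=> hv hv2; have [mv hs] := hv2.
have h : L2 mu (conv k v).
  split; first exact: measurable_conv.
  apply: L1_le (conv_L1 hs) _; first by apply: measurable_funX; exact: measurable_conv.
  by move=> x; rewrite ger0_norm ?sqr_ge0// conv_sqr.
split => //; rewrite -(conv_I hs); apply: I_le; [by case: h|exact: conv_L1|].
by move=> x; exact: conv_sqr.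
Qed.

End conv_theory.
End line.
Arguments I_to {R} g {f}.
Ltac nz := repeat (apply/andP; split); by [apply: lt0r_neq0 | apply: lt0r_neq0; assumption].
Section derive_lambda.
Context {R : realType}.
Implicit Types f g : R -> R.

Lemma dcst (c x : R) : is_derive x 1 (fun _ : R => c) 0.
Proof. exact: is_derive_cst. Qed.

Lemma did (x : R) : is_derive x 1 (fun y : R => y) 1.
Proof. exact: is_derive_id. Qed.

Lemma dD f g (x a b : R) : is_derive x 1 f a -> is_derive x 1 g b ->
  is_derive x 1 (fun y => f y + g y) (a + b).
Proof. by move=> hf hg; exact: is_deriveD. Qed.

Lemma dB f g (x a b : R) : is_derive x 1 f a -> is_derive x 1 g b ->
  is_derive x 1 (fun y => f y - g y) (a - b).
Proof. by move=> hf hg; exact: is_deriveB. Qed.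

Lemma dN f (x a : R) : is_derive x 1 f a -> is_derive x 1 (fun y => - f y) (- a).
Proof. by move=> hf; exact: is_deriveN. Qed.

Lemma dM f g (x a b : R) : is_derive x 1 f a -> is_derive x 1 g b ->
  is_derive x 1 (fun y => f y * g y) (f x * b + g x * a).
Proof. by move=> hf hg; exact: is_deriveM. Qed.

Lemma dZ f (c x a : R) : is_derive x 1 f a -> is_derive x 1 (fun y => c * f y) (c * a).
Proof. by move=> hf; exact: (is_deriveZ c). Qed.

Lemma dcomp f g (x a b : R) : is_derive (g x) 1 f a -> is_derive x 1 g b ->
  is_derive x 1 (fun y => f (g y)) (a * b).
Proof. by move=> hf hg; exact: is_derive1_comp. Qed.

Lemma deq f (x a b : R) : is_derive x 1 f a -> a = b -> is_derive x 1 f b.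
Proof. by move=> hf <-. Qed.

Lemma der_cont f (a : R -> R) : (forall x : R, is_derive x 1 f (a x)) -> continuous f.
Proof.
move=> h x; apply: differentiable_continuous; apply/derivable1_diffP.
by have [] := h x.
Qed.

Lemma FTC2y (f F : R -> R) (l : R) : (forall x, 0 <= f x) -> continuous f ->
  (forall x : R, is_derive x 1 F (f x)) -> F x @[x --> +oo%R] --> l ->
  (\int[lebesgue_measure]_(x in `[0%R, +oo[) (f x)%:E = (l - F 0)%:E)%E.
Proof.
move=> f0 cf dF Fl; rewrite EFinB; apply: ge0_continuous_FTC2y => //.
- exact: continuous_subspaceT.
- by apply: cvg_at_right_filter; exact: (der_cont dF).
- by move=> x _; rewrite derive1E; have [_ h] := dF x; exact: h.
Qed.

End derive_lambda.
Section poisson.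
Context {R : realType}.
Local Notation mu := (@lebesgue_measure R).
Implicit Types (v w : R -> R) (h x : R).

(** Poisson kernel of the upper half-plane at height [h], the convolution kernel of exp (- h
    (-Delta)^(1/2)). *)
Definition pois h x := h / (pi * (h ^+ 2 + x ^+ 2)).

Lemma pi_gt0' : 0 < (pi : R). Proof. exact: pi_gt0. Qed.

Lemma pi2_gt0 : 0 < 2 * (pi : R). Proof. by rewrite mulr_gt0// pi_gt0'. Qed.

Lemma ipi_gt0 : 0 < (2 * (pi : R))^-1. Proof. by rewrite invr_gt0 pi2_gt0. Qed.

Lemma pois_den h x : 0 < h -> 0 < h ^+ 2 + x ^+ 2.
Proof. by move=> h0; rewrite ltr_pwDl ?exprn_gt0// sqr_ge0. Qed.

Lemma pois_ge0 h x : 0 < h -> 0 <= pois h x.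
Proof.
move=> h0; have P := pi_gt0'; have D := pois_den x h0.
by rewrite /pois divr_ge0 ?(ltW h0)// mulr_ge0 ?(ltW P) ?(ltW D).
Qed.

Lemma pois_even h x : pois h (- x) = pois h x.
Proof. by rewrite /pois sqrrN. Qed.

Lemma pois_le h x : 0 < h -> pois h x <= (pi * h)^-1.
Proof.
move=> h0; have P := pi_gt0'; have D := pois_den x h0.
rewrite /pois ler_pdivrMr ?mulr_gt0// mulrC ler_pdivlMr ?mulr_gt0//.
rewrite -subr_ge0; have -> : pi * (h ^+ 2 + x ^+ 2) - h * (pi * h) = pi * x ^+ 2 by ring.
by rewrite mulr_ge0 ?(ltW P)// sqr_ge0.
Qed.

Lemma der_den h x : is_derive x 1 (fun y => h ^+ 2 + y ^+ 2) (2 * x).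
Proof.
apply: deq (dD (dcst (h ^+ 2) x) (dM (did x) (did x))) _.
by rewrite add0r mulr1 mulr_natl mulr2n.
Qed.

Lemma pois_cont h : 0 < h -> continuous (pois h).
Proof.
move=> h0 x; have P := pi_gt0'; have D := pois_den x h0.
apply: cvgM; first exact: cvg_cst.
apply: cvgV; first by rewrite mulf_neq0 ?gt_eqF.
by apply: cvgM; [exact: cvg_cst|exact: (der_cont (der_den h))].
Qed.

Lemma int_half (f : R -> R) (l : \bar R) : (forall x, 0 <= f x) -> continuous f ->
  (forall x, f (- x) = f x) -> (\int[mu]_(x in `[0%R, +oo[) (f x)%:E = l)%E ->
  (\int[mu]_x (f x)%:E = 2%:E * l)%E.
Proof.
move=> f0 cf fe <-; rewrite ge0_symfun_integralT//; first by rewrite -set_itvcy.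
by move=> x /=; rewrite fe.
Qed.

Lemma pois_int h : 0 < h -> (\int[mu]_x (pois h x)%:E = 1)%E.
Proof.
move=> h0; have P := pi_gt0'.
rewrite (@int_half (pois h) (2^-1)%:E).
- by rewrite -EFinM divff.
- by move=> x; exact: pois_ge0.
- exact: pois_cont.
- exact: pois_even.
apply: etrans (@FTC2y _ (pois h) (fun x => pi^-1 * atan (h^-1 * x)) 2^-1 _ _ _ _) _; last first.
- by rewrite mulr0 atan0 mulr0 subr0.
- have -> : (2^-1 : R) = pi^-1 * (pi / 2) by move: (pi : R) P => p P; field; nz.
  apply: cvgM; first exact: cvg_cst.
  apply: (@cvg_comp _ _ _ (fun x : R => h^-1 * x) atan _ (pinfty_nbhs R)); last exact: cvgy_atan.
  by apply: gt0_cvgMry; [rewrite invr_gt0|exact: cvg_id].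
- move=> x.
  apply: deq (dZ _ (@dcomp _ atan (fun y => h^-1 * y) x _ _ (is_derive1_atan _) (dZ _ (did x)))) _.
  rewrite /pois; have D := pois_den x h0.
  have -> : 1 + (h^-1 * x) ^+ 2 = (h ^+ 2 + x ^+ 2) / h ^+ 2 by field; nz.
  by move: (pi : R) P => p P; field; nz.
- exact: pois_cont.
- by move=> x; exact: pois_ge0.
Qed.

Lemma pois_meas h : 0 < h -> mfun (pois h).
Proof. by move=> h0; apply: continuous_measurable_fun; exact: pois_cont. Qed.

Lemma pois_kernel h : 0 < h -> kernel (pois h).
Proof.
move=> h0; have hp := pois_int h0.
split.
- by apply/L1_ge0P; [exact: pois_meas|move=> x; exact: pois_ge0|rewrite hp ltry].
- by move=> x; exact: pois_ge0.
- by exists (pi * h)^-1 => x; exact: pois_le.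
- by rewrite /Rintegral hp.
- exact: pois_even.
Qed.

(** Finite-difference form of |d/da pois a| <= pois a / a. It controls the mass that escapes to
    infinity, and the time-Lipschitz constant for data already smoothed by the kernel. *)
Lemma pois_diff (a h x : R) : 0 < a -> 0 < h ->
  `|pois a x - pois (a + h) x| <= h / a * pois a x.
Proof.
move=> a0 h0; have P := pi_gt0'; have D1 := pois_den x a0.
have ah : 0 < a + h by exact: addr_gt0.
have D2 := pois_den x ah.
have D2n : 0 < h ^+ 2 + 2 * h * a + a ^+ 2 + x ^+ 2.
  by have -> : h ^+ 2 + 2 * h * a + a ^+ 2 + x ^+ 2 = (a + h) ^+ 2 + x ^+ 2 by ring.
have -> : pois a x - pois (a + h) x =
   h * ((a * (a + h) - x ^+ 2) / ((a + h) ^+ 2 + x ^+ 2)) / (pi * (a ^+ 2 + x ^+ 2)).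
  by rewrite /pois; move: (pi : R) P => p P; field; nz.
have -> : h / a * pois a x = h * 1 / (pi * (a ^+ 2 + x ^+ 2)).
  by rewrite /pois; move: (pi : R) P => p P; field; nz.
have D3 : 0 < pi * (a ^+ 2 + x ^+ 2) by rewrite mulr_gt0.
rewrite normrM (@ger0_norm _ _^-1) ?invr_ge0 ?(ltW D3)//.
rewrite ler_wpM2r ?invr_ge0 ?(ltW D3)// normrM (gtr0_norm h0) ler_wpM2l ?(ltW h0)//.
rewrite normrM (@ger0_norm _ _^-1) ?invr_ge0 ?(ltW D2)// ler_pdivrMr// mul1r.
have X := sqr_ge0 x.
rewrite ler_norml; apply/andP; split; nra.
Qed.

Lemma pois_le1 h x : 0 < h -> pi * h * pois h x <= 1.
Proof.
move=> h0; have P := pi_gt0'; rewrite mulrC -ler_pdivlMr ?mulr_gt0// mul1r.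
exact: pois_le.
Qed.

(* [pi h p_h] is a profile that is [1] near the origin and decays at scale [h]. *)
Lemma pois_tail h x : 0 < h -> h <= `|x| -> 2^-1 <= 1 - pi * h * pois h x.
Proof.
move=> h0 hx; have P := pi_gt0'; have D := pois_den x h0.
have -> : 1 - pi * h * pois h x = x ^+ 2 / (h ^+ 2 + x ^+ 2).
  by rewrite /pois; move: (pi : R) P => p P; field; nz.
rewrite ler_pdivlMr// mulrDr -[x ^+ 2]real_normK ?num_real//.
have : h ^+ 2 <= `|x| ^+ 2 by rewrite lerXn2r ?nnegrE ?(ltW h0).
lra.
Qed.

Definition eabs h x := expR (- (h * `|x|)).

Lemma eabs_ge0 h x : 0 <= eabs h x. Proof. exact: expR_ge0. Qed.

Lemma eabs_even h x : eabs h (- x) = eabs h x.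
Proof. by rewrite /eabs normrN. Qed.

Lemma eabs_cont h : continuous (eabs h).
Proof.
move=> x; apply: (@continuous_comp _ _ _ (fun y : R => - (h * `|y|)) expR); last exact: continuous_expR.
by apply: cvgN; apply: cvgM; [exact: cvg_cst|exact: cvg_norm].
Qed.

Lemma eabs_le1 h x : 0 < h -> eabs h x <= 1.
Proof. by move=> h0; rewrite -expR0 ler_expR oppr_le0 mulr_ge0// ltW. Qed.

Lemma eabs_meas h : mfun (eabs h).
Proof. by apply: continuous_measurable_fun; exact: eabs_cont. Qed.

Lemma cont_cosM (x : R) : continuous (fun y : R => cos (x * y)).
Proof.
move=> y; apply: (@continuous_comp _ _ _ (fun y : R => x * y) cos); last exact: continuous_cos.
by apply: cvgM; [exact: cvg_cst|exact: cvg_id].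
Qed.

(** Adding 1 to the cosine makes the integrand nonnegative, as [FTC2y] requires; [eabs_cos] removes
    it by comparison with x = 0. *)
Lemma eabs_cos_aux h x : 0 < h ->
  (\int[mu]_y (eabs h y * (1 + cos (x * y)))%:E = (2 * (h^-1 + h / (h ^+ 2 + x ^+ 2)))%:E)%E.
Proof.
move=> h0; have D := pois_den x h0.
have g0 y : 0 <= eabs h y * (1 + cos (x * y)).
  by rewrite mulr_ge0 ?eabs_ge0// -lerBlDl sub0r cos_geN1.
have gc : continuous (fun y => eabs h y * (1 + cos (x * y))).
  move=> y; apply: cvgM; first exact: eabs_cont.
  by apply: cvgD; [exact: cvg_cst|exact: cont_cosM].
rewrite (@int_half _ (h^-1 + h / (h ^+ 2 + x ^+ 2))%:E)//; last first.
  have -> : (\int[mu]_(y in `[0%R, +oo[) (eabs h y * (1 + cos (x * y)))%:E =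
     \int[mu]_(y in `[0%R, +oo[) (expR (- (h * y)) * (1 + cos (x * y)))%:E)%E.
    apply: eq_integral => y; rewrite inE/= in_itv/= andbT => y0.
    by rewrite /eabs ger0_norm.
  apply: etrans (@FTC2y _ (fun y => expR (- (h * y)) * (1 + cos (x * y)))
   (fun y => expR (- (h * y)) * (- h^-1 + (h ^+ 2 + x ^+ 2)^-1 * (x * sin (x * y) - h * cos (x * y)))) 0 _ _ _ _) _; first 4 last.
  - rewrite !mulr0 oppr0 expR0 sin0 cos0; congr EFin; field.
    by rewrite !gt_eqF.
  - by move=> y; rewrite mulr_ge0 ?expR_ge0// -lerBlDl sub0r cos_geN1.
  - move=> y; apply: cvgM; last by apply: cvgD; [exact: cvg_cst|exact: cont_cosM].
    apply: (@continuous_comp _ _ _ (fun y : R => - (h * y)) expR); last exact: continuous_expR.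
    by apply: cvgN; apply: cvgM; [exact: cvg_cst|exact: cvg_id].
  - move=> y.
    have d1 : is_derive y 1 (fun y => x * y) x by apply: deq (dZ x (did y)) _; rewrite mulr1.
    have d2 : is_derive y 1 (fun y => - (h * y)) (- h).
      by apply: deq (dN (dZ h (did y))) _; rewrite mulr1.
    have d3 := @dcomp _ expR (fun y => - (h * y)) y _ _ (is_derive_expR _) d2.
    have d4 := @dcomp _ sin (fun y => x * y) y _ _ (is_derive_sin _) d1.
    have d5 := @dcomp _ cos (fun y => x * y) y _ _ (is_derive_cos _) d1.
    apply: deq (dM d3 (dD (dcst _ y) (dZ _ (dB (dZ x d4) (dZ h d5))))) _.
    by field; nz.
  - pose K := h^-1 + (h ^+ 2 + x ^+ 2)^-1 * (`|x| + h).
    have cE : (expR (- (h * y)) * K) @[y --> +oo%R] --> (0 : R).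
      apply: cvg0_Zr.
      apply: (@cvg_comp _ _ _ (fun y : R => h * y) (fun z => expR (- z)) _ (pinfty_nbhs R)); last exact: cvgr_expR.
      by apply: gt0_cvgMry => //; exact: cvg_id.
    apply: (@cvg0_le _ _ _ _ _ (fun y => expR (- (h * y)) * K)) cE => y.
    rewrite normrM ger0_norm ?expR_ge0// ler_wpM2l ?expR_ge0//.
    apply: le_trans (ler_normD _ _) _; rewrite normrN gtr0_norm ?invr_gt0// lerD2l.
    rewrite normrM gtr0_norm ?invr_gt0// ler_wpM2l ?invr_ge0 ?(ltW D)//.
    apply: le_trans (ler_normB _ _) _; rewrite !normrM (gtr0_norm h0).
    by apply: lerD; [rewrite ler_piMr ?normr_ge0|rewrite ler_piMr ?(ltW h0)]; rewrite ?sin_max ?cos_max//.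

by move=> y; rewrite eabs_even mulrN cosN.
Qed.

Lemma eabs_L1 h : 0 < h -> L1 mu (eabs h).
Proof.
move=> h0; apply/L1_ge0P; [exact: eabs_meas|exact: eabs_ge0|].
have e := eabs_cos_aux 0 h0; apply: (@le_lt_trans _ _ ((2 * (h^-1 + h / (h ^+ 2 + 0 ^+ 2)))%:E)); last exact: ltry.
rewrite -e; apply: ge0_le_integral => //.
- by move=> x _; rewrite lee_fin eabs_ge0.
- by apply/measurable_EFinP; exact: eabs_meas.
- apply/measurable_EFinP; apply: measurable_funM; first exact: eabs_meas.
  by apply: measurable_funD => //; apply: continuous_measurable_fun; exact: cont_cosM.
- by move=> x _; rewrite lee_fin mul0r cos0 ler_peMr ?eabs_ge0// lerDl.
Qed.

Lemma measurable_cosM (x : R) : mfun (fun y : R => cos (x * y)).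
Proof. by apply: continuous_measurable_fun; exact: cont_cosM. Qed.

Lemma eabs_cos_L1 h x : 0 < h -> L1 mu (fun y => eabs h y * cos (x * y)).
Proof.
move=> h0; apply: L1_le (eabs_L1 h0) _.
- by apply: measurable_funM; [exact: eabs_meas|exact: measurable_cosM].
- by move=> y; rewrite normrM (ger0_norm (eabs_ge0 _ _)) ler_piMr ?eabs_ge0// cos_max.
Qed.

Lemma eabs_cos h x : 0 < h ->
  \int[mu]_y (eabs h y * cos (x * y)) = 2 * pi * pois h x.
Proof.
move=> h0; have P := pi_gt0'; have D := pois_den x h0.
have I1 z : \int[mu]_y (eabs h y) + \int[mu]_y (eabs h y * cos (z * y)) =
   2 * (h^-1 + h / (h ^+ 2 + z ^+ 2)).
  rewrite -I_D; [|exact: eabs_L1|exact: eabs_cos_L1].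
  rewrite /Rintegral -[RHS]/(fine (2 * (h^-1 + h / (h ^+ 2 + z ^+ 2)))%:E) -(eabs_cos_aux z h0).
  by congr fine; apply: eq_integral => y _; congr EFin; ring.
have I0 : \int[mu]_y (eabs h y) = 2 * h^-1.
  have := I1 0; rewrite (@I_ext _ _ _ mu (fun y => eabs h y * cos (0 * y)) (eabs h)).
    rewrite expr0n addr0 (_ : h / h ^+ 2 = h^-1); first lra.
    by field; rewrite gt_eqF.
  by move=> y; rewrite mul0r cos0 mulr1.
have := I1 x; rewrite I0 => h1.
have -> : 2 * pi * pois h x = 2 * (h / (h ^+ 2 + x ^+ 2)).
  by rewrite /pois; move: (pi : R) P => p P; field; nz.
lra.
Qed.

End poisson.
(** * The Hartley transform *)

Section hartley.
Context {R : realType}.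
Local Notation mu := (@lebesgue_measure R).
Implicit Types (v w : R -> R) (h x : R).

Definition cas (t : R) := cos t + sin t.

(* A real-valued substitute for the Fourier transform, with the same Plancherel identity and the same
   multipliers for even kernels. *)
Definition hart v (xi : R) := \int[mu]_x (v x * cas (x * xi)).

Lemma cas_bound t : `|cas t| <= 2.
Proof.
apply: le_trans (ler_normD _ _) _; have := cos_max t; have := sin_max t; lra.
Qed.

Lemma cas_cont : continuous cas.
Proof. by move=> t; apply: cvgD; [exact: continuous_cos|exact: continuous_sin]. Qed.

Lemma cas_meas : mfun cas.
Proof. exact: continuous_measurable_fun cas_cont. Qed.

Lemma casM_meas xi : mfun (fun x => cas (x * xi)).
Proof. by apply: (measurableT_comp cas_meas); exact: measurable_funM. Qed.

Lemma cas2_meas : mfun (fun p : R * R => cas (p.1 * p.2)).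
Proof. by apply: (measurableT_comp cas_meas); exact: measurable_mul2. Qed.

Lemma cas_prod (a b : R) : cas a * cas b = cos (a - b) + sin (a + b).
Proof. rewrite /cas cosB sinD; ring. Qed.

Lemma bmul_L1 v (g : R -> R) (M : R) : L1 mu v -> mfun g ->
  (forall x, `|g x| <= M) -> L1 mu (fun x => v x * g x).
Proof.
move=> hv mg gM; apply: L1_le (L1Z M (L1_abs hv)) _.
  by apply: measurable_funM => //; exact: L1_meas hv.
by move=> x; rewrite normrM mulrC ler_wpM2r.
Qed.

Lemma hart_L1 v xi : L1 mu v -> L1 mu (fun x => v x * cas (x * xi)).
Proof. by move=> hv; apply: bmul_L1 hv (casM_meas _) (fun x => cas_bound _). Qed.

Lemma hart_bound v xi : L1 mu v -> `|hart v xi| <= 2 * \int[mu]_x `|v x|.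
Proof.
move=> hv; rewrite -I_Z; last exact: L1_abs.
apply: I_abs_le; [exact: hart_L1|by apply: L1Z; exact: L1_abs|].
by move=> x; rewrite normrM mulrC ler_wpM2r// cas_bound.
Qed.

Lemma hart_meas v : mfun v -> mfun (hart v).
Proof.
move=> mv; apply: (@measurable_I1 _ _ _ _ _ mu (fun p : R * R => v p.1 * cas (p.1 * p.2))).
by apply: measurable_funM; [exact: measurable_fst_comp|exact: cas2_meas].
Qed.

Lemma hartD v w xi : L1 mu v -> L1 mu w ->
  hart (fun x => v x + w x) xi = hart v xi + hart w xi.
Proof.
by move=> hv hw; rewrite /hart -I_D; try exact: hart_L1; apply: I_ext => x; ring.
Qed.

Lemma hartB v w xi : L1 mu v -> L1 mu w ->
  hart (fun x => v x - w x) xi = hart v xi - hart w xi.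
Proof.
by move=> hv hw; rewrite /hart -I_B; try exact: hart_L1; apply: I_ext => x; ring.
Qed.

Lemma hartZ c v xi : L1 mu v -> hart (fun x => c * v x) xi = c * hart v xi.
Proof.
by move=> hv; rewrite /hart -I_Z; try exact: hart_L1; apply: I_ext => x; ring.
Qed.

Lemma hart_ext v w : v =1 w -> hart v =1 hart w.
Proof. by move=> /funext ->. Qed.

Lemma hart_dual v w : L1 mu v -> L1 mu w ->
  \int[mu]_x (hart v x * w x) = \int[mu]_x (v x * hart w x).
Proof.
move=> hv hw; pose F (p : R * R) := v p.1 * cas (p.1 * p.2) * w p.2.
have mF : mfun F.
  apply: measurable_funM; last by apply: measurable_snd_comp; exact: L1_meas hw.
  by apply: measurable_funM; [by apply: measurable_fst_comp; exact: L1_meas hv|exact: cas2_meas].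
have hF x : L1 mu (fun y => F (x, y)).
  have := L1Z (v x) (hart_L1 x hw); apply: L1_ext => y; rewrite /F/= (mulrC x y); ring.
have L : L1 (mu \x mu)%E F.
  apply: (@L1_prod1 _ _ _ _ _ mu mu _ (fun x => (2 * \int[mu]_x `|w x|) * `|v x|)) => //.
    move=> x; rewrite [leRHS](_ : _ = \int[mu]_y (2 * `|v x| * `|w y|)); last first.
      by rewrite I_Z; [ring|exact: L1_abs].
    apply: I_le; first exact: (L1_abs (hF x)).
      by apply: L1Z; exact: L1_abs.
    move=> y; rewrite /F/= !normrM ler_wpM2r// mulrC ler_wpM2r//; exact: cas_bound.
  by apply: L1Z; exact: L1_abs.
have := I_swap L; rewrite /F /= => e.
transitivity (\int[mu]_y \int[mu]_x (v x * cas (x * y) * w y)).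
  by apply: I_ext => y; rewrite mulrC -I_Z; [apply: I_ext => x; ring|exact: hart_L1].
rewrite -e; apply: I_ext => x; rewrite /hart -I_Z; last exact: hart_L1.
by apply: I_ext => y; rewrite (mulrC x y); ring.
Qed.

Lemma eabs_sin_L1 h x : 0 < h -> L1 mu (fun y => eabs h y * sin (x * y)).
Proof.
move=> h0; apply: (bmul_L1 (eabs_L1 h0) (M := 1)).
  by apply: (measurableT_comp (continuous_measurable_fun (@continuous_sin R))); exact: measurable_funM.
by move=> y; exact: sin_max.
Qed.

Lemma eabs_sin h x : 0 < h -> \int[mu]_y (eabs h y * sin (x * y)) = 0.
Proof.
by move=> h0; apply: I_odd; [exact: eabs_sin_L1|move=> y; rewrite eabs_even mulrN sinN mulrN].
Qed.

Lemma hart_eabs h x : 0 < h -> hart (eabs h) x = 2 * pi * pois h x.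
Proof.
move=> h0; rewrite -eabs_cos// -[RHS]addr0 -(eabs_sin x h0) /hart -I_D;
  [|exact: eabs_cos_L1|exact: eabs_sin_L1].
by apply: I_ext => y; rewrite /cas (mulrC y x) mulrDr.
Qed.

Lemma eabs_hart_L1 h v : 0 < h -> L1 mu v -> L1 mu (fun xi => eabs h xi * hart v xi).
Proof.
move=> h0 hv; apply: (bmul_L1 (eabs_L1 h0)) (fun x => hart_bound x hv).
exact: hart_meas (L1_meas hv).
Qed.

(** By [cas_prod] the product of the two [cas] factors is cos (xi (y - x)) + sin (xi (y + x)).
    Against the even damping the sine integrates to 0, and the cosine gives the Poisson kernel. *)
Lemma hart_inv_pois h v y : 0 < h -> L1 mu v ->
  hart (fun xi => eabs h xi * hart v xi) y = 2 * pi * conv (pois h) v y.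
Proof.
move=> h0 hv; have hg : L1 mu (fun xi => eabs h xi * cas (xi * y)) by exact: hart_L1 (eabs_L1 h0).
transitivity (\int[mu]_xi (hart v xi * (eabs h xi * cas (xi * y)))).
  by apply: I_ext => xi; ring.
rewrite hart_dual// /conv -I_Z; last exact: (kernel_mul_L1 (pois_kernel h0)).
apply: I_ext => x; rewrite mulrC [RHS]mulrA; congr (_ * _).
rewrite -(eabs_cos (y - x) h0) -[RHS]addr0 -(eabs_sin (y + x) h0) /hart -I_D;
  [|exact: eabs_cos_L1|exact: eabs_sin_L1].
apply: I_ext => xi; rewrite -mulrA cas_prod mulrDr.
by congr (_ * cos _ + _ * sin _); ring.
Qed.

Lemma plancherel_pois h v w : 0 < h -> L1 mu v -> L1 mu w ->
  \int[mu]_xi (eabs h xi * hart v xi * hart w xi) = 2 * pi * \int[mu]_x (conv (pois h) v x * w x).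
Proof.
move=> h0 hv hw; rewrite -I_Z; last first.
  rewrite (_ : (fun x => _) = (fun x => w x * conv (pois h) v x)); last by apply/funext => x; rewrite mulrC.
  have [M hM] := conv_bounded (pois_kernel h0) hv.
  apply: bmul_L1 hM => //; apply: measurable_conv; first exact: pois_kernel.
  exact: L1_meas hv.
rewrite -hart_dual//; last exact: eabs_hart_L1.
by apply: I_ext => x; rewrite hart_inv_pois// mulrA.
Qed.

(** Near 0 the function [om] is small. For |z| >= d one has pois h z <= h (1 + d^-2) pois 1 z, so
    the rest contributes O(h). *)
Lemma pois_approx (om : R -> R) (M : R) : mfun om ->
  (forall z, 0 <= om z <= M) ->
  (forall e : R, 0 < e -> exists2 d : R, 0 < d & forall z, `|z| < d -> om z <= e) ->
  forall e : R, 0 < e -> exists2 h0 : R, 0 < h0 &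
    forall h, 0 < h -> h <= h0 -> \int[mu]_z (pois h z * om z) <= e.
Proof.
move=> mom omM om0 e e0; have P := @pi_gt0' R.
have [d d0 hd] : exists2 d : R, 0 < d & forall z : R, `|z| < d -> om z <= e / 2.
  by apply: om0; rewrite divr_gt0.
have M0 : 0 <= M by have /andP[a b] := omM 0; exact: le_trans a b.
pose C := (1 + d ^- 2) * M.
have C0 : 0 <= C by rewrite mulr_ge0 ?addr_ge0 ?invr_ge0 ?exprn_ge0 ?(ltW d0).
exists (e / 2 / (C + 1)); first by rewrite !divr_gt0// ltr_wpDl.
move=> h h0 hh; have kh := pois_kernel h0; have k1 := @pois_kernel R 1 ltr01.
have hC : h * C <= e / 2.
  apply: le_trans (_ : h * (C + 1) <= _); first by rewrite ler_wpM2l ?(ltW h0)// lerDl.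
  by rewrite -ler_pdivlMr// ltr_wpDl.
apply: le_trans (_ : \int[mu]_z (e / 2 * pois h z + h * C * pois 1 z) <= _); last first.
  rewrite I_D; [|by apply: L1Z; exact: kernel_L1|by apply: L1Z; exact: kernel_L1].
  rewrite (I_Z _ (kernel_L1 kh)) (I_Z _ (kernel_L1 k1)) (kernel_I kh) (kernel_I k1); lra.
apply: I_le.
- apply: (bmul_L1 (kernel_L1 kh) mom (M := M)) => z.
  by have /andP[a b] := omM z; rewrite ger0_norm.
- by apply: L1D; apply: L1Z; exact: kernel_L1.
- move=> z; have p0 := kernel_ge0 kh z; have p1 := kernel_ge0 k1 z; have /andP[a b] := omM z.
  have [zd|zd] := ltP `|z| d.
    rewrite -[leLHS]addr0; apply: lerD; last by apply: mulr_ge0 => //; apply: mulr_ge0 => //; exact: ltW.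
    by rewrite mulrC ler_wpM2r// hd.
  rewrite -[leLHS]add0r; apply: lerD; first by rewrite mulr_ge0// divr_ge0// ltW.
  apply: le_trans (_ : pois h z * M <= _); first by rewrite ler_wpM2l.
  have -> : h * C * pois 1 z = (h * (1 + d ^- 2) * pois 1 z) * M by rewrite /C; ring.
  rewrite ler_wpM2r//.
  have z2 : d ^+ 2 <= z ^+ 2.
    by rewrite -[z ^+ 2]real_normK ?num_real// lerXn2r ?nnegrE ?(ltW d0)//.
  have d2 : 0 < d ^+ 2 by rewrite exprn_gt0.
  have D1 : 0 < 1 + z ^+ 2 by rewrite ltr_pwDl// sqr_ge0.
  have Dh := pois_den z h0.
  rewrite /pois expr1n.
  have -> : h * (1 + d ^- 2) * (1 / (pi * (1 + z ^+ 2))) =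
     h * ((1 + d ^- 2) / (1 + z ^+ 2)) / pi.
    by move: (pi : R) P => p P; field; nz.
  have -> : h / (pi * (h ^+ 2 + z ^+ 2)) = h * (1 / (h ^+ 2 + z ^+ 2)) / pi.
    by move: (pi : R) P => p P; field; nz.
  rewrite ler_wpM2r ?invr_ge0 ?(ltW P)// ler_wpM2l ?(ltW h0)//.
  rewrite ler_pdivlMr// mulrAC ler_pdivrMr// mul1r.
  have : 1 <= z ^+ 2 / d ^+ 2 by rewrite ler_pdivlMr// mul1r.
  have h2 : 0 <= h ^+ 2 by exact: sqr_ge0.
  have : 0 <= h ^+ 2 * d ^- 2 by rewrite mulr_ge0// invr_ge0 ltW.
  rewrite mulrDl mul1r mulrDr (mulrC (d ^- 2)) [d ^- 2 * _]mulrC => u1 u2.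
  lra.
Qed.

Lemma eabs_lip h x y : 0 < h -> `|eabs h x - eabs h y| <= h * `|x - y|.
Proof.
move=> h0; wlog: x y / `|x| <= `|y|.
  move=> H; have [xy|/ltW xy] := leP `|x| `|y|; first exact: H.
  by rewrite distrC (distrC x); exact: H.
move=> xy; have E : eabs h y <= eabs h x by rewrite ler_expR lerN2 ler_wpM2l ?(ltW h0).
rewrite ger0_norm ?subr_ge0//.
have -> : eabs h x - eabs h y = eabs h x * (1 - expR (- (h * (`|y| - `|x|)))).
  by rewrite mulrBr mulr1 -expRD /eabs; congr (_ - expR _); ring.
have h1 : 0 <= h * (`|y| - `|x|) by rewrite mulr_ge0 ?(ltW h0)// subr_ge0.
apply: le_trans (_ : 1 * (h * (`|y| - `|x|)) <= _); last first.
  by rewrite mul1r ler_wpM2l ?(ltW h0)// distrC lerB_dist.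
apply: ler_pM; [exact: eabs_ge0| |exact: eabs_le1|].
  by rewrite subr_ge0 -expR0 ler_expR oppr_le0.
have := expR_ge1Dx (- (h * (`|y| - `|x|))); lra.
Qed.

End hartley.
#[global] Opaque pois.

(** * Approximation in L^1 by continuous functions and by convolutions *)

Section approximation.
Context {R : realType}.
Local Notation mu := (@lebesgue_measure R).
Implicit Types (v w g : R -> R).

Lemma itv_meas (n : R) : measurable (`[- n, n]%classic : set R).
Proof. exact: measurable_itv. Qed.

Lemma indic_itv (n x : R) : (\1_(`[- n, n]%classic) x : R) = (`|x| <= n)%R%:R.
Proof.
rewrite indicE; congr (_ : bool)%:R; apply/idP/idP; rewrite inE/= in_itv/= ler_norml//.
Qed.

Lemma itv_mu (n : R) : 0 <= n -> mu (`[- n, n]%classic : set R) = (2 * n)%:E.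
Proof.
move=> n0; rewrite lebesgue_measure_itv/= lte_fin; case: ltP => h.
  by rewrite -EFinB; congr EFin; ring.
have -> : n = 0 by lra.
by rewrite mulr0.
Qed.

Lemma indic_meas (n : R) : mfun (\1_(`[- n, n]%classic) : R -> R).
Proof. exact: measurable_indic (itv_meas n). Qed.

Lemma near_nat_ge (x : R) : \forall n \near \oo, x <= n%:R.
Proof.
exists (Num.bound `|x|) => // n /= hn; apply: le_trans (ler_norm x) _.
by apply: ltW; apply: lt_le_trans (archi_boundP (normr_ge0 x)) _; rewrite ler_nat.
Qed.

Lemma indic_cvg (x : R) : \1_(`[- n%:R, n%:R]%classic) x @[n --> \oo] --> (1 : R).
Proof.
apply: cvg_near_cst; near=> n; rewrite indic_itv.
suff -> : `|x| <= n%:R by [].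
by near: n; exact: near_nat_ge.
Unshelve. all: by end_near. Qed.

Lemma truncate_meas g n : mfun g -> mfun (truncate g n).
Proof. by move=> mg; apply: measurable_funM => //; exact: indic_meas. Qed.

Lemma truncate_le g n x : `|truncate g n x| <= `|g x|.
Proof.
rewrite /truncate indic_itv; case: (`|x| <= _)%R; rewrite ?mul1r// mul0r normr0; exact: normr_ge0.
Qed.

Lemma truncate_cvg g x : truncate g n x @[n --> \oo] --> g x.
Proof.
by rewrite -[X in _ --> X]mul1r; apply: cvgM; [exact: indic_cvg|exact: cvg_cst].
Qed.

Lemma truncate_L1 v n : L1 mu v -> L1 mu (truncate v n).
Proof.
move=> hv; apply: L1_le (L1_abs hv) (truncate_le v n).
exact: truncate_meas (L1_meas hv).
Qed.

Lemma truncate_L2 v n : L2 mu v -> L2 mu (truncate v n).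
Proof.
move=> hv; have mv := L2_meas hv; apply: L2_le hv (truncate_le v n).
exact: truncate_meas.
Qed.

Lemma indic_itv_L1 (n : R) : L1 mu (\1_(`[- n, n]%classic) : R -> R).
Proof.
exact: integrable_indic_itv.
Qed.

Lemma indic_itv_I (n : R) : 0 <= n -> \int[mu]_x (\1_(`[- n, n]%classic) x : R) = 2 * n.
Proof.
move=> n0; rewrite /Rintegral integral_indic ?setIT//.
by have /= -> := itv_mu n0.
Qed.

Lemma truncate_L2_L1 v n : L2 mu v -> L1 mu (truncate v n).
Proof.
move=> hv; have h : L2 mu (\1_(`[- n%:R, n%:R]%classic) : R -> R).
  apply: (L2_bounded (M := 1)); first exact: indic_itv_L1.
  by move=> x; rewrite indic_itv normr_nat; case: (`|x| <= _)%R.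
exact: L2_mul h hv.
Qed.

Lemma L2_dominated (d : nat -> R -> R) (w : R -> R) C : (forall n, mfun (d n)) ->
  (forall x, d ^~ x @ \oo --> 0) -> L2 mu w -> (forall n x, d n x ^+ 2 <= C * w x ^+ 2) ->
  \int[mu]_x (d n x ^+ 2) @[n --> \oo] --> (0 : R).
Proof.
move=> md cd [_ hw] dw; rewrite -[X in _ --> X](I_0 mu).
have [] // := @DCT _ _ _ mu (fun n x => d n x ^+ 2) (fun=> 0) (fun x => C * w x ^+ 2).
- by move=> n; exact: (measurable_funX 2 (md n)).
- by apply: aeW => x; exact: cvg0_sqr.
- exact: L1Z.
- by move=> n x; rewrite ger0_norm ?sqr_ge0.
Qed.

Lemma truncate_cvg_L2 v : L2 mu v ->
  \int[mu]_x ((truncate v n x - v x) ^+ 2) @[n --> \oo] --> (0 : R).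
Proof.
move=> hv; have [mv _] := hv; apply: (L2_dominated (C := 4) _ _ hv) => [n|x|n x].
- by apply: measurable_funB => //; exact: truncate_meas.
- by rewrite -(subrr (v x)); apply: cvgB; [exact: truncate_cvg|exact: cvg_cst].
rewrite /truncate indic_itv.
by have := sqr_ge0 (v x); case: (`|x| <= _)%R; rewrite ?mul1r ?mul0r => h; nra.
Qed.

Lemma L1_tail v : L1 mu v ->
  \int[mu]_x `|truncate v n x - v x| @[n --> \oo] --> (0 : R).
Proof.
move=> hv; have [] := @DCT _ _ _ mu (truncate v) v (fun x => `|v x|).
- by move=> n; apply: truncate_meas; exact: L1_meas hv.
- exact: L1_meas hv.
- by apply: aeW => x; exact: truncate_cvg.
- exact: L1_abs.
- by move=> n x; exact: truncate_le.
by [].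
Qed.

(** Piecewise linear cutoff: 1 on [-r, r], 0 beyond 2 r, slope 1 / r in between. *)
Definition chi (r x : R) : R := Num.max 0 (Num.min 1 (2 - `|x| / r)).

Lemma chi_ge0 r x : 0 <= chi r x.
Proof. by rewrite /chi le_max lexx. Qed.

Lemma chi_le1 r x : chi r x <= 1.
Proof. by rewrite /chi ge_max ler01 ge_min lexx. Qed.

Lemma chi_in r x : 0 < r -> `|x| <= r -> chi r x = 1.
Proof.
move=> r0 xr; have h : `|x| / r <= 1 by rewrite ler_pdivrMr// mul1r.
by rewrite /chi min_l; [rewrite max_r|lra].
Qed.

Lemma chi_out r x : 0 < r -> 2 * r <= `|x| -> chi r x = 0.
Proof.
move=> r0 xr; have h : 2 <= `|x| / r by rewrite ler_pdivlMr.
by rewrite /chi max_l// ge_min; apply/orP; right; lra.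
Qed.

Lemma sqrt_cvg0 (e : nat -> R) : e @ \oo --> (0 : R) -> Num.sqrt (e n) @[n --> \oo] --> (0 : R).
Proof.
by move=> c; rewrite -sqrtr0; apply: continuous_cvg => //; exact: sqrt_continuous.
Qed.

Lemma max_lip (a x y : R) : `|Num.max a x - Num.max a y| <= `|x - y|.
Proof.
have h1 := ler_norm (x - y); have h2 := ler_norm (y - x); rewrite distrC in h2; have h3 := normr_ge0 (x - y).
by rewrite /Num.max; case: (ltP a x) => ?; case: (ltP a y) => ?; rewrite ler_norml; lra.
Qed.

Lemma min_lip (a x y : R) : `|Num.min a x - Num.min a y| <= `|x - y|.
Proof.
have h1 := ler_norm (x - y); have h2 := ler_norm (y - x); rewrite distrC in h2; have h3 := normr_ge0 (x - y).
by rewrite /Num.min; case: (ltP a x) => ?; case: (ltP a y) => ?; rewrite ler_norml; lra.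
Qed.

Lemma clamp_lip (a b : R) :
  `|Num.max 0 (Num.min 1 a) - Num.max 0 (Num.min 1 b)| <= `|a - b|.
Proof. exact: le_trans (max_lip _ _ _) (min_lip _ _ _). Qed.

Lemma chi_lip (r x y : R) : 0 < r -> `|chi r x - chi r y| <= `|x - y| / r.
Proof.
move=> r0; apply: le_trans (clamp_lip _ _) _.
have -> : (2 - `|x| / r) - (2 - `|y| / r) = (`|y| - `|x|) / r by field; nz.
rewrite normrM (ger0_norm (_ : 0 <= r^-1)) ?invr_ge0 ?(ltW r0)//.
by rewrite ler_wpM2r ?invr_ge0 ?(ltW r0)// distrC ler_dist_dist.
Qed.

Lemma chi_cont (r : R) : 0 < r -> continuous (chi r).
Proof.
move=> r0 x; apply/cvgrPdist_le => e e0; exists (e * r) => [|y /= h]; first exact: mulr_gt0.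
by apply: le_trans (chi_lip _ _ r0) _; rewrite ler_pdivrMr// ltW.
Qed.

(** Approximate on [-2 r, 2 r], then multiply by [chi r]. On the collar the error is chi (v - g0) +
    (1 - chi) v, whose second part is a tail of [v]. *)
Lemma cc_dense v (e : R) : L1 mu v -> 0 < e ->
  exists (g : R -> R) (N : R), [/\ 0 < N, continuous g, forall x, N <= `|x| -> g x = 0,
    L1 mu g & \int[mu]_x `|v x - g x| <= e].
Proof.
move=> hv e0; have e2 : 0 < e / 2 by rewrite divr_gt0.
have /cvg0P /(_ _ e2) [n0 hn0] := L1_tail hv.
pose n := maxn n0 1; pose r : R := n%:R.
have r0 : 0 < r by rewrite ltr0n /n leq_max orbT.
have {hn0} tail : \int[mu]_x `|truncate v n x - v x| <= e / 2.
  have := hn0 n (leq_maxl _ _); rewrite ger0_norm//; exact: I_ge0.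
pose E : set R := `[- (2 * r), 2 * r]%classic.
have mE : measurable E by exact: itv_meas.
have muE : (mu E < +oo)%E by rewrite itv_mu ?ltry// mulr_ge0 ?(ltW r0).
have hvE : mu.-integrable E (EFin \o v) by apply: integrableS hv.
have [g_ [cg ig]] := @approximation_continuous_integrable R E v mE muE hvE.
move=> /fine_cvgP [fing /cvg0P /(_ _ e2) [m hm]].
have [m1 _ hm1] := fing.
pose k := maxn m m1; pose g0 := g_ k.
have hk : (\int[mu]_(z in E) `|(v z - g0 z)%:E| <= (e / 2)%:E)%E.
  have := hm k (leq_maxl _ _); have := hm1 k (leq_maxr _ _) => /= fk.
  rewrite /= ger0_norm; last by rewrite fine_ge0// integral_ge0.
  by rewrite -lee_fin fineK.
pose g x := g0 x * chi r x; exists g, (2 * r).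
have gc : continuous g by move=> x; apply: cvgM; [exact: cg|exact: (chi_cont r0)].
have g0E x : 2 * r <= `|x| -> g x = 0 by move=> h; rewrite /g chi_out ?mulr0.
have mg : mfun g by exact: continuous_measurable_fun.
have indE : L1 mu (fun x => \1_E x * `|v x - g0 x|).
  apply/L1_ge0P.
  - apply: measurable_funM; first exact: indic_meas.
    apply: measurableT_comp => //; apply: measurable_funB; first exact: L1_meas hv.
    exact: continuous_measurable_fun (cg k).
  - by move=> x; rewrite mulr_ge0// indic_itv ler0n.
  - apply: le_lt_trans (ltry (e / 2)); apply: le_trans hk.
    rewrite [leRHS]integral_mkcond; rewrite le_eqVlt; apply/orP; left; apply/eqP; apply: eq_integral => x _.
  by rewrite patchE indicE; case: (x \in E); rewrite ?mul1r ?mul0r.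
have bound x : `|v x - g x| <= \1_E x * `|v x - g0 x| + `|truncate v n x - v x|.
  rewrite /E !indic_itv /truncate indic_itv -/r /g.
  have c0 := chi_ge0 r x; have c1 := chi_le1 r x.
  have [xr|xr] := leP `|x| r.
    rewrite chi_in// mulr1 !mul1r subrr normr0 addr0.
    by rewrite (_ : `|x| <= 2 * r) ?mul1r//; lra.
  have [x2|x2] := leP `|x| (2 * r).
    rewrite !mul1r mul0r sub0r normrN.
    have -> : v x - g0 x * chi r x = chi r x * (v x - g0 x) + (1 - chi r x) * v x by ring.
    apply: le_trans (ler_normD _ _) _; rewrite !normrM (ger0_norm c0) (ger0_norm (_ : 0 <= 1 - chi r x)) ?subr_ge0//.
    by apply: lerD; apply: ler_piMl => //; rewrite gerBl.
  by rewrite chi_out ?(ltW x2)// !mul0r mulr0 subr0 sub0r normrN add0r.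
have tl : L1 mu (fun x => `|truncate v n x - v x|).
  by apply: L1_abs; apply: L1B => //; exact: truncate_L1.
have vg : L1 mu (fun x => v x - g x).
  apply: (@L1_le _ _ _ mu _ (fun x => \1_E x * `|v x - g0 x| + `|truncate v n x - v x|)) => //.
    by apply: measurable_funB => //; exact: L1_meas hv.
  exact: L1D.
split => //; first by rewrite mulr_gt0.
  by apply: L1_ext (L1B hv vg) => x; rewrite opprB addrC subrK.
apply: le_trans (I_le (L1_abs vg) (L1D indE tl) bound) _.
rewrite I_D//; suff : \int[mu]_x (\1_E x * `|v x - g0 x|) <= e / 2 by lra.
rewrite -lee_fin -L1_integralE//; apply: le_trans hk.
rewrite [leRHS]integral_mkcond; rewrite le_eqVlt; apply/orP; left; apply/eqP; apply: eq_integral => x _.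
  by rewrite patchE indicE; case: (x \in E); rewrite ?mul1r ?mul0r.
Qed.

Lemma add3_le (a b e : R) : b <= e / 2 -> a <= e / 4 -> b + (a + a) <= e.
Proof. lra. Qed.

Lemma L1_transl v : L1 mu v -> forall e : R, 0 < e -> exists2 d : R, 0 < d &
  forall z, `|z| < d -> \int[mu]_x `|v (x - z) - v x| <= e.
Proof.
move=> hv e e0; have e4 : 0 < e / 4 by rewrite divr_gt0.
have [g [N [N0 gc gN hg vg]]] := cc_dense hv e4.
have sh z : L1 mu (fun x => g (x - z)) by exact: (L1_shift (- z) hg).
have shv z : L1 mu (fun x => v (x - z)) by exact: (L1_shift (- z) hv).
suff [d d0 hd] : exists2 d : R, 0 < d & forall z, `|z| < d -> \int[mu]_x `|g (x - z) - g x| <= e / 2.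
  exists d => // z zd.
  have h1 := L1_abs (L1B (shv z) (sh z)); have h2 := L1_abs (L1B (sh z) hg).
  have h3 := L1_abs (L1B hg hv).
  apply: le_trans (I_le (L1_abs (L1B (shv z) hv)) (L1D h1 (L1D h2 h3)) _) _.
    move=> x; apply: le_trans (ler_distD (g (x - z)) _ _) _; rewrite lerD2l.
    exact: ler_distD.
  rewrite I_D//; last exact: L1D.
  rewrite I_D//; have hz := hd z zd.
  have /= -> := I_shift (- z) (L1_abs (L1B hv hg)).
  rewrite (@I_ext _ _ _ mu (fun x => `|g x - v x|) (fun x => `|v x - g x|)); last by move=> x; rewrite distrC.
  by rewrite addrCA; exact: (add3_le hz vg).
(* Dominated convergence needs a sequence: were the claim false, some shifts [z n] of size below 1 /
   (n + 1) would violate it. *)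
apply: contrapT => H.
have ex (n : nat) : exists z : R, `|z| < n.+1%:R^-1 /\
    ~ (\int[mu]_x `|g (x - z) - g x| <= e / 2).
  apply: contrapT => H2; apply: H; exists n.+1%:R^-1; first by rewrite invr_gt0.
  by move=> z zn; apply: contrapT => H3; apply: H2; exists z.
have [z hz] := choice ex.
have z0 : z @ \oo --> (0 : R).
  apply: (@cvg0_le _ _ _ _ _ (fun n => n.+1%:R^-1)); last exact: cvg_harmonic.
  by move=> n; have [/ltW] := hz n.
have [K hK] : exists K, forall x, `|g x| <= K.
  have cg' : {within `[- N, N], continuous (fun x => `|g x|)}.
    by apply: continuous_subspaceT => x; apply: cvg_norm; exact: gc.
  have NN : - N <= N by rewrite (le_trans (_ : _ <= 0)) ?oppr_le0 ?ltW.
  have [c _ hc] := EVT_max NN cg'.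
  exists `|g c| => x; have [xN|xN] := leP `|x| N.
    by apply: hc; rewrite in_itv/= -ler_norml.
  by rewrite gN ?normr0// ltW.
have [] := @DCT _ _ _ mu (fun n x => g (x - z n) - g x) (fun=> 0)
   (fun x => 2 * K * \1_(`[- (N + 1), N + 1]%classic) x).
- by move=> n; apply: measurable_funB; [exact: L1_meas (sh _)|exact: L1_meas hg].
- exact: measurable_cst.
- apply: aeW => x; rewrite -(subrr (g x)); apply: cvgB; last exact: cvg_cst.
  apply: continuous_cvg; first exact: gc.
  by rewrite -[X in _ --> X]subr0; apply: cvgB => //; exact: cvg_cst.
- by apply: L1Z; exact: indic_itv_L1.
- move=> n x; rewrite indic_itv; have [xN|xN] := leP `|x| (N + 1).
    rewrite mulr1; apply: le_trans (ler_normB _ _) _.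
    by have := hK x; have := hK (x - z n); lra.
  have zn1 : `|z n| <= 1.
    by have [/ltW h _] := hz n; apply: le_trans h _; rewrite invf_le1 ?ler1n.
  have xz : N <= `|x - z n| by have := lerB_dist x (z n); lra.
  by rewrite !gN ?subr0 ?normr0 ?mulr0//; lra.
move=> _ _; under eq_fun do under I_ext do rewrite subr0.
move=> /cvg0P /(_ (e / 2)) -[|n hn]; first by rewrite divr_gt0.
have [_] := hz n; apply; have := hn n (leqnn _); rewrite ger0_norm//.
exact: I_ge0.
Qed.

Definition omod v (z : R) := \int[mu]_x `|v (x - z) - v x|.

Lemma omod_bound v z : L1 mu v -> 0 <= omod v z <= 2 * \int[mu]_x `|v x|.
Proof.
move=> hv; have shv : L1 mu (fun x => v (x - z)) by exact: (L1_shift (- z) hv).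
apply/andP; split; first by apply: I_ge0 => x; exact: normr_ge0.
apply: le_trans (I_le (L1_abs (L1B shv hv)) (L1D (L1_abs shv) (L1_abs hv)) _) _.
  by move=> x; exact: ler_normB.
rewrite I_D; [|exact: L1_abs|exact: L1_abs].
by have := I_shift (- z) (L1_abs hv) => /= ->; lra.
Qed.

Lemma omod_meas v : mfun v -> mfun (omod v).
Proof.
move=> mv; apply: (@measurable_I1 _ _ _ _ _ mu (fun p : R * R => `|v (p.1 - p.2) - v p.1|)).
apply: measurableT_comp => //; apply: measurable_funB; last exact: measurable_fst_comp.
by apply: (measurableT_comp mv); exact: measurable_sub2.
Qed.

(** Minkowski's integral inequality: [conv k v - v] is the average of the differences
    [v (x - z) - v x] with weight [k z]. *)
Lemma conv_omod k v : kernel k -> L1 mu v ->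
  \int[mu]_x `|conv k v x - v x| <= \int[mu]_z (k z * omod v z).
Proof.
move=> kh hv; have mv := L1_meas hv.
pose G (p : R * R) := `|v (p.1 - p.2) - v p.1|.
have mG : mfun G.
  apply: measurableT_comp => //; apply: measurable_funB; last exact: measurable_fst_comp.
  by apply: (measurableT_comp mv); exact: measurable_sub2.
have shv z : L1 mu (fun x => v (x - z)) by exact: (L1_shift (- z) hv).
have hG z : L1 mu (fun x => G (x, z)) by exact: (L1_abs (L1B (shv z) hv)).
have hc := conv_L1 kh hv.
pose F (p : R * R) := k p.2 * G p.
have mF : mfun F.
  by apply: measurable_funM => //; apply: measurable_snd_comp; exact: L1_meas (kernel_L1 kh).
have LF : L1 (mu \x mu)%E F.
  apply: (@L1_prod2 _ _ _ _ _ mu mu _ (fun z => 2 * (\int[mu]_x `|v x|) * k z)) => //.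
  - by move=> z; exact: (L1Z (k z) (hG z)).
  - move=> z; have -> : \int[mu]_x `|F (x, z)| = k z * omod v z.
      have -> : k z * omod v z = \int[mu]_x (k z * G (x, z)) by rewrite (I_Z (k z) (hG z)).
      apply: I_ext => x; rewrite /F/= ger0_norm//.
      by apply: mulr_ge0; [exact: (kernel_ge0 kh)|exact: normr_ge0].
    by rewrite mulrC; apply: ler_wpM2r; [exact: (kernel_ge0 kh)|have /andP[] := omod_bound z hv].
  - by apply: L1Z; exact: kernel_L1.
have -> : \int[mu]_z (k z * omod v z) = \int[mu]_x \int[mu]_z F (x, z).
  by rewrite (I_swap LF); apply: I_ext => z; rewrite (I_Z (k z) (hG z)).
have ae := L1_sect1 LF.
have mL : L1 mu (fun x => \int[mu]_z F (x, z)) by exact: L1_I2.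
rewrite -lee_fin -!L1_integralE//; last by apply: L1_abs; exact: L1B.
apply: ae_ge0_le_integral => //.
- apply/measurable_EFinP; apply: measurableT_comp => //; apply: measurable_funB => //.
  exact: L1_meas hc.
- move=> x _; rewrite lee_fin; apply: I_ge0 => z.
  by apply: mulr_ge0; [exact: (kernel_ge0 kh)|exact: normr_ge0].
- by apply/measurable_EFinP; exact: L1_meas mL.
apply: filterS ae => x hx _; rewrite lee_fin.
have h1 : L1 mu (fun z => k z * v (x - z)).
  have := L1_shiftl x (kernel_mul_L1 kh x hv); apply: L1_ext => z.
  by rewrite opprB addrC subrK.
have -> : conv (k) v x - v x = \int[mu]_z (k z * (v (x - z) - v x)).
  have -> : conv (k) v x = \int[mu]_z (k z * v (x - z)).
    rewrite /conv -(I_shiftl x (kernel_mul_L1 kh x hv)); apply: I_ext => z.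
    by rewrite opprB addrC subrK.
  rewrite -[v x in LHS]mulr1 -(kernel_I kh) -I_Z; last exact: kernel_L1.
  rewrite -I_B//; last by apply: L1Z; exact: kernel_L1.
  by apply: I_ext => z; ring.
apply: I_abs_le => //.
  rewrite (_ : (fun z => _) = (fun z => k z * v (x - z) - v x * k z)).
    by apply: L1B => //; apply: L1Z; exact: kernel_L1.
  by apply/funext => z; ring.
by move=> z; rewrite normrM (ger0_norm (kernel_ge0 kh _)).
Qed.

Lemma pois_L1 v : L1 mu v -> forall e : R, 0 < e -> exists2 h0 : R, 0 < h0 &
  forall h, 0 < h -> h <= h0 -> \int[mu]_x `|conv (pois h) v x - v x| <= e.
Proof.
move=> hv e e0; have mv := L1_meas hv.
have [h0 h00 hh0] := pois_approx (omod_meas mv) (fun z => omod_bound z hv) (L1_transl hv) e0.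
by exists h0 => // h hp hh; apply: le_trans (hh0 h hp hh); apply: conv_omod => //; exact: pois_kernel.
Qed.

End approximation.

(** * Inversion, the semigroup law and Plancherel's identity *)

Section plancherel.
Context {R : realType}.
Local Notation mu := (@lebesgue_measure R).
Implicit Types (v w g : R -> R) (h : R).

Lemma sin_meas : mfun (@sin R).
Proof. exact: continuous_measurable_fun (@continuous_sin R). Qed.

Lemma cos_meas : mfun (@cos R).
Proof. exact: continuous_measurable_fun (@continuous_cos R). Qed.

Definition hn (n : nat) : R := n.+1%:R^-1.

Lemma hn_gt0 n : 0 < hn n. Proof. by rewrite /hn invr_gt0. Qed.

Lemma hn_cvg : hn @ \oo --> (0 : R).
Proof. exact: cvg_harmonic. Qed.

Lemma hn_small (h0 : R) : 0 < h0 -> exists N, forall n, (N <= n)%N -> hn n <= h0.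
Proof.
move=> h00; have /cvg0P /(_ _ h00) [N hN] := hn_cvg.
by exists N => n /hN; rewrite ger0_norm// ltW// hn_gt0.
Qed.

Lemma eabs_hn_cvg (x : R) : eabs (hn n) x @[n --> \oo] --> (1 : R).
Proof.
rewrite -expR0; apply: continuous_cvg; first exact: continuous_expR.
rewrite -oppr0; apply: cvgN; rewrite -[X in _ --> X](mul0r `|x|).
by apply: cvgM; [exact: hn_cvg|exact: cvg_cst].
Qed.

(* Inversion: apply [hart_inv_pois] to [exp (- h |x|)] and let the regularisation go to 0. *)
Lemma hart_pois h y : 0 < h -> hart (pois h) y = eabs h y.
Proof.
move=> h0; have P := @pi_gt0' R; have kh := pois_kernel h0; have hk := kernel_L1 kh.
have he := eabs_L1 h0.
pose A n := hart (fun xi => eabs (hn n) xi * hart (eabs h) xi) y.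
have A1 : A @ \oo --> 2 * pi * hart (pois h) y.
  rewrite -I_Z; last exact: hart_L1.
  have [] := @DCT _ _ _ mu (fun n x => eabs (hn n) x * hart (eabs h) x * cas (x * y))
    (fun x => 2 * pi * (pois h x * cas (x * y))) (fun x => 4 * pi * pois h x).
  - move=> n; apply: measurable_funM; last exact: casM_meas.
    by apply: measurable_funM; [exact: eabs_meas|exact: hart_meas (L1_meas he)].
  - exact: (L1_meas (L1Z (2 * pi) (hart_L1 y hk))).
  - apply: aeW => x; rewrite mulrA -hart_eabs// -[X in _ --> X]mul1r.
    under eq_fun do rewrite -mulrA.
    by apply: cvgM; [exact: eabs_hn_cvg|exact: cvg_cst].
  - exact: L1Z.
  - move=> n x; have c2 := cas_bound (x * y).
    have e1 := eabs_le1 x (hn_gt0 n); have e0 := eabs_ge0 (hn n) x.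
    have q0 : 0 <= 2 * pi * pois h x by apply: mulr_ge0; [rewrite mulr_ge0 ?(ltW P)|exact: (kernel_ge0 kh)].
    rewrite (hart_eabs _ h0) normrM (normrM (eabs _ _)) (ger0_norm e0) (ger0_norm q0).
    have -> : 4 * pi * pois h x = 1 * (2 * pi * pois h x) * 2 by ring.
    have c0 := normr_ge0 (cas (x * y)).
    apply: ler_pM => //; first exact: mulr_ge0.
    exact: ler_wpM2r.
  by [].
have A2 : A @ \oo --> 2 * pi * eabs h y.
  pose om z := `|eabs h (y - z) - eabs h y|.
  have mom : mfun om.
    apply: measurableT_comp => //; apply: measurable_funB => //.
    by apply: (measurableT_comp (eabs_meas h)); exact: measurable_funB.
  have omM z : 0 <= om z <= 1.
    have a1 := eabs_le1 (y - z) h0; have b1 := eabs_le1 y h0.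
    have a0 := eabs_ge0 h (y - z); have b0 := eabs_ge0 h y.
    by rewrite /om normr_ge0/= ler_norml; apply/andP; split; lra.
  have om0 (e : R) : 0 < e -> exists2 d : R, 0 < d & forall z : R, `|z| < d -> om z <= e.
    move=> e0; exists (e / h); first exact: divr_gt0.
    move=> z zd; apply: le_trans (eabs_lip _ _ h0) _.
    rewrite addrAC subrr add0r normrN mulrC -ler_pdivlMr//; exact: ltW.
  have := pois_approx mom omM om0 => H.
  have E n : `|A n - 2 * pi * eabs h y| <= 2 * pi * \int[mu]_z (pois (hn n) z * om z).
    have kn := pois_kernel (hn_gt0 n).
    have h1 : L1 mu (fun z => pois (hn n) z * eabs h (y - z)).
      apply: (bmul_L1 (kernel_L1 kn) (M := 1)); last by move=> z; rewrite ger0_norm ?eabs_ge0// eabs_le1.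
      by apply: (measurableT_comp (eabs_meas h)); exact: measurable_funB.
    rewrite /A hart_inv_pois; [|exact: hn_gt0|exact: he].
    rewrite -mulrBr normrM (ger0_norm (_ : 0 <= 2 * pi)) ?mulr_ge0 ?(ltW P)//.
    rewrite ler_wpM2l ?mulr_ge0 ?(ltW P)//.
    have -> : conv (pois (hn n)) (eabs h) y = \int[mu]_z (pois (hn n) z * eabs h (y - z)).
      rewrite /conv -(I_shiftl y (kernel_mul_L1 kn y he)); apply: I_ext => z.
      by rewrite opprB addrC subrK.
    rewrite -[eabs h y in leLHS]mulr1 -(kernel_I kn) -I_Z; last exact: kernel_L1.
    rewrite -I_B//; last by apply: L1Z; exact: kernel_L1.
    apply: I_abs_le.
    - by apply: L1B => //; apply: L1Z; exact: kernel_L1.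
    - apply: (bmul_L1 (kernel_L1 kn) (M := 1)) => // z.
      by have /andP[a b] := omM z; rewrite ger0_norm.
    - move=> z; rewrite (mulrC (eabs h y)) -mulrBr normrM (ger0_norm (kernel_ge0 kn _)) lexx//.
  apply: (@cvg_le _ _ _ _ _ _ _ E); apply: cvg0_Zl.
  apply/cvg0P => e e0; have [d d0 hd] := H e e0; have [N hN] := hn_small d0.
  exists N => n nN; have := hd (hn n) (hn_gt0 n) (hN n nN); rewrite ger0_norm//.
  by apply: I_ge0 => z; apply: mulr_ge0; [exact: (kernel_ge0 (pois_kernel (hn_gt0 n)))|exact: normr_ge0].
have e := cvg_unique _ A1 A2.
apply: (mulfI (_ : 2 * (pi : R) != 0)); first exact/lt0r_neq0/mulr_gt0.
exact: e.
Qed.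

(** The addition formulas for [cas] produce a second term, the sine transform of [k] times
    [hart v (- xi)], which vanishes because [k] is even. *)
Lemma hart_conv k v xi : kernel k -> L1 mu v ->
  hart (conv k v) xi = hart k xi * hart v xi.
Proof.
move=> kk hv; have hk := kernel_L1 kk.
have [_ E] := @conv_dual R k kk v (fun x => cas (x * xi)) 2 hv (casM_meas xi) (fun x => cas_bound _).
rewrite /hart E -I_Z; last exact: hart_L1.
apply: I_ext => y; rewrite mulrCA; congr (_ * _).
have hc : L1 mu (fun x => k x * cos (x * xi)).
  apply: (bmul_L1 hk (M := 1)); last by move=> x; exact: cos_max.
  by apply: (measurableT_comp cos_meas); exact: measurable_funM.
have hs : L1 mu (fun x => k x * sin (x * xi)).
  apply: (bmul_L1 hk (M := 1)); last by move=> x; exact: sin_max.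
  by apply: (measurableT_comp sin_meas); exact: measurable_funM.
have s0 : \int[mu]_x (k x * sin (x * xi)) = 0.
  by apply: I_odd => // x; rewrite (kernel_even kk) mulNr sinN mulrN.
have hkc : L1 mu (fun x => k (x - y) * cas (x * xi)).
  apply: (bmul_L1 (L1_shift (- y) hk) (casM_meas xi)) => x; exact: cas_bound.
rewrite -(I_shift y hkc).
rewrite (_ : \int[mu]_x (k x * cas (x * xi)) = \int[mu]_x (k x * cos (x * xi))); last first.
  rewrite -[RHS]addr0 -s0 -I_D//; apply: I_ext => x; rewrite /cas; ring.
rewrite (@I_ext _ _ _ mu (fun x => k (x + y - y) * cas ((x + y) * xi))
  (fun x => cas (y * xi) * (k x * cos (x * xi)) + (cos (y * xi) - sin (y * xi)) * (k x * sin (x * xi)))).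
  by rewrite I_D ?I_Z ?s0 ?mulr0 ?addr0//; [rewrite mulrC|exact: L1Z|exact: L1Z].
by move=> x; rewrite addrK mulrDl /cas cosD sinD; ring.
Qed.

Lemma hart_conv_pois h v xi : 0 < h -> L1 mu v ->
  hart (conv (pois h) v) xi = eabs h xi * hart v xi.
Proof. by move=> h0 hv; rewrite hart_conv ?hart_pois//; exact: pois_kernel. Qed.

Lemma eabsD a b (x : R) : eabs a x * eabs b x = eabs (a + b) x.
Proof. by rewrite /eabs -expRD; congr expR; ring. Qed.

(** By [hart_inv_pois] both sides are, up to 2 pi, transforms of the same function, because the
    damping factors multiply to [eabs (a + b)]. *)
Lemma conv_conv a b v y : 0 < a -> 0 < b -> L1 mu v ->
  conv (pois a) (conv (pois b) v) y = conv (pois (a + b)) v y.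
Proof.
move=> a0 b0 hv; have P := @pi_gt0' R; have ab0 : 0 < a + b by exact: addr_gt0.
have E1 := hart_inv_pois y a0 (conv_L1 (pois_kernel b0) hv).
have E2 := hart_inv_pois y ab0 hv.
apply: (mulfI (_ : 2 * (pi : R) != 0)); first exact/lt0r_neq0/mulr_gt0.
rewrite -E1 -E2; apply: hart_ext => xi.
by rewrite (hart_conv_pois _ b0 hv) mulrA eabsD.
Qed.

Lemma conv_pois (a b y : R) : 0 < a -> 0 < b -> conv (pois a) (pois b) y = pois (a + b) y.
Proof.
move=> a0 b0; have P := @pi_gt0' R; have ab0 : 0 < a + b by exact: addr_gt0.
apply: (mulfI (_ : 2 * pi != 0)); first exact/lt0r_neq0/mulr_gt0.
rewrite -(hart_inv_pois y a0 (kernel_L1 (pois_kernel b0))) -(hart_eabs y ab0).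
by apply: hart_ext => xi; rewrite (hart_pois _ b0) eabsD.
Qed.

Definition clip (M x : R) := Num.max (- M) (Num.min M x).

Lemma clip_abs M x : 0 <= M -> `|clip M x| <= M.
Proof.
move=> M0; rewrite /clip /Num.max /Num.min ler_norml.
by case: (ltP M x) => h; case: ltP => h2; apply/andP; split; lra.
Qed.

Lemma clip_id M x : `|x| <= M -> clip M x = x.
Proof.
rewrite ler_norml => /andP[a b]; rewrite /clip /Num.max /Num.min.
by case: (ltP M x) => h; case: ltP => h2; lra.
Qed.

Lemma clip_lip M x y : `|clip M x - clip M y| <= `|x - y|.
Proof. exact: le_trans (max_lip _ _ _) (min_lip _ _ _). Qed.

Lemma clip_le M x : 0 <= M -> `|clip M x| <= `|x|.
Proof.
move=> M0; have := clip_lip M x 0; rewrite subr0 (@clip_id M 0) ?normr0//.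
by rewrite subr0.
Qed.

Lemma clip_sub M x : 0 <= M -> `|x - clip M x| <= `|x|.
Proof.
move=> M0; have h1 := ler_norm x; have h2 := ler_norm (- x); rewrite normrN in h2.
rewrite /clip /Num.max /Num.min.
by case: (ltP M x) => a1; case: (ltP (- M)) => a2; rewrite ler_norml; apply/andP; split; lra.
Qed.

Lemma clip_meas M v : mfun v -> mfun (fun x => clip M (v x)).
Proof. by move=> mv; apply: measurable_maxr => //; exact: measurable_minr. Qed.

Lemma clip_cvg (x : R) : clip n%:R x @[n --> \oo] --> x.
Proof.
apply: cvg_near_cst; near=> n; apply: clip_id.
near: n; exact: near_nat_ge.
Unshelve. all: by end_near. Qed.

Lemma clip_cvg_L2 v : L2 mu v ->
  \int[mu]_x ((v x - clip n%:R (v x)) ^+ 2) @[n --> \oo] --> (0 : R).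
Proof.
move=> hv; have [mv _] := hv; apply: (L2_dominated (C := 1) _ _ hv) => [n|x|n x].
- by apply: measurable_funB => //; exact: clip_meas.
- by rewrite -(subrr (v x)); apply: cvgB; [exact: cvg_cst|exact: clip_cvg].
by rewrite mul1r -[leRHS]real_normK ?num_real// -[leLHS]real_normK ?num_real// lerXn2r ?nnegrE//; exact: clip_sub.
Qed.

(** Splits [w]: its clipped part is bounded and meets the L^1 convergence, the remainder is small in
    L^2 and meets the uniform L^2 bound on [conv (pois h) v - v]. *)
Lemma pois_weak v w : L1 mu v -> L2 mu v -> L1 mu w -> L2 mu w ->
  \int[mu]_x (conv (pois (hn n)) v x * w x) @[n --> \oo] --> \int[mu]_x (v x * w x).
Proof.
move=> hv hv2 hw hw2; have mw := L1_meas hw.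
pose d n x := conv (pois (hn n)) v x - v x.
have hd n : L1 mu (d n) by apply: L1B => //; exact: (conv_L1 (pois_kernel (hn_gt0 n))).
pose V := \int[mu]_x (v x ^+ 2).
have V0 : 0 <= V by apply: I_ge0 => x; exact: sqr_ge0.
have hc2 n := conv_L2 (pois_kernel (hn_gt0 n)) hv hv2.
have hd2 n : L2 mu (d n) by apply: L2B => //; case: (hc2 n).
have dV n : \int[mu]_x (d n x ^+ 2) <= 4 * V.
  have h1 := (hc2 n).1; have h2 : L2 mu (fun x => -1 * v x) by exact: L2Z.
  have := I_sqrD_le h1 h2; have := (hc2 n).2.
  rewrite (@I_ext _ _ _ mu (fun x => (-1 * v x) ^+ 2) (fun x => v x ^+ 2)); last by move=> x; ring.
  rewrite (@I_ext _ _ _ mu (fun x => (_ + -1 * v x) ^+ 2) (fun x => d n x ^+ 2)); last first.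
    by move=> x; rewrite /d; ring.
  by rewrite -/V => a b; lra.
have E n : \int[mu]_x (conv (pois (hn n)) v x * w x) - \int[mu]_x (v x * w x) = \int[mu]_x (d n x * w x).
  rewrite -I_B; [|exact: L2_mul (hc2 n).1 hw2|exact: L2_mul].
  by apply: I_ext => x; rewrite /d; ring.
apply/subr_cvg0; apply/cvg0P => e e0; rewrite /=.
have [M [M0 hM]] : exists M : nat, 4 * V * \int[mu]_x ((w x - clip M%:R (w x)) ^+ 2) <= (e / 2) ^+ 2 /\ True.
  have e2 : 0 < (e / 2) ^+ 2 / (4 * V + 1) by rewrite divr_gt0 ?exprn_gt0 ?divr_gt0// ltr_wpDl// mulr_ge0.
  have /cvg0P /(_ _ e2) [N hN] := clip_cvg_L2 hw2.
  exists N; split => //; have := hN N (leqnn _); rewrite ger0_norm; last by apply: I_ge0 => x; exact: sqr_ge0.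
  rewrite ler_pdivlMr ?ltr_wpDl ?mulr_ge0// => h; apply: le_trans h.
  rewrite mulrC ler_wpM2l ?lerDl//; apply: I_ge0 => x; exact: sqr_ge0.
set c := fun x => clip M%:R (w x).
have hcw : L1 mu c.
  apply: L1_le (L1_abs hw) _; first exact: clip_meas.
  by move=> x; apply: clip_le.
have hcw2 : L2 mu c by apply: (L2_bounded hcw (M := M%:R)) => x; exact: clip_abs.
have eM : 0 < e / 2 / (M%:R + 1) by rewrite !divr_gt0// ltr_wpDl.
have [h0 h00 hh0] := pois_L1 hv eM; have [N hN] := hn_small h00.
exists N => n nN; rewrite E.
have -> : \int[mu]_x (d n x * w x) = \int[mu]_x (d n x * c x) + \int[mu]_x (d n x * (w x - c x)).
  rewrite -I_D; [|exact: L2_mul|by apply: L2_mul => //; exact: L2B].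
  by apply: I_ext => x; ring.
apply: le_trans (ler_normD _ _) _.
have b1 : `|\int[mu]_x (d n x * c x)| <= e / 2.
  have := hh0 (hn n) (hn_gt0 n) (hN n nN); rewrite ler_pdivlMr ?ltr_wpDl// => h.
  apply: le_trans h; rewrite mulrC -I_Z; last exact: (L1_abs (hd n)).
  apply: I_abs_le; [exact: L2_mul|by apply: L1Z; exact: (L1_abs (hd n))|].
  move=> x; rewrite normrM mulrC ler_wpM2r//; apply: le_trans (clip_abs _ _) _ => //.
  by rewrite lerDl.
have b2 : `|\int[mu]_x (d n x * (w x - c x))| <= e / 2.
  rewrite -ler_sqr ?nnegrE ?divr_ge0 ?(ltW e0)// real_normK ?num_real//.
  apply: le_trans (CS (hd2 n) (L2B hw2 hcw2)) _; apply: le_trans M0.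
  by rewrite ler_wpM2r// ?dV//; apply: I_ge0 => x; exact: sqr_ge0.
exact: halves_le.
Qed.

(** With damping, [plancherel_pois] bounds the integral of [hart v] squared by 2 pi times that of
    [v] squared; Fatou then removes the damping. *)
Lemma hart_L2 v : L1 mu v -> L2 mu v -> L2 mu (hart v).
Proof.
move=> hv hv2; have mh := hart_meas (L1_meas hv).
split => //.
have P := @pi_gt0' R.
have hb n : L1 mu (fun xi => eabs (hn n) xi * hart v xi * hart v xi).
  apply: (bmul_L1 (eabs_hart_L1 (hn_gt0 n) hv) mh) => x; exact: hart_bound.
have [] := @Fatou _ _ _ mu (fun n xi => eabs (hn n) xi * hart v xi * hart v xi)
   (fun xi => hart v xi ^+ 2) (2 * pi * \int[mu]_x (v x ^+ 2)).
- by move=> n; exact: L1_meas (hb n).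
- exact: measurable_funX.
- by move=> n x; rewrite -mulrA -expr2 mulr_ge0 ?eabs_ge0 ?sqr_ge0.
- by move=> x; exact: sqr_ge0.
- apply: aeW => x; rewrite -[X in _ --> X]mul1r expr2.
  under eq_fun do rewrite -mulrA.
  by apply: cvgM; [exact: eabs_hn_cvg|exact: cvg_cst].
- move=> n; rewrite (L1_integralE (hb n)) lee_fin plancherel_pois//; last exact: hn_gt0.
  rewrite ler_wpM2l ?mulr_ge0 ?(ltW P)//.
  have [c2 cl] := conv_L2 (pois_kernel (hn_gt0 n)) hv hv2.
  have := I_ge0 mu (fun x => sqr_ge0 (conv (pois (hn n)) v x - v x)).
  have hm := L2_mul c2 hv2; have [_ c22] := c2; have [_ v22] := hv2.
  rewrite (I_to (fun x => (conv (pois (hn n)) v x ^+ 2 + v x ^+ 2) - 2 * (conv (pois (hn n)) v x * v x))); last by move=> x; ring.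
  rewrite I_B; [|exact: L1D|exact: L1Z].
  by rewrite I_D// I_Z// => a; lra.
by [].
Qed.

Lemma plancherel v w : L1 mu v -> L2 mu v -> L1 mu w -> L2 mu w ->
  \int[mu]_xi (hart v xi * hart w xi) = 2 * pi * \int[mu]_x (v x * w x).
Proof.
move=> hv hv2 hw hw2; have P := @pi_gt0' R.
have Hv := hart_L2 hv hv2; have Hw := hart_L2 hw hw2.
pose A n := \int[mu]_xi (eabs (hn n) xi * hart v xi * hart w xi).
have A1 : A @ \oo --> \int[mu]_xi (hart v xi * hart w xi).
  have [] := @DCT _ _ _ mu (fun n xi => eabs (hn n) xi * hart v xi * hart w xi)
    (fun xi => hart v xi * hart w xi) (fun xi => `|hart v xi * hart w xi|).
  - move=> n; apply: measurable_funM; last exact: L2_meas Hw.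
    by apply: measurable_funM; [exact: eabs_meas|exact: L2_meas Hv].
  - by exact: (L1_meas (L2_mul Hv Hw)).
  - apply: aeW => x; rewrite -[X in _ --> X]mul1r.
    under eq_fun do rewrite -mulrA.
    by apply: cvgM; [exact: eabs_hn_cvg|exact: cvg_cst].
  - by apply: L1_abs; exact: L2_mul.
  - move=> n x; rewrite -mulrA normrM (ger0_norm (eabs_ge0 _ _)) ler_piMl//.
    exact: eabs_le1 (hn_gt0 n).
  by [].
have A2 : A @ \oo --> 2 * pi * \int[mu]_x (v x * w x).
  rewrite /A; under eq_fun do rewrite plancherel_pois ?hn_gt0//.
  by apply: cvgM; [exact: cvg_cst|exact: pois_weak].
exact: (cvg_unique _ A1 A2).
Qed.

Lemma plancherel_sqr v : L1 mu v /\ L2 mu v -> \int[mu]_xi (hart v xi ^+ 2) = 2 * pi * \int[mu]_x (v x ^+ 2).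
Proof.
move=> [a b]; have e := plancherel a b a b.
rewrite (@I_ext _ _ _ mu (fun x => v x ^+ 2) (fun x => v x * v x)); last by move=> x; rewrite expr2.
by rewrite -e; apply: I_ext => x; rewrite expr2.
Qed.

End plancherel.
Section cvg_misc.
Context {R : realType}.

Lemma cvg_uniqR (u : nat -> R) (a b : R) :
  u n @[n --> \oo] --> a -> u n @[n --> \oo] --> b -> a = b.
Proof. by move=> h1 h2; apply: (cvg_unique _ h1 h2). Qed.

Lemma cvge0_2D (a b : nat -> \bar R) :
  (a n @[n --> \oo] --> 0 -> b n @[n --> \oo] --> 0 ->
  2%:E * a n + 2%:E * b n @[n --> \oo] --> 0)%E.
Proof.
move=> ha hb; rewrite -[X in _ --> X](adde0 (0 : \bar R)%E).
apply: cvgeD => //.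
  by rewrite -[X in _ --> X](mule0 2%:E); apply: cvgeZl.
by rewrite -[X in _ --> X](mule0 2%:E); apply: cvgeZl.
Qed.

Lemma mulVK_eq (a b c : R) : 0 < a -> b = a * c -> c = a^-1 * b.
Proof. by move=> a0 ->; rewrite mulrA mulVf ?mul1r ?gt_eqF. Qed.

Lemma polar_arith (a b c g p q x y z : R) : x = g * a -> y = g * c -> z = g * q ->
  z = x + 2 * p + y -> q = a + 2 * b + c -> p = g * b.
Proof.
move=> -> -> -> h e; rewrite e in h.
have : 2 * p = 2 * (g * b) by rewrite !mulrDr in h; lra.
lra.
Qed.

End cvg_misc.

(** * Convergence in L^2 *)

Section L2_cvg.
Context d (T : measurableType d) (R : realType).
Variable mu : {measure set T -> \bar R}.
Implicit Types f g h : T -> R.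

Lemma L2cvg_ip (f_ : nat -> T -> R) f h : (forall n, L2 mu (f_ n)) -> L2 mu f -> L2 mu h ->
  \int[mu]_x ((f_ n x - f x) ^+ 2) @[n --> \oo] --> (0 : R) ->
  \int[mu]_x (f_ n x * h x) @[n --> \oo] --> \int[mu]_x (f x * h x).
Proof.
move=> hf_ hf hh hc.
pose C := Num.sqrt (\int[mu]_x (h x ^+ 2)).
apply: (@cvg_le _ _ _ _ _ (fun n => Num.sqrt (\int[mu]_x ((f_ n x - f x) ^+ 2)) * C)).
  move=> n; rewrite -I_B; try exact: L2_mul.
  rewrite (@I_ext _ _ _ mu _ (fun x => (f_ n x - f x) * h x)); last by move=> x; ring.
  by apply: CS_abs => //; exact: L2B.
apply: cvg0_Zr.
rewrite -[X in _ --> X]sqrtr0; apply: continuous_cvg => //; exact: sqrt_continuous.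
Qed.

Lemma L2cvg_norm (f_ : nat -> T -> R) f : (forall n, L2 mu (f_ n)) -> L2 mu f ->
  \int[mu]_x ((f_ n x - f x) ^+ 2) @[n --> \oo] --> (0 : R) ->
  \int[mu]_x (f_ n x ^+ 2) @[n --> \oo] --> \int[mu]_x (f x ^+ 2).
Proof.
move=> hf_ hf hc.
have h1 := L2cvg_ip hf_ hf hf hc.
have E n : \int[mu]_x (f_ n x ^+ 2) = \int[mu]_x ((f_ n x - f x) ^+ 2) +
   (2 * \int[mu]_x (f_ n x * f x) - \int[mu]_x (f x ^+ 2)).
  have a1 := L2B (hf_ n) hf; have a2 := L2_mul (hf_ n) hf; have [_ a3] := hf.
  rewrite -I_Z// -I_B//; last exact: L1Z.
  rewrite -I_D//; [by apply: I_ext => x; ring|by case: a1|by apply: L1B => //; exact: L1Z].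
under eq_fun do rewrite E.
have e0 : 0 + (2 * \int[mu]_x (f x * f x) - \int[mu]_x (f x ^+ 2)) = \int[mu]_x (f x ^+ 2).
  rewrite (@I_ext _ _ _ mu (fun x => f x * f x) (fun x => f x ^+ 2)); last by move=> x; rewrite expr2.
  ring.
suff : \int[mu]_x ((f_ n x - f x) ^+ 2) +
   (2 * \int[mu]_x (f_ n x * f x) - \int[mu]_x (f x ^+ 2)) @[n --> \oo] -->
   0 + (2 * \int[mu]_x (f x * f x) - \int[mu]_x (f x ^+ 2)) by rewrite e0.
apply: cvgD => //; apply: cvgB; last exact: cvg_cst.
by apply: cvgM => //; exact: cvg_cst.
Qed.

Lemma L2_LfunP f : L2 mu f <-> f \in Lfun mu 2%:E.
Proof.
split=> [[mf hf]|hf]; last first.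
  split; last exact: Lfun2_integrable_sqr.
  by move: hf; rewrite inE => /andP[]; rewrite inE.
rewrite inE; apply/andP; split; rewrite inE//= /finite_norm.
rewrite unlock; apply: poweR_lty.
rewrite (_ : (\int[mu]_x _)%E = (\int[mu]_x (f x ^+ 2)%:E)%E).
  by have /integrableP[_] := hf; apply: le_lt_trans; rewrite le_eqVlt; apply/orP; left;
    apply/eqP; apply: eq_integral => x _ /=; rewrite ger0_norm// sqr_ge0.
by apply: eq_integral => x _ /=; rewrite powR_mulrn// real_normK// num_real.
Qed.

Lemma Lnorm2E f : L2 mu f ->
  ('N[mu]_2%:E [EFin \o f])%E = (Num.sqrt (\int[mu]_x (f x ^+ 2)))%:E.
Proof.
move=> [mf hf]; rewrite unlock.
rewrite (_ : (\int[mu]_x _)%E = (\int[mu]_x (f x ^+ 2)%:E)%E).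
  by rewrite L1_integralE// -powR12_sqrt//; apply: I_ge0 => x; exact: sqr_ge0.
by apply: eq_integral => x _ /=; rewrite powR_mulrn// real_normK// num_real.
Qed.

Lemma L2cvg_cauchy (f_ : nat -> T -> R) f : (forall n, L2 mu (f_ n)) -> L2 mu f ->
  \int[mu]_x ((f_ n x - f x) ^+ 2) @[n --> \oo] --> (0 : R) ->
  forall e : R, 0 < e -> exists N : nat, forall n m, (N <= n)%N -> (N <= m)%N ->
    \int[mu]_x ((f_ n x - f_ m x) ^+ 2) <= e.
Proof.
move=> hf_ hf hc e e0; have e4 : 0 < e / 4 by rewrite divr_gt0.
have /cvg0P /(_ _ e4) [N hN] := hc.
have hN' n : (N <= n)%N -> \int[mu]_x ((f_ n x - f x) ^+ 2) <= e / 4.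
  by move=> /hN; exact: le_trans (ler_norm _).
exists N => n m /hN' h1 /hN' h2.
have a1 := L2B (hf_ n) hf; have a2 := L2Z (-1) (L2B (hf_ m) hf).
rewrite (@I_ext _ _ _ mu _ (fun x => ((f_ n x - f x) + -1 * (f_ m x - f x)) ^+ 2)); last first.
  by move=> x; congr (_ ^+ 2); ring.
apply: le_trans (I_sqrD_le a1 a2) _.
rewrite (@I_ext _ _ _ mu (fun x => (-1 * (f_ m x - f x)) ^+ 2) (fun x => (f_ m x - f x) ^+ 2)); last by move=> x; ring.
by move: h1 h2; set a := (\int[mu]_x _); set b := (\int[mu]_x _); move: a b => a b; clear; lra.
Qed.

(** Kept in the extended reals because the defects in [is_fracLap] are extended numbers, not finite
    by definition. *)
Lemma ge0_int_sqrD f g : mfun f -> mfun g ->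
  (\int[mu]_x ((f x + g x) ^+ 2)%:E <=
   2%:E * \int[mu]_x (f x ^+ 2)%:E + 2%:E * \int[mu]_x (g x ^+ 2)%:E)%E.
Proof.
move=> mf mg.
have p h (x : T) : setT x -> (0 <= (2 * h x ^+ 2)%:E)%E.
  by move=> _; rewrite lee_fin mulr_ge0// sqr_ge0.
have m2 h : mfun h -> mfun (fun x => (2 * h x ^+ 2)%:E).
  by move=> mh; apply/measurable_EFinP; apply: measurable_funM => //; exact: measurable_funX.
have m h : mfun h -> mfun (fun x => (h x ^+ 2)%:E).
  by move=> mh; apply/measurable_EFinP; exact: measurable_funX.
have z h : mfun h ->
    (2%:E * \int[mu]_x (h x ^+ 2)%:E = \int[mu]_x (2 * h x ^+ 2)%:E)%E.
  move=> mh; rewrite -ge0_integralZl_EFin//; last exact: m.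
  by move=> x _; rewrite lee_fin sqr_ge0.
rewrite !z// -(ge0_integralD mu measurableT (p f) (m2 f mf) (p g) (m2 g mg)).
apply: ge0_le_integral => //.
- by move=> x _; rewrite lee_fin sqr_ge0.
- by apply: (m (fun x => f x + g x)); exact: measurable_funD.
- by apply: emeasurable_funD; exact: m2.
- move=> x _; rewrite lee_fin -subr_ge0.
  have -> : 2 * f x ^+ 2 + 2 * g x ^+ 2 - (f x + g x) ^+ 2 = (f x - g x) ^+ 2 by ring.
  exact: sqr_ge0.
Qed.

End L2_cvg.
(** * The form of the half-Laplacian *)

Section fraclap.
Context {R : realType}.
Local Notation mu := (@lebesgue_measure R).
Implicit Types (v w g : R -> R).

(** The real part of the Fourier transform is the even part of [hart v]; the imaginary part is minus
    its odd part. *)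
Lemma fourier_reE v xi : L1 mu v -> fourier_re v xi = (hart v xi + hart v (- xi)) / 2.
Proof.
move=> hv; rewrite /hart -I_D; try exact: hart_L1.
rewrite mulrC -I_Z; last by apply: L1D; exact: hart_L1.
by apply: I_ext => x; rewrite /cas mulrN cosN sinN; field.
Qed.

Lemma fourier_imE v xi : L1 mu v -> fourier_im v xi = (hart v (- xi) - hart v xi) / 2.
Proof.
move=> hv; rewrite /hart -I_B; try exact: hart_L1.
rewrite mulrC -I_Z; last by apply: L1B; exact: hart_L1.
have hs : L1 mu (fun x => v x * sin (x * xi)).
  apply: (bmul_L1 hv (M := 1)); last by move=> x; exact: sin_max.
  by apply: (measurableT_comp sin_meas); exact: measurable_funM.
rewrite /fourier_im -I_N//.
by apply: I_ext => x; rewrite /cas mulrN cosN sinN; field.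
Qed.

Definition rxi (xi : R) : R := `|xi| `^ 2^-1.

Lemma rxi_sqr xi : rxi xi ^+ 2 = `|xi|.
Proof. by rewrite /rxi powR12_sqrt// sqr_sqrtr. Qed.

Lemma rxi_ge0 xi : 0 <= rxi xi. Proof. exact: powR_ge0. Qed.

Lemma rxi_even xi : rxi (- xi) = rxi xi.
Proof. by rewrite /rxi normrN. Qed.

Lemma norm_meas : mfun (fun x : R => `|x|).
Proof. exact: measurableT_comp. Qed.

Lemma rxi_meas : mfun rxi.
Proof. by apply: (measurableT_comp (measurable_powR _)); exact: norm_meas. Qed.

Definition fdef v g n xi := rxi xi * hart v xi - hart (truncate g n) xi.

Lemma fdef_meas v g n : L1 mu v -> L2 mu g -> mfun (fdef v g n).
Proof.
move=> hv hg; apply: measurable_funB; last first.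
  by apply: hart_meas; apply: truncate_meas; exact: L2_meas hg.
by apply: measurable_funM; [exact: rxi_meas|exact: hart_meas (L1_meas hv)].
Qed.

(** The real and imaginary defects are the even part of [fdef] and minus its odd part, so the sum of
    their squares is the mean of the values of [fdef] squared at xi and at - xi. *)
Lemma fdef_int v g n : L1 mu v -> L2 mu g ->
  (\int[mu]_xi
         ((`|xi| `^ 2^-1 * fourier_re v xi - fourier_re (truncate g n) xi) ^+ 2
          + (`|xi| `^ 2^-1 * fourier_im v xi - fourier_im (truncate g n) xi)
             ^+ 2)%:E = \int[mu]_xi (fdef v g n xi ^+ 2)%:E)%E.
Proof.
move=> hv hg; have hn := truncate_L2_L1 n hg; have mf := fdef_meas n hv hg.
have mS : mfun (fun xi => (fdef v g n xi ^+ 2)%:E).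
  by apply/measurable_EFinP; exact: measurable_funX.
have mSo : mfun (fun xi : R => (fdef v g n (- xi) ^+ 2)%:E).
  by apply: (measurableT_comp mS); exact: measurable_opp.
transitivity (\int[mu]_xi ((2^-1)%:E * ((fdef v g n xi ^+ 2)%:E + (fdef v g n (- xi) ^+ 2)%:E)))%E.
  apply: eq_integral => xi _; rewrite !fourier_reE// !fourier_imE// -EFinD -EFinM; congr EFin.
  by rewrite /fdef rxi_even -/(rxi xi); field.
rewrite ge0_integralZl//; last 2 first.
- exact: emeasurable_funD.
- by move=> x _; rewrite adde_ge0// lee_fin sqr_ge0.
rewrite ge0_integralD//; try by move=> x _; rewrite lee_fin sqr_ge0.
rewrite (@ge0_int_opp R (fun xi => (fdef v g n xi ^+ 2)%:E))//; last by move=> x; rewrite lee_fin sqr_ge0.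
have : (0 <= \int[mu]_x (fdef v g n x ^+ 2)%:E)%E by apply: integral_ge0 => x _; rewrite lee_fin sqr_ge0.
case: (\int[mu]_x (fdef v g n x ^+ 2)%:E)%E => [r| |]//= _.
  by rewrite -EFinD -EFinM; congr EFin; field.
by rewrite addye// gt0_muley// lte_fin invr_gt0.
Qed.

Lemma is_fracLapP v g : is_fracLap 2^-1 v g <->
  [/\ L1 mu v, L2 mu g &
   (\int[mu]_xi (fdef v g n xi ^+ 2)%:E @[n --> \oo] --> 0)%E].
Proof.
split=> [[/Lfun1_integrable hv /L2_LfunP hg h]|[hv hg h]]; split.
- exact: hv.
- exact: hg.
- by move: h; under eq_fun do rewrite fdef_int//.
- exact/Lfun1_integrable.
- exact/L2_LfunP.
- by under eq_fun do rewrite fdef_int//.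
Qed.

(** Finite energy. For v in L^1 it characterizes the domain of (-Delta)^(1/4), see
    [fracLap_domP]. *)
Definition FE v := L1 mu (fun xi => `|xi| * hart v xi ^+ 2).

(* 2 pi times the quadratic form of (-Delta)^(1/2). *)
Definition EE v w := \int[mu]_xi (`|xi| * hart v xi * hart w xi).

Lemma FE_L2 v : mfun v -> FE v <-> L2 mu (fun xi => rxi xi * hart v xi).
Proof.
move=> mv; split=> [h|[_ h]].
  split; first by apply: measurable_funM; [exact: rxi_meas|exact: hart_meas].
  by apply: L1_ext h => xi; rewrite exprMn rxi_sqr.
by apply: L1_ext h => xi; rewrite exprMn rxi_sqr.
Qed.

Lemma EE_rxi v w : EE v w = \int[mu]_xi ((rxi xi * hart v xi) * (rxi xi * hart w xi)).
Proof. by apply: I_ext => xi; rewrite -rxi_sqr; ring. Qed.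

Lemma EEvv v : EE v v = \int[mu]_xi ((rxi xi * hart v xi) ^+ 2).
Proof. by apply: I_ext => xi; rewrite -rxi_sqr; ring. Qed.

Lemma EE_ge0 v : 0 <= EE v v.
Proof. by rewrite EEvv; apply: I_ge0 => x; exact: sqr_ge0. Qed.

(** The transforms of the truncations of [g] converge in L^2 to [rxi * hart v], and Plancherel
    computes their norms. *)
Lemma is_fracLap_norm v g : is_fracLap 2^-1 v g -> FE v /\ \int[mu]_x (g x ^+ 2) = (2 * pi)^-1 * EE v v.
Proof.
move=> /is_fracLapP[hv hg hc]; have P := @pi_gt0' R.
have mv := L1_meas hv.
have hT n := truncate_L2_L1 n hg; have hT2 n := truncate_L2 n hg.
have hH n := hart_L2 (hT n) (hT2 n).
have /fine_cvgP[[N _ hN] hc'] := hc.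
have D2 n : (N <= n)%N -> L2 mu (fdef v g n).
  move=> /hN /= fn; split; first exact: fdef_meas.
  apply/L1_ge0P; [by apply: measurable_funX; exact: fdef_meas|by move=> x; exact: sqr_ge0|].
  by rewrite ltey_eq fn.
have G2 : L2 mu (fun xi => rxi xi * hart v xi).
  have := L2D (D2 N (leqnn _)) (hH N); congr L2; apply/funext => xi.
  by rewrite /fdef subrK.
have fE : FE v by apply/FE_L2.
split => //.
have c1 : \int[mu]_xi ((hart (truncate g (n + N)%N) xi - rxi xi * hart v xi) ^+ 2) @[n --> \oo] --> (0 : R).
  move: hc'; rewrite -(cvg_shiftn N); apply: cvg_trans; apply: near_eq_cvg; apply: nearW => n /=.
  by apply: I_ext => x; rewrite /fdef -[in RHS]sqrrN opprB.
have c2 := L2cvg_norm (fun n => hH (n + N)%N) G2 c1.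
have c3 : 2 * pi * \int[mu]_x (truncate g (n + N)%N x ^+ 2) @[n --> \oo] --> 2 * pi * \int[mu]_x (g x ^+ 2).
  apply: cvgM; first exact: cvg_cst.
  have := L2cvg_norm hT2 hg (truncate_cvg_L2 hg); rewrite -(cvg_shiftn N); exact.
have c4 : \int[mu]_xi (hart (truncate g (n + N)%N) xi ^+ 2) @[n --> \oo] --> 2 * pi * \int[mu]_x (g x ^+ 2).
  apply: cvg_trans c3; apply: near_eq_cvg; apply: nearW => n.
  transitivity (\int[mu]_xi (hart (truncate g (n + N)%N) xi * hart (truncate g (n + N)%N) xi)).
    by rewrite plancherel//; congr (_ * _); apply: I_ext => x; rewrite expr2.
  by apply: I_ext => x; rewrite expr2.
have e := cvg_uniqR c2 c4; rewrite EEvv.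
by apply: mulVK_eq => //; rewrite mulr_gt0.
Qed.

Lemma is_fracLapD v g w k : is_fracLap 2^-1 v g -> is_fracLap 2^-1 w k ->
  is_fracLap 2^-1 (fun x => v x + w x) (fun x => g x + k x).
Proof.
move=> /is_fracLapP[hv hg hc] /is_fracLapP[hw hk hd]; apply/is_fracLapP; split.
- exact: L1D.
- exact: L2D.
have E n xi : fdef (fun x => v x + w x) (fun x => g x + k x) n xi = fdef v g n xi + fdef w k n xi.
  rewrite /fdef hartD//.
  rewrite (_ : hart (truncate _ n) xi = hart (truncate g n) xi + hart (truncate k n) xi); first ring.
  rewrite -hartD; try exact: truncate_L2_L1.
  by apply: hart_ext => x; rewrite /truncate mulrDr.
apply: (@squeeze_cvge _ _ _ _ (fun=> 0%E) _ (fun n => 2%:E * (\int[mu]_xi (fdef v g n xi ^+ 2)%:E) + 2%:E * (\int[mu]_xi (fdef w k n xi ^+ 2)%:E))%E).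
- apply: nearW => n; apply/andP; split; first by apply: integral_ge0 => x _; rewrite lee_fin sqr_ge0.
  under eq_integral do rewrite E.
  by apply: ge0_int_sqrD; exact: fdef_meas.
- exact: cvg_cst.
- exact: (cvge0_2D hc hd).
Qed.

(** Up to the factor 2 pi the Hartley transform is an involution, so [g] is the L^2 limit of the
    rescaled transforms of the truncations of [G]. The squared defect of [g] equals int G^2 - 2 pi
    int (truncate g n)^2, which tends to 0 because int G^2 = 2 pi int g^2. *)
Lemma fracLap_ex v : L1 mu v -> FE v -> exists g, is_fracLap 2^-1 v g.
Proof.
move=> hv fe; have P := @pi_gt0' R; have P2 : 0 < 2 * (pi : R) by rewrite mulr_gt0.
pose G xi := rxi xi * hart v xi.
have G2 : L2 mu G by apply/FE_L2 => //; exact: L1_meas hv.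
have T1 n := truncate_L2_L1 n G2; have T2 n := truncate_L2 n G2.
pose q (n : nat) x := (2 * pi)^-1 * hart (truncate G n) x.
have H2 n := hart_L2 (T1 n) (T2 n).
have q2 n : L2 mu (q n) by exact: L2Z.
have qq n m : \int[mu]_x ((q n x - q m x) ^+ 2) =
    (2 * pi)^-1 * \int[mu]_x ((truncate G n x - truncate G m x) ^+ 2).
  have d1 := L1B (T1 n) (T1 m); have d2 := L2B (T2 n) (T2 m).
  have -> : \int[mu]_x ((q n x - q m x) ^+ 2) =
    (2 * pi)^-1 ^+ 2 * \int[mu]_x (hart (fun y => truncate G n y - truncate G m y) x ^+ 2).
    by rewrite -I_Z; [apply: I_ext => x; rewrite /q hartB//; ring|by case: (hart_L2 d1 d2)].
  by rewrite (plancherel_sqr (conj d1 d2)); move: (2 * pi) P2 => p p0; field; exact: lt0r_neq0.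
have hc := truncate_cvg_L2 G2.
have [g [g2 gc]] : exists g, L2 mu g /\ \int[mu]_x ((q n x - g x) ^+ 2) @[n --> \oo] --> (0 : R).
  apply: (L2_complete q2) => e e0.
  have e2 : 0 < 2 * pi * e by rewrite mulr_gt0.
  have [N hN] := L2cvg_cauchy T2 G2 hc e2.
  by exists N => n m nN mN; rewrite qq ler_pdivrMl//; exact: hN.
exists g; apply/is_fracLapP; split => //.
have t1 n := truncate_L2_L1 n g2; have t2 n := truncate_L2 n g2.
have h2 n := hart_L2 (t1 n) (t2 n).
(* [hart_dual] between the truncations of [G] and a truncation of [g], in the limit m -> oo; this
   reduces the defect to a difference of norms. *)
have ip n : \int[mu]_x (hart (truncate g n) x * G x) = 2 * pi * \int[mu]_x (truncate g n x ^+ 2).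
  have c1 := L2cvg_ip T2 G2 (h2 n) hc.
  have c2 := L2cvg_ip q2 g2 (t2 n) gc.
  have c3 : \int[mu]_x (truncate G m x * hart (truncate g n) x) @[m --> \oo] --> 2 * pi * \int[mu]_x (g x * truncate g n x).
    rewrite (_ : (fun m => _) = (fun m => 2 * pi * \int[mu]_x (q m x * truncate g n x))).
      by apply: cvgM => //; exact: cvg_cst.
    apply/funext => m; rewrite -hart_dual//.
    rewrite -I_Z; last exact: L2_mul.
    apply: I_ext => x; rewrite /q; move: (2 * pi) P2 => p p0; field; exact: lt0r_neq0.
  have e := cvg_uniqR c1 c3.
  rewrite (I_to (fun x => G x * hart (truncate g n) x)); last by move=> x; rewrite mulrC.
  rewrite e; congr (_ * _); apply: I_ext => x; rewrite /truncate indic_itv.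
  by case: (`|x| <= _)%R; rewrite ?mul1r ?mul0r ?mulr0 ?expr2 ?mul0r.
have D2 n : L2 mu (fdef v g n) by exact: (L2B G2 (h2 n)).
have DE n : \int[mu]_x (fdef v g n x ^+ 2) = \int[mu]_x (G x ^+ 2) - 2 * pi * \int[mu]_x (truncate g n x ^+ 2).
  have h2' : L2 mu (fun x => -1 * hart (truncate g n) x) by exact: L2Z.
  rewrite (I_to (fun x => (G x + -1 * hart (truncate g n) x) ^+ 2)); last by move=> x; rewrite /fdef -/(G x); ring.
  rewrite I_sqrD//.
  rewrite (@I_ext _ _ _ mu (fun x => (-1 * _) ^+ 2) (fun x => hart (truncate g n) x ^+ 2)); last by move=> x; ring.
  rewrite (@I_ext _ _ _ mu (fun x => G x * _) (fun x => -1 * (hart (truncate g n) x * G x))); last by move=> x; ring.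
  rewrite I_Z; last exact: L2_mul.
  rewrite ip (plancherel_sqr (conj (t1 n) (t2 n))); ring.
have gn : \int[mu]_x (G x ^+ 2) = 2 * pi * \int[mu]_x (g x ^+ 2).
  have c1 := L2cvg_norm T2 G2 hc.
  have c2 : 2 * pi * \int[mu]_x (q m x ^+ 2) @[m --> \oo] --> 2 * pi * \int[mu]_x (g x ^+ 2).
    by apply: cvgM; [exact: cvg_cst|exact: L2cvg_norm].
  have c3 : \int[mu]_x (truncate G m x ^+ 2) @[m --> \oo] --> 2 * pi * \int[mu]_x (g x ^+ 2).
    apply: cvg_trans c2; apply: near_eq_cvg; apply: nearW => m.
    have := plancherel_sqr (conj (T1 m) (T2 m)).
    rewrite (I_to (fun x => (2 * pi) ^+ 2 * q m x ^+ 2)); last first.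
      by move=> x; rewrite /q; move: (2 * pi) P2 => p p0; field; exact: lt0r_neq0.
    by rewrite I_Z; [rewrite expr2 -mulrA => /mulfI -> //; exact: lt0r_neq0|case: (q2 m)].
  exact: (cvg_uniqR c1 c3).
have -> : (fun n => \int[mu]_xi (fdef v g n xi ^+ 2)%:E)%E = (fun n => (\int[mu]_xi (fdef v g n xi ^+ 2))%:E).
  by apply/funext => n; rewrite L1_integralE//; case: (D2 n).
apply: cvg_EFin; first exact: nearW.
rewrite (_ : (fine \o _) = (fun n => \int[mu]_x (G x ^+ 2) - 2 * pi * \int[mu]_x (truncate g n x ^+ 2))); last first.
  by apply/funext => n /=; rewrite DE.
rewrite -(subrr (\int[mu]_x (G x ^+ 2))); apply: cvgB; first exact: cvg_cst.
rewrite gn; apply: cvgM; first exact: cvg_cst.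
exact: (L2cvg_norm t2 g2 (truncate_cvg_L2 g2)).
Qed.

Local Notation flap := (fracLap (2^-1 : R)).

Lemma flapP v : L1 mu v -> FE v -> is_fracLap 2^-1 v (flap v).
Proof. by move=> hv fe; apply: xgetPex; exact: fracLap_ex. Qed.

Lemma fracLap_domP v : fracLap_dom 2^-1 v <-> L1 mu v /\ FE v.
Proof.
split=> [[g hg]|[hv fe]]; last exact: fracLap_ex.
by have [? _] := is_fracLap_norm hg; split => //; have /is_fracLapP[] := hg.
Qed.

Lemma flap_L2 v : L1 mu v -> FE v -> L2 mu (flap v).
Proof. by move=> hv fe; have /is_fracLapP[] := flapP hv fe. Qed.

Lemma FED v w : L1 mu v -> L1 mu w -> FE v -> FE w -> FE (fun x => v x + w x).
Proof.
move=> hv hw fv fw; apply/FE_L2; first exact: L1_meas (L1D hv hw).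
have a := (FE_L2 (L1_meas hv)).1 fv; have b := (FE_L2 (L1_meas hw)).1 fw.
by have := L2D a b; congr L2; apply/funext => xi; rewrite hartD// mulrDr.
Qed.

Lemma FEZ c v : L1 mu v -> FE v -> FE (fun x => c * v x).
Proof.
move=> hv fv; apply: L1_ext (L1Z (c ^+ 2) fv) => xi; rewrite hartZ//; ring.
Qed.

Lemma FEB v w : L1 mu v -> L1 mu w -> FE v -> FE w -> FE (fun x => v x - w x).
Proof.
move=> hv hw fv fw; have := FED hv (L1Z (-1) hw) fv (FEZ (-1) hw fw).
by congr FE; apply/funext => x; rewrite mulN1r.
Qed.

Lemma EE_L1 v w : L1 mu v -> L1 mu w -> FE v -> FE w ->
  L1 mu (fun xi => `|xi| * hart v xi * hart w xi).
Proof.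
move=> hv hw fv fw; have a := (FE_L2 (L1_meas hv)).1 fv; have b := (FE_L2 (L1_meas hw)).1 fw.
by apply: L1_ext (L2_mul a b) => xi; rewrite -rxi_sqr; ring.
Qed.

Lemma EE_sym v w : EE v w = EE w v.
Proof. by apply: I_ext => xi; ring. Qed.

Lemma EE_Dl v w z : L1 mu v -> L1 mu w -> L1 mu z -> FE v -> FE w -> FE z ->
  EE (fun x => v x + w x) z = EE v z + EE w z.
Proof.
move=> hv hw hz fv fw fz; rewrite /EE -I_D; try exact: EE_L1.
by apply: I_ext => xi; rewrite hartD//; ring.
Qed.

Lemma EE_Zl c v z : L1 mu v -> L1 mu z -> FE v -> FE z ->
  EE (fun x => c * v x) z = c * EE v z.
Proof.
move=> hv hz fv fz; rewrite /EE -I_Z; last exact: EE_L1.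
by apply: I_ext => xi; rewrite hartZ//; ring.
Qed.

Lemma EE_CS v w : L1 mu v -> L1 mu w -> FE v -> FE w ->
  `|EE v w| <= Num.sqrt (EE v v) * Num.sqrt (EE w w).
Proof.
move=> hv hw fv fw; have a := (FE_L2 (L1_meas hv)).1 fv; have b := (FE_L2 (L1_meas hw)).1 fw.
by rewrite !EEvv EE_rxi; exact: CS_abs.
Qed.

Opaque EE hart fracLap.

Lemma EE_sqrD v w : L1 mu v -> L1 mu w -> FE v -> FE w ->
  EE (fun x => v x + w x) (fun x => v x + w x) = EE v v + 2 * EE v w + EE w w.
Proof.
move=> hv hw fv fw; have fvw := FED hv hw fv fw; have hvw := L1D hv hw.
rewrite (EE_Dl hv hw hvw fv fw fvw) (EE_sym v) (EE_sym w) (EE_Dl hv hw hv fv fw fv) (EE_Dl hv hw hw fv fw fw).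
by rewrite (EE_sym w v) mulr_natl mulr2n !addrA.
Qed.

(** Polarisation: by [is_fracLapD] the sum of the two choices is an admissible choice for v + w, so
    [is_fracLap_norm] computes its norm. *)
Lemma flap_pair v w : L1 mu v -> L1 mu w -> FE v -> FE w ->
  \int[mu]_x (flap v x * flap w x) = (2 * pi)^-1 * EE v w.
Proof.
move=> hv hw fv fw; have pv := flapP hv fv; have pw := flapP hw fw.
have [_ nv] := is_fracLap_norm pv; have [_ nw] := is_fracLap_norm pw.
have [_ nvw] := is_fracLap_norm (is_fracLapD pv pw).
have e1 := I_sqrD (flap_L2 hv fv) (flap_L2 hw fw).
have e2 := EE_sqrD hv hw fv fw.
exact: (polar_arith nv nw nvw e1 e2).
Qed.

Lemma Hdot_normE v : L1 mu v -> FE v ->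
  Hdot_norm v = (Num.sqrt ((2 * pi)^-1 * EE v v))%:E.
Proof.
move=> hv fv; rewrite /Hdot_norm Lnorm2E; last exact: flap_L2.
by rewrite -flap_pair//; congr (Num.sqrt _)%:E; apply: I_ext => x; rewrite expr2.
Qed.

End fraclap.

Local Notation EE2 v := (EE v v).
#[global] Opaque EE FE fracLap Rintegral hart.

(** * Bounded approximations of the form, and limits of energies *)

Section energy.
Context {R : realType}.
Local Notation mu := (@lebesgue_measure R).
Implicit Types (v w g : R -> R) (h r : R).

Definition L12 v := L1 mu v /\ L2 mu v.

Lemma L12_1 v : L12 v -> L1 mu v. Proof. by case. Qed.

Lemma L12_2 v : L12 v -> L2 mu v. Proof. by case. Qed.

Lemma L12B v w : L12 v -> L12 w -> L12 (fun x => v x - w x).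
Proof. by move=> [a b] [c e]; split; [exact: L1B|exact: L2B]. Qed.

Lemma L12Z c v : L12 v -> L12 (fun x => c * v x).
Proof. by move=> [a b]; split; [exact: L1Z|exact: L2Z]. Qed.

Lemma L12_conv k v : kernel k -> L12 v -> L12 (conv k v).
Proof. by move=> kk [a b]; split; [exact: conv_L1|have [] := conv_L2 kk a b]. Qed.

Lemma L12_hart v : L12 v -> L2 mu (hart v).
Proof. by case=> a b; exact: hart_L2. Qed.

Lemma L12_bounded v M : L1 mu v -> (forall x, `|v x| <= M) -> L12 v.
Proof. by move=> hv hM; split => //; exact: (L2_bounded hv hM). Qed.

Definition lam h (xi : R) := (1 - eabs h xi) / h.

Lemma lam_ge0 h xi : 0 < h -> 0 <= lam h xi.
Proof. by move=> h0; rewrite divr_ge0 ?subr_ge0 ?eabs_le1// ltW. Qed.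

Lemma lam_le h xi : 0 < h -> lam h xi <= `|xi|.
Proof.
move=> h0; rewrite ler_pdivrMr// /eabs mulrC.
have := expR_ge1Dx (- (h * `|xi|)); rewrite (mulrC h); move: (`|xi| * h) => b; move: (expR (- b)) => a; clear; lra.
Qed.

Lemma lam_leV h xi : 0 < h -> lam h xi <= h^-1.
Proof.
move=> h0; rewrite -[leRHS]mul1r ler_pM2r ?invr_gt0//.
by have := eabs_ge0 h xi; move: (eabs _ _) => a; lra.
Qed.

Lemma exp_quad (s : R) : 0 <= s -> expR (- s) <= 1 - s + s ^+ 2.
Proof.
move=> s0; rewrite expRN; apply: (@le_trans _ _ (1 + s)^-1).
  rewrite lef_pV2 ?posrE ?expR_gt0//; [exact: expR_ge1Dx|lra].
rewrite -[leLHS]mul1r ler_pdivrMr; last lra.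
have : 0 <= s ^+ 3 by apply: exprn_ge0.
by rewrite exprS; nra.
Qed.

Lemma lam_sub h xi : 0 < h -> `|xi| - lam h xi <= h * xi ^+ 2.
Proof.
move=> h0; rewrite lerBlDr -lerBlDl ler_pdivlMr// /eabs.
have s0 : 0 <= h * `|xi| by apply: mulr_ge0 => //; exact: ltW.
have := exp_quad s0; rewrite exprMn real_normK ?num_real//.
move: (expR (- (h * `|xi|))) (`|xi|) (xi ^+ 2) => a b c; clear; nra.
Qed.

Lemma lam_meas h : mfun (lam h).
Proof. by apply: measurable_funM => //; apply: measurable_funB => //; exact: eabs_meas. Qed.

Definition dy (n : nat) : R := 2^-1 ^+ n.

Lemma dy_gt0 n : 0 < dy n.
Proof. by apply: exprn_gt0; rewrite invr_gt0. Qed.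

Lemma dy_ge0 n : 0 <= dy n. Proof. exact: ltW (dy_gt0 n). Qed.

Lemma dy_pow l i : (l <= i)%N -> dy l = (2 ^ (i - l))%N%:R * dy i.
Proof. by move=> li; rewrite /dy -{2}(subnK li) exprD mulrA natrX -exprMn mulfV// expr1n mul1r. Qed.

Lemma dyS n : dy n = dy n.+1 + dy n.+1.
Proof. by rewrite /dy exprS; field. Qed.

Lemma dy_le1 n : dy n <= 1.
Proof. by elim: n => [|n ih]; [rewrite /dy expr0|have := dyS n; have := dy_gt0 n.+1; lra]. Qed.

Lemma dy_mono m n : (m <= n)%N -> dy n <= dy m.
Proof.
move=> mn; rewrite -(subnK mn); elim: (n - m)%N => [|k ih]; first by rewrite add0n.
by apply: le_trans ih; rewrite addSn (dyS (k + m)) lerDl dy_ge0.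
Qed.

Lemma dy_cvg : dy @ \oo --> (0 : R).
Proof. by apply: cvg_expr; rewrite ger0_norm; lra. Qed.

Lemma dy_small (e : R) : 0 < e -> exists N, forall n, (N <= n)%N -> dy n <= e.
Proof.
move=> e0; have /cvg0P /(_ _ e0) [N hN] := dy_cvg.
by exists N => n /hN; rewrite ger0_norm// dy_ge0.
Qed.

(** With a = exp (- h |xi|) this reads (1 - a^2) / 2 <= 1 - a. *)
Lemma lam_double h xi : 0 < h -> lam (h + h) xi <= lam h xi.
Proof.
move=> h0; rewrite /lam -eabsD ler_pdivrMr ?addr_gt0//.
have := eabs_le1 xi h0; have := eabs_ge0 h xi; move: (eabs _ _) => a a0 a1.
have -> : (1 - a) / h * (h + h) = 2 * (1 - a) by field; nz.
nra.
Qed.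

Lemma lam_mono m n xi : (m <= n)%N -> lam (dy m) xi <= lam (dy n) xi.
Proof.
move=> mn; rewrite -(subnK mn); elim: (n - m)%N => [|k ih]; first by rewrite add0n.
by apply: le_trans ih _; rewrite (dyS (k + m)) -addSn; apply: lam_double; exact: dy_gt0.
Qed.

Lemma lam_cvg xi : lam (dy n) xi @[n --> \oo] --> `|xi|.
Proof.
apply: (@cvg_le _ _ _ _ _ (fun n => dy n * xi ^+ 2)).
  move=> n; rewrite distrC ger0_norm ?subr_ge0 ?lam_le ?dy_gt0//.
  by apply: lam_sub; exact: dy_gt0.
by apply: cvg0_Zr; exact: dy_cvg.
Qed.

(* A bounded approximation of (-Delta)^(1/2), with symbol [lam h]. *)
Definition Lam h v x := (v x - conv (pois h) v x) / h.

Lemma Lam_L12 h v : 0 < h -> L12 v -> L12 (Lam h v).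
Proof.
move=> h0 hv; have := L12Z h^-1 (L12B hv (L12_conv (pois_kernel h0) hv)).
by congr L12; apply/funext => x; rewrite mulrC.
Qed.

Lemma hart_Lam h v xi : 0 < h -> L1 mu v -> hart (Lam h v) xi = lam h xi * hart v xi.
Proof.
move=> h0 hv; have cv := conv_L1 (pois_kernel h0) hv.
rewrite (@hart_ext _ _ (fun x => h^-1 * (v x - conv (pois h) v x))); last by move=> x; rewrite mulrC.
rewrite hartZ; last exact: L1B.
by rewrite hartB// hart_conv_pois// /lam; ring.
Qed.

Lemma mulHH_le (a b c : R) : a <= b -> a * c * c <= b * c * c.
Proof. by move=> ab; rewrite -!mulrA ler_wpM2r// -expr2 sqr_ge0. Qed.

Definition Eh h v w := \int[mu]_x (Lam h v x * w x).

Lemma Eh_hart h v w : 0 < h -> L12 v -> L12 w ->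
  Eh h v w = (2 * pi)^-1 * \int[mu]_xi (lam h xi * hart v xi * hart w xi).
Proof.
move=> h0 hv hw; have [l1 l2] := Lam_L12 h0 hv; have [w1 w2] := hw.
have P := @pi_gt0' R; apply: mulVK_eq; first by rewrite mulr_gt0.
rewrite -(plancherel l1 l2 w1 w2); apply: I_ext => xi.
by rewrite hart_Lam//; case: hv.
Qed.

Lemma lam_hart_L1 h v w : 0 < h -> L12 v -> L12 w ->
  L1 mu (fun xi => lam h xi * hart v xi * hart w xi).
Proof.
move=> h0 hv hw; apply: L1_ext (L2_mul (L12_hart (Lam_L12 h0 hv)) (L12_hart hw)) => xi.
by rewrite hart_Lam//; case: hv.
Qed.

Lemma Eh_sym h v w : 0 < h -> L12 v -> L12 w -> Eh h v w = Eh h w v.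
Proof.
move=> h0 hv hw; rewrite (Eh_hart h0 hv hw) (Eh_hart h0 hw hv); congr (_ * _).
by apply: I_ext => xi; rewrite mulrAC.
Qed.

Lemma Eh_ge0 h v : 0 < h -> L12 v -> 0 <= Eh h v v.
Proof.
move=> h0 hv; have P := @pi_gt0' R; rewrite Eh_hart// mulr_ge0//.
  by rewrite invr_ge0 ltW// mulr_gt0.
by apply: I_ge0 => xi; rewrite -mulrA mulr_ge0 ?lam_ge0// -expr2 sqr_ge0.
Qed.

Lemma Eh_mono m n v : (m <= n)%N -> L12 v -> Eh (dy m) v v <= Eh (dy n) v v.
Proof.
move=> mn hv; have P := @pi_gt0' R; rewrite !Eh_hart ?dy_gt0// ler_pM2l; last first.
  by rewrite invr_gt0 mulr_gt0.
apply: I_le; try by apply: lam_hart_L1 => //; exact: dy_gt0.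
by move=> xi; apply: mulHH_le; exact: lam_mono.
Qed.

Lemma Eh_le_EE h v : 0 < h -> L12 v -> FE v -> Eh h v v <= (2 * pi)^-1 * EE v v.
Proof.
move=> h0 hv fv; have P := @pi_gt0' R; have [v1 _] := hv.
rewrite Eh_hart// ler_pM2l; last by rewrite invr_gt0 mulr_gt0.
have := EE_L1 v1 v1 fv fv => e1.
apply: I_le => //; first exact: lam_hart_L1.
by move=> xi; apply: mulHH_le; exact: lam_le.
Qed.

Transparent FE EE.

(** The symbols [lam (dy n)] tend to |xi|, and Fatou applies on the Fourier side. *)
Lemma FE_bound v C : L12 v -> (forall n, Eh (dy n) v v <= C) -> FE v /\ (2 * pi)^-1 * EE v v <= C.
Proof.
move=> hv hC; have P := @pi2_gt0 R.
have mh := hart_meas (L1_meas (L12_1 hv)).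
have [] := @Fatou _ _ _ mu (fun n xi => lam (dy n) xi * hart v xi ^+ 2) (fun xi => `|xi| * hart v xi ^+ 2) (2 * pi * C).
- by move=> n; apply: measurable_funM; [exact: lam_meas|exact: measurable_funX].
- by apply: measurable_funM; [exact: norm_meas|exact: measurable_funX].
- by move=> n x; rewrite mulr_ge0 ?lam_ge0 ?dy_gt0 ?sqr_ge0.
- by move=> x; rewrite mulr_ge0 ?sqr_ge0.
- by apply: aeW => xi; apply: cvgM; [exact: lam_cvg|exact: cvg_cst].
- move=> n; have h1 := lam_hart_L1 (dy_gt0 n) hv hv.
  have h2 : L1 mu (fun xi => lam (dy n) xi * hart v xi ^+ 2) by apply: L1_ext h1 => x; ring.
  rewrite L1_integralE// lee_fin; have := hC n; rewrite Eh_hart ?dy_gt0// ler_pdivrMl//.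
  by apply: le_trans; rewrite le_eqVlt; apply/orP; left; apply/eqP; apply: I_ext => x; ring.
move=> f1 f2; split => //; rewrite ler_pdivrMl//.
by apply: le_trans f2; rewrite le_eqVlt; apply/orP; left; apply/eqP; apply: I_ext => x; ring.
Qed.

Opaque FE EE.

Lemma polar_cvg_arith (p a b c q : R) : q = a - 2 * b + c -> p * a = p * q + (2 * (p * b) - p * c).
Proof. by move=> ->; ring. Qed.

(** For fixed [h] the form is at most h^-1 times the squared L^2 norm, hence continuous for L^2
    convergence. *)
Lemma Eh_cvg h (v_ : nat -> R -> R) v : 0 < h -> (forall n, L12 (v_ n)) -> L12 v ->
  \int[mu]_x ((v_ n x - v x) ^+ 2) @[n --> \oo] --> (0 : R) ->
  Eh h (v_ n) (v_ n) @[n --> \oo] --> Eh h v v.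
Proof.
move=> h0 hv_ hv hc; have [_ l2] := Lam_L12 h0 hv.
have d n := L12B (hv_ n) hv.
have E n : Eh h (v_ n) (v_ n) = Eh h (fun x => v_ n x - v x) (fun x => v_ n x - v x)
   + (2 * \int[mu]_x (v_ n x * Lam h v x) - Eh h v v).
  rewrite -[X in 2 * X](_ : Eh h (v_ n) v = _); last first.
    by rewrite Eh_sym//; apply: I_ext => x; rewrite mulrC.
  rewrite (Eh_hart h0 (hv_ n) (hv_ n)) (Eh_hart h0 (hv_ n) hv) (Eh_hart h0 hv hv) (Eh_hart h0 (d n) (d n)).
  have a1 := lam_hart_L1 h0 (hv_ n) (hv_ n); have a2 := lam_hart_L1 h0 (hv_ n) hv.
  have a3 := lam_hart_L1 h0 hv hv; have a4 := lam_hart_L1 h0 (d n) (d n).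
  have k : \int[mu]_xi (lam h xi * hart (fun x => v_ n x - v x) xi * hart (fun x => v_ n x - v x) xi) =
    \int[mu]_xi (lam h xi * hart (v_ n) xi * hart (v_ n) xi) - 2 * \int[mu]_xi (lam h xi * hart (v_ n) xi * hart v xi)
     + \int[mu]_xi (lam h xi * hart v xi * hart v xi).
    rewrite -(I_Z 2 a2) -(I_B a1 (L1Z 2 a2)) -(I_D (L1B a1 (L1Z 2 a2)) a3).
    by apply: I_ext => xi; rewrite hartB; [ring|case: (hv_ n)|case: hv].
  exact: (polar_cvg_arith _ k).
have c1 : Eh h (fun x => v_ n x - v x) (fun x => v_ n x - v x) @[n --> \oo] --> (0 : R).
  apply: (@cvg0_le _ _ _ _ _ (fun n => h^-1 * \int[mu]_x ((v_ n x - v x) ^+ 2))).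
    move=> n; rewrite ger0_norm; last exact: Eh_ge0.
    have P := @pi2_gt0 R.
    rewrite Eh_hart// ler_pdivrMl//.
    have -> : 2 * pi * (h^-1 * \int[mu]_x (v_ n x - v x) ^+ 2) = h^-1 * \int[mu]_xi (hart (fun x => v_ n x - v x) xi ^+ 2).
      by rewrite (plancherel_sqr (d n)); ring.
    have [_ hh] := L12_hart (d n); rewrite -I_Z//.
    apply: I_le; [exact: lam_hart_L1|exact: L1Z|].
    by move=> xi; rewrite -mulrA -expr2 ler_wpM2r ?sqr_ge0// lam_leV.
  by apply: cvg0_Zl.
have c2 := L2cvg_ip (fun n => L12_2 (hv_ n)) (L12_2 hv) l2 hc.
have e0 : 0 + (2 * \int[mu]_x (v x * Lam h v x) - Eh h v v) = Eh h v v.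
  by rewrite (_ : \int[mu]_x _ = Eh h v v); [ring|apply: I_ext => x; rewrite mulrC].
under eq_fun do rewrite E.
suff : Eh h (fun x => v_ n x - v x) (fun x => v_ n x - v x)
   + (2 * \int[mu]_x (v_ n x * Lam h v x) - Eh h v v) @[n --> \oo] -->
   0 + (2 * \int[mu]_x (v x * Lam h v x) - Eh h v v) by rewrite e0.
apply: cvgD => //; apply: cvgB; last exact: cvg_cst.
by apply: cvgM => //; exact: cvg_cst.
Qed.

Lemma cvg_leC (u : nat -> R) (l C : R) (N : nat) : u n @[n --> \oo] --> l ->
  (forall n, (N <= n)%N -> u n <= C) -> l <= C.
Proof.
move=> ul uC; rewrite -(cvg_lim _ ul)//; apply: limr_le; first by apply/cvg_ex; exists l.
by exists N.
Qed.

(** Two limits, one at a time: at a frozen level m the energy is at most that at level [k n], and it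
    passes to the limit by [Eh_cvg]; then m -> oo by [FE_bound]. *)
Lemma FE_lsc (k : nat -> nat) (v_ : nat -> R -> R) v C : (forall n, L12 (v_ n)) -> L12 v ->
  \int[mu]_x ((v_ n x - v x) ^+ 2) @[n --> \oo] --> (0 : R) ->
  (forall m : nat, exists N, forall n, (N <= n)%N -> (m <= k n)%N) ->
  (forall n, Eh (dy (k n)) (v_ n) (v_ n) <= C) -> FE v /\ (2 * pi)^-1 * EE v v <= C.
Proof.
move=> hv_ hv hc kn hC; apply: FE_bound => // m.
have c := Eh_cvg (dy_gt0 m) hv_ hv hc.
have [N hN] := kn m.
apply: (cvg_leC c) => n /hN nm.
exact: le_trans (Eh_mono nm (hv_ n)) (hC n).
Qed.

Lemma wk_arith (a b c A e : R) : 0 <= A -> 0 <= b -> 0 <= c -> a <= A * b + c -> b <= e / (2 * (A + 1)) -> c <= e / 2 -> a <= e.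
Proof.
move=> A0 b0 c0 h1 h2 h3; apply: le_trans h1 _; apply: halves_le => //.
have A1 : 0 < A + 1 by lra.
move: h2; rewrite ler_pdivlMr ?mulr_gt0// => h2.
by rewrite ler_pdivlMr//; nra.
Qed.

(** The multiplier [a n] is the square root of [lam] for the scheme and [rxi] for the limiting
    energy. Low frequencies of [phi] are handled by the L^2 convergence of [v_ n], high ones by the
    uniform bound [C] and the small tail of [rxi * hart phi]. *)
Lemma energy_weak (a : nat -> R -> R) (v_ : nat -> R -> R) v phi C :
  (forall n, mfun (a n)) -> (forall n xi, 0 <= a n xi <= rxi xi) ->
  (forall xi, a n xi @[n --> \oo] --> rxi xi) ->
  (forall n, L12 (v_ n)) -> L12 v -> L12 phi -> FE v -> FE phi ->
  \int[mu]_x ((v_ n x - v x) ^+ 2) @[n --> \oo] --> (0 : R) ->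
  (forall n, L2 mu (fun xi => a n xi * hart (v_ n) xi)) ->
  (forall n, \int[mu]_xi ((a n xi * hart (v_ n) xi) ^+ 2) <= C) ->
  \int[mu]_xi ((a n xi * hart (v_ n) xi) * (a n xi * hart phi xi)) @[n --> \oo] --> EE v phi.
Proof.
move=> ma ha ca hv_ hv hp fv fp hc h2 hC.
have P := @pi2_gt0 R.
have ha1 n xi : 0 <= a n xi by have /andP[] := ha n xi.
have ha2 n xi : a n xi <= rxi xi by have /andP[] := ha n xi.
have hn n xi : `|a n xi| <= rxi xi by rewrite ger0_norm.
have G2 : L2 mu (fun xi => rxi xi * hart phi xi) by apply/FE_L2 => //; exact: L1_meas (L12_1 hp).
have V2 : L2 mu (fun xi => rxi xi * hart v xi) by apply/FE_L2 => //; exact: L1_meas (L12_1 hv).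
have mh w : L12 w -> mfun (hart w) by move=> [w1 _]; exact: hart_meas (L1_meas w1).
have aL2 n w : mfun w -> L2 mu (fun xi => rxi xi * w xi) -> L2 mu (fun xi => a n xi * w xi).
  move=> mw hw; apply: (@L2_le _ _ _ mu (fun xi => a n xi * w xi) _ _ hw); first exact: measurable_funM (ma n) mw.
  by move=> xi; rewrite normrM [leRHS]normrM ler_wpM2r// (ger0_norm (rxi_ge0 _)).
have av n := aL2 n _ (mh _ hv) V2; have ap n := aL2 n _ (mh _ hp) G2.
have aap n : L2 mu (fun xi => a n xi * hart (fun x => v_ n x - v x) xi).
  have := L2B (h2 n) (av n); congr L2; apply/funext => xi.
  by rewrite hartB; [ring|case: (hv_ n)|case: hv].
have d n := L12B (hv_ n) hv.
have c1 : \int[mu]_xi ((a n xi * hart v xi) * (a n xi * hart phi xi)) @[n --> \oo] --> EE v phi.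
  rewrite EE_rxi.
  have [] // := @DCT _ _ _ mu (fun n xi => (a n xi * hart v xi) * (a n xi * hart phi xi))
    (fun xi => (rxi xi * hart v xi) * (rxi xi * hart phi xi))
    (fun xi => `|(rxi xi * hart v xi) * (rxi xi * hart phi xi)|).
  - by move=> n; exact: L1_meas (L2_mul (av n) (ap n)).
  - exact: L1_meas (L2_mul V2 G2).
  - apply: aeW => xi; apply: cvgM; apply: cvgM => //; exact: cvg_cst.
  - exact: L1_abs (L2_mul V2 G2).
  - move=> n xi; rewrite !normrM !(ger0_norm (rxi_ge0 _)).
    by apply: ler_pM => //; apply: ler_pM.
have c2 : \int[mu]_xi ((a n xi * hart (fun x => v_ n x - v x) xi) * (a n xi * hart phi xi)) @[n --> \oo] --> (0 : R).
  pose B := 2 * C + 2 * EE v v.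
  have bB n : \int[mu]_xi ((a n xi * hart (fun x => v_ n x - v x) xi) ^+ 2) <= B.
    rewrite (I_to (fun xi => (a n xi * hart (v_ n) xi + -1 * (a n xi * hart v xi)) ^+ 2)); last first.
      by move=> xi; rewrite hartB; [ring|case: (hv_ n)|case: hv].
    apply: le_trans (I_sqrD_le (h2 n) (L2Z (-1) (av n))) _.
    apply: lerD; first by rewrite ler_pM2l.
    rewrite ler_pM2l// EEvv; apply: I_le; [by case: (L2Z (-1) (av n))|by case: V2|].
    move=> xi; rewrite !exprMn sqrrN expr1n mul1r ler_wpM2r ?sqr_ge0//.
    by rewrite lerXn2r ?nnegrE ?rxi_ge0.
  have tc := truncate_cvg_L2 G2.
  apply/cvg0P => e e0.
  have sB : 0 <= Num.sqrt B by exact: sqrtr_ge0.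
  have e1 : 0 < (e / (2 * (Num.sqrt B + 1))) ^+ 2 by apply: exprn_gt0; rewrite divr_gt0// mulr_gt0//; lra.
  have /cvg0P /(_ _ e1) [A hA] := tc.
  have {}hA := hA A (leqnn _).
  pose H := hart phi; pose HA := truncate H A.
  have H2 : L2 mu H by exact: L12_hart.
  have HA2 : L2 mu HA by exact: truncate_L2.
  (* Constant of the low-frequency part: there [a n] squared is at most |xi| <= A, and the 2 pi
     comes from Plancherel for [v_ n - v]. *)
  pose K := Num.sqrt (2 * pi) * (A%:R * Num.sqrt (\int[mu]_x (H x ^+ 2))).
  have K0 : 0 <= K by rewrite mulr_ge0 ?sqrtr_ge0// mulr_ge0// sqrtr_ge0.
  pose dn n := Num.sqrt (\int[mu]_x ((v_ n x - v x) ^+ 2)).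
  have dnc : dn n @[n --> \oo] --> (0 : R).
    exact: sqrt_cvg0 hc.
  have e2 : 0 < e / (2 * (K + 1)) by rewrite divr_gt0// mulr_gt0//; lra.
  have /cvg0P /(_ _ e2) [N hN] := dnc.
  exists N => n /hN; rewrite ger0_norm ?sqrtr_ge0// => hdn.
  pose D := hart (fun x => v_ n x - v x).
  have D2 : L2 mu D by exact: L12_hart.
  have rHA : L2 mu (fun xi => rxi xi * (H xi - HA xi)).
    have := L2B G2 (truncate_L2 A G2); congr L2; apply/funext => xi.
    by rewrite /HA /truncate /H; ring.
  have mHA : mfun (fun xi => H xi - HA xi) by apply: measurable_funB; [exact: L2_meas H2|exact: L2_meas HA2].
  have aHA := aL2 n _ mHA rHA.
  have aaHAb xi : `|a n xi ^+ 2 * HA xi| <= `|A%:R * H xi|.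
    rewrite /HA /truncate indic_itv; case: (leP `|xi| A%:R) => hx; last first.
      by rewrite mul0r mulr0 normr0.
    rewrite mul1r normrM [leRHS]normrM ler_wpM2r// normrX (ger0_norm (_ : 0 <= A%:R))//.
    by apply: le_trans hx; rewrite -rxi_sqr lerXn2r ?nnegrE//; exact: rxi_ge0.
  have aaHA : L2 mu (fun xi => a n xi ^+ 2 * HA xi).
    apply: (L2_le _ (L2Z A%:R H2)) => //.
    exact: measurable_funM (measurable_funX 2 (ma n)) (L2_meas HA2).
  have Sp : \int[mu]_xi ((a n xi * D xi) * (a n xi * H xi)) =
     \int[mu]_xi (D xi * (a n xi ^+ 2 * HA xi)) + \int[mu]_xi ((a n xi * D xi) * (a n xi * (H xi - HA xi))).
    rewrite -I_D; [|exact: L2_mul|exact: L2_mul (aap n) aHA].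
    by apply: I_ext => xi; ring.
  rewrite Sp.
  apply: (@wk_arith _ (dn n) (Num.sqrt B * Num.sqrt (\int[mu]_xi ((a n xi * (H xi - HA xi)) ^+ 2))) K) => //.
  - exact: sqrtr_ge0.
  - apply: le_trans (ler_normD _ _) _; apply: lerD.
      apply: le_trans (CS_abs D2 aaHA) _.
      rewrite (plancherel_sqr (d n)) sqrtrM; last exact: ltW.
      rewrite /K (mulrAC _ (_ * _)) ler_wpM2l ?mulr_ge0 ?sqrtr_ge0//.
      have sA : Num.sqrt (A%:R ^+ 2 : R) = A%:R by rewrite sqrtr_sqr ger0_norm.
      rewrite -[X in X * _]sA -sqrtrM ?sqr_ge0//; apply: ler_wsqrtr.
      rewrite -I_Z; last by case: H2.
      have [_ z1] := aaHA; have [_ z2] := H2; apply: I_le => //; first exact: L1Z.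
      move=> xi; rewrite -exprMn -[leLHS]real_normK ?num_real// -[leRHS]real_normK ?num_real//.
      by rewrite lerXn2r ?nnegrE//; exact: aaHAb.
    apply: le_trans (CS_abs (aap n) aHA) _.
    by apply: ler_wpM2r; [exact: sqrtr_ge0|exact: ler_wsqrtr].
  - have sm : Num.sqrt (\int[mu]_xi ((a n xi * (H xi - HA xi)) ^+ 2)) <= e / (2 * (Num.sqrt B + 1)).
      rewrite -[leRHS]ger0_norm; last by rewrite divr_ge0 ?mulr_ge0 ?addr_ge0// ltW.
      rewrite -sqrtr_sqr; apply: ler_wsqrtr; apply: le_trans hA; apply: le_trans (ler_norm _).
      have q := L2B (truncate_L2 A G2) G2.
      apply: I_le; [by case: aHA|by case: q|].
      move=> xi; rewrite -[leRHS]sqrrN opprB.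
      have -> : rxi xi * hart phi xi - truncate (fun x : R => rxi x * hart phi x) A xi = rxi xi * (H xi - HA xi).
        by rewrite /HA /truncate /H; ring.
      by rewrite !exprMn ler_wpM2r ?sqr_ge0// lerXn2r ?nnegrE//; exact: rxi_ge0.
    apply: le_trans (ler_wpM2l sB sm) _.
    by move: (Num.sqrt B) sB => b b0; rewrite mulrA ler_pdivrMr ?mulr_gt0//; [nra|lra].
have -> : EE v phi = EE v phi + 0 by rewrite addr0.
have E n : \int[mu]_xi ((a n xi * hart (v_ n) xi) * (a n xi * hart phi xi)) =
    \int[mu]_xi ((a n xi * hart v xi) * (a n xi * hart phi xi)) + \int[mu]_xi ((a n xi * hart (fun x => v_ n x - v x) xi) * (a n xi * hart phi xi)).
  rewrite -(I_D (L2_mul (av n) (ap n)) (L2_mul (aap n) (ap n))).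
  by apply: I_ext => xi; rewrite hartB; [ring|case: (hv_ n)|case: hv].
by under eq_fun do rewrite E; apply: cvgD.
Qed.

Lemma energy_weak_EE (v_ : nat -> R -> R) v phi C :
  (forall n, L12 (v_ n)) -> L12 v -> L12 phi -> (forall n, FE (v_ n)) -> FE v -> FE phi ->
  \int[mu]_x ((v_ n x - v x) ^+ 2) @[n --> \oo] --> (0 : R) ->
  (forall n, EE2 (v_ n) <= C) -> EE (v_ n) phi @[n --> \oo] --> EE v phi.
Proof.
move=> hv_ hv hp fv_ fv fp hc hC; under eq_fun do rewrite EE_rxi.
apply: (@energy_weak (fun=> rxi) v_ v phi C) => //.
- by move=> n; exact: rxi_meas.
- by move=> n xi; rewrite rxi_ge0 lexx.
- by move=> xi; exact: cvg_cst.
- by move=> n; apply/FE_L2 => //; exact: L1_meas (L12_1 (hv_ n)).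
- by move=> n; rewrite -EEvv.
Qed.

Lemma EE_sqrB v w : L1 mu v -> L1 mu w -> FE v -> FE w ->
  EE2 (fun x => v x - w x) = EE v v - 2 * EE v w + EE w w.
Proof.
move=> hv hw fv fw; have := EE_sqrD hv (L1Z (-1) hw) fv (FEZ (-1) hw fw).
have -> : (fun x => v x + -1 * w x) = (fun x => v x - w x) by apply/funext => x; ring.
move=> ->; have hw' := L1Z (-1) hw; have fw' := FEZ (-1) hw fw.
rewrite (EE_Zl (-1) hw hw' fw fw') (EE_sym w) (EE_sym v) (EE_Zl (-1) hw hw fw fw) (EE_Zl (-1) hw hv fw fv) (EE_sym w v).
by move: (EE v v) (EE v w) (EE w w) => a b c; ring.
Qed.

Lemma strong_arith (a b c d e : R) : a <= b -> e = a - 2 * c + d -> e <= b - 2 * c + d.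
Proof. lra. Qed.

(** Radon-Riesz: weak convergence, together with upper bounds on the norms that tend to the norm of
    the limit, forces strong convergence. *)
Lemma energy_strong (v_ : nat -> R -> R) v (e : nat -> R) C :
  (forall n, L12 (v_ n)) -> L12 v -> (forall n, FE (v_ n)) -> FE v ->
  \int[mu]_x ((v_ n x - v x) ^+ 2) @[n --> \oo] --> (0 : R) ->
  (forall n, EE2 (v_ n) <= e n) -> (forall n, e n <= C) -> e n @[n --> \oo] --> EE v v ->
  EE2 (fun x => v_ n x - v x) @[n --> \oo] --> (0 : R).
Proof.
move=> hv_ hv fv_ fv hc he hC ec.
have c1 := energy_weak_EE hv_ hv hv fv_ fv fv hc (fun n => le_trans (he n) (hC n)).
apply: (@cvg0_le _ _ _ _ _ (fun n => e n - 2 * EE (v_ n) v + EE v v)).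
  move=> n; rewrite ger0_norm ?EE_ge0//.
  apply: (strong_arith (he n)); apply: EE_sqrB => //; [exact: L12_1|exact: L12_1].
have -> : 0 = EE v v - 2 * EE v v + EE v v by ring.
apply: cvgD; last exact: cvg_cst.
by apply: cvgB => //; apply: cvgM => //; exact: cvg_cst.
Qed.

End energy.

Local Notation Eh2 h v := (Eh h v v).

(** * The energy as a double integral over increments *)

Section gagliardo.
Context {R : realType}.
Local Notation mu := (@lebesgue_measure R).
Local Notation mu2 := (mu \x mu)%E.
Implicit Types (v w g : R -> R) (h r : R).

Lemma ker2_meas (k : R -> R) : mfun k -> mfun (fun z : R * R => k (z.1 - z.2)).
Proof. by move=> mk; apply: (measurableT_comp mk); exact: measurable_sub2. Qed.

Lemma kernel_cst (l : R -> R) (I c : R) : L1 mu l -> (forall x, 0 <= l x) -> \int[mu]_x l x = I ->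
  [/\ L1 mu (fun x => l x * c), \int[mu]_x (l x * c) = I * c & \int[mu]_x `|l x * c| = I * `|c|].
Proof.
move=> hl l0 <-; have E (d : R) : (fun x => l x * d) = (fun x => d * l x) by apply/funext => x; rewrite mulrC.
split; [by rewrite E; exact: L1Z|by rewrite E I_Z// mulrC|].
rewrite mulrC -I_Z//; apply: I_ext => x; by rewrite normrM mulrC (ger0_norm (l0 x)).
Qed.

Lemma ker2_y (k g : R -> R) : L1 mu k -> (forall x, 0 <= k x) -> L1 mu g ->
  L1 mu2 (fun z : R * R => k (z.1 - z.2) * g z.2) /\
  \int[mu2]_z (k (z.1 - z.2) * g z.2) = (\int[mu]_x k x) * \int[mu]_x g x.
Proof.
move=> hk k0 hg.
have K (y : R) := kernel_cst (g y) (L1_shift (- y) hk) (fun x => k0 (x - y)) (I_shift (- y) hk).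
have F : L1 mu2 (fun z : R * R => k (z.1 - z.2) * g z.2).
  apply: (@L1_prod2 _ _ _ _ _ mu mu _ (fun y => (\int[mu]_x k x) * `|g y|)) => /= [|y|y|].
  - apply: measurable_funM; first exact: ker2_meas (L1_meas hk).
    exact: measurable_snd_comp (L1_meas hg).
  - by case: (K y).
  - by case: (K y) => _ _ ->.
  - exact: L1Z (L1_abs hg).
by split => //; rewrite (I_prod2 F) -(I_Z _ hg); apply: I_ext => y /=; case: (K y).
Qed.

Lemma ker2_x (k g : R -> R) : L1 mu k -> (forall x, 0 <= k x) -> L1 mu g ->
  L1 mu2 (fun z : R * R => k (z.1 - z.2) * g z.1) /\
  \int[mu2]_z (k (z.1 - z.2) * g z.1) = (\int[mu]_x k x) * \int[mu]_x g x.
Proof.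
move=> hk k0 hg.
have K (y : R) := kernel_cst (g y) (L1_shiftl y hk) (fun x => k0 (y - x)) (I_shiftl y hk).
have F : L1 mu2 (fun z : R * R => k (z.1 - z.2) * g z.1).
  apply: (@L1_prod1 _ _ _ _ _ mu mu _ (fun y => (\int[mu]_x k x) * `|g y|)) => /= [|y|y|].
  - apply: measurable_funM; first exact: ker2_meas (L1_meas hk).
    exact: measurable_fst_comp (L1_meas hg).
  - by case: (K y).
  - by case: (K y) => _ _ ->.
  - exact: L1Z (L1_abs hg).
by split => //; rewrite (I_prod1 F) -(I_Z _ hg); apply: I_ext => y /=; case: (K y).
Qed.

Lemma dist01 (x y : R) : 0 <= x -> x <= 1 -> 0 <= y -> y <= 1 -> `|x - y| <= 1.
Proof. by move=> *; rewrite ler_norml; lra. Qed.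

Lemma norm_sub2 (x y M : R) : `|x| <= M -> `|y| <= M -> `|x - y| <= 1 * (2 * M).
Proof. by move=> hx hy; apply: le_trans (ler_normB _ _) _; lra. Qed.

Lemma dbl_bound (a b : R) : `|a * b| <= a ^+ 2 + b ^+ 2.
Proof. by rewrite ler_norml; apply/andP; split; have := sqr_ge0 (a - b); have := sqr_ge0 (a + b); have := sqr_ge0 a; have := sqr_ge0 b; nra. Qed.

Lemma dbl_arith (h V A : R) : 0 < h -> h^-1 * (V - A) = (2 * h)^-1 * (V - 2 * A + V).
Proof. by move=> h0; field; nz. Qed.

(** Expand the square: as the kernel has mass 1, each of the two pure squares gives int v^2, and the
    cross term gives int (P_h v) v. In this form the energy sees only increments of v. *)
Lemma Eh_dbl h v : 0 < h -> L12 v ->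
  L1 mu2 (fun z : R * R => pois h (z.1 - z.2) * (v z.1 - v z.2) ^+ 2) /\
  Eh h v v = (2 * h)^-1 * \int[mu2]_z (pois h (z.1 - z.2) * (v z.1 - v z.2) ^+ 2).
Proof.
move=> h0 [v1 v2]; have kk := pois_kernel h0; have k0 z := @pois_ge0 R h z h0.
have hk := kernel_L1 kk; have [mv sv] := v2.
have [f1 i1] := ker2_x hk k0 sv; have [f2 i2] := ker2_y hk k0 sv.
rewrite (kernel_I kk) !mul1r in i1 i2.
have f3 : L1 mu2 (fun z : R * R => pois h (z.1 - z.2) * (v z.1 * v z.2)).
  apply: L1_le (L1D f1 f2) _.
    apply: measurable_funM; first exact: ker2_meas (L1_meas hk).
    by apply: measurable_funM; [exact: measurable_fst_comp|exact: measurable_snd_comp].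
  by move=> z; rewrite normrM (ger0_norm (k0 _)) -mulrDr ler_wpM2l//; exact: dbl_bound.
have i3 : \int[mu2]_z (pois h (z.1 - z.2) * (v z.1 * v z.2)) = \int[mu]_x (conv (pois h) v x * v x).
  rewrite (I_prod1 f3); apply: I_ext => x /=.
  rewrite mulrC -(I_Z _ (kernel_mul_L1 kk x v1)); apply: I_ext => y; ring.
have E (z : R * R) : pois h (z.1 - z.2) * (v z.1 - v z.2) ^+ 2 =
   pois h (z.1 - z.2) * v z.1 ^+ 2 - 2 * (pois h (z.1 - z.2) * (v z.1 * v z.2)) + pois h (z.1 - z.2) * v z.2 ^+ 2.
  by ring.
split; first by apply: L1_ext (L1D (L1B f1 (L1Z 2 f3)) f2) => z; rewrite E.
rewrite (@I_ext _ _ _ mu2 _ _ E) (I_D (L1B f1 (L1Z 2 f3)) f2) (I_B f1 (L1Z 2 f3)) (I_Z 2 f3) i1 i2 i3.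
rewrite -dbl_arith//.
have [_ c2] := L12_conv kk (conj v1 v2).
rewrite -(I_B sv (L2_mul c2 v2)) -(I_Z _ (L1B sv (L2_mul c2 v2))).
by apply: I_ext => x; rewrite /Lam; ring.
Qed.

Lemma Eh_leG h v (G : R * R -> R) : 0 < h -> L12 v ->
  L1 mu2 (fun z : R * R => pois h (z.1 - z.2) * G z) ->
  (forall x y, (v x - v y) ^+ 2 <= G (x, y)) ->
  Eh h v v <= (2 * h)^-1 * \int[mu2]_z (pois h (z.1 - z.2) * G z).
Proof.
move=> h0 hv hG vG; have [l1 ->] := Eh_dbl h0 hv.
rewrite ler_pM2l; last by rewrite invr_gt0 mulr_gt0.
apply: I_le => // -[x y] /=; apply: ler_wpM2l; [exact: pois_ge0|exact: vG].
Qed.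

Lemma Eh_contr h v w : 0 < h -> L12 v -> L12 w ->
  (forall x y, `|v x - v y| <= `|w x - w y|) -> Eh h v v <= Eh h w w.
Proof.
move=> h0 hv hw vw; have [l1 e] := Eh_dbl h0 hw; rewrite e.
apply: (@Eh_leG h v (fun z => (w z.1 - w z.2) ^+ 2)) => // x y /=.
rewrite -[leLHS]real_normK ?num_real// -[leRHS]real_normK ?num_real//.
by rewrite lerXn2r ?nnegrE//; exact: vw.
Qed.

Lemma EE_le_of (v : R -> R) (C : R) : L12 v -> (forall n, Eh (dy n) v v <= (2 * pi)^-1 * C) -> FE v /\ EE v v <= C.
Proof.
move=> hv hC; have [fv] := FE_bound hv hC; split => //.
by have P := @pi_gt0' R; rewrite ler_pM2l // invr_gt0 mulr_gt0 in b.
Qed.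

Lemma EE_contr v w : L12 v -> L12 w -> FE w ->
  (forall x y, `|v x - v y| <= `|w x - w y|) -> FE v /\ EE v v <= EE w w.
Proof.
move=> hv hw fw vw; apply: EE_le_of => // n.
by apply: le_trans (Eh_contr (dy_gt0 n) hv hw vw) _; apply: Eh_le_EE => //; exact: dy_gt0.
Qed.

Lemma clip_L12 M v : 0 <= M -> L12 v -> L12 (fun x => clip M (v x)).
Proof.
move=> M0 [v1 v2]; split.
  apply: L1_le (L1_abs v1) _; first exact: clip_meas (L1_meas v1).
  by move=> x; exact: clip_le.
by apply: L2_le v2 _ => [|x]; [exact: clip_meas (L1_meas v1)|exact: clip_le].
Qed.

Lemma clip_FE M v : 0 <= M -> L12 v -> FE v ->
  FE (fun x => clip M (v x)) /\ EE2 (fun x => clip M (v x)) <= EE v v.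
Proof. by move=> M0 hv fv; apply: EE_contr => //; [exact: clip_L12|move=> x y; exact: clip_lip]. Qed.

(** Clipping is a contraction, so it does not increase the energy, and [energy_strong] applies with
    the constant bound [EE v v]. *)
Lemma clip_EE_cvg v : L12 v -> FE v ->
  EE2 (fun x => clip n%:R (v x) - v x) @[n --> \oo] --> (0 : R).
Proof.
move=> hv fv; have n0 (n : nat) : (0 : R) <= n%:R by [].
apply: (@energy_strong _ (fun n x => clip n%:R (v x)) v (fun=> EE v v) (EE v v)).
- by move=> n; exact: clip_L12.
- exact: hv.
- by move=> n; have [] := clip_FE (n0 n) hv fv.
- exact: fv.
- have := clip_cvg_L2 (L12_2 hv); apply: cvg_trans; apply: near_eq_cvg; apply: nearW => n /=.
  by apply: I_ext => x; ring.
- by move=> n; have [] := clip_FE (n0 n) hv fv.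
- by move=> n; exact: lexx.
- exact: cvg_cst.
Qed.

(** Equal to z^2 / (r^2 + z^2), a substitute for min (1, (z / r)^2). This form is chosen because the
    semigroup law evaluates its integral against [pois h]: it is h / (h + r). *)
Definition Dw r (z : R) := 1 - pi * r * pois r z.

Lemma DwE r z : 0 < r -> Dw r z = z ^+ 2 / (r ^+ 2 + z ^+ 2).
Proof.
move=> r0; have P := @pi_gt0' R; have d0 := pois_den z r0; rewrite /Dw.
Transparent pois. rewrite /pois. Opaque pois.
by move: d0 P; move: (pi : R) => p d0 P; field; rewrite !lt0r_neq0.
Qed.

Lemma Dw_ge0 r z : 0 < r -> 0 <= Dw r z.
Proof. by move=> r0; rewrite subr_ge0 pois_le1. Qed.

Lemma Dw_bound r z a : 0 < r -> `|a| <= 1 -> `|a| <= `|z| / r -> a ^+ 2 <= 2 * Dw r z.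
Proof.
move=> r0 a1; rewrite DwE// ler_pdivlMr// => az; have d0 := pois_den z r0.
rewrite mulrA ler_pdivlMr// -[in leLHS](real_normK (num_real a)) -[in leLHS](real_normK (num_real z)) -[in leRHS](real_normK (num_real z)).
have := normr_ge0 a; have := normr_ge0 z.
move: (`|a|) (`|z|) a1 az => b c b1 bz c0 b0.
have : (b * r) ^+ 2 <= c ^+ 2 by rewrite lerXn2r ?nnegrE ?mulr_ge0// ltW.
have : b ^+ 2 <= 1 by rewrite expr_le1.
rewrite exprMn; have := sqr_ge0 c; move: (b ^+ 2) (c ^+ 2) (r ^+ 2) => x y z'; nra.
Qed.

Lemma pD_L1 h r : 0 < h -> 0 < r ->
  [/\ L1 mu (fun z => pois h z * Dw r z), forall z, 0 <= pois h z * Dw r z &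
      \int[mu]_z (pois h z * Dw r z) <= h / r].
Proof.
move=> h0 r0; have kh := kernel_L1 (pois_kernel h0); have kr := pois_kernel r0.
have P := @pi_gt0' R.
have l1 : L1 mu (fun z => pois h z * pois r z).
  apply: (@bmul_L1 _ (pois h) (pois r) (pi * r)^-1) => //; first exact: pois_meas.
  by move=> z; rewrite ger0_norm ?pois_ge0// pois_le.
have E z : pois h z * Dw r z = pois h z - pi * r * (pois h z * pois r z) by rewrite /Dw; ring.
split.
- by apply: L1_ext (L1B kh (L1Z (pi * r) l1)) => z; rewrite E.
- by move=> z; rewrite mulr_ge0 ?pois_ge0 ?Dw_ge0.
rewrite (@I_ext _ _ _ mu _ _ E) (I_B kh (L1Z (pi * r) l1)) (I_Z _ l1) (kernel_I (pois_kernel h0)).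
have -> : \int[mu]_z (pois h z * pois r z) = pois (h + r) 0.
  rewrite -conv_pois//; apply: I_ext => z; rewrite sub0r pois_even//.
Transparent pois. rewrite /pois. Opaque pois.
rewrite expr0n addr0; move: (pi : R) P => p P.
have -> : 1 - p * r * ((h + r) / (p * (h + r) ^+ 2)) = h / (h + r).
  by field; rewrite !lt0r_neq0// addr_gt0.
by rewrite ler_pM2l// lef_pV2 ?posrE ?addr_gt0// lerDr ltW.
Qed.

(** Young's inequality with parameter [e]: the factor 1 + e of the increment must be able to tend to
    1, so that the energies of the cut-off functions converge to the full energy. *)
Lemma cut_sq (e cx cy a b d : R) : 0 < e -> 0 <= cx <= 1 -> (cx - cy) ^+ 2 <= 2 * d ->
  (cx * a - cy * b) ^+ 2 <= (1 + e) * (a - b) ^+ 2 + (1 + e^-1) * (2 * d * b ^+ 2).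
Proof.
move=> e0 /andP[c0 c1] h.
have e10 : 0 < e^-1 by rewrite invr_gt0.
have -> : cx * a - cy * b = cx * (a - b) + (cx - cy) * b by ring.
set A := a - b; set B := (cx - cy) * b.
have h1 : (cx * A + B) ^+ 2 <= (1 + e) * (cx * A) ^+ 2 + (1 + e^-1) * B ^+ 2.
  rewrite -subr_ge0.
  have -> : (1 + e) * (cx * A) ^+ 2 + (1 + e^-1) * B ^+ 2 - (cx * A + B) ^+ 2 = e^-1 * (e * (cx * A) - B) ^+ 2.
    by field; nz.
  by rewrite mulr_ge0 ?sqr_ge0// ltW.
apply: le_trans h1 _; apply: lerD.
  apply: ler_wpM2l; first by rewrite addr_ge0// ltW.
  rewrite exprMn -[leRHS]mul1r; apply: ler_wpM2r; first exact: sqr_ge0.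
  by rewrite expr_le1.
apply: ler_wpM2l; first by rewrite addr_ge0// ltW.
by rewrite /B exprMn; apply: ler_wpM2r => //; exact: sqr_ge0.
Qed.

Lemma cut_L12 r v : 0 < r -> L12 v -> L12 (fun x => chi r x * v x).
Proof.
move=> r0 [v1 v2]; have mc : mfun (chi r : R -> R).
  by apply: continuous_measurable_fun; exact: chi_cont.
have b x : `|chi r x * v x| <= `|v x|.
  by rewrite normrM ler_piMl// ger0_norm ?chi_ge0 ?chi_le1.
have m := measurable_funM mc (L1_meas v1).
by split; [exact: (@L1_le _ _ _ mu (fun x => chi r x * v x) _ m (L1_abs v1) b)|exact: (@L2_le _ _ _ mu (fun x => chi r x * v x) _ m v2 b)].
Qed.

Lemma cut_arith (h r e E V K : R) : 0 < h -> 0 < r -> 0 < e -> 0 <= V -> K <= h / r ->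
  (2 * h)^-1 * ((1 + e) * (2 * h * E) + 2 * (1 + e^-1) * (K * V)) <= (1 + e) * E + (1 + e^-1) / r * V.
Proof.
move=> h0 r0 e0 V0 hK.
have -> : (2 * h)^-1 * ((1 + e) * (2 * h * E) + 2 * (1 + e^-1) * (K * V)) = (1 + e) * E + (1 + e^-1) * (K / h) * V.
  by field; nz.
rewrite lerD2l; apply: ler_wpM2r => //; apply: ler_wpM2l.
  by rewrite addr_ge0// invr_ge0 ltW.
by rewrite ler_pdivrMr// mulrC.
Qed.

Lemma Eh_cut h r e v : 0 < h -> 0 < r -> 0 < e -> L12 v ->
  Eh2 h (fun x => chi r x * v x) <=
  (1 + e) * Eh h v v + (1 + e^-1) / r * \int[mu]_x (v x ^+ 2).
Proof.
move=> h0 r0 e0 hv; have [v1 [mv sv]] := hv.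
have [l1 eh] := Eh_dbl h0 hv; have [k1 k0 kI] := pD_L1 h0 r0.
have [l2 i2] := ker2_y k1 k0 sv.
have LL := L1D (L1Z (1 + e) l1) (L1Z (2 * (1 + e^-1)) l2).
pose G (z : R * R) := (1 + e) * (v z.1 - v z.2) ^+ 2 + (1 + e^-1) * (2 * Dw r (z.1 - z.2) * v z.2 ^+ 2).
have EG (z : R * R) : pois h (z.1 - z.2) * G z = (1 + e) * (pois h (z.1 - z.2) * (v z.1 - v z.2) ^+ 2) +
   2 * (1 + e^-1) * (pois h (z.1 - z.2) * Dw r (z.1 - z.2) * v z.2 ^+ 2) by rewrite /G; ring.
have LG : L1 mu2 (fun z : R * R => pois h (z.1 - z.2) * G z) by apply: L1_ext LL => z; rewrite EG.
have := @Eh_leG h _ G h0 (cut_L12 r0 hv) LG.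
have -> : \int[mu2]_z (pois h (z.1 - z.2) * G z) = (1 + e) * (2 * h * Eh h v v) +
    2 * (1 + e^-1) * ((\int[mu]_z (pois h z * Dw r z)) * \int[mu]_x (v x ^+ 2)).
  rewrite (@I_ext _ _ _ mu2 _ _ EG) (I_D (L1Z (1 + e) l1) (L1Z (2 * (1 + e^-1)) l2)) (I_Z _ l1) (I_Z _ l2) i2.
  by rewrite eh mulVKf// mulf_neq0// lt0r_neq0.
move=> H; apply: le_trans (H _) _; last first.
  by apply: cut_arith => //; apply: I_ge0 => x; exact: sqr_ge0.
move=> x y; apply: cut_sq => //; first by rewrite chi_ge0 chi_le1.
apply: Dw_bound => //; last exact: chi_lip.
exact: dist01 (chi_ge0 r x) (chi_le1 r x) (chi_ge0 r y) (chi_le1 r y).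
Qed.

Lemma EE_cut_arith (e E V r p X : R) : 0 < p -> X <= (1 + e) * (p^-1 * E) + (1 + e^-1) / r * V ->
  X <= p^-1 * ((1 + e) * E + p * ((1 + e^-1) / r * V)).
Proof. by move=> p0 h; apply: le_trans h _; rewrite mulrDr mulKf ?lt0r_neq0// lerD2r mulrCA. Qed.

Lemma EE_cut r e v : 0 < r -> 0 < e -> L12 v -> FE v -> FE (fun x => chi r x * v x) /\
  EE2 (fun x => chi r x * v x) <= (1 + e) * EE v v + 2 * pi * ((1 + e^-1) / r * \int[mu]_x (v x ^+ 2)).
Proof.
move=> r0 e0 hv fv; have P := @pi2_gt0 R.
apply: EE_le_of; first exact: cut_L12.
move=> n; apply: EE_cut_arith => //; apply: le_trans (Eh_cut (dy_gt0 n) r0 e0 hv) _.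
rewrite lerD2r; apply: ler_wpM2l; first by rewrite addr_ge0// ltW.
by apply: Eh_le_EE => //; exact: dy_gt0.
Qed.

(** The radius is [hn n] to the power -2 and the parameter of Young's inequality will be [hn n], so
    that the error factor (1 + 1 / e) / r is hn^2 + hn. *)
Definition cutn (n : nat) v x := chi ((hn n ^+ 2)^-1) x * v x.

Lemma rn_gt0 n : 0 < ((hn n : R) ^+ 2)^-1.
Proof. by rewrite invr_gt0 exprn_gt0// hn_gt0. Qed.

Lemma rn_ge n : (n%:R : R) <= (hn n ^+ 2)^-1.
Proof.
rewrite /hn exprVn invrK -natrX ler_nat.
by rewrite expnS expn1 (leq_trans (leqnSn n))// leq_pmulr.
Qed.

Lemma cutn_cvg x v : cutn n v x @[n --> \oo] --> v x.
Proof.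
apply: cvg_near_cst; near=> n; rewrite /cutn chi_in ?mul1r ?rn_gt0//.
apply: le_trans (rn_ge n); near: n; exact: near_nat_ge.
Unshelve. all: end_near. Qed.

Lemma cutn_abs n v x : `|cutn n v x| <= `|v x|.
Proof. by rewrite normrM ler_piMl// ger0_norm ?chi_ge0 ?chi_le1. Qed.

Lemma cutn_L12 n v : L12 v -> L12 (cutn n v).
Proof. exact: cut_L12 (rn_gt0 n). Qed.

Lemma cutn_L1_cvg v : L12 v -> \int[mu]_x `|cutn n v x - v x| @[n --> \oo] --> (0 : R).
Proof.
move=> hv; have [_ _ //] := @DCT _ _ _ mu (fun n x => cutn n v x) v (fun x => `|v x|)
  (fun n => L1_meas (L12_1 (cutn_L12 n hv))) (L1_meas (L12_1 hv)) (@aeW _ _ _ mu _ (fun x => @cutn_cvg x v)) (L1_abs (L12_1 hv)) (fun n x => cutn_abs n v x).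
Qed.

Lemma cutn_L2_cvg v : L12 v -> \int[mu]_x ((cutn n v x - v x) ^+ 2) @[n --> \oo] --> (0 : R).
Proof.
move=> hv; have [mv sv] := L12_2 hv.
have d n := L12_2 (L12B (cutn_L12 n hv) hv).
have [] := @DCT _ _ _ mu (fun n x => (cutn n v x - v x) ^+ 2) (fun=> 0) (fun x => 4 * v x ^+ 2).
- by move=> n; case: (d n) => _ /L1_meas.
- exact: measurable_cst.
- apply: aeW => x; apply: cvg0_sqr; rewrite -(subrr (v x)); apply: cvgB; [exact: cutn_cvg|exact: cvg_cst].
- exact: L1Z.
- move=> n x; rewrite ger0_norm ?sqr_ge0//.
  have -> : 4 * v x ^+ 2 = (2 * `|v x|) ^+ 2 by rewrite exprMn real_normK ?num_real//; ring.
  rewrite -[leLHS]real_normK ?num_real// lerXn2r ?nnegrE//.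
  by apply: le_trans (ler_normB _ _) _; have := cutn_abs n v x; move: (`|_|) (`|_|) => a b; lra.
by rewrite I_0.
Qed.

Lemma cutn_EE_cvg v : L12 v -> FE v ->
  EE2 (fun x => cutn n v x - v x) @[n --> \oo] --> (0 : R).
Proof.
move=> hv fv; have h0 n := @hn_gt0 R n.
pose V := \int[mu]_x (v x ^+ 2); have V0 : 0 <= V by apply: I_ge0 => x; exact: sqr_ge0.
have q n := EE_cut (rn_gt0 n) (h0 n) hv fv.
have P := @pi2_gt0 R.
have h1 n : hn n <= (1 : R) by rewrite invf_le1// ler1n.
apply: (@energy_strong _ (fun n => cutn n v) v (fun n => (1 + hn n) * EE v v + 2 * pi * ((hn n ^+ 2 + hn n) * V)) (2 * EE v v + 2 * pi * (2 * V))) => //.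
- by move=> n; exact: cutn_L12.
- by move=> n; have [] := q n.
- exact: cutn_L2_cvg.
- move=> n; have [_] := q n; rewrite -/V.
  by have -> : (1 + (hn n)^-1) / (hn n ^+ 2)^-1 = hn n ^+ 2 + hn n :> R by move: (hn n) (h0 n) => a a0; field; nz.
- move=> n; apply: lerD; first by apply: ler_wpM2r; [exact: EE_ge0|have := h1 n; lra].
  rewrite ler_pM2l//; apply: ler_wpM2r => //.
  have : hn n ^+ 2 <= (1 : R) by rewrite expr_le1// ltW.
  by have := h1 n; lra.
- have E0 : (1 + 0) * EE v v + 2 * pi * ((0 ^+ 2 + 0) * V) = EE v v.
    by rewrite expr0n addr0 mul1r addr0 mul0r mulr0 addr0.
  have hc := @hn_cvg R.
  rewrite -[X in _ --> X]E0; apply: cvgD; first by apply: cvgM; [apply: cvgD => //; exact: cvg_cst|exact: cvg_cst].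
  apply: cvgM; first exact: cvg_cst.
  apply: cvgM; last exact: cvg_cst.
  by apply: cvgD => //; rewrite expr0n; exact: cvg0_sqr.
Qed.

(** Increments are at most min (2 M, L |x - y|), and vanish unless x or y lies in [-N, N];
    integration against the kernel then gives a bound free of the step. *)
Lemma lip_FE (phi : R -> R) (M L N : R) : 0 < M -> 0 < L -> 0 < N ->
  mfun phi -> (forall x, `|phi x| <= M) ->
  (forall x y, `|phi x - phi y| <= L * `|x - y|) -> (forall x, N < `|x| -> phi x = 0) ->
  [/\ L12 phi, FE phi & EE phi phi <= 2 * pi * (8 * M * N * L)].
Proof.
move=> M0 L0 N0 mp pM pL pN.
pose J x : R := \1_(`[- N, N]%classic) x.
have J1 : L1 mu J by exact: indic_itv_L1.
have JI : \int[mu]_x J x = 2 * N by rewrite indic_itv_I// ltW.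
have p1 : L1 mu phi.
  apply: L1_le (L1Z M J1) _ => // x; rewrite /J indic_itv.
  by case: (leP `|x| N) => hx; [rewrite mulr1|rewrite pN// normr0 mulr0].
have hp : L12 phi := L12_bounded p1 pM.
have P := @pi2_gt0 R.
(* The distance at which the Lipschitz bound reaches the trivial bound 2 M. *)
pose r := 2 * M / L; have r0 : 0 < r by rewrite divr_gt0 ?mulr_gt0.
suff [] : FE phi /\ EE phi phi <= 2 * pi * (8 * M * N * L) by [].
apply: EE_le_of => // n.
  have eK (p X : R) : 0 < p -> p^-1 * (p * X) = X by move=> p0; field; nz.
  rewrite eK//.
  have h0 : 0 < (dy n : R) := @dy_gt0 R n; move: (dy n : R) h0 => h h0.
  have [k1 k0 kI] := pD_L1 h0 r0.
  have [l1 i1] := ker2_x k1 k0 J1; have [l2 i2] := ker2_y k1 k0 J1.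
  pose G (z : R * R) := 8 * M ^+ 2 * (Dw r (z.1 - z.2) * (J z.1 + J z.2)).
  have EG (z : R * R) : pois h (z.1 - z.2) * G z = 8 * M ^+ 2 * (pois h (z.1 - z.2) * Dw r (z.1 - z.2) * J z.1 + pois h (z.1 - z.2) * Dw r (z.1 - z.2) * J z.2).
    by rewrite /G; ring.
  have LG : L1 mu2 (fun z : R * R => pois h (z.1 - z.2) * G z).
    by apply: L1_ext (L1Z (8 * M ^+ 2) (L1D l1 l2)) => z; rewrite EG.
  have := @Eh_leG h _ G h0 hp LG.
  rewrite (@I_ext _ _ _ mu2 _ _ EG) (I_Z _ (L1D l1 l2)) (I_D l1 l2) i1 i2 JI.
  move=> H; apply: le_trans (H _) _; last first.
    move: (\int[mu]_z _) kI => K kI.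
    have -> : (2 * h)^-1 * (8 * M ^+ 2 * (K * (2 * N) + K * (2 * N))) = 16 * M ^+ 2 * N * (K / h) by field; nz.
    have -> : 8 * M * N * L = 16 * M ^+ 2 * N * r^-1 by rewrite /r; field; nz.
    apply: ler_wpM2l; first by rewrite !mulr_ge0 ?sqr_ge0// ltW.
    by rewrite ler_pdivrMr// mulrC.
  move=> x y; rewrite /G /=.
  have D0 := Dw_ge0 (x - y) r0.
  have bd : (phi x - phi y) ^+ 2 <= 8 * M ^+ 2 * Dw r (x - y).
    have := @Dw_bound r (x - y) ((phi x - phi y) / (2 * M)) r0.
    have nM : `|2 * M| = 2 * M by rewrite ger0_norm// mulr_ge0// ltW.
    rewrite normrM normfV nM => H1.
    have {H1} : ((phi x - phi y) / (2 * M)) ^+ 2 <= 2 * Dw r (x - y).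
      apply: H1; rewrite ler_pdivrMr ?mulr_gt0//.
        exact: norm_sub2 (pM x) (pM y).
      have -> : `|x - y| / r * (2 * M) = L * `|x - y| by rewrite /r; field; nz.
      exact: pL.
    by rewrite expr_div_n ler_pdivrMr ?exprn_gt0 ?mulr_gt0// exprMn; move: (Dw _ _) (M ^+ 2) => a b; lra.
  have D8 : 0 <= 8 * M ^+ 2 by rewrite mulr_ge0 ?sqr_ge0.
  have [hx|hx] := leP `|x| N.
    apply: le_trans bd _; rewrite ler_wpM2l// -[leLHS]mulr1 ler_wpM2l// /J !indic_itv hx.
    by rewrite lerDl.
  have [hy|hy] := leP `|y| N.
    apply: le_trans bd _; rewrite ler_wpM2l// -[leLHS]mulr1 ler_wpM2l// /J !indic_itv hy.
    by rewrite lerDr.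
  rewrite (pN x hx) (pN y hy) subrr expr0n/=; apply: mulr_ge0 => //; apply: mulr_ge0 => //.
  by apply: addr_ge0; rewrite /J indic_itv.
Qed.

End gagliardo.

(** * Smooth compactly supported functions and their density *)

Section smooth.
Context {R : realType}.
Local Notation mu := (@lebesgue_measure R).
Implicit Types (f g k v w : R -> R).

Lemma is_derive_quad f (x d C : R) :
  (forall h, `|f (h + x) - f x - h * d| <= C * h ^+ 2) -> is_derive x 1 f d.
Proof.
move=> H.
have L : h^-1 *: (f (h *: (1 : R) + x) - f x) @[h --> (0 : R)^'] --> d.
  apply/cvgrPdist_le => e e0.
  near=> h.
  have h0 : h != 0 by near: h; exact: nbhs_dnbhs_neq.
  rewrite -[h *: (1 : R)]/(h * 1) mulr1 -[_ *: _]/(_ * _) distrC.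
  have -> : h^-1 * (f (h + x) - f x) - d = h^-1 * (f (h + x) - f x - h * d).
    have aux (a b c : R) : a != 0 -> a^-1 * b - c = a^-1 * (b - a * c) by move=> a0; field.
    exact: aux.
  rewrite normrM normfV ler_pdivrMl ?normr_gt0//; apply: le_trans (H h) _.
  rewrite -(real_normK (num_real h)) mulrC expr2 -mulrA ler_wpM2l//.
  have : `|h| <= e / (`|C| + 1).
    near: h; apply: dnbhs0_le; rewrite divr_gt0//; have := normr_ge0 C; lra.
  have C1 : 0 < `|C| + 1 by have := normr_ge0 C; lra.
  rewrite ler_pdivlMr//; have := ler_norm C; have := normr_ge0 h.
  move: (`|h|) (`|C|) => a b; nra.
apply: DeriveDef; last by rewrite /derive; apply: cvg_lim.
by apply/cvg_ex; exists d.
Unshelve. all: end_near. Qed.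

Lemma MVT_le f (f' : R -> R) (a b : R) : (forall x : R, is_derive x 1 f (f' x)) ->
  exists2 c, `|c - a| <= `|b - a| & f b - f a = f' c * (b - a).
Proof.
move=> df; have cf := der_cont df.
have [ab|ba|->] := ltgtP a b; last by exists b; rewrite ?subrr ?mulr0.
- have [|c] := MVT ab (fun x _ => df x); first exact: continuous_subspaceT.
  rewrite in_itv => /= /andP[ac cb] ->; exists c => //.
  by rewrite !ger0_norm; lra.
- have [|c] := MVT ba (fun x _ => df x); first exact: continuous_subspaceT.
  rewrite in_itv => /= /andP[bc ca] e; exists c.
    by rewrite !ler0_norm; lra.
  by rewrite -opprB e; ring.
Qed.

Lemma taylor_le f (f' f'' : R -> R) (L x h : R) : (forall x : R, is_derive x 1 f (f' x)) ->
  (forall x : R, is_derive x 1 f' (f'' x)) -> (forall x, `|f'' x| <= L) ->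
  `|f (h + x) - f x - h * f' x| <= L * h ^+ 2.
Proof.
move=> d1 d2 hL; have [c hc ->] := MVT_le x (h + x) d1.
have [e _ he] := MVT_le x c d2.
have -> : f' c * (h + x - x) - h * f' x = (f' c - f' x) * h by ring.
rewrite he !normrM -(real_normK (num_real h)) expr2 mulrA.
apply: ler_wpM2r => //; apply: ler_pM => //.
by apply: le_trans hc _; rewrite addrK.
Qed.

(** The functions x^-n exp (- 1 / x), extended by 0. Their linear span is stable under
    differentiation, and [fe 0] is the classical flat function. *)
Definition fe (n : nat) (x : R) : R := if 0 < x then x^-1 ^+ n * expR (- x^-1) else 0.

Lemma fe_ge0 n x : 0 <= fe n x.
Proof.
rewrite /fe; case: ifP => // x0; apply: mulr_ge0; last exact: expR_ge0.
by apply: exprn_ge0; rewrite invr_ge0 ltW.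
Qed.

(** With t = s / (n + 1), the inequality t <= exp t gives s^n <= (n + 1)^n exp (n t), and n t <=
    s. *)
Lemma exp_pow (s : R) n : 0 <= s -> s ^+ n * expR (- s) <= n.+1%:R ^+ n.
Proof.
move=> s0; have n0 : (0 : R) < n.+1%:R by [].
rewrite expRN ler_pdivrMr ?expR_gt0//.
have -> : s = n.+1%:R * (s / n.+1%:R) by field; nz.
set t := s / n.+1%:R; have t0 : 0 <= t by rewrite divr_ge0.
rewrite exprMn ler_wpM2l ?exprn_ge0//.
apply: (@le_trans _ _ (expR t ^+ n)).
  rewrite lerXn2r ?nnegrE ?expR_ge0//.
  by have := expR_ge1Dx t; lra.
rewrite -expRM_natl ler_expR ler_wpM2r// ler_nat //.
Qed.

(** Flatness at 0 in quadratic form, which yields the derivative 0 there through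
    [is_derive_quad]. *)
Lemma fe_quad n x : fe n x <= n.+3%:R ^+ n.+2 * x ^+ 2.
Proof.
rewrite /fe; case: ifP => [x0|_]; last by rewrite mulr_ge0 ?sqr_ge0 ?exprn_ge0.
have s0 : 0 <= x^-1 by rewrite invr_ge0 ltW.
have := exp_pow n.+2 s0; move: (n.+3%:R ^+ n.+2) => K.
have e : x^-1 ^+ n = x^-1 ^+ n.+2 * x ^+ 2.
  by rewrite -addn2 exprD -mulrA -exprMn mulVf ?lt0r_neq0// expr1n mulr1.
move=> h; have -> : x^-1 ^+ n * expR (- x^-1) = x^-1 ^+ n.+2 * expR (- x^-1) * x ^+ 2 by rewrite e mulrAC.
by apply: ler_wpM2r => //; exact: sqr_ge0.
Qed.

Lemma fe_der n (x : R) : is_derive x 1 (fe n) (fe n.+2 x - n%:R * fe n.+1 x).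
Proof.
have [x0|x0|->] := ltgtP x 0.
- apply: (@near_eq_is_derive _ _ _ (fun=> 0)).
    near=> y; rewrite /fe ifF//; apply/negbTE; rewrite -leNgt ltW//.
    by near: y; exact: lt_nbhsl.
  by rewrite /fe !ifF; [apply: deq (dcst _ _) _; ring|apply/negbTE; rewrite -leNgt ltW..].
- apply: (@near_eq_is_derive R R^o R^o (fun y : R => y^-1 ^+ n * expR (- y^-1)) (fe n) x 1).
    by near=> y; rewrite /fe ifT//; near: y; exact: lt_nbhsr.
  have dV : is_derive x 1 (fun y : R => y^-1) (- x^-1 ^+ 2).
    have := @is_deriveV _ (fun y : R => y) x 1 1 (lt0r_neq0 x0) (did x).
    by move=> h; apply: (deq h); rewrite -[_ *: _]/(_ * _) mulr1 exprVn.
  have dX : is_derive x 1 (fun y : R => y^-1 ^+ n) (- (n%:R * x^-1 ^+ n.+1)).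
    elim: n => [|m ih]; first by apply: deq (dcst _ _) _; rewrite mul0r oppr0.
    rewrite (_ : (fun y : R => y^-1 ^+ m.+1) = (fun y : R => y^-1 * y^-1 ^+ m)); last by apply/funext=> y; rewrite exprS.
    by apply: deq (dM dV ih) _; rewrite -natr1 !exprS; ring.
  have dE : is_derive x 1 (fun y : R => expR (- y^-1)) (expR (- x^-1) * x^-1 ^+ 2).
    have := @dcomp _ expR (fun y : R => - y^-1) x _ _ (is_derive_expR (- x^-1)) (dN dV).
    by move=> h; apply: (deq h); rewrite opprK.
  apply: deq (dM dX dE) _; rewrite /fe x0 !exprS; ring.
- have f0 m : fe m 0 = 0 by rewrite /fe ltxx.
  rewrite !f0 mulr0 subrr; apply: (@is_derive_quad _ _ _ (n.+3%:R ^+ n.+2)) => h.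
  by rewrite addr0 f0 mulr0 !subr0 ger0_norm ?fe_ge0//; exact: fe_quad.
Unshelve. all: end_near. Qed.

(** A syntactic class, stable under differentiation, that contains the bumps; infinite
    differentiability becomes an induction on the order. *)
Inductive Sm : (R -> R) -> Prop :=
  | Sm_e n a c : Sm (fun x => fe n (a * x + c))
  | Sm_c c : Sm (fun=> c)
  | Sm_D f g : Sm f -> Sm g -> Sm (fun x => f x + g x)
  | Sm_M f g : Sm f -> Sm g -> Sm (fun x => f x * g x).

Lemma Sm_der f : Sm f -> exists2 f', Sm f' & forall x : R, is_derive x 1 f (f' x).
Proof.
elim=> [n a c|c|{}f g _ [f' sf' df] _ [g' sg' dg]|{}f g sf [f' sf' df] sg [g' sg' dg]].
- exists (fun x => (fe n.+2 (a * x + c) + (- n%:R) * fe n.+1 (a * x + c)) * a).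
    by apply: Sm_M (Sm_c a); apply: Sm_D; [exact: Sm_e|apply: Sm_M; [exact: Sm_c|exact: Sm_e]].
  move=> x; have dl : is_derive x 1 (fun y : R => a * y + c) a.
    by apply: deq (dD (dZ a (did x)) (dcst c x)) _; ring.
  by apply: deq (@dcomp _ (fe n) (fun y => a * y + c) x _ _ (fe_der n (a * x + c)) dl) _; ring.
- by exists (fun=> 0); [exact: Sm_c|move=> x; exact: dcst].
- by exists (fun x => f' x + g' x); [exact: Sm_D|move=> x; exact: dD].
- exists (fun x => f x * g' x + g x * f' x); first by apply: Sm_D; exact: Sm_M.
  by move=> x; exact: dM.
Qed.

Definition supp_in (N : R) f := forall x, N < `|x| -> f x = 0.

Definition Smc (N : R) f := Sm f /\ supp_in N f.

Lemma Smc_der N f : Smc N f -> exists2 f', Smc N f' & forall x : R, is_derive x 1 f (f' x).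
Proof.
move=> [sf f0]; have [f' sf' df] := Sm_der sf; exists f' => //; split => // x hx.
have : is_derive x 1 f 0.
  apply: (@near_eq_is_derive R R^o R^o (fun=> 0) f x 1 0 _ (dcst 0 x)).
  near=> y; rewrite f0//; near: y.
  have : `|y| @[y --> x] --> `|x| by exact: (@norm_continuous _ R^o).
  by move=> /cvgr_gt; apply.
by move=> [_ <-]; have [_ <-] := df x.
Unshelve. all: end_near. Qed.

Lemma Sm_cont f : Sm f -> continuous f.
Proof. by move=> /Sm_der[f' _ df]; exact: der_cont df. Qed.

Lemma Smc_bounded N f : 0 < N -> Smc N f -> exists2 M, 0 < M & forall x, `|f x| <= M.
Proof.
move=> N0 [sf f0]; have cf := Sm_cont sf.
have cn : {within `[- N, N], continuous (fun x => `|f x|)}.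
  apply: continuous_subspaceT => x.
  by apply: (@continuous_comp _ _ _ f (fun y : R => `|y|)); [exact: cf|exact: (@norm_continuous _ R^o)].
have NN : - N <= N by lra.
have [c _ hc] := EVT_max NN cn.
exists (`|f c| + 1); first by have := normr_ge0 (f c); lra.
move=> x; have [hx|hx] := leP `|x| N.
  by have := hc x; rewrite in_itv /= -ler_norml => /(_ hx); lra.
by rewrite f0// normr0; have := normr_ge0 (f c); lra.
Qed.

Lemma Smc_cw (N : R) f (x : R) g : 0 < N -> Smc N f -> L1 mu g -> L1 mu (fun y => f (x - y) * g y).
Proof.
move=> N0 sf hg; have [M _ hM] := Smc_bounded N0 sf.
have mf : mfun f by apply: continuous_measurable_fun; exact: Sm_cont sf.1.
apply: L1_ext (@bmul_L1 _ g (fun y => f (x - y)) M hg _ _) => [y||y]; last exact: hM.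
  by rewrite mulrC.
by apply: (measurableT_comp mf); apply: measurable_funB.
Qed.

Lemma conv_der (N : R) k g : 0 < N -> Smc N k -> L1 mu g ->
  exists2 k', Smc N k' & forall x : R, is_derive x 1 (conv k g) (conv k' g x).
Proof.
move=> N0 sk hg; have [k' sk' d1] := Smc_der sk; have [k'' sk'' d2] := Smc_der sk'.
have [L L0 hL] := Smc_bounded N0 sk''.
exists k' => // x; apply: (@is_derive_quad _ _ _ (L * \int[mu]_y `|g y|)) => h.
have i1 := Smc_cw (h + x) N0 sk hg; have i2 := Smc_cw x N0 sk hg; have i3 := Smc_cw x N0 sk' hg.
rewrite /conv -(I_B i1 i2) -(I_Z h i3) -(I_B (L1B i1 i2) (L1Z h i3)).
rewrite mulrAC -(I_Z (L * h ^+ 2) (L1_abs hg)).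
apply: I_abs_le; [exact: L1B (L1B i1 i2) (L1Z h i3)|exact: L1Z _ (L1_abs hg)|].
move=> y; have -> : k (h + x - y) * g y - k (x - y) * g y - h * (k' (x - y) * g y) =
  (k (h + (x - y)) - k (x - y) - h * k' (x - y)) * g y by rewrite addrA; ring.
rewrite normrM; apply: ler_wpM2r => //.
exact: (taylor_le _ _ d1 d2 hL).
Qed.

Lemma conv_derive1n (N : R) k g n : 0 < N -> Smc N k -> L1 mu g ->
  exists2 k', Smc N k' & derive1n n (conv k g) = conv k' g.
Proof.
move=> N0 sk hg; elim: n => [|n [k' sk' e]]; first by exists k.
have [k'' sk'' d] := conv_der N0 sk' hg; exists k'' => //.
by rewrite derive1nS e; apply/funext => x; rewrite derive1E; have [_ <-] := d x.
Qed.

Lemma conv_C0infty (N N' : R) k g : 0 < N -> Smc N k -> L1 mu g -> supp_in N' g -> C0infty (conv k g).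
Proof.
move=> N0 sk hg g0; split.
  move=> n x; have [k' sk' ->] := conv_derive1n n N0 sk hg.
  by have [k'' _ d] := conv_der N0 sk' hg; case: (d x).
exists (`[- (N + N'), N + N']%classic); first exact: segment_compact.
move=> x /= hx; rewrite /conv I_zero// => y.
have [hy|/g0 ->] := leP `|y| N'; last by rewrite mulr0.
rewrite sk.2 ?mul0r//; rewrite ltNge; apply/negP => hxy; apply: hx.
rewrite in_itv/= -ler_norml; have := ler_normD (x - y) y; rewrite subrK; lra.
Qed.

Definition bump (e x : R) := fe 0 (e^-1 * x + 1) * fe 0 (- e^-1 * x + 1).

Definition moll (e x : R) := bump e x / \int[mu]_y bump e y.

Lemma bump_ge0 e x : 0 <= bump e x. Proof. by apply: mulr_ge0; exact: fe_ge0. Qed.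

Lemma bump_Smc e : 0 < e -> Smc e (bump e).
Proof.
move=> e0; split; first by apply: Sm_M; exact: Sm_e.
move=> x hx; rewrite /bump /fe; have [x0|x0] := leP 0 x.
  rewrite (ger0_norm x0) in hx.
  have -> : (0 < - e^-1 * x + 1) = false; last by rewrite mulr0.
  apply/negbTE; rewrite -leNgt mulNr addrC subr_le0 mulrC ler_pdivlMr// mul1r; exact: ltW.
rewrite (ltr0_norm x0) in hx.
have -> : (0 < e^-1 * x + 1) = false; last by rewrite mul0r.
by apply/negbTE; rewrite -leNgt -lerBrDr sub0r mulrC ler_pdivrMr// mulN1r lerNr ltW.
Qed.

Lemma Smc_L1 (N : R) f : 0 < N -> Smc N f -> L1 mu f.
Proof.
move=> N0 sf; have [M _ hM] := Smc_bounded N0 sf.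
apply: L1_le (L1Z M (indic_itv_L1 N)) _.
  by apply: continuous_measurable_fun; exact: Sm_cont sf.1.
move=> x; rewrite indic_itv; case: (leP `|x| N) => hx; first by rewrite mulr1.
by rewrite sf.2// normr0 mulr0.
Qed.

Lemma bump_L1 e : 0 < e -> L1 mu (bump e).
Proof. by move=> e0; apply: (Smc_L1 e0); exact: bump_Smc. Qed.

Lemma bump_I e : 0 < e -> 0 < \int[mu]_y bump e y.
Proof.
move=> e0; have e2 : 0 < e / 2 by rewrite divr_gt0.
have c0 : 0 < expR (- 2) * expR (- 2) :> R by rewrite mulr_gt0// expR_gt0.
apply: (@lt_le_trans _ _ (\int[mu]_x (expR (- 2) * expR (- 2) * \1_(`[- (e / 2), e / 2]%classic) x))).
  by rewrite I_Z; [rewrite indic_itv_I ?mulr_gt0// ltW|exact: indic_itv_L1].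
apply: I_le; [exact: L1Z (indic_itv_L1 _)|exact: bump_L1|] => x.
rewrite indic_itv; case: (leP `|x| (e / 2)) => hx; last by rewrite mulr0 bump_ge0.
have fel t : 2^-1 <= t -> expR (- 2) <= fe 0 t.
  move=> t2; have t0 : 0 < t by apply: lt_le_trans t2; rewrite invr_gt0.
  rewrite /fe t0 expr0 mul1r ler_expR lerN2 -[leRHS]invrK lef_pV2 ?posrE ?invr_gt0//.
have hx2 : `|e^-1 * x| <= 2^-1.
  by rewrite normrM normfV (gtr0_norm e0) mulrC ler_pdivrMr// mulrC.
move: hx2; rewrite ler_norml => /andP[h1 h2].
rewrite mulr1 /bump; apply: ler_pM; rewrite ?expR_ge0//; apply: fel; lra.
Qed.

Lemma moll_Smc e : 0 < e -> Smc e (moll e).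
Proof.
move=> e0; have [s h] := bump_Smc e0; split; first by apply: Sm_M => //; exact: Sm_c.
by move=> x hx; rewrite /moll h// mul0r.
Qed.

Lemma moll_kernel e : 0 < e -> kernel (moll e).
Proof.
move=> e0; have I0 := bump_I e0; split.
- by apply: (Smc_L1 e0); exact: moll_Smc.
- by move=> x; rewrite divr_ge0 ?bump_ge0// ltW.
- have [M _ hM] := Smc_bounded e0 (moll_Smc e0); exists M => x; exact: le_trans (ler_norm _) (hM x).
- rewrite (I_to (fun x => (\int[mu]_y bump e y)^-1 * bump e x)); last by move=> x; rewrite mulrC.
  by rewrite I_Z ?mulVf ?lt0r_neq0//; exact: bump_L1.
- by move=> x; rewrite /moll /bump mulrC !mulrN !mulNr opprK mulrC (mulrC (fe 0 _)).
Qed.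

Lemma hart_kernel_le1 k xi : kernel k -> `|hart k xi| <= 1.
Proof.
move=> kk; have hk := kernel_L1 kk.
have mc : mfun (fun x : R => cos (x * xi)) by apply: (measurableT_comp cos_meas); exact: measurable_funM.
have ms : mfun (fun x : R => sin (x * xi)) by apply: (measurableT_comp sin_meas); exact: measurable_funM.
have c1 : L1 mu (fun x => k x * cos (x * xi)).
  by apply: (bmul_L1 hk mc (M := 1)) => x; exact: cos_max.
have s1 : L1 mu (fun x => k x * sin (x * xi)).
  by apply: (bmul_L1 hk ms (M := 1)) => x; exact: sin_max.
have -> : hart k xi = \int[mu]_x (k x * cos (x * xi)).
Transparent hart. rewrite /hart. Opaque hart.
  rewrite -[RHS]addr0 -(I_odd s1); last by move=> x; rewrite (kernel_even kk) mulNr sinN mulrN.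
  by rewrite -I_D//; apply: I_ext => x; rewrite /cas mulrDr.
rewrite -(kernel_I kk); apply: I_abs_le => // x.
by rewrite normrM (ger0_norm (kernel_ge0 kk x)) ler_piMr ?(kernel_ge0 kk)// cos_max.
Qed.

Lemma EE_conv k v : kernel k -> L1 mu v -> FE v -> FE (conv k v) /\ EE2 (conv k v) <= EE v v.
Proof.
move=> kk hv fv; have cv := conv_L1 kk hv.
have b xi : `|rxi xi * hart (conv k v) xi| <= `|rxi xi * hart v xi|.
  rewrite !normrM; apply: ler_wpM2l => //; rewrite hart_conv// normrM ler_piMl//; exact: hart_kernel_le1.
have V2 := (FE_L2 (L1_meas hv)).1 fv.
have C2 : L2 mu (fun xi => rxi xi * hart (conv k v) xi).
  by apply: (@L2_le _ _ _ mu (fun xi => rxi xi * hart (conv k v) xi) _ _ V2 b); apply: measurable_funM; [exact: rxi_meas|exact: hart_meas (L1_meas cv)].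
have F : FE (conv k v) by apply/FE_L2 => //; exact: L1_meas cv.
split => //; rewrite !EEvv; apply: I_le; [by case: C2|by case: V2|] => xi.
by rewrite -[leLHS]real_normK ?num_real// -[leRHS]real_normK ?num_real// lerXn2r ?nnegrE//; exact: b.
Qed.

Lemma EE_D_le v w : L1 mu v -> L1 mu w -> FE v -> FE w ->
  EE2 (fun x => v x + w x) <= 2 * EE v v + 2 * EE w w.
Proof.
move=> hv hw fv fw; rewrite (EE_sqrD hv hw fv fw).
have := EE_ge0 (fun x => v x - w x); rewrite (EE_sqrB hv hw fv fw).
by move: (EE v v) (EE v w) (EE w w) => a b c; lra.
Qed.

Lemma moll_L1_cvg v : L1 mu v -> \int[mu]_x `|conv (moll (hn n)) v x - v x| @[n --> \oo] --> (0 : R).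
Proof.
move=> hv; apply/cvg0P => e e0; have [d d0 hd] := L1_transl hv e0.
have d2 : 0 < d / 2 by rewrite divr_gt0.
have [N hN] := hn_small d2; exists N => n /hN hnd.
have h0 := @hn_gt0 R n; have kk := moll_kernel h0.
rewrite ger0_norm; last by apply: I_ge0 => x; exact: normr_ge0.
apply: le_trans (conv_omod kk hv) _.
have -> : e = \int[mu]_z (e * moll (hn n) z) by rewrite I_Z ?(kernel_I kk) ?mulr1//; exact: kernel_L1 kk.
have mo := omod_meas (L1_meas hv).
have l1 : L1 mu (fun z => moll (hn n) z * omod v z).
  apply: (bmul_L1 (kernel_L1 kk) mo (M := 2 * \int[mu]_x `|v x|)) => z.
  by have /andP[h1 h2] := omod_bound z hv; rewrite ger0_norm.
apply: I_le => //; first exact: L1Z (kernel_L1 kk).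
move=> z; have k0 := kernel_ge0 kk z; rewrite mulrC; have [hz|hz] := leP `|z| (hn n).
  by apply: ler_wpM2r => //; apply: hd; lra.
by have [_ ->] := moll_Smc h0; rewrite ?mulr0.
Qed.

Lemma moll_EE_cvg v M : L1 mu v -> (forall x, `|v x| <= M) -> FE v ->
  EE2 (fun x => conv (moll (hn n)) v x - v x) @[n --> \oo] --> (0 : R).
Proof.
move=> v1 vM fv; have hv := L12_bounded v1 vM; have kk n := moll_kernel (@hn_gt0 R n).
apply: (@energy_strong _ (fun n => conv (moll (hn n)) v) v (fun=> EE v v) (EE v v)).
- by move=> n; exact: L12_conv.
- exact: hv.
- by move=> n; have [] := EE_conv (kk n) v1 fv.
- exact: fv.
- have M0 : 0 <= M by exact: le_trans (normr_ge0 _) (vM 0).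
  apply: (@cvg0_le _ _ _ _ _ (fun n => 2 * M * \int[mu]_x `|conv (moll (hn n)) v x - v x|)).
    move=> n; rewrite ger0_norm; last by apply: I_ge0 => x; exact: sqr_ge0.
    have d := L12B (L12_conv (kk n) hv) hv.
    rewrite -I_Z; last exact: L1_abs (L12_1 d).
    apply: I_le; [by case: (L12_2 d)|exact: L1Z (L1_abs (L12_1 d))|] => x.
    rewrite -real_normK ?num_real// expr2; apply: ler_wpM2r => //.
    apply: le_trans (ler_normB _ _) _; have := conv_absM (kk n) x v1 vM; have := vM x.
    by move: (`|_|) (`|_|) => a b; lra.
  apply: cvg0_Zl; exact: moll_L1_cvg.
- by move=> n; have [] := EE_conv (kk n) v1 fv.
- by move=> n; exact: lexx.
- exact: cvg_cst.
Qed.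

Lemma quarters (a b e : R) : 0 < e -> `|a| <= e / 4 -> `|b| <= e / 4 -> a + b <= e.
Proof. by have := ler_norm a; have := ler_norm b; lra. Qed.

Lemma quarters2 (a b e : R) : `|a| <= e / 4 -> `|b| <= e / 4 -> 2 * a + 2 * b <= e.
Proof. by have := ler_norm a; have := ler_norm b; lra. Qed.

(** Cut off, then mollify. The bound [M] survives both operations; [diff_bounded] uses it for
    domination. *)
Lemma dens v (M e : R) : L1 mu v -> (forall x, `|v x| <= M) -> FE v -> 0 < e ->
  exists psi, [/\ C0infty psi, forall x, `|psi x| <= M, L1 mu psi, FE psi &
    EE2 (fun x => psi x - v x) <= e /\ \int[mu]_x `|psi x - v x| <= e].
Proof.
move=> v1 vM fv e0; have hv := L12_bounded v1 vM.
have e4 : 0 < e / 4 by rewrite divr_gt0.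
have /cvg0P /(_ _ e4) [N1 h1] := cutn_EE_cvg hv fv.
have /cvg0P /(_ _ e4) [N2 h2] := cutn_L1_cvg hv.
pose n := maxn N1 N2.
have {}h1 := h1 n (leq_maxl _ _); have {}h2 := h2 n (leq_maxr _ _).
pose g := cutn n v; have hg : L12 g := cutn_L12 n hv; have g1 := L12_1 hg.
have gM x : `|g x| <= M by exact: le_trans (cutn_abs n v x) (vM x).
have fg : FE g by have [] := EE_cut (rn_gt0 n) (@hn_gt0 R n) hv fv.
have g0 : supp_in (2 * (hn n ^+ 2)^-1) g.
  by move=> x hx; rewrite /g /cutn chi_out ?mul0r ?rn_gt0// ltW.
have /cvg0P /(_ _ e4) [N3 h3] := moll_EE_cvg g1 gM fg.
have /cvg0P /(_ _ e4) [N4 h4] := moll_L1_cvg g1.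
pose m := maxn N3 N4.
have {}h3 := h3 m (leq_maxl _ _); have {}h4 := h4 m (leq_maxr _ _).
have m0 := @hn_gt0 R m; have kk := moll_kernel m0.
have p1 := conv_L1 kk g1; have [fp _] := EE_conv kk g1 fg.
exists (conv (moll (hn m)) g); split => //.
- exact: conv_C0infty m0 (moll_Smc m0) g1 g0.
- by move=> x; exact: conv_absM.
set psi := conv _ g.
have E x : psi x - v x = (psi x - g x) + (g x - v x) by ring.
split.
  rewrite (_ : (fun x => psi x - v x) = (fun x => (psi x - g x) + (g x - v x))); last by apply/funext.
  apply: le_trans (EE_D_le (L1B p1 g1) (L1B g1 v1) (FEB p1 g1 fp fg) (FEB g1 v1 fg fv)) _.
  exact: quarters2 h3 h1.
rewrite (I_to (fun x => `|(psi x - g x) + (g x - v x)|)); last by move=> x; rewrite E.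
have q1 := L1_abs (L1B p1 g1); have q2 := L1_abs (L1B g1 v1).
apply: le_trans (I_le (L1_abs (L1D (L1B p1 g1) (L1B g1 v1))) (L1D q1 q2) (fun x => ler_normD _ _)) _.
rewrite (I_D q1 q2).
exact: quarters e0 h4 h2.
Qed.

(** [dens] asks for a bounded function, so [v] is first clipped; the factor 4 is [EE_D_le] applied
    to two errors of size at most [hn n]. *)
Lemma in_Hdot_of (v : R -> R) : L12 v -> FE v -> in_Hdot v.
Proof.
move=> hv fv; have v1 := L12_1 hv; split; first by apply/fracLap_domP.
have H (n : nat) : exists psi, [/\ C0infty psi, L1 mu psi, FE psi &
    EE2 (fun x => v x - psi x) <= 4 * hn n].
  have /cvg0P /(_ _ (@hn_gt0 R n)) [N hN] := clip_EE_cvg hv fv.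
  have {}hN := hN N (leqnn _).
  have N0 : (0 : R) <= N%:R by [].
  have w1 := L12_1 (clip_L12 N0 hv); have [fw _] := clip_FE N0 hv fv.
  have [psi [c0 _ p1 fp [hp _]]] := dens w1 (fun x => clip_abs (v x) N0) fw (@hn_gt0 R n).
  exists psi; split => //.
  have -> : (fun x => v x - psi x) = (fun x => -1 * (clip N%:R (v x) - v x) + -1 * (psi x - clip N%:R (v x))).
    by apply/funext => x; ring.
  have a1 := L1B w1 v1; have a2 := L1B p1 w1; have b1 := FEB w1 v1 fw fv; have b2 := FEB p1 w1 fp fw.
  apply: le_trans (EE_D_le (L1Z (-1) a1) (L1Z (-1) a2) (FEZ (-1) a1 b1) (FEZ (-1) a2 b2)) _.
  have nn z : L1 mu z -> FE z -> EE2 (fun x => -1 * z x) = EE z z.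
    move=> z1 fz; have z1' := L1Z (-1) z1; have fz' := FEZ (-1) z1 fz.
    by rewrite (EE_Zl (-1) z1 z1' fz fz') (EE_sym z) (EE_Zl (-1) z1 z1 fz fz) !mulN1r opprK.
  rewrite (nn _ a1 b1) (nn _ a2 b2).
  rewrite ger0_norm ?EE_ge0// in hN.
  by move: (EE _ _) (EE _ _) (hn n) hN hp => a b c; lra.
have [psi hpsi] := choice H; exists psi; split; first by move=> n; have [] := hpsi n.
have E n : Hdot_norm (v \- psi n) = (Num.sqrt ((2 * pi)^-1 * EE2 (fun x => v x - psi n x)))%:E.
  by have [_ p1 fp _] := hpsi n; rewrite Hdot_normE//; [exact: L1B|exact: FEB].
rewrite (eq_cvg _ _ E); apply: cvg_EFin; first exact: nearW.
rewrite -sqrtr0; apply: continuous_cvg; first exact: sqrt_continuous.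
have P := @ipi_gt0 R.
apply: (@cvg0_le _ _ _ _ _ (fun n => (2 * pi)^-1 * (4 * hn n))).
  move=> n; rewrite ger0_norm; last by rewrite mulr_ge0 ?EE_ge0// ltW.
  by rewrite ler_pM2l//; have [] := hpsi n.
apply: cvg0_Zl.
apply: cvg0_Zl; exact: hn_cvg.
Qed.

Lemma in_Hdot_FE (v : R -> R) : in_Hdot v -> L1 mu v /\ FE v.
Proof. by move=> [/fracLap_domP]. Qed.

End smooth.
(** * The semi-discrete scheme *)

Section log_facts.
Context {R : realType}.
Implicit Types (a b M : R).

Definition lg a : R := ln (1 + a).

Lemma expR_lg a : 0 <= a -> expR (lg a) = 1 + a.
Proof. by move=> a0; rewrite /lg lnK// posrE; lra. Qed.

Lemma lg0 : lg 0 = 0. Proof. by rewrite /lg addr0 ln1. Qed.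

(** Both bounds are 1 + x <= exp x, at x = lg b - lg a and at x = lg a - lg b. *)
Lemma lg_diff a b : 0 <= b -> b <= a -> (a - b) / (1 + a) <= lg a - lg b <= (a - b) / (1 + b).
Proof.
move=> b0 ba; have a0 : 0 <= a by lra.
have ea := expR_lg a0; have eb := expR_lg b0.
have a1 : 0 < 1 + a by lra. have b1 : 0 < 1 + b by lra.
apply/andP; split.
  have := expR_ge1Dx (lg b - lg a); rewrite expRD expRN ea eb => h.
  have -> : (a - b) / (1 + a) = 1 - (1 + b) / (1 + a) by field; nz.
  by move: h; move: (_ / _) => x; lra.
have := expR_ge1Dx (lg a - lg b); rewrite expRD expRN ea eb => h.
have -> : (a - b) / (1 + b) = (1 + a) / (1 + b) - 1 by field; nz.
by move: h; move: (_ / _) => x; lra.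
Qed.

Lemma lg_mono a b : 0 <= b -> b <= a -> lg b <= lg a.
Proof.
move=> b0 ba; have /andP[h _] := lg_diff b0 ba; rewrite -subr_ge0; apply: le_trans h.
by apply: divr_ge0; lra.
Qed.

Lemma lg_ge0 a : 0 <= a -> 0 <= lg a.
Proof. by move=> a0; rewrite -lg0; exact: lg_mono. Qed.

Lemma lg_le1 a b : 0 <= b -> b <= a -> lg a - lg b <= a - b.
Proof.
move=> b0 ba; have /andP[_ h] := lg_diff b0 ba; apply: le_trans h _.
by rewrite ler_pdivrMr; nra.
Qed.

Lemma lg_le a : 0 <= a -> lg a <= a.
Proof. by move=> a0; have := lg_le1 (lexx 0) a0; rewrite lg0; lra. Qed.

(** From (1 + l / 2)^2 <= exp l with l = lg a. It puts log (1 + u) in L^2 when u is only known to be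
    in L^1. *)
Lemma lg_sq a : 0 <= a -> lg a ^+ 2 <= 4 * a.
Proof.
move=> a0; have l0 := lg_ge0 a0; have e := expR_lg a0.
have h := expR_ge1Dx (lg a / 2).
have : (1 + lg a / 2) ^+ 2 <= expR (lg a / 2) ^+ 2.
  by rewrite lerXn2r ?nnegrE ?expR_ge0//; lra.
rewrite -expRM_natl (_ : 2%:R * (lg a / 2) = lg a); last by field.
by rewrite e; nra.
Qed.

(** Subadditivity, lg a - lg b <= lg (a - b) for b <= a, combined with [lg_sq]. Thus L^1 closeness
    of solutions becomes L^2 closeness of their logarithms. *)
Lemma lg_diff_sq a b : 0 <= a -> 0 <= b -> (lg a - lg b) ^+ 2 <= 4 * `|a - b|.
Proof.
wlog ba : a b / b <= a.
  move=> H a0 b0; have [h|h] := leP b a; first exact: H.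
  by rewrite -sqrrN opprB distrC; apply: H => //; exact: ltW.
move=> a0 b0; rewrite ger0_norm ?subr_ge0//.
have d0 : 0 <= a - b by rewrite subr_ge0.
apply: le_trans (lg_sq d0).
have l0 : 0 <= lg a - lg b by rewrite subr_ge0 lg_mono.
rewrite lerXn2r ?nnegrE ?lg_ge0// -ler_expR (expR_lg d0) expRD expRN !expR_lg//.
by rewrite ler_pdivrMr; nra.
Qed.

Lemma lg_lip a b : 0 <= a -> 0 <= b -> `|lg a - lg b| <= `|a - b|.
Proof.
wlog ba : a b / b <= a.
  move=> H a0 b0; have [h|h] := leP b a; first exact: H.
  by rewrite distrC (distrC a); apply: H => //; exact: ltW.
by move=> a0 b0; rewrite !ger0_norm ?subr_ge0 ?lg_mono//; exact: lg_le1.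
Qed.

Lemma lg_prod_ge a b : 0 <= a -> 0 <= b -> (lg a - lg b) ^+ 2 <= (lg a - lg b) * (a - b).
Proof.
wlog ba : a b / b <= a.
  move=> H a0 b0; have [h|h] := leP b a; first exact: H.
  by rewrite -sqrrN opprB -mulrNN !opprB; apply: H => //; exact: ltW.
move=> a0 b0; have := lg_le1 b0 ba; have := lg_mono b0 ba; nra.
Qed.

(** The reverse of the Lipschitz bound, with a loss 1 + max that reflects the degeneracy for large
    values. *)
Lemma lg_prod_low a b : 0 <= a -> 0 <= b ->
  (a - b) ^+ 2 <= (1 + Num.max a b) * ((lg a - lg b) * (a - b)).
Proof.
wlog ba : a b / b <= a.
  move=> H a0 b0; case/orP: (le_total b a) => h; first exact: H.
  rewrite -sqrrN opprB maxC (_ : (lg a - lg b) * (a - b) = (lg b - lg a) * (b - a)); last by ring.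
  exact: H.
move=> a0 b0; rewrite (max_idPl ba); have /andP[h _] := lg_diff b0 ba.
rewrite ler_pdivrMr in h; last by lra.
by rewrite mulrA expr2 (mulrC (1 + a)); apply: ler_wpM2r => //; lra.
Qed.

Lemma lg_prod_ge0 a b : 0 <= a -> 0 <= b -> 0 <= (lg a - lg b) * (a - b).
Proof. by move=> a0 b0; apply: le_trans (lg_prod_ge a0 b0); exact: sqr_ge0. Qed.

(** The entropy density: the primitive of [lg] that vanishes at 0. It is integrable for data in X
    ([in_X_Lp]). *)
Definition Phi a : R := (1 + a) * lg a - a.

Lemma Phi_convex a b : 0 <= a -> 0 <= b -> Phi b - Phi a <= lg b * (b - a).
Proof.
move=> a0 b0; rewrite /Phi.
suff : (1 + a) * (lg b - lg a) <= b - a by lra.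
have a1 : 0 < 1 + a by lra.
have [h|h] := leP a b.
  by have /andP[_ k] := lg_diff a0 h; rewrite ler_pdivlMr// in k; lra.
have /andP[k _] := lg_diff b0 (ltW h); rewrite ler_pdivrMr// in k; lra.
Qed.

Lemma Phi_ge0 a : 0 <= a -> 0 <= Phi a.
Proof. by move=> a0; have := Phi_convex a0 (lexx 0); rewrite /Phi lg0; lra. Qed.

(* Splits |a - b| between the two order-preserving parts a - lg a / 2 and lg a / 2. *)
Lemma lg_split a b : 0 <= a -> 0 <= b ->
  `|(a - 2^-1 * lg a) - (b - 2^-1 * lg b)| = `|a - b| - 2^-1 * `|lg a - lg b|.
Proof.
wlog ba : a b / b <= a.
  move=> H a0 b0; have [h|h] := leP b a; first exact: H.
  by rewrite distrC (distrC a) (distrC (lg a)); apply: H => //; exact: ltW.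
move=> a0 b0; have h1 := lg_mono b0 ba; have h2 := lg_le1 b0 ba.
by rewrite !ger0_norm; lra.
Qed.

Lemma lg_meas : mfun lg.
Proof. by apply: (measurableT_comp (@measurable_ln R)); apply: measurable_funD. Qed.

End log_facts.

(** * The scheme: contraction, entropy, energy and tails *)

Section scheme.
Context {R : realType}.
Local Notation mu := (@lebesgue_measure R).
Implicit Types (u v f g : R -> R) (h M : R).

Definition Lp u := L1 mu u /\ forall x, 0 <= u x.

Definition lgf u x := lg (u x).

Lemma lgf_meas u : mfun u -> mfun (lgf u).
Proof. by move=> mu'; apply: (measurableT_comp lg_meas). Qed.

Lemma lgf_L1 u : Lp u -> L1 mu (lgf u).
Proof.
move=> [u1 u0]; apply: (L1_le _ u1); first exact: lgf_meas (L1_meas u1).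
by move=> x; rewrite ger0_norm ?lg_ge0// lg_le.
Qed.

Lemma lgf_L12 u : Lp u -> L12 (lgf u).
Proof.
move=> hu; have l1 := lgf_L1 hu; split => //; have [u1 u0] := hu.
split; first exact: L1_meas l1.
apply: L1_le (L1Z 4 u1) _; first by apply: measurable_funX; exact: L1_meas l1.
by move=> x; rewrite ger0_norm ?sqr_ge0// lg_sq.
Qed.

Lemma lgf_I2 u : Lp u -> \int[mu]_x (lgf u x ^+ 2) <= 4 * \int[mu]_x u x.
Proof.
move=> hu; have [_ [_ l2]] := lgf_L12 hu; have [u1 u0] := hu.
by rewrite -I_Z//; apply: I_le => //; [exact: L1Z|move=> x; exact: lg_sq].
Qed.

(* One explicit Euler step of length h / 2 for u' + Lam_h log (1 + u) = 0. It preserves order and contracts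
   L^1 because both u - log (1 + u) / 2 and log (1 + u) increase with u. *)
Definition Sc h u x := u x - 2^-1 * (lgf u x - conv (pois h) (lgf u) x).

Lemma Sc_Lam h u x : 0 < h -> Sc h u x - u x = - (h / 2 * Lam h (lgf u) x).
Proof. by move=> h0; rewrite /Sc /Lam; field; nz. Qed.

Lemma Sc_Lp h u : 0 < h -> Lp u -> Lp (Sc h u).
Proof.
move=> h0 hu; have [u1 u0] := hu; have l1 := lgf_L1 hu; have kk := pois_kernel h0.
split; first by apply: L1B => //; apply: L1Z; apply: L1B => //; exact: conv_L1.
move=> x; rewrite /Sc /lgf; have := conv_ge0 kk x (fun y => lg_ge0 (u0 y)).
by have := lg_le (u0 x); have := u0 x; rewrite -/(lgf u); move: (conv _ _ _) (lg _) => a b; lra.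
Qed.

Lemma Sc_mass h u : 0 < h -> Lp u -> \int[mu]_x Sc h u x = \int[mu]_x u x.
Proof.
move=> h0 hu; have [u1 u0] := hu; have l1 := lgf_L1 hu; have kk := pois_kernel h0.
have c1 := conv_L1 kk l1.
by rewrite (I_B u1 (L1Z 2^-1 (L1B l1 c1))) (I_Z _ (L1B l1 c1)) (I_B l1 c1) (conv_I kk l1) subrr mulr0 subr0.
Qed.

Lemma Sc_contr h u v : 0 < h -> Lp u -> Lp v ->
  \int[mu]_x `|Sc h u x - Sc h v x| <= \int[mu]_x `|u x - v x|.
Proof.
move=> h0 hu hv; have [u1 u0] := hu; have [v1 v0] := hv.
have lu := lgf_L1 hu; have lv := lgf_L1 hv; have kk := pois_kernel h0.
have [s1 _] := Sc_Lp h0 hu; have [s2 _] := Sc_Lp h0 hv.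
have d := L1_abs (L1B lu lv); have cd := conv_L1 kk d; have uv := L1_abs (L1B u1 v1).
have -> : \int[mu]_x `|u x - v x| = \int[mu]_x (`|u x - v x| - 2^-1 * `|lgf u x - lgf v x| + 2^-1 * conv (pois h) (fun y => `|lgf u y - lgf v y|) x).
  rewrite (I_D (L1B uv (L1Z 2^-1 d)) (L1Z 2^-1 cd)) (I_B uv (L1Z 2^-1 d)) (I_Z 2^-1 d) (I_Z 2^-1 cd) (conv_I kk d).
  by rewrite subrK.
apply: I_le.
- exact: L1_abs (L1B s1 s2).
- exact: L1D (L1B uv (L1Z 2^-1 d)) (L1Z 2^-1 cd).
move=> x; rewrite -(lg_split (u0 x) (v0 x)).
have -> : Sc h u x - Sc h v x = ((u x - 2^-1 * lg (u x)) - (v x - 2^-1 * lg (v x))) + 2^-1 * conv (pois h) (fun y => lgf u y - lgf v y) x.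
  by rewrite (convB kk lu lv) /Sc /lgf; ring.
apply: le_trans (ler_normD _ _) _; rewrite lerD2l normrM ger0_norm// ler_pM2l//.
exact: (conv_abs kk x (L1B lu lv)).
Qed.

(** The step is monotone and fixes the constant M: u - lg u / 2 <= M - lg M / 2, and the average of
    lg u is at most lg M. *)
Lemma Sc_bnd h u M : 0 < h -> Lp u -> (forall x, u x <= M) -> forall x, Sc h u x <= M.
Proof.
move=> h0 hu uM x; have [u1 u0] := hu; have lu := lgf_L1 hu; have kk := pois_kernel h0.
have M0 : 0 <= M by exact: le_trans (u0 0) (uM 0).
have := conv_leM kk x lu (fun y => lg_mono (u0 y) (uM y)).
have := lg_le1 (u0 x) (uM x); have := lg_mono (u0 x) (uM x); have := uM x.
by rewrite /Sc /lgf; move: (conv _ _ _) (lg _) (lg M) => a b c; lra.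
Qed.

(** On the Fourier side lam^2 <= lam / h, because lam <= 1 / h. *)
Lemma Lam_sqr h v : 0 < h -> L12 v -> \int[mu]_x (Lam h v x ^+ 2) <= h^-1 * Eh h v v.
Proof.
move=> h0 hv; have P := @pi2_gt0 R.
have hl := Lam_L12 h0 hv.
have e := plancherel_sqr hl; rewrite (Eh_hart h0 hv hv).
rewrite mulrCA -ler_pdivrMl ?invr_gt0// invrK -e.
have l1 := lam_hart_L1 h0 hv hv; rewrite -(I_Z h^-1 l1).
apply: I_le; [by case: (L12_hart hl)|exact: L1Z|] => xi.
rewrite hart_Lam//; last exact: L12_1.
have -> : (lam h xi * hart v xi) ^+ 2 = lam h xi * (lam h xi * hart v xi * hart v xi) by ring.
apply: ler_wpM2r; last exact: lam_leV.
by rewrite -mulrA; apply: mulr_ge0; [exact: lam_ge0|rewrite -expr2 sqr_ge0].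
Qed.

Lemma Eh_le_L2 h v : 0 < h -> L12 v -> h * Eh h v v <= \int[mu]_x (v x ^+ 2).
Proof.
move=> h0 hv; have P := @pi2_gt0 R.
rewrite (Eh_hart h0 hv hv) mulrCA ler_pdivrMl// -(plancherel_sqr hv).
have l1 := lam_hart_L1 h0 hv hv; rewrite -(I_Z h l1).
apply: I_le; [exact: L1Z|by case: (L12_hart hv)|] => xi.
have -> : h * (lam h xi * hart v xi * hart v xi) = (lam h xi * h) * hart v xi ^+ 2 by ring.
rewrite ler_piMl ?sqr_ge0// -ler_pdivlMr// div1r; exact: lam_leV.
Qed.

Lemma scheme_arith (h I1 I2 E S : R) : 0 < h -> S <= h^-1 * E -> I1 = - (h / 2 * E) -> I2 <= (h / 2) ^+ 2 * S ->
  I1 + I2 <= - (h / 4 * E).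
Proof.
move=> h0 hS -> h2; have h20 : 0 <= (h / 2) ^+ 2 by exact: sqr_ge0.
have := ler_wpM2l h20 hS; have -> : (h / 2) ^+ 2 * (h^-1 * E) = h / 4 * E by field; nz.
by lra.
Qed.

Lemma dud_L1 h u : 0 < h -> Lp u ->
  [/\ L2 mu (fun x => Sc h u x - u x), L2 mu (fun x => lgf (Sc h u) x - lgf u x) &
      L1 mu (fun x => (lgf (Sc h u) x - lgf u x) * (Sc h u x - u x))].
Proof.
move=> h0 hu; have hs := Sc_Lp h0 hu.
have a : L2 mu (fun x => Sc h u x - u x).
  have [_ l2] := Lam_L12 h0 (lgf_L12 hu).
  have := L2Z (-1) (L2Z (h / 2) l2); congr L2; apply/funext => x; rewrite Sc_Lam//; ring.
have [_ b] := L12B (lgf_L12 hs) (lgf_L12 hu).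
by split => //; exact: L2_mul.
Qed.

Lemma Phi_arith (P Q la lb d : R) : Q - P <= lb * d -> Q <= P + (la * d + (lb - la) * d).
Proof. by move=> h; rewrite mulrBl; lra. Qed.

Lemma Usum_arith (s p q q' e : R) : s <= p - q -> q' <= q - e -> s + e <= p - q'.
Proof. lra. Qed.

Lemma Udiss_arith (a b e P : R) : 0 <= e -> b <= 2 * P -> 0 <= P -> 3 * a + e <= 2 * b -> a <= 4 * P.
Proof. lra. Qed.

Lemma Utail_arith (F A B C h r n : R) : F - B <= F - A + n * (h / 2) / r * F ->
  B - h / 2 / r * F <= C -> F - C <= F - A + (n + 1) * (h / 2) / r * F.
Proof. by rewrite !mulrDl mul1r; lra. Qed.

(** [Phi_convex] bounds the change of entropy by lg (new) times the increment, that is lg (old)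
    times the increment plus an Euler error. The first part is - h / 2 times the energy; the error
    is at most (h / 2)^2 int Lam^2, hence at most h / 4 times the energy. Half of the dissipation is
    left. *)
Lemma Sc_Phi h u : 0 < h -> Lp u -> L1 mu (fun x => Phi (u x)) ->
  L1 mu (fun x => Phi (Sc h u x)) /\
  \int[mu]_x Phi (Sc h u x) <= \int[mu]_x Phi (u x) - h / 4 * Eh2 h (lgf u).
Proof.
move=> h0 hu hP; have hs := Sc_Lp h0 hu; have [s1 s0] := hs; have [u1 u0] := hu.
have lw := lgf_L12 hu; have [a b c] := dud_L1 h0 hu.
have d : L1 mu (fun x => lgf u x * (Sc h u x - u x)) := L2_mul (L12_2 lw) a.
have E x : Phi (Sc h u x) <= Phi (u x) + (lgf u x * (Sc h u x - u x) + (lgf (Sc h u) x - lgf u x) * (Sc h u x - u x)).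
  exact: Phi_arith (Phi_convex (u0 x) (s0 x)).
have mP : mfun (fun x => Phi (Sc h u x)).
  have ms := L1_meas s1; apply: measurable_funB => //; apply: measurable_funM; first exact: measurable_funD.
  exact: lgf_meas ms.
have LL := L1D hP (L1D d c).
have P1 : L1 mu (fun x => Phi (Sc h u x)).
  apply: (@L1_le _ _ _ mu (fun x => Phi (Sc h u x)) _ mP LL) => x; rewrite ger0_norm; [exact: E|exact: Phi_ge0].
split => //; apply: le_trans (I_le P1 LL E) _.
rewrite (I_D hP (L1D d c)) (I_D d c) lerD2l.
have [ll1 ll2] := Lam_L12 h0 lw.
apply: (@scheme_arith _ _ _ _ (\int[mu]_x (Lam h (lgf u) x ^+ 2))) => //.
- exact: Lam_sqr.
- have l12 := L2_mul ll2 (L12_2 lw).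
  rewrite /Eh -(I_Z (h / 2) l12) -(I_N (L1Z (h / 2) l12)); apply: I_ext => x.
  by rewrite Sc_Lam//; ring.
- have [_ ls] := ll2; rewrite -(I_Z _ ls); apply: I_le => //; first exact: L1Z.
  move=> x; have -> : (h / 2) ^+ 2 * Lam h (lgf u) x ^+ 2 = (Sc h u x - u x) ^+ 2 by rewrite Sc_Lam//; ring.
  have := lg_lip (s0 x) (u0 x); rewrite -/(lgf u x) -/(lgf (Sc h u) x) => k.
  apply: le_trans (ler_norm _) _; rewrite normrM -[leRHS]real_normK ?num_real// expr2.
  by apply: ler_wpM2r.
Qed.

Lemma diss_arith (h E E' D X d : R) : 0 < h -> E' = E + 2 * X + d -> h * X = - (2 * D) -> h * d <= D -> 3 * D <= h * (E - E').
Proof. by move=> h0 -> hX hd; rewrite !mulrDr mulrN mulrDr mulrDr mulrCA hX; lra. Qed.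

(** Let D be the integral on the left and dw the increment of the logarithm. The new energy is the
    old one plus 2 Eh (w, dw) + Eh (dw, dw); here h Eh (w, dw) = - 2 D by the definition of the
    step, and h Eh (dw, dw) <= int dw^2 <= D. *)
Lemma Sc_energy h u : 0 < h -> Lp u ->
  3 * \int[mu]_x ((lgf (Sc h u) x - lgf u x) * (Sc h u x - u x)) <=
  h * (Eh2 h (lgf u) - Eh2 h (lgf (Sc h u))).
Proof.
move=> h0 hu; have hs := Sc_Lp h0 hu; have [s1 s0] := hs; have [u1 u0] := hu.
have lw := lgf_L12 hu; have ls := lgf_L12 hs; have [a b c] := dud_L1 h0 hu.
have ld := L12B ls lw.
have [ll1 ll2] := Lam_L12 h0 lw.
pose dw x := lgf (Sc h u) x - lgf u x.
apply: (@diss_arith _ _ _ _ (Eh h (lgf u) dw) (Eh h dw dw)) => //.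
- rewrite (Eh_hart h0 ls ls) (Eh_hart h0 lw lw) (Eh_hart h0 lw ld) (Eh_hart h0 ld ld).
  have a1 := lam_hart_L1 h0 lw lw; have a2 := lam_hart_L1 h0 lw ld; have a3 := lam_hart_L1 h0 ld ld.
  have -> (p x y z : R) : p * x + 2 * (p * y) + p * z = p * (x + 2 * y + z) by ring.
  congr (_ * _); rewrite -(I_Z 2 a2) -(I_D a1 (L1Z 2 a2)) -(I_D (L1D a1 (L1Z 2 a2)) a3).
  by apply: I_ext => xi; rewrite /dw hartB; [ring|exact: L12_1|exact: L12_1].
- have l12 := L2_mul ll2 b.
  rewrite /Eh -(I_Z h l12) -(I_Z 2 c) -(I_N (L1Z 2 c)); apply: I_ext => x.
  by rewrite Sc_Lam// /dw; field.
- apply: le_trans (Eh_le_L2 h0 ld) _; apply: I_le => //; first by case: b.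
  by move=> x; exact: lg_prod_ge.
Qed.

(* The weight q_R(x) = R^2/(R^2+x^2) = pi R p_R(x). *)
Definition wt (r x : R) := pi * r * pois r x.

Lemma wt_ge0 r x : 0 < r -> 0 <= wt r x.
Proof. by move=> r0; rewrite mulr_ge0 ?pois_ge0// mulr_ge0 ?ltW// pi_gt0'. Qed.

Lemma wt_le1 r x : 0 < r -> wt r x <= 1. Proof. exact: pois_le1. Qed.

Lemma wt_meas r : 0 < r -> mfun (wt r).
Proof. by move=> r0; apply: measurable_funM => //; exact: pois_meas. Qed.

Lemma wt_L1 r v : 0 < r -> L1 mu v -> L1 mu (fun x => v x * wt r x).
Proof.
move=> r0 hv; apply: (bmul_L1 hv (wt_meas r0) (M := 1)) => x.
by rewrite ger0_norm ?wt_ge0// wt_le1.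
Qed.

(** Self-adjointness moves P_h onto the weight, and P_h maps [wt r] to pi r times the kernel at
    height h + r. By [pois_diff] the weight changes by at most h / r, and log (1 + u) <= u. *)
Lemma Sc_tail h r u : 0 < h -> 0 < r -> Lp u ->
  \int[mu]_x (u x * wt r x) - h / 2 / r * \int[mu]_x u x <= \int[mu]_x (Sc h u x * wt r x).
Proof.
move=> h0 r0 hu; have [u1 u0] := hu; have [s1 s0] := Sc_Lp h0 hu.
have lu := lgf_L1 hu; have kk := pois_kernel h0; have cu := conv_L1 kk lu.
have w1 := wt_L1 r0 u1; have w2 := wt_L1 r0 lu; have w3 := wt_L1 r0 cu.
have P := @pi_gt0' R.
have pr : 0 < pi * r by rewrite mulr_gt0.
have E : \int[mu]_x (Sc h u x * wt r x) = \int[mu]_x (u x * wt r x) -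
   2^-1 * (\int[mu]_x (lgf u x * wt r x) - \int[mu]_x (conv (pois h) (lgf u) x * wt r x)).
  rewrite -(I_B w2 w3) -(I_Z 2^-1 (L1B w2 w3)) -(I_B w1 (L1Z 2^-1 (L1B w2 w3))).
  by apply: I_ext => x; rewrite /Sc; ring.
rewrite E lerD2l lerN2.
have kr := pois_kernel r0.
have [_ e2] : L1 mu (fun x => conv (pois h) (lgf u) x * wt r x) /\ \int[mu]_x (conv (pois h) (lgf u) x * wt r x) = \int[mu]_y (lgf u y * \int[mu]_x (pois h (x - y) * wt r x)).
  apply: (conv_dual kk (M := 1) lu (wt_meas r0)) => x.
  by rewrite ger0_norm ?wt_ge0// wt_le1.
have inner y : \int[mu]_x (pois h (x - y) * wt r x) = pi * r * pois (h + r) y.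
  rewrite -conv_pois// -(I_Z (pi * r) (kernel_mul_L1 kk y (kernel_L1 kr))).
  by apply: I_ext => x; rewrite (kernel_sym kk) /wt; ring.
have l4 : L1 mu (fun y => lgf u y * (pi * r * pois (h + r) y)).
  have hr : 0 < h + r by rewrite addr_gt0.
  apply: (bmul_L1 lu (M := pi * r * (pi * (h + r))^-1)).
    by apply: measurable_funM => //; exact: pois_meas.
  move=> y; rewrite ger0_norm; last by apply: mulr_ge0; [exact: ltW|exact: pois_ge0].
    by apply: ler_wpM2l; [exact: ltW|exact: pois_le].
rewrite e2 (@I_ext _ _ _ mu (fun y => lgf u y * \int[mu]_x (pois h (x - y) * wt r x)) (fun y => lgf u y * (pi * r * pois (h + r) y))); last by move=> y; congr (_ * _); exact: inner.
rewrite -(I_B w2 l4) -(I_Z 2^-1 (L1B w2 l4)) -(I_Z _ u1).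
apply: I_le; [exact: L1Z (L1B w2 l4)|exact: L1Z|] => x.
have := pois_diff x r0 h0; rewrite (addrC r h) => hd.
have -> : 2^-1 * (lgf u x * wt r x - lgf u x * (pi * r * pois (h + r) x)) = 2^-1 * (lgf u x * (pi * r * (pois r x - pois (h + r) x))).
  by rewrite /wt; ring.
have -> : h / 2 / r * u x = 2^-1 * (u x * (h / r)) by ring.
rewrite ler_pM2l//; apply: le_trans (ler_norm _) _; rewrite normrM.
apply: ler_pM => //; first by rewrite ger0_norm ?lg_ge0// lg_le.
rewrite normrM (gtr0_norm pr); apply: le_trans (ler_wpM2l (ltW pr) hd) _.
rewrite mulrCA ler_piMr ?divr_ge0 ?(ltW h0) ?(ltW r0)//; exact: pois_le1.
Qed.

Definition U h f n := iter n (Sc h) f.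

Lemma US h f n : U h f n.+1 = Sc h (U h f n). Proof. by []. Qed.

Section iterates.
Variables (h : R) (f : R -> R).
Hypotheses (h0 : 0 < h) (hf : Lp f).
Local Notation w n := (lgf (U h f n)).

Lemma U_Lp n : Lp (U h f n).
Proof. by elim: n => [//|n ih]; rewrite US; exact: Sc_Lp. Qed.

Lemma U_mass n : \int[mu]_x U h f n x = \int[mu]_x f x.
Proof. by elim: n => [//|n ih]; rewrite US Sc_mass//; exact: U_Lp. Qed.

Lemma U_bnd M n : (forall x, f x <= M) -> forall x, U h f n x <= M.
Proof. by move=> fM; elim: n => [//|n ih]; rewrite US; apply: Sc_bnd => //; exact: U_Lp. Qed.

Lemma U_Phi n : L1 mu (fun x => Phi (f x)) -> L1 mu (fun x => Phi (U h f n x)) /\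
  \sum_(k < n) (h / 4 * Eh2 h (w k)) <= \int[mu]_x Phi (f x) - \int[mu]_x Phi (U h f n x).
Proof.
move=> fP; elim: n => [|n [ih1 ih2]]; first by split => //; rewrite big_ord0 subrr.
have [a b] := Sc_Phi h0 (U_Lp n) ih1; split => //.
by rewrite big_ord_recr /=; exact: (Usum_arith ih2 b).
Qed.

Lemma U_sum n : L1 mu (fun x => Phi (f x)) ->
  \sum_(k < n) (h / 2 * Eh2 h (w k)) <= 2 * \int[mu]_x Phi (f x).
Proof.
move=> fP; have [a b] := U_Phi n fP.
have : 0 <= \int[mu]_x Phi (U h f n x) by apply: I_ge0 => x; apply: Phi_ge0; have [] := U_Lp n.
have -> : \sum_(k < n) (h / 2 * Eh2 h (w k)) = 2 * \sum_(k < n) (h / 4 * Eh2 h (w k)).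
  by rewrite mulr_sumr; apply: eq_bigr => k _; field.
by move: b; lra.
Qed.

Definition diss n := \int[mu]_x ((w n.+1 x - w n x) * (U h f n.+1 x - U h f n x)).

Lemma diss_ge0 n : 0 <= diss n.
Proof. by apply: I_ge0 => x; apply: lg_prod_ge0; [have [] := U_Lp n.+1|have [] := U_Lp n]. Qed.

Lemma U_dissE n : 3 * diss n <= h * (Eh2 h (w n) - Eh2 h (w n.+1)).
Proof. exact: Sc_energy (U_Lp n). Qed.

Lemma U_Emono n : Eh2 h (w n.+1) <= Eh2 h (w n).
Proof.
have e := U_dissE n; have d := diss_ge0 n.
by rewrite -subr_ge0 -(pmulr_rge0 _ h0); apply: le_trans e; rewrite mulr_ge0.
Qed.

Lemma U_Ele m n : (m <= n)%N -> Eh2 h (w n) <= Eh2 h (w m).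
Proof.
move=> mn; rewrite -(subnK mn); elim: (n - m)%N => [//|k ih].
by rewrite addSn; apply: le_trans ih; exact: U_Emono.
Qed.

(** The energies decrease along the scheme, so n + 1 times the last one is at most their sum. *)
Lemma U_Ebnd n : L1 mu (fun x => Phi (f x)) ->
  n.+1%:R * (h / 2) * Eh2 h (w n) <= 2 * \int[mu]_x Phi (f x).
Proof.
move=> fP; apply: le_trans (U_sum n.+1 fP).
rewrite -[n.+1 in leLHS]card_ord -mulrA mulr_natl -sumr_const.
by apply: ler_sum => k _; rewrite ler_pM2l ?divr_gt0//; apply: U_Ele; rewrite -ltnS.
Qed.

(** Abel summation of [U_dissE] with weights k + 1: the discrete form of a bound on the space-time
    integral of t u_t^2 / (1 + u). *)
Lemma U_diss n : L1 mu (fun x => Phi (f x)) ->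
  \sum_(k < n) (k.+1%:R * diss k) <= 4 * \int[mu]_x Phi (f x).
Proof.
move=> fP; have s := U_sum n.+1 fP.
(* The term with n times the last energy is the boundary term of the summation; keeping it makes the
   induction close. *)
suff : 3 * \sum_(k < n) (k.+1%:R * diss k) + n%:R * (h * Eh2 h (w n)) <= 2 * \sum_(k < n) (h / 2 * Eh2 h (w k)).
  have e0 : 0 <= n%:R * (h * Eh2 h (w n)).
    by apply: mulr_ge0 => //; apply: mulr_ge0; [exact: ltW|apply: Eh_ge0 => //; apply: lgf_L12; exact: U_Lp].
  have s' := U_sum n fP.
  have P0 : 0 <= \int[mu]_x Phi (f x) by apply: I_ge0 => x; apply: Phi_ge0; have [] := hf.
  exact: (Udiss_arith e0 s' P0).
elim: n {s} => [|n ih]; first by rewrite !big_ord0 !mulr0 mul0r addr0.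
rewrite !big_ord_recr /=; have := U_dissE n; move: ih.
rewrite -(natr1 n) -[w n.+1]/(lgf (U h f n.+1)).
move: (\sum_(_ < _) _) (\sum_(_ < _) _) (Eh2 h (w n)) (Eh2 h (w n.+1)) (diss n) => a b e e' d ih hd.
have n0 : (0 : R) <= n%:R + 1 by rewrite addr_ge0.
have := ler_wpM2l n0 hd; nra.
Qed.

Lemma U_tail r n : 0 < r ->
  \int[mu]_x (U h f n x * (1 - wt r x)) <= \int[mu]_x (f x * (1 - wt r x)) + n%:R * (h / 2) / r * \int[mu]_x f x.
Proof.
move=> r0.
have E m : \int[mu]_x (U h f m x * (1 - wt r x)) = \int[mu]_x f x - \int[mu]_x (U h f m x * wt r x).
  have [u1 _] := U_Lp m; rewrite -(U_mass m) -(I_B u1 (wt_L1 r0 u1)).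
  by apply: I_ext => x; ring.
have := E 0%N; rewrite -[U h f 0]/f => ->; rewrite E.
elim: n => [|n ih]; first by rewrite !mul0r addr0.
have h1 := Sc_tail h0 r0 (U_Lp n); rewrite (U_mass n) -US in h1.
by rewrite -natr1; exact: (Utail_arith ih h1).
Qed.

Lemma U_contr g n : Lp g -> \int[mu]_x `|U h f n x - U h g n x| <= \int[mu]_x `|f x - g x|.
Proof.
move=> hg; have Ug m : Lp (U h g m) by elim: m => [//|m ih]; rewrite US; exact: Sc_Lp.
elim: n => [//|n ih]; apply: le_trans ih; rewrite !US; apply: Sc_contr => //; exact: U_Lp.
Qed.

Lemma U_step1 n : \int[mu]_x `|U h f n.+1 x - U h f n x| <= \int[mu]_x `|Sc h f x - f x|.
Proof.
elim: n => [//|n ih]; apply: le_trans ih; rewrite !US.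
by apply: Sc_contr => //; [exact: Sc_Lp (U_Lp n)|exact: U_Lp].
Qed.

Lemma U_step m n : \int[mu]_x `|U h f (m + n) x - U h f n x| <= m%:R * \int[mu]_x `|Sc h f x - f x|.
Proof.
elim: m => [|m ih].
  by rewrite mul0r I_zero// => x; rewrite subrr normr0.
have [a1 _] := U_Lp (m + n); have [a2 _] := U_Lp (m + n).+1; have [a3 _] := U_Lp n.
have b1 := L1_abs (L1B a2 a1); have b2 := L1_abs (L1B a1 a3).
rewrite addSn -natr1 mulrDl mul1r addrC.
apply: le_trans (lerD (U_step1 (m + n)) ih); rewrite -(I_D b1 b2).
apply: I_le; [exact: L1_abs (L1B a2 a3)|exact: L1D|] => x.
by apply: le_trans (ler_normD _ _); rewrite addrA subrK.
Qed.

End iterates.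

(* Data for which the scheme is Lipschitz in time, uniformly in h. *)
Definition nice (f : R -> R) (L : R) := [/\ Lp f, exists M, forall x, f x <= M &
  forall h, 0 < h -> \int[mu]_x `|Sc h f x - f x| <= h / 2 * L].

(** The datum is prescribed through its logarithm, log (1 + f) = P_a g. One step then changes f by
    (P_(a+h) g - P_a g) / 2, which [pois_diff] bounds by h / (2 a) times P_a g. *)
Lemma nice_exp (g : R -> R) (a M : R) : 0 < a -> L1 mu g -> (forall x, 0 <= g x <= M) ->
  exists2 f, nice f (a^-1 * \int[mu]_x g x) & forall x, f x = expR (conv (pois a) g x) - 1.
Proof.
move=> a0 hg gM; pose G := conv (pois a) g; exists (fun x => expR (G x) - 1) => //.
have ka := pois_kernel a0; have G1 : L1 mu G := conv_L1 ka hg.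
have g0 x : 0 <= g x by have /andP[] := gM x.
have G0 x : 0 <= G x by exact: conv_ge0.
have GM x : G x <= M by apply: (conv_leM ka x hg) => y; have /andP[] := gM y.
have f0 x : 0 <= expR (G x) - 1 by have := expR_ge1Dx (G x); have := G0 x; lra.
have lf : lgf (fun x => expR (G x) - 1) = G.
  by apply/funext => x; rewrite /lgf /lg addrC subrK expRK.
have hfL : Lp (fun x => expR (G x) - 1).
  split => //; apply: L1_le (L1Z (expR M) G1) _.
    apply: measurable_funB => //; apply: measurableT_comp (L1_meas G1); exact: measurable_expR.
  move=> x; rewrite ger0_norm//.
  have := expR_ge1Dx (- G x); rewrite expRN => h1.
  have e0 := expR_gt0 (G x).
  have : expR (G x) * (1 - G x) <= 1 by rewrite -ler_pdivlMl// mulr1.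
  have eM : expR (G x) <= expR M by rewrite ler_expR.
  have := ler_wpM2r (G0 x) eM; lra.
split => //.
  by exists (expR M) => x; have : expR (G x) <= expR M; [rewrite ler_expR|lra].
move=> h h0; have kh := pois_kernel h0; have kah := pois_kernel (addr_gt0 a0 h0).
have E x : Sc h (fun x => expR (G x) - 1) x - (expR (G x) - 1) = 2^-1 * conv (fun z => pois (a + h) z - pois a z) g x.
  rewrite /Sc lf /G (conv_conv x h0 a0 hg) (addrC h a).
  have -> : conv (fun z => pois (a + h) z - pois a z) g x = conv (pois (a + h)) g x - conv (pois a) g x.
    rewrite /conv -(I_B (kernel_mul_L1 kah x hg) (kernel_mul_L1 ka x hg)); apply: I_ext => y; ring.
  by ring.
rewrite (I_to (fun x => 2^-1 * `|conv (fun z => pois (a + h) z - pois a z) g x|)); last first.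
  by move=> x; rewrite E normrM ger0_norm.
have D1 : L1 mu (fun x => conv (fun z => pois (a + h) z - pois a z) g x).
  apply: L1_ext (L1B (conv_L1 kah hg) G1) => x.
  rewrite /G /conv -(I_B (kernel_mul_L1 kah x hg) (kernel_mul_L1 ka x hg)); apply: I_ext => y; ring.
rewrite (I_Z _ (L1_abs D1)).
have -> : h / 2 * (a^-1 * \int[mu]_x g x) = 2^-1 * (h / a * \int[mu]_x g x) by ring.
rewrite ler_pM2l// -(conv_I ka hg) -(I_Z _ G1).
apply: I_le; [exact: L1_abs|exact: L1Z|] => x.
have k1 := kernel_mul_L1 ka x hg; have k2 := kernel_mul_L1 kah x hg.
rewrite /G /conv -(I_Z _ k1); apply: I_abs_le; [|exact: L1Z|].
  by apply: L1_ext (L1B k2 k1) => y; ring.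
move=> y; rewrite normrM (ger0_norm (g0 y)) mulrA; apply: ler_wpM2r => //.
by rewrite distrC; exact: pois_diff.
Qed.

End scheme.
(** * Comparison of two time steps *)

Section cauchy_algebra.
Context {R : realType}.
Implicit Types (A B r Z : nat -> R) (l m t k c e : R).

(** One time step at one frequency: [a], [b] are the transforms of the two logarithms, [s], [q]
    their running sums, [l] and [m] the symbols of the fine and the coarse step, [r] the time
    elapsed since the last coarse update. A running sum times its increment is half a difference of
    squares, up to squares of increments; what does not telescope is the term in (l - m) s b. *)
Lemma step_alg (l m t k a b s q r : R) : 0 <= m -> m <= l -> 0 <= t -> 0 <= r -> r <= k ->
  (- (t * (l * s - m * q)) - r * m * b) * (a - b) <=
  (t + k * 2) * (l * a ^+ 2 + m * b ^+ 2) + t * ((l - m) * (s * b))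
   - t / 2 * (m * ((s - q + (a - b)) ^+ 2 - (s - q) ^+ 2)) - t / 2 * ((l - m) * ((s + a) ^+ 2 - s ^+ 2)).
Proof.
move=> m0 ml t0 r0 rk; rewrite -subr_ge0.
have -> : (t + k * 2) * (l * a ^+ 2 + m * b ^+ 2) + t * ((l - m) * (s * b))
   - t / 2 * (m * ((s - q + (a - b)) ^+ 2 - (s - q) ^+ 2)) - t / 2 * ((l - m) * ((s + a) ^+ 2 - s ^+ 2))
   - (- (t * (l * s - m * q)) - r * m * b) * (a - b) =
   t / 2 * ((l - m) * a ^+ 2 + m * (a + b) ^+ 2)
   + k * 2 * ((l - m) * a ^+ 2) + m * ((k - r) * 2 * (a ^+ 2 + b ^+ 2) + r * (2 * a ^+ 2 + a * b + b ^+ 2)).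
  by field.
have lm : 0 <= l - m by rewrite subr_ge0.
have k0 : 0 <= k by exact: le_trans rk.
have q1 : 0 <= 2 * a ^+ 2 + a * b + b ^+ 2.
  have := sqr_ge0 (a + b / 2); have := sqr_ge0 a; have := sqr_ge0 b.
  have -> : (a + b / 2) ^+ 2 = a ^+ 2 + a * b + b ^+ 2 / 4 by field.
  lra.
have a0 := sqr_ge0 a; have b0 := sqr_ge0 b; have ab0 := sqr_ge0 (a + b).
have kr : 0 <= k - r by rewrite subr_ge0.
by repeat first [done | apply: addr_ge0 | apply: mulr_ge0].
Qed.

(** The telescoped squares carry a favourable sign and are dropped at the end. *)
Lemma sum_alg A B r Z l m t k N : 0 <= m -> m <= l -> 0 <= t -> (forall n, 0 <= r n <= k) ->
  (forall n, Z n = - (t * (l * \sum_(j < n) A j - m * \sum_(j < n) B j)) - r n * m * B n) ->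
  \sum_(n < N) Z n * (A n - B n) <= (t + k * 2) * \sum_(n < N) (l * A n ^+ 2 + m * B n ^+ 2)
    + t * \sum_(n < N) ((l - m) * ((\sum_(j < n) A j) * B n)).
Proof.
move=> m0 ml t0 hr hZ.
pose s n := \sum_(j < n) A j; pose q n := \sum_(j < n) B j.
suff : \sum_(n < N) Z n * (A n - B n) <= (t + k * 2) * \sum_(n < N) (l * A n ^+ 2 + m * B n ^+ 2)
    + t * \sum_(n < N) ((l - m) * (s n * B n)) - t / 2 * (m * (s N - q N) ^+ 2) - t / 2 * ((l - m) * s N ^+ 2).
  move=> h; apply: le_trans h _.
  have lm : 0 <= l - m by rewrite subr_ge0.
  have x0 : 0 <= t / 2 * (m * (s N - q N) ^+ 2) by rewrite mulr_ge0 ?divr_ge0// mulr_ge0 ?sqr_ge0.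
  have y0 : 0 <= t / 2 * ((l - m) * s N ^+ 2) by rewrite mulr_ge0 ?divr_ge0// mulr_ge0 ?sqr_ge0.
  by rewrite -addrA gerDl -opprD oppr_le0 addr_ge0.
elim: N => [|N ih].
  by rewrite !big_ord0 /s /q !big_ord0 subrr expr0n/= !mulr0 !subr0 addr0.
rewrite !big_ord_recr /=.
have /andP[r0 rk] := hr N.
have := step_alg (A N) (B N) (s N) (q N) m0 ml t0 r0 rk.
rewrite -/(s N) -/(q N) [s N.+1]big_ord_recr [q N.+1]big_ord_recr /= -/(s N) -/(q N) hZ -/(s N) -/(q N).
have -> : s N + A N - (q N + B N) = s N - q N + (A N - B N) by ring.
move: ih; rewrite !mulrDr.
move: (\sum_(_ < _) _) (\sum_(_ < _) _) (\sum_(_ < _) _) => x y z; move: (s N) (q N) => S Q.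
move: (A N) (B N) => a b; move: (r N) => w; clear; rewrite !mulrDl; lra.
Qed.

(** Two regimes for the term left by [sum_alg]. Where the symbols differ by at most [c], that factor
    is used. Where [m] is large, [V] = t l s, in the application the transform of the datum minus
    the fine solution, is bounded in L^2, and b is absorbed by m b^2. *)
Lemma cross_alg A B l m t c e n V : 0 <= m -> m <= l -> 0 <= t -> 0 <= c -> 0 < e ->
  (l - m <= c \/ 1 <= 2 * e ^+ 2 * m) -> V = t * (l * \sum_(j < n) A j) ->
  t * ((l - m) * ((\sum_(j < n) A j) * B n)) <=
  c * t / 2 * (\sum_(j < n) A j ^+ 2 + n%:R * B n ^+ 2) + e * (V ^+ 2 + m * B n ^+ 2).
Proof.
move=> m0 ml t0 c0 e0 cas hV; set s := \sum_(j < n) A j; set b := B n.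
have lm : 0 <= l - m by rewrite subr_ge0.
have Q0 : 0 <= \sum_(j < n) A j ^+ 2 by apply: sumr_ge0 => j _; exact: sqr_ge0.
have b0 := sqr_ge0 b; have V0 := sqr_ge0 V.
have sb : s * b <= 2^-1 * (\sum_(j < n) A j ^+ 2 + n%:R * b ^+ 2).
  have -> : n%:R * b ^+ 2 = \sum_(j < n) b ^+ 2 by rewrite sumr_const card_ord mulr_natl.
  rewrite -big_split /= mulr_sumr mulr_suml; apply: ler_sum => j _.
  have := sqr_ge0 (A j - b); nra.
have nb : 0 <= n%:R * b ^+ 2 by rewrite mulr_ge0.
case: cas => h.
  have e1 : 0 <= e * (V ^+ 2 + m * b ^+ 2) by rewrite mulr_ge0 ?(ltW e0)// addr_ge0// mulr_ge0.
  suff : t * ((l - m) * (s * b)) <= c * t / 2 * (\sum_(j < n) A j ^+ 2 + n%:R * b ^+ 2) by lra.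
  have -> : c * t / 2 * (\sum_(j < n) A j ^+ 2 + n%:R * b ^+ 2) = t * (c * (2^-1 * (\sum_(j < n) A j ^+ 2 + n%:R * b ^+ 2))) by field.
  apply: ler_wpM2l => //.
  apply: le_trans (ler_wpM2l lm sb) _.
  by apply: ler_wpM2r => //; rewrite mulr_ge0// addr_ge0.
have e1 : 0 <= c * t / 2 * (\sum_(j < n) A j ^+ 2 + n%:R * b ^+ 2).
  by rewrite mulr_ge0 ?addr_ge0// divr_ge0// mulr_ge0.
suff : t * ((l - m) * (s * b)) <= e * (V ^+ 2 + m * b ^+ 2) by lra.
have l0 : 0 < l.
  have : 0 < m; last by move=> h2; exact: lt_le_trans ml.
  rewrite lt0r m0 andbT; apply/negP => /eqP mz; move: h; rewrite mz mulr0; lra.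
pose th := (l - m) / l.
have th01 : 0 <= th <= 1 by rewrite divr_ge0 ?(ltW l0)//= ler_pdivrMr// mul1r gerBl.
have -> : t * ((l - m) * (s * b)) = th * (V * b) by rewrite hV /th -/s; field; nz.
have Vb : `|V * b| <= e * (V ^+ 2 + m * b ^+ 2).
  have h1 : b ^+ 2 <= 2 * e ^+ 2 * m * b ^+ 2 by rewrite ler_peMl.
  have e2 : 0 < 2 * e by rewrite mulr_gt0.
  have k (x : R) : x * b <= e * (x ^+ 2 + m * b ^+ 2).
    rewrite -(ler_pM2l e2); have := sqr_ge0 (e * x - b).
    have -> : (e * x - b) ^+ 2 = e ^+ 2 * x ^+ 2 - 2 * e * (x * b) + b ^+ 2 by ring.
    have -> : 2 * e * (e * (x ^+ 2 + m * b ^+ 2)) = 2 * (e ^+ 2 * x ^+ 2) + 2 * e ^+ 2 * m * b ^+ 2 by ring.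
    have : 0 <= e ^+ 2 * x ^+ 2 by rewrite mulr_ge0 ?sqr_ge0.
    lra.
  by rewrite ler_norml (k V) andbT -[V ^+ 2]sqrrN lerNl -mulNr k.
apply: le_trans (ler_norm _) _; rewrite normrM; apply: le_trans Vb.
by have /andP[t1 t2] := th01; rewrite ger0_norm// ler_piMl.
Qed.

Lemma total_alg A B r Z V l m t k c e N : 0 <= m -> m <= l -> 0 <= t -> 0 <= c -> 0 < e ->
  (forall n, 0 <= r n <= k) ->
  (l - m <= c \/ 1 <= 2 * e ^+ 2 * m) ->
  (forall n, V n = t * (l * \sum_(j < n) A j)) ->
  (forall n, Z n = - (t * (l * \sum_(j < n) A j - m * \sum_(j < n) B j)) - r n * m * B n) ->
  \sum_(n < N) Z n * (A n - B n) <= (t + k * 2) * \sum_(n < N) (l * A n ^+ 2 + m * B n ^+ 2)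
    + c * t / 2 * (N%:R * \sum_(n < N) (A n ^+ 2 + B n ^+ 2))
    + e * \sum_(n < N) (V n ^+ 2 + m * B n ^+ 2).
Proof.
move=> m0 ml t0 c0 e0 hr cas hV hZ; apply: le_trans (sum_alg N m0 ml t0 hr hZ) _.
rewrite -addrA lerD2l mulr_sumr.
apply: (@le_trans _ _ (\sum_(n < N) (c * t / 2 * (\sum_(j < n) A j ^+ 2 + n%:R * B n ^+ 2) + e * (V n ^+ 2 + m * B n ^+ 2)))).
  by apply: ler_sum => n _; exact: cross_alg.
rewrite big_split /= -mulr_sumr -mulr_sumr lerD2r; apply: ler_wpM2l.
  by rewrite divr_ge0// mulr_ge0.
rewrite big_split /= [X in _ <= _ * X]big_split /= mulrDr; apply: lerD.
  have -> : N%:R * \sum_(n < N) A n ^+ 2 = \sum_(n < N) \sum_(j < N) A j ^+ 2.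
    by rewrite sumr_const card_ord mulr_natl.
  apply: ler_sum => n _.
  rewrite (big_ord_widen N (fun j => A j ^+ 2)) ?(ltnW (ltn_ord n))// big_mkcond /=.
  by apply: ler_sum => j _; case: ifP => // _; exact: sqr_ge0.
rewrite mulr_sumr; apply: ler_sum => n _; apply: ler_wpM2r; first exact: sqr_ge0.
by rewrite ler_nat ltnW.
Qed.

Lemma scal_arith (w S X Y T' N x y z : R) : 0 <= w -> S <= X * x + Y * (N * y) + T' * z ->
  w * S <= X * (w * x) + Y * (N * (w * y)) + T' * (w * z).
Proof.
move=> w0 h; apply: le_trans (ler_wpM2l w0 h) _.
by rewrite le_eqVlt; apply/orP; left; apply/eqP; ring.
Qed.

End cauchy_algebra.
#[global] Opaque pi.

(** * The comparison of two steps on the Fourier side *)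

Section cauchy.
Context {R : realType}.
Local Notation mu := (@lebesgue_measure R).
Implicit Types (f g : R -> R).

Lemma hart_Sc h f xi : 0 < h -> Lp f ->
  hart (Sc h f) xi = hart f xi - h / 2 * (lam h xi * hart (lgf f) xi).
Proof.
move=> h0 hf; have [f1 _] := hf; have lw := lgf_L12 hf; have [l1 _] := Lam_L12 h0 lw.
rewrite (@hart_ext _ _ (fun x => f x - h / 2 * Lam h (lgf f) x)); last first.
  by move=> x; have := Sc_Lam f x h0; move: (Sc _ _ _) => s; lra.
by rewrite hartB ?hartZ ?hart_Lam//; [exact: L12_1|exact: L1Z].
Qed.

Lemma hart_U h f n xi : 0 < h -> Lp f ->
  hart (U h f n) xi = hart f xi - h / 2 * (lam h xi * \sum_(j < n) hart (lgf (U h f j)) xi).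
Proof.
move=> h0 hf; elim: n => [|n ih]; first by rewrite big_ord0 !mulr0 subr0.
by rewrite US hart_Sc//; [rewrite ih big_ord_recr /=; ring|exact: U_Lp].
Qed.

(** The coarse solution is held constant on blocks of [p] fine steps: full blocks, and the one just
    started. The latter is the source of [r] in [ZE]. *)
Lemma sum_divn p n (F : nat -> R) : (0 < p)%N ->
  \sum_(j < n) F (j %/ p)%N = p%:R * (\sum_(j < n %/ p) F j) + (n %% p)%:R * F (n %/ p)%N.
Proof.
move=> p0; elim: n => [|n ih]; first by rewrite div0n mod0n !big_ord0 mulr0 mul0r addr0.
rewrite big_ord_recr /= ih.
case: (boolP (p %| n.+1)%N) => hd.
  have e1 : (n.+1 %/ p = (n %/ p).+1)%N by rewrite divnS// hd.
  have e2 : (n %% p).+1 = p.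
    apply/eqP; rewrite eqn_leq (ltn_pmod n p0) /=.
    by apply: dvdn_leq => //; move: hd; rewrite {1}(divn_eq n p) -addnS dvdn_addr// dvdn_mull.
  have e3 : (n.+1 %% p = 0)%N by apply/eqP.
  rewrite e1 e3 mul0r addr0 big_ord_recr /= mulrDr -addrA; congr (_ + _).
  have e4 : (n %% p)%:R + 1 = p%:R :> R by rewrite natr1 e2.
  by rewrite -e4 mulrDl mul1r.
have e1 : (n.+1 %/ p = n %/ p)%N by rewrite divnS// (negbTE hd).
have e2 : (n.+1 %% p = (n %% p).+1)%N.
  by apply: (@addnI (n %/ p * p)%N); rewrite addnS -(divn_eq n p) -{1}e1 -(divn_eq n.+1 p).
by rewrite e1 e2 -natr1 -addrA mulrDl mul1r.
Qed.

Lemma scalar_I_D (u v : R -> R) (c x y : R) : L1 mu u -> L1 mu v -> c * \int[mu]_xi u xi = x -> c * \int[mu]_xi v xi = y ->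
  x + y = c * \int[mu]_xi (u xi + v xi).
Proof. by move=> hu hv <- <-; rewrite I_D// mulrDr. Qed.

Lemma Eh_sq_hart h v : 0 < h -> L12 v -> L1 mu (fun xi => lam h xi * hart v xi ^+ 2) /\
  (2 * pi)^-1 * \int[mu]_xi (lam h xi * hart v xi ^+ 2) = Eh h v v.
Proof.
move=> h0 lw; rewrite (Eh_hart h0 lw lw).
have l1 := lam_hart_L1 h0 lw lw; split; first by apply: L1_ext l1 => xi; rewrite expr2 mulrA.
by congr (_ * _); apply: I_ext => xi; rewrite expr2 mulrA.
Qed.

Section estimate.
Variables (i l : nat) (f : R -> R) (M : R).
Hypotheses (li : (l <= i)%N) (hf : Lp f) (fM : forall x, f x <= M) (fP : L1 mu (fun x => Phi (f x))).

Let p := (2 ^ (i - l))%N.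

Let h : R := dy i.

Let k : R := dy l.

Local Notation t := (h / 2).

Let a n := U h f n.

Let b n := U k f (n %/ p)%N.

Let P := \int[mu]_x Phi (f x).

Let m := \int[mu]_x f x.

Let h0 : 0 < h. Proof. exact: dy_gt0. Qed.

Let k0 : 0 < k. Proof. exact: dy_gt0. Qed.

Let p0 : (0 < p)%N. Proof. by rewrite expn_gt0. Qed.

Let kE : k = p%:R * h.
Proof.
rewrite /k /h /p /dy -{2}(subnK li) exprD mulrA natrX -exprMn mulfV// expr1n mul1r//.
Qed.

Let ha n : Lp (a n). Proof. exact: U_Lp. Qed.

Let hb n : Lp (b n). Proof. exact: U_Lp. Qed.

Let aM n x : a n x <= M. Proof. exact: U_bnd. Qed.

Let bM n x : b n x <= M. Proof. exact: U_bnd. Qed.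

Let M0 : 0 <= M. Proof. by have [_ f0] := hf; exact: le_trans (f0 0) (fM 0). Qed.

Let Lpb_L12 g : Lp g -> (forall x, g x <= M) -> L12 g.
Proof. by move=> [g1 g0] gM; apply: (L12_bounded g1 (M := M)) => x; rewrite ger0_norm. Qed.

Let A n := hart (lgf (a n)).

Let B n := hart (lgf (b n)).

Let Z n xi := hart (a n) xi - hart (b n) xi.

Let V n xi := hart f xi - hart (a n) xi.

Let r n := (n %% p)%:R * t.

Let hr n : 0 <= r n <= k / 2.
Proof.
apply/andP; split; first by rewrite /r mulr_ge0// divr_ge0// ltW.
rewrite /r kE -mulrA ler_wpM2r ?divr_ge0 ?(ltW h0)// ler_nat ltnW// ltn_pmod//.
Qed.

Let VE n xi : V n xi = t * (lam h xi * \sum_(j < n) A j xi).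
Proof. by rewrite /V /a hart_U// /A /a opprB addrC subrK. Qed.

Let ZE n xi : Z n xi = - (t * (lam h xi * \sum_(j < n) A j xi - lam k xi * \sum_(j < n) B j xi)) - r n * lam k xi * B n xi.
Proof.
rewrite /Z /a /b (hart_U n xi h0 hf) (hart_U (n %/ p) xi k0 hf).
have -> : \sum_(j < n) B j xi = p%:R * (\sum_(j < n %/ p) hart (lgf (U k f j)) xi) + (n %% p)%:R * B n xi.
  by rewrite -(sum_divn n (fun j => hart (lgf (U k f j)) xi) p0).
have kt : k / 2 = p%:R * t by rewrite kE mulrA.
rewrite kt /r /A /a; move: (hart f xi) (lam h xi) (lam k xi) (B n xi) t p%:R (n %% p)%:R => F lh lk Bn tt pp rr.
by move: (\sum_(_ < _) _) => x; move: (\sum_(_ < _) _) => y; ring.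
Qed.

(* Strict monotonicity of the logarithm turns a bound on this pairing into an L^1 bound on a - b. *)
Definition pairint (n : nat) := \int[mu]_x ((a n x - b n x) * (lgf (a n) x - lgf (b n) x)).

Let pairE n : pairint n = (2 * pi)^-1 * \int[mu]_xi (Z n xi * (A n xi - B n xi)).
Proof.
have ab := L12B (Lpb_L12 (ha n) (aM n)) (Lpb_L12 (hb n) (bM n)).
have ww := L12B (lgf_L12 (ha n)) (lgf_L12 (hb n)).
have [ab1 ab2] := ab; have [ww1 ww2] := ww.
apply: mulVK_eq; first exact: pi2_gt0.
rewrite -(plancherel ab1 ab2 ww1 ww2); apply: I_ext => xi.
have [a1 _] := ha n; have [b1 _] := hb n.
rewrite (hartB xi a1 b1) (hartB xi (lgf_L1 (ha n)) (lgf_L1 (hb n))) //.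
Qed.

Let Z_L1 n : L1 mu (fun xi => Z n xi * (A n xi - B n xi)).
Proof.
have [a1 _] := ha n; have [b1 _] := hb n.
have x1 := L12_hart (L12B (Lpb_L12 (ha n) (aM n)) (Lpb_L12 (hb n) (bM n))).
have x2 := L12_hart (L12B (lgf_L12 (ha n)) (lgf_L12 (hb n))).
apply: L1_ext (L2_mul x1 x2) => xi.
by rewrite (hartB xi a1 b1) (hartB xi (lgf_L1 (ha n)) (lgf_L1 (hb n))).
Qed.

Let AE n : L1 mu (fun xi => lam h xi * A n xi ^+ 2) /\ (2 * pi)^-1 * \int[mu]_xi (lam h xi * A n xi ^+ 2) = Eh2 h (lgf (a n)).
Proof. exact: Eh_sq_hart (lgf_L12 (ha n)). Qed.

Let BE n : L1 mu (fun xi => lam k xi * B n xi ^+ 2) /\ (2 * pi)^-1 * \int[mu]_xi (lam k xi * B n xi ^+ 2) = Eh2 k (lgf (b n)).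
Proof. exact: Eh_sq_hart (lgf_L12 (hb n)). Qed.

Let sq_hart v : L12 v -> L1 mu (fun xi => hart v xi ^+ 2) /\ (2 * pi)^-1 * \int[mu]_xi (hart v xi ^+ 2) = \int[mu]_x (v x ^+ 2).
Proof.
move=> hv; split; first by case: (L12_hart hv).
by apply/esym; apply: mulVK_eq; [exact: pi2_gt0|exact: plancherel_sqr].
Qed.

Lemma pair_le N (e : R) : 0 < e -> k <= e ^+ 2 / 2 ->
  \sum_(n < N) pairint n <= (t + k) * \sum_(n < N) (Eh2 h (lgf (a n)) + Eh2 k (lgf (b n)))
   + k / e ^+ 4 * t / 2 * (N%:R * \sum_(n < N) (\int[mu]_x (lgf (a n) x ^+ 2) + \int[mu]_x (lgf (b n) x ^+ 2)))
   + e * \sum_(n < N) (\int[mu]_x ((f x - a n x) ^+ 2) + Eh2 k (lgf (b n))).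
Proof.
move=> e0 ke; have e2 : 0 < e ^+ 2 by rewrite exprn_gt0.
have PI := @pi2_gt0 R.
have e4 : 0 < e ^+ 4 by rewrite exprn_gt0.
have VL n : L12 (fun x => f x - a n x) := L12B (Lpb_L12 hf fM) (Lpb_L12 (ha n) (aM n)).
have VH n xi : V n xi = hart (fun x => f x - a n x) xi.
  by have [f1 _] := hf; have [a1 _] := ha n; rewrite hartB.
pose FA (n : nat) xi := lam h xi * A n xi ^+ 2 + lam k xi * B n xi ^+ 2.
pose FB (n : nat) xi := A n xi ^+ 2 + B n xi ^+ 2.
pose FC (n : nat) xi := V n xi ^+ 2 + lam k xi * B n xi ^+ 2.
have LA n : L1 mu (FA n) := L1D (AE n).1 (BE n).1.
have [qa qb] : (forall n, L1 mu (fun xi => A n xi ^+ 2)) /\ (forall n, L1 mu (fun xi => B n xi ^+ 2)).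
  by split => n; [have [] := sq_hart (lgf_L12 (ha n))|have [] := sq_hart (lgf_L12 (hb n))].
have LB n : L1 mu (FB n) := L1D (qa n) (qb n).
have LV n : L1 mu (fun xi => V n xi ^+ 2) by have [h1 _] := sq_hart (VL n); apply: L1_ext h1 => xi; rewrite VH.
have LC n : L1 mu (FC n) := L1D (LV n) (BE n).1.
have PT xi : \sum_(n < N) Z n xi * (A n xi - B n xi) <=
   (t + k) * \sum_(n < N) FA n xi + k / e ^+ 4 * t / 2 * (N%:R * \sum_(n < N) FB n xi) + e * \sum_(n < N) FC n xi.
  have -> : t + k = t + k / 2 * 2 by field.
  apply: (@total_alg _ (fun n => A n xi) (fun n => B n xi) r (fun n => Z n xi) (fun n => V n xi) (lam h xi) (lam k xi)) => //.
  - exact: lam_ge0.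
  - exact: lam_mono.
  - by rewrite divr_ge0// ltW.
  - by rewrite divr_ge0// ltW.
  (* Frequencies are split at e^-2. Below it, [lam_sub] bounds the difference of the symbols by k /
     e^4. Above it, monotonicity of the symbol and k <= e^2 / 2 give lam k xi >= e^-2 / 2. *)
  - have [hx|hx] := leP (`|xi|) (e ^+ 2)^-1.
      left; apply: le_trans (lerB (lam_le xi h0) (lexx _)) _.
      apply: le_trans (lam_sub xi k0) _; rewrite ler_pM2l//.
      have -> : (e ^+ 4)^-1 = (e ^+ 2)^-1 ^+ 2 by rewrite exprVn -exprM.
      by rewrite -(real_normK (num_real xi)) lerXn2r ?nnegrE ?invr_ge0 ?(ltW e2).
    right.
    have mono : lam k (e ^+ 2)^-1 <= lam k xi.
      rewrite /lam ler_pM2r ?invr_gt0// lerD2l lerN2 /eabs ler_expR lerN2 ler_pM2l//.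
      by rewrite ger0_norm ?invr_ge0 ?(ltW e2)// ltW.
    have ee : 0 < (e ^+ 2)^-1 by rewrite invr_gt0.
    have := lam_sub ((e ^+ 2)^-1) k0; rewrite ger0_norm ?(ltW ee)// => ls.
    have : k * (e ^+ 2)^-1 ^+ 2 <= (e ^+ 2)^-1 / 2.
      rewrite expr2 mulrA (mulrC (_^-1) 2^-1) ler_pM2r// ler_pdivrMr// mulrC; lra.
    move=> kk; have : (e ^+ 2)^-1 / 2 <= lam k xi by lra.
    by rewrite -[(e ^+ 2)^-1 / 2]invfM -[X in X <= _]mul1r ler_pdivrMr ?mulr_gt0// mulrC (mulrC 2).
have SA := L1_sum (index_enum 'I_N) (fun n : 'I_N => LA n).
have SB := L1_sum (index_enum 'I_N) (fun n : 'I_N => LB n).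
have SC := L1_sum (index_enum 'I_N) (fun n : 'I_N => LC n).
have TA := L1Z (t + k) SA; have TB := L1Z (k / e ^+ 4 * t / 2) (L1Z N%:R SB); have TC := L1Z e SC.
have := I_le (L1_sum (index_enum 'I_N) (fun n : 'I_N => Z_L1 n)) (L1D (L1D TA TB) TC) PT.
rewrite (I_sum _ (fun n : 'I_N => Z_L1 n)) (I_D (L1D TA TB) TC) (I_D TA TB).
rewrite (I_Z _ SA) (I_Z _ (L1Z N%:R SB)) (I_Z _ SB) (I_Z _ SC).
rewrite (I_sum _ (fun n : 'I_N => LA n)) (I_sum _ (fun n : 'I_N => LB n)) (I_sum _ (fun n : 'I_N => LC n)).
move=> H.
have sE (F G : nat -> R) : (forall n, F n = (2 * pi)^-1 * G n) -> \sum_(n < N) F n = (2 * pi)^-1 * \sum_(n < N) G n.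
  by move=> FG; rewrite mulr_sumr; apply: eq_bigr => n _; exact: FG.
rewrite (sE _ _ pairE).
rewrite (sE (fun n => Eh2 h (lgf (a n)) + Eh2 k (lgf (b n))) (fun n => \int[mu]_xi FA n xi)); last first.
  by move=> n; exact: scalar_I_D (AE n).1 (BE n).1 (AE n).2 (BE n).2.
rewrite (sE (fun n => \int[mu]_x (lgf (a n) x ^+ 2) + \int[mu]_x (lgf (b n) x ^+ 2)) (fun n => \int[mu]_xi FB n xi)); last first.
  by move=> n; exact: scalar_I_D (qa n) (qb n) (sq_hart (lgf_L12 (ha n))).2 (sq_hart (lgf_L12 (hb n))).2.
rewrite (sE (fun n => \int[mu]_x ((f x - a n x) ^+ 2) + Eh2 k (lgf (b n))) (fun n => \int[mu]_xi FC n xi)); last first.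
  move=> n; rewrite (I_D (LV n) (BE n).1) mulrDr (BE n).2 -(sq_hart (VL n)).2; congr (_ * _ + _).
  by apply: I_ext => xi; rewrite VH.
by apply: scal_arith H; rewrite invr_ge0 ltW.
Qed.

End estimate.
End cauchy.
Section cauchy_arith.
Context {R : realType}.

Lemma Qarith (t k e T P m M N Q S1 S2 S3 S4 S5 : R) : 0 < t -> t <= k -> 0 < e -> 0 <= m -> 0 <= M -> 0 <= P -> 0 <= N ->
  N * t <= T ->
  Q <= (t + k) * (S1 + S2) + k / e ^+ 4 * t / 2 * (N * (S3 + S4)) + e * (S5 + S2) ->
  t * S1 <= 2 * P -> t * S2 <= 2 * P -> S3 <= N * (4 * m) -> S4 <= N * (4 * m) -> S5 <= N * (2 * M * m) ->
  t * Q <= 8 * k * P + 4 * k * m * T ^+ 2 / e ^+ 4 + e * (2 * M * m * T + 2 * P).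
Proof.
move=> t0 tk e0 m0 M0 P0 N0 NT hQ h1 h2 h3 h4 h5.
have k0 : 0 < k by exact: lt_le_trans tk.
have c0 : 0 <= k / e ^+ 4 by rewrite divr_ge0 ?exprn_ge0// ltW.
apply: le_trans (ler_wpM2l (ltW t0) hQ) _.
have -> : t * ((t + k) * (S1 + S2) + k / e ^+ 4 * t / 2 * (N * (S3 + S4)) + e * (S5 + S2)) =
  (t + k) * (t * S1 + t * S2) + k / e ^+ 4 * ((N * t) * (t * (S3 + S4) / 2)) + e * (t * S5 + t * S2) by field; nz.
apply: lerD; first apply: lerD.
- have tk0 : 0 <= t + k by lra.
  have h : t * S1 + t * S2 <= 4 * P by lra.
  apply: le_trans (ler_wpM2l tk0 h) _; have : t * P <= k * P by rewrite ler_wpM2r.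
  lra.
- have -> : 4 * k * m * T ^+ 2 / e ^+ 4 = k / e ^+ 4 * (T * (4 * m * T)) by field; nz.
  apply: ler_wpM2l => //.
  have Nt0 : 0 <= N * t by rewrite mulr_ge0// ltW.
  have s : t * (S3 + S4) / 2 <= 4 * m * (N * t).
    have : S3 + S4 <= N * (8 * m) by lra.
    move=> /(ler_wpM2l (ltW t0)); lra.
  have s2 : 4 * m * (N * t) <= 4 * m * T by rewrite ler_wpM2l// mulr_ge0.
  apply: (@le_trans _ _ (N * t * (4 * m * T))); first by apply: ler_wpM2l => //; exact: le_trans s2.
  by apply: ler_wpM2r => //; apply: le_trans s2; rewrite mulr_ge0// mulr_ge0.
- apply: ler_wpM2l; first exact: ltW.
  apply: lerD => //; apply: le_trans (ler_wpM2l (ltW t0) h5) _.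
  have -> : t * (N * (2 * M * m)) = 2 * M * m * (N * t) by ring.
  by apply: ler_wpM2l => //; repeat first [done | apply: mulr_ge0].
Qed.

Lemma sub_sum (F : nat -> R) n q K : (forall n, 0 <= F n) -> (n + q <= K)%N ->
  \sum_(j < q) F (n + j)%N <= \sum_(j < K) F j.
Proof.
move=> F0 h; rewrite -(big_mkord xpredT F) (@big_cat_nat _ _ _ (n + q)) //=.
rewrite (@big_cat_nat _ _ _ n 0 (n + q)) ?leq_addr//=.
have -> : \sum_(j < q) F (n + j)%N = \sum_(n <= j < n + q) F j.
  rewrite -{1}[n in RHS]add0n big_addn addKn big_mkord.
  by apply: eq_bigr => j _; rewrite addnC.
have a0 : 0 <= \sum_(0 <= j < n) F j by apply: sumr_ge0.
have b0 : 0 <= \sum_(n + q <= j < K) F j by apply: sumr_ge0.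
lra.
Qed.

Lemma sum_div_le p N (F : nat -> R) : (0 < p)%N -> \sum_(n < (p * N)%N) F (n %/ p)%N = p%:R * \sum_(n < N) F n.
Proof. by move=> p0; rewrite sum_divn// mulKn// modnMr mul0r addr0. Qed.

Lemma small_arith (k C K e : R) : 0 <= k -> 0 < C -> 0 < K + 1 -> k <= e / (8 * C * (K + 1)) ->
  C * (k * K) <= e / 8.
Proof.
move=> k0 C0 K1; rewrite ler_pdivlMr ?mulr_gt0// => h.
by have := mulr_ge0 k0 (ltW C0); lra.
Qed.

Lemma wstep_arith (x y z k D : R) : x = k / 2 -> y <= D -> z <= y + x -> 0 <= k -> k <= D -> z <= 2 * D.
Proof. lra. Qed.

Lemma Te_arith (T e : R) : 0 < e -> T * e <= e / 2 * (2 * (T + 1)).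
Proof. by move=> e0; rewrite (_ : e / 2 * _ = T * e + e); [lra|field]. Qed.

Lemma eighths (e x y : R) : 0 < e -> x <= e / 8 -> y <= e / 8 -> x + y <= e / 2.
Proof. lra. Qed.

Lemma tri_a (A B C D : R) : `|A - B| <= `|C - D| + (`|C - A| + `|D - B|).
Proof.
have -> : A - B = (C - D) + (- (C - A) + (D - B)) by ring.
by apply: le_trans (ler_normD _ _) _; rewrite lerD2l; apply: le_trans (ler_normD _ _) _; rewrite normrN.
Qed.

Lemma tri_b (A B C D : R) : `|A - B| <= `|A - C| + `|C - D| + `|B - D|.
Proof.
have -> : A - B = (A - C) + (C - D) - (B - D) by ring.
by apply: le_trans (ler_normB _ _) _; rewrite lerD2r; exact: ler_normD.
Qed.

End cauchy_arith.

(** * The Cauchy property of the scheme in L^1 *)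

Section cauchy2.
Context {R : realType}.
Local Notation mu := (@lebesgue_measure R).
Implicit Types (f g : R -> R).

Lemma Phi_bnd_L1 f M : Lp f -> (forall x, f x <= M) -> L1 mu (fun x => Phi (f x)).
Proof.
move=> [f1 f0] fM; have mf := L1_meas f1.
have M0 : 0 <= M by exact: le_trans (f0 0) (fM 0).
apply: (@L1_le _ _ _ mu (fun x => Phi (f x)) (fun x => M * f x) _ (L1Z M f1)).
  by apply: measurable_funB => //; apply: measurable_funM; [exact: measurable_funD|exact: lgf_meas].
move=> x; rewrite ger0_norm ?Phi_ge0// /Phi.
have l0 := lg_ge0 (f0 x); have l1 := lg_le (f0 x).
have := ler_wpM2r (f0 x) (fM x); have := ler_wpM2l (f0 x) l1; lra.
Qed.

(** A majorant, uniform in the step, for the weighted mass near infinity of all iterates up to time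
    [T] ([U_tailw]). *)
Definition tailw f (T r : R) := \int[mu]_x (f x * (1 - wt r x)) + T / r * \int[mu]_x f x.

Lemma wt_cvg x : wt n.+1%:R x @[n --> \oo] --> (1 : R).
Proof.
have E n : wt n.+1%:R x = 1 - x ^+ 2 / (n.+1%:R ^+ 2 + x ^+ 2).
  by rewrite -(@DwE R n.+1%:R x) // /Dw /wt opprB addrC subrK.
apply: (@cvg_le _ _ _ _ _ (fun n => x ^+ 2 * hn n)).
  move=> n; rewrite E addrAC subrr sub0r normrN ger0_norm; last by rewrite divr_ge0 ?sqr_ge0// ltW// pois_den.
  rewrite ler_wpM2l ?sqr_ge0// /hn lef_pV2 ?posrE//; last exact: pois_den.
  have := sqr_ge0 x; have : n.+1%:R <= n.+1%:R ^+ 2 :> R by rewrite expr2 ler_peMl// ler1n.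
  lra.
by apply: cvg0_Zl; exact: hn_cvg.
Qed.

Lemma tailw_cvg f T : Lp f -> tailw f T n.+1%:R @[n --> \oo] --> (0 : R).
Proof.
move=> [f1 f0]; rewrite -[X in _ --> X](addr0 0); apply: cvgD.
  have [] := @DCT _ _ _ mu (fun n x => f x * (1 - wt n.+1%:R x)) (fun=> 0) f.
  - move=> n; apply: measurable_funM; first exact: L1_meas f1.
    by apply: measurable_funB => //; exact: wt_meas.
  - exact: measurable_cst.
  - apply: aeW => x; apply: cvg0_Zl.
    by rewrite -(subrr 1); apply: cvgB; [exact: cvg_cst|exact: wt_cvg].
  - exact: f1.
  - move=> n x; have a := @wt_ge0 R n.+1%:R x (ltr0Sn _ _); have b := @wt_le1 R n.+1%:R x (ltr0Sn _ _).
    rewrite ger0_norm; last by rewrite mulr_ge0// subr_ge0.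
    by rewrite ler_piMr// gerBl.
  by rewrite I_0.
have E : (fun n : nat => T / n.+1%:R * \int[mu]_x f x) = (fun n => T * \int[mu]_x f x * hn n).
  by apply/funext => n; rewrite /hn; ring.
rewrite E; apply: cvg0_Zl; exact: hn_cvg.
Qed.

Lemma U_tailw h f T r n : 0 < h -> 0 < r -> Lp f -> n%:R * (h / 2) <= T ->
  \int[mu]_x (U h f n x * (1 - wt r x)) <= tailw f T r.
Proof.
move=> h0 r0 hf hT; apply: le_trans (U_tail h0 hf n r0) _; rewrite lerD2l.
apply: ler_wpM2r; first by apply: I_ge0 => x; have [_] := hf.
by rewrite ler_pM2r// invr_gt0.
Qed.

(* |z| is split by AM-GM on [-r, r] and by the weight outside. *)
Lemma L1_split_le a b (r d M : R) : 0 < r -> 0 < d -> Lp a -> Lp b -> (forall x, a x <= M) -> (forall x, b x <= M) ->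
  \int[mu]_x `|a x - b x| <= (1 + M) / (4 * d) * \int[mu]_x ((a x - b x) * (lgf a x - lgf b x)) + 2 * r * d
    + 2 * (\int[mu]_x (a x * (1 - wt r x)) + \int[mu]_x (b x * (1 - wt r x))).
Proof.
move=> r0 d0 ha hb aM bM; have [a1 a0] := ha; have [b1 b0] := hb.
have M0 : 0 <= M by exact: le_trans (a0 0) (aM 0).
have bd g : Lp g -> (forall x, g x <= M) -> L2 mu g.
  by move=> [g1 g0] gM; apply: (L2_bounded g1 (M := M)) => x; rewrite ger0_norm.
have l1 := L2_mul (L2B (bd _ ha aM) (bd _ hb bM)) (L12_2 (L12B (lgf_L12 ha) (lgf_L12 hb))).
have w1 g : Lp g -> L1 mu (fun x => g x * (1 - wt r x)).
  by move=> [g1 _]; apply: L1_ext (L1B g1 (wt_L1 r0 g1)) => x; ring.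
have i1 := indic_itv_L1 r.
have J := L1D (L1D (L1Z ((1 + M) / (4 * d)) l1) (L1Z d i1)) (L1Z 2 (L1D (w1 _ ha) (w1 _ hb))).
have -> : 2 * r * d = d * (2 * r) by ring.
rewrite -(indic_itv_I (ltW r0)).
rewrite -(I_D (w1 _ ha) (w1 _ hb)) -(I_Z 2 (L1D (w1 _ ha) (w1 _ hb))) -(I_Z _ l1) -(I_Z d i1).
rewrite -(I_D (L1Z ((1 + M) / (4 * d)) l1) (L1Z d i1)) -(I_D (L1D (L1Z ((1 + M) / (4 * d)) l1) (L1Z d i1)) (L1Z 2 (L1D (w1 _ ha) (w1 _ hb)))).
apply: I_le; [exact: L1_abs (L1B a1 b1)|exact: J|] => x.
have c0 : 0 <= (1 + M) / (4 * d) by rewrite divr_ge0 ?addr_ge0// mulr_ge0// ltW.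
have p0 := lg_prod_ge0 (a0 x) (b0 x); rewrite mulrC in p0.
have w0 := @wt_ge0 R r x r0; have w1' := @wt_le1 R r x r0.
rewrite indic_itv; have [hx|hx] := leP (`|x|) r.
  have q0 : 0 <= 2 * (a x * (1 - wt r x) + b x * (1 - wt r x)).
    by rewrite mulr_ge0// addr_ge0// mulr_ge0// subr_ge0.
  suff : `|a x - b x| <= (1 + M) / (4 * d) * ((a x - b x) * (lgf a x - lgf b x)) + d by rewrite mulr1; lra.
  have low := lg_prod_low (a0 x) (b0 x).
  have mM : Num.max (a x) (b x) <= M by rewrite ge_max aM bM.
  have h2 : (a x - b x) ^+ 2 <= (1 + M) * ((a x - b x) * (lgf a x - lgf b x)).
    apply: le_trans low _; rewrite [X in _ * X]mulrC; apply: ler_wpM2r => //; lra.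
  have -> : (1 + M) / (4 * d) * ((a x - b x) * (lgf a x - lgf b x)) = ((1 + M) * ((a x - b x) * (lgf a x - lgf b x))) / (4 * d) by ring.
  have d4 : 0 < 4 * d by rewrite mulr_gt0.
  rewrite -lerBlDr ler_pdivlMr//; apply: le_trans h2.
  rewrite -(real_normK (num_real (a x - b x))); have := sqr_ge0 (`|a x - b x| - 2 * d).
  move: (`|a x - b x|) => z; rewrite sqrrB; lra.
rewrite mulr0 addr0.
have T0 := mulr_ge0 c0 p0.
suff : `|a x - b x| <= 2 * (a x * (1 - wt r x) + b x * (1 - wt r x)) by move: T0; rewrite /lgf; lra.
have hw := pois_tail r0 (ltW hx); rewrite -/(wt r x) in hw.
have h1 := ler_wpM2l (a0 x) hw; have h2 := ler_wpM2l (b0 x) hw.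
apply: le_trans (ler_normB _ _) _; rewrite !ger0_norm//; lra.
Qed.

Section levels.
Variables (f : R -> R) (M : R).
Hypotheses (hf : Lp f) (fM : forall x, f x <= M).

(** Mass, entropy and the bound [M] of the datum control every sum in [pair_le], whatever the finer
    step. *)
Lemma Q_le (i l N : nat) (T e m P : R) : m = \int[mu]_x f x -> P = \int[mu]_x Phi (f x) -> (l <= i)%N -> 0 < e -> dy l <= e ^+ 2 / 2 -> N%:R * (dy l / 2) <= T ->
  dy i / 2 * \sum_(n < (2 ^ (i - l) * N)%N) pairint i l f n <=
  8 * dy l * P + 4 * dy l * m * T ^+ 2 / e ^+ 4 + e * (2 * M * m * T + 2 * P).
Proof.
move=> mE PE li e0 ke NT; have [f1 f0] := hf.
have fP := Phi_bnd_L1 hf fM.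
have M0 : 0 <= M by exact: le_trans (f0 0) (fM 0).
have h0 := @dy_gt0 R i; have k0 := @dy_gt0 R l.
have p0 : (0 < 2 ^ (i - l))%N by rewrite expn_gt0.
have kE := @dy_pow R _ _ li.
set p := (2 ^ (i - l))%N in p0 kE *.
have H := pair_le li hf fM (p * N) e0 ke.
rewrite !big_split /= in H.
have Nt : (p * N)%:R * (dy i / 2) = N%:R * (dy l / 2) :> R by rewrite kE natrM; ring.
have cst (c : R) K : \sum_(n < K) c = K%:R * c by rewrite sumr_const card_ord mulr_natl.
apply: (Qarith _ _ e0 _ M0 _ _ _ H) => //.
- by rewrite divr_gt0.
- by have := @dy_mono R _ _ li; have := h0; lra.
- by rewrite mE; apply: I_ge0.
- by rewrite PE; apply: I_ge0 => x; exact: Phi_ge0.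
- by rewrite Nt.
- by have := U_sum h0 hf (p * N) fP; rewrite -mulr_sumr -PE.
- have := U_sum k0 hf N fP; rewrite -mulr_sumr -PE; apply: le_trans.
  rewrite (sum_div_le N (fun n => Eh2 (dy l) (lgf (U (dy l) f n))) p0).
  by rewrite kE; move: (\sum_(_ < _) _) => s; rewrite le_eqVlt; apply/orP; left; apply/eqP; ring.
- rewrite -(cst (4 * m)); apply: ler_sum => n _; apply: le_trans (lgf_I2 (U_Lp h0 hf n)) _.
  by rewrite (U_mass h0 hf) mE.
- rewrite -(cst (4 * m)); apply: ler_sum => n _; apply: le_trans (lgf_I2 (U_Lp k0 hf _)) _.
  by rewrite (U_mass k0 hf) mE.
- rewrite -(cst (2 * M * m)); apply: ler_sum => n _; have [a1 a0] := U_Lp h0 hf n.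
  have aM := U_bnd h0 hf n fM.
  have bd g : L1 mu g -> (forall x, 0 <= g x) -> (forall x, g x <= M) -> L2 mu g.
    by move=> g1 g0 gM; apply: (L2_bounded g1 (M := M)) => x; rewrite ger0_norm.
  have [_ d2] := L2B (bd f f1 f0 fM) (bd _ a1 a0 aM).
  have -> : 2 * M * m = M * (\int[mu]_x f x + \int[mu]_x U (dy i) f n x).
    by rewrite (U_mass h0 hf) mE; ring.
  rewrite -(I_D f1 a1) -(I_Z M (L1D f1 a1)); apply: I_le => //; first exact: L1Z (L1D f1 a1).
  move=> x; have := f0 x; have := a0 x; have := fM x; have := aM x.
  by move: (f x) (U _ _ _ x) => y z; nra.
Qed.

(** Order of the constants: the radius [r] makes the tails small; [d] makes 2 r d small in
    [L1_split_le], at the price of the factor [C]; the frequency parameter [s] is small against [C];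
    the level comes last, because [K] contains s^-4. *)
Lemma L1sum_small (T e : R) : 0 < e -> 0 <= T -> exists L0 : nat, forall l i N : nat, (L0 <= l)%N -> (l <= i)%N ->
  N%:R * (dy l / 2) <= T ->
  dy i / 2 * \sum_(n < (2 ^ (i - l) * N)%N) \int[mu]_x `|U (dy i) f n x - U (dy l) f (n %/ 2 ^ (i - l))%N x| <= e.
Proof.
move=> e0 T0; have [f1 f0] := hf.
have M0 : 0 <= M by exact: le_trans (f0 0) (fM 0).
pose m := \int[mu]_x f x; pose P := \int[mu]_x Phi (f x).
have m0 : 0 <= m by apply: I_ge0.
have P0 : 0 <= P by apply: I_ge0 => x; exact: Phi_ge0.
have M1 : 0 < 1 + M by rewrite ltr_pwDl.
have T1 : 0 < T + 1 by rewrite ltr_wpDl.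
have eT : 0 < e / (16 * (T + 1)) by rewrite divr_gt0// mulr_gt0.
have /cvg0P /(_ _ eT) [r' hr] := tailw_cvg T hf.
have {}hr : tailw f T r'.+1%:R <= e / (16 * (T + 1)) by apply: le_trans (hr r' (leqnn _)); exact: ler_norm.
pose r : R := r'.+1%:R; have r0 : 0 < r by [].
pose d := e / (8 * r * (T + 1)); have d0 : 0 < d by rewrite divr_gt0// !mulr_gt0.
pose C := (1 + M) / (4 * d); have C0 : 0 < C by apply: divr_gt0 => //; apply: mulr_gt0.
pose D := 2 * M * m * T + 2 * P.
have D0 : 0 <= D by rewrite addr_ge0 ?mulr_ge0.
have D1 : 0 < D + 1 by rewrite ltr_wpDl.
pose s := e / (8 * C * (D + 1)); have s0 : 0 < s by apply: divr_gt0 => //; apply: mulr_gt0 => //; apply: mulr_gt0.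
pose K := 8 * P + 4 * m * T ^+ 2 / s ^+ 4.
have K0 : 0 <= K.
  apply: addr_ge0; first exact: mulr_ge0.
  by apply: divr_ge0; [repeat first [done | exact: exprn_ge0 | apply: mulr_ge0]|exact: exprn_ge0 (ltW s0)].
have s2 : 0 < s ^+ 2 / 2 by rewrite divr_gt0// exprn_gt0.
have [L1' hL1] := dy_small s2.
have K1 : 0 < K + 1 by rewrite ltr_wpDl.
have q0 : 0 < e / (8 * C * (K + 1)) by apply: divr_gt0 => //; apply: mulr_gt0 => //; apply: mulr_gt0.
have [L2' hL2] := dy_small q0.
exists (maxn L1' L2') => l i N; rewrite geq_max => /andP[l1 l2] li NT.
have h0 := @dy_gt0 R i; have k0 := @dy_gt0 R l.
have p0 : (0 < 2 ^ (i - l))%N by rewrite expn_gt0.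
have kE := @dy_pow R _ _ li.
have HQ := Q_le (erefl m) (erefl P) li s0 (hL1 _ l1) NT; rewrite -/D in HQ.
set p := (2 ^ (i - l))%N in p0 kE HQ *.
have Nt : (p * N)%:R * (dy i / 2) = N%:R * (dy l / 2) :> R by rewrite kE natrM; ring.
have one n : (n < p * N)%N -> \int[mu]_x `|U (dy i) f n x - U (dy l) f (n %/ p)%N x| <=
   C * pairint i l f n + (2 * r * d + 4 * (e / (16 * (T + 1)))).
  move=> nN.
  have nT : n%:R * (dy i / 2) <= T.
    by apply: le_trans NT; rewrite -Nt ler_wpM2r ?divr_ge0 ?(ltW h0)// ler_nat ltnW.
  have nT2 : (n %/ p)%N%:R * (dy l / 2) <= T.
    apply: le_trans nT; rewrite kE.
    have -> : (n %/ p)%N%:R * (p%:R * dy i / 2) = (n %/ p * p)%N%:R * (dy i / 2) :> R by rewrite natrM; ring.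
    by rewrite ler_wpM2r ?divr_ge0 ?(ltW h0)// ler_nat leq_trunc_div.
  apply: le_trans (L1_split_le r0 d0 (U_Lp h0 hf n) (U_Lp k0 hf (n %/ p)%N) (U_bnd h0 hf n fM) (U_bnd k0 hf (n %/ p)%N fM)) _.
  rewrite -/C -addrA lerD2l lerD2l.
  have t1 := U_tailw h0 r0 hf nT; have t2 := U_tailw k0 r0 hf nT2.
  have hr' : tailw f T r <= e / (16 * (T + 1)) := hr.
  by move: t1 t2 hr'; move: (\int[mu]_x _) (tailw _ _ _) (e / _) => x y z; lra.
apply: (@le_trans _ _ (dy i / 2 * \sum_(n < (p * N)%N) (C * pairint i l f n + (2 * r * d + 4 * (e / (16 * (T + 1))))))).
  by rewrite ler_pM2l ?divr_gt0//; apply: ler_sum => n _; exact: one.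
have cst (c : R) K' : \sum_(n < K') c = K'%:R * c by rewrite sumr_const card_ord mulr_natl.
rewrite big_split /= -mulr_sumr (cst (2 * r * d + 4 * (e / (16 * (T + 1))))) [X in X <= _]mulrDr.
have -> : dy i / 2 * (C * \sum_(n < (p * N)%N) pairint i l f n) = C * (dy i / 2 * \sum_(n < (p * N)%N) pairint i l f n) by ring.
have -> (c : R) : dy i / 2 * ((p * N)%:R * c) = (N%:R * (dy l / 2)) * c by rewrite -Nt; ring.
have c0 : 0 <= 2 * r * d + 4 * (e / (16 * (T + 1))).
  by apply: addr_ge0; apply: mulr_ge0 => //; [apply: mulr_ge0 => //; exact: ltW|exact: ltW|exact: ltW].
have b2 : N%:R * (dy l / 2) * (2 * r * d + 4 * (e / (16 * (T + 1)))) <= e / 2.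
  apply: le_trans (ler_wpM2r c0 NT) _.
  have -> : 2 * r * d + 4 * (e / (16 * (T + 1))) = e / (2 * (T + 1)) by rewrite /d; field; rewrite !lt0r_neq0.
  rewrite mulrA ler_pdivrMr ?mulr_gt0//.
  exact: Te_arith.
have b1 : C * (dy i / 2 * \sum_(n < (p * N)%N) pairint i l f n) <= e / 2.
  apply: le_trans (ler_wpM2l (ltW C0) HQ) _.
  have -> : 8 * dy l * P + 4 * dy l * m * T ^+ 2 / s ^+ 4 + s * D = dy l * K + s * D by rewrite /K; ring.
  have x1 : C * (dy l * K) <= e / 8.
    exact: (small_arith (ltW k0) C0 K1 (hL2 _ l2)).
  have x2 : C * (s * D) <= e / 8.
    rewrite /s; have -> : C * (e / (8 * C * (D + 1)) * D) = e / 8 * (D / (D + 1)) by field; rewrite !lt0r_neq0.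
    by rewrite ler_piMr ?divr_ge0 ?(ltW e0)// ler_pdivrMr// mul1r lerDl.
  by rewrite mulrDr; exact: (eighths e0 x1 x2).
exact: halves_le.
Qed.

End levels.

(** From an integral in time to a supremum: for nice data the distance [z] changes slowly, so [z n]
    is at most its mean over a window of length [dy d] plus 3 L times that length. The window is
    fixed before the level, since the bound on the integral must be small against its length. *)
Lemma sup_small f L (T e : R) : nice f L -> 0 < e -> 0 <= T -> exists L0 : nat, forall l i n : nat, (L0 <= l)%N -> (l <= i)%N ->
  n%:R * (dy i / 2) <= T ->
  \int[mu]_x `|U (dy i) f n x - U (dy l) f (n %/ 2 ^ (i - l))%N x| <= e.
Proof.
move=> [hf [M fM] hL] e0 T0; have L0 : 0 <= L.
  have := hL 1 ltr01; have : 0 <= \int[mu]_x `|Sc 1 f x - f x| by apply: I_ge0 => x; exact: normr_ge0.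
  lra.
have q0 : 0 < e / (6 * (L + 1)) by rewrite divr_gt0// mulr_gt0//; lra.
have [d0 hd0] := dy_small q0.
pose d := d0; have hd := hd0 d (leqnn _).
have dd := @dy_gt0 R d; have d1 := @dy_le1 R d.
have e1 : 0 < dy d * (e / 2) by rewrite mulr_gt0// divr_gt0.
(* The window and the rounding up to whole coarse steps lengthen the time interval by at most 2. *)
have T2 : 0 <= T + 2 by lra.
have [K hK] := L1sum_small hf fM e1 T2.
exists (maxn K d) => l i n; rewrite geq_max => /andP[Kl dl] li nT.
have h0 := @dy_gt0 R i; have k0 := @dy_gt0 R l.
have p0 : (0 < 2 ^ (i - l))%N by rewrite expn_gt0.
have kE := @dy_pow R _ _ li.
have kd : dy l <= dy d :> R by exact: dy_mono.
have di : (d <= i)%N by exact: leq_trans li.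
(* Number of fine steps in the window: the time step is [dy i / 2], that is [dy i.+1]. *)
pose q := (2 ^ (i.+1 - d))%N.
have qE : q%:R * (dy i / 2) = dy d :> R.
  have -> : dy i / 2 = dy i.+1 :> R by have := @dyS R i; lra.
  by rewrite /q -dy_pow// leqW.
set p := (2 ^ (i - l))%N in p0 kE *.
pose N := ((n + q) %/ p).+1.
have nqN : (n + q <= p * N)%N by rewrite mulnC ltnW// ltn_ceil.
have NT : N%:R * (dy l / 2) <= T + 2.
  have -> : N%:R * (dy l / 2) = (N * p)%N%:R * (dy i / 2) :> R by rewrite kE natrM; ring.
  have : (N * p)%N%:R * (dy i / 2) <= (n + q + p)%N%:R * (dy i / 2) :> R.
    by rewrite ler_wpM2r ?divr_ge0 ?(ltW h0)// ler_nat mulSn addnC leq_add2r leq_trunc_div.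
  rewrite !natrD !mulrDl qE => H; apply: le_trans H _.
  have -> : p%:R * (dy i / 2) = dy l / 2 :> R by rewrite kE; ring.
  by have := @dy_le1 R l; lra.
have {}hK := hK l i N Kl li NT; rewrite -/p in hK.
pose z j := \int[mu]_x `|U (dy i) f j x - U (dy l) f (j %/ p)%N x|.
rewrite -/(z n).
have z0 j : 0 <= z j by apply: I_ge0 => x; exact: normr_ge0.
have U1 j : L1 mu (U (dy i) f j) by have [] := U_Lp h0 hf j.
have W1 j : L1 mu (U (dy l) f j) by have [] := U_Lp k0 hf j.
have zj j : (j < q)%N -> z n <= z (n + j)%N + 3 * dy d * L.
  move=> jq.
  have s1 : \int[mu]_x `|U (dy i) f (j + n) x - U (dy i) f n x| <= dy d * L.
    apply: le_trans (U_step h0 hf j n) _; apply: le_trans (ler_wpM2l (ler0n _ _) (hL _ h0)) _.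
    rewrite mulrA -qE; apply: ler_wpM2r => //.
    by rewrite ler_wpM2r ?divr_ge0 ?(ltW h0)// ler_nat ltnW.
  have s2 : \int[mu]_x `|U (dy l) f ((j + n) %/ p)%N x - U (dy l) f (n %/ p)%N x| <= 2 * dy d * L.
    have jn : (n %/ p <= (j + n) %/ p)%N by apply: leq_div2r; exact: leq_addl.
    pose w := ((j + n) %/ p - n %/ p)%N.
    have -> : ((j + n) %/ p = w + n %/ p)%N by rewrite subnK.
    apply: le_trans (U_step k0 hf w _) _; apply: le_trans (ler_wpM2l (ler0n _ _) (hL _ k0)) _.
    rewrite mulrA; apply: ler_wpM2r => //.
    have wp : (w * p <= j + p)%N.
      rewrite mulnBl leq_subLR addnA (leq_trans (leq_trunc_div _ _))// addnC.
      rewrite [X in (_ <= X)%N]addnAC leq_add2r.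
      by have := ltn_ceil n p0; rewrite mulSn addnC => /ltnW.
    have -> : w%:R * (dy l / 2) = (w * p)%N%:R * (dy i / 2) :> R by rewrite kE natrM; ring.
    have h2 : 0 <= dy i / 2 :> R by rewrite divr_ge0// ltW.
    have : (w * p)%N%:R * (dy i / 2) <= (j + p)%N%:R * (dy i / 2) :> R by rewrite ler_wpM2r// ler_nat.
    have : j%:R * (dy i / 2) <= q%:R * (dy i / 2) :> R by rewrite ler_wpM2r// ler_nat ltnW.
    have : p%:R * (dy i / 2) = dy l / 2 :> R by rewrite kE; ring.
    rewrite natrD mulrDl qE => ha hb hc; exact: (wstep_arith ha hb hc (ltW k0) kd).
  rewrite addnC; have a1 := L1_abs (L1B (U1 (j + n)%N) (W1 ((j + n) %/ p)%N)).
  have a2 := L1_abs (L1B (U1 (j + n)%N) (U1 n)); have a3 := L1_abs (L1B (W1 ((j + n) %/ p)%N) (W1 (n %/ p)%N)).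
  apply: (@le_trans _ _ (z (j + n)%N + (\int[mu]_x `|U (dy i) f (j + n) x - U (dy i) f n x| + \int[mu]_x `|U (dy l) f ((j + n) %/ p)%N x - U (dy l) f (n %/ p)%N x|))).
    rewrite -(I_D a2 a3) -(I_D a1 (L1D a2 a3)); apply: I_le; [exact: L1_abs (L1B (U1 n) (W1 _))|exact: L1D a1 (L1D a2 a3)|].
    by move=> x; exact: tri_a.
  by rewrite lerD2l; move: s1 s2; move: (\int[mu]_x _) (\int[mu]_x _) => x y; lra.
have S : \sum_(j < q) z (n + j)%N <= \sum_(j < (p * N)%N) z j by apply: sub_sum.
have h2 : 0 < dy i / 2 :> R by rewrite divr_gt0.
have : q%:R * z n <= \sum_(j < q) z (n + j)%N + q%:R * (3 * dy d * L).
  have cst (c : R) : q%:R * c = \sum_(j < q) c by rewrite sumr_const card_ord mulr_natl.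
  by rewrite !cst -big_split /=; apply: ler_sum => j _; exact: zj.
move=> H; have {H} : dy i / 2 * (q%:R * z n) <= dy i / 2 * (\sum_(j < (p * N)%N) z j + q%:R * (3 * dy d * L)).
  by rewrite ler_pM2l//; apply: le_trans H _; rewrite lerD2r.
rewrite mulrDr !mulrA -(mulrC q%:R) qE => H.
have {H} : dy d * z n <= dy d * (e / 2) + dy d * (3 * dy d * L).
  apply: le_trans H _; rewrite !mulrA lerD2r; move: hK; rewrite !mulrA; exact.
rewrite -mulrDr ler_pM2l// => H; apply: le_trans H _.
have : 3 * dy d * L <= e / 2.
  move: hd; rewrite ler_pdivlMr; last by rewrite mulr_gt0//; lra.
  have := mulr_ge0 (ltW dd) L0; move: (dy d) dd => D dd; nra.
lra.
Qed.

(** The logarithm of 1 + f is clipped at n and smoothed by P_a, which keeps it at most n; the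
    exponential is Lipschitz there with constant exp n. *)
Lemma nice_dense f (e : R) : Lp f -> 0 < e -> exists g L, nice g L /\ \int[mu]_x `|f x - g x| <= e.
Proof.
move=> hf e0; have [f1 f0] := hf; have l1 := lgf_L1 hf.
have l0 x : 0 <= lgf f x by exact: lg_ge0.
pose F (n : nat) x := expR (clip n%:R (lgf f x)) - 1.
have cl (n : nat) x : 0 <= clip n%:R (lgf f x) <= lgf f x.
  rewrite /clip; have n0 : (0 : R) <= n%:R by []. 
  rewrite le_max le_min n0 l0 orbT ge_max ge_min lexx orbT andbT /=.
  by apply: le_trans (l0 x); rewrite oppr_le0.
have Fb n x : 0 <= F n x <= f x.
  have /andP[a b] := cl n x; rewrite /F subr_ge0 -[X in X <= _]expR0 ler_expR a /=.
  by rewrite lerBlDl -(expR_lg (f0 x)) ler_expR.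
have mF n : mfun (F n).
  apply: measurable_funB => //; apply: measurableT_comp; first exact: measurable_expR.
  by apply: clip_meas; exact: L1_meas l1.
have [_ _ c] : [/\ L1 mu f, \int[mu]_x F n x @[n --> \oo] --> \int[mu]_x f x & \int[mu]_x `|F n x - f x| @[n --> \oo] --> (0 : R)].
  apply: (@DCT _ _ _ mu F f f mF (L1_meas f1) _ f1).
    apply: aeW => x; have : (fun n : nat => clip n%:R (lgf f x)) @ \oo --> lgf f x by exact: clip_cvg.
    move=> h; rewrite -[X in _ --> X](_ : expR (lgf f x) - 1 = f x); last by rewrite (expR_lg (f0 x)); ring.
    apply: cvgB; last exact: cvg_cst.
    by apply: continuous_cvg => //; exact: continuous_expR.
  by move=> n x; have /andP[a b] := Fb n x; rewrite ger0_norm.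
have e2 : 0 < e / 2 by rewrite divr_gt0.
have /cvg0P /(_ _ e2) [n hn] := c; have {}hn := hn n (leqnn _).
rewrite ger0_norm in hn; last by apply: I_ge0 => x; exact: normr_ge0.
pose g x := clip n%:R (lgf f x).
have g1 : L1 mu g.
  apply: (@L1_le _ _ _ mu g (lgf f) _ l1); first by apply: clip_meas; exact: L1_meas l1.
  by move=> x; have /andP[a b] := cl n x; rewrite ger0_norm.
have gb x : 0 <= g x <= n%:R.
  by have /andP[-> _] := cl n x; apply: le_trans (ler_norm _) _; apply: clip_abs.
have e3 : 0 < e / 2 / expR n%:R by rewrite divr_gt0// expR_gt0.
have [a a0 ha] := pois_L1 g1 e3.
have {}ha := ha a a0 (lexx _).
have [G Gn GE] := nice_exp a0 g1 gb.
exists G, (a^-1 * \int[mu]_x g x); split => //.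
have [[G1 G0] _ _] := Gn.
have F1 : L1 mu (F n).
  by apply: (@L1_le _ _ _ mu (F n) f (mF n) f1) => x; have /andP[b c'] := Fb n x; rewrite ger0_norm.
have ka := pois_kernel a0; have c1 := conv_L1 ka g1.
have b1 := L1_abs (L1B F1 f1); have b2 := L1_abs (L1B c1 g1).
apply: (@le_trans _ _ (\int[mu]_x `|F n x - f x| + expR n%:R * \int[mu]_x `|conv (pois a) g x - g x|)).
  rewrite -(I_Z _ b2) -(I_D b1 (L1Z (expR n%:R) b2)); apply: I_le; [exact: L1_abs (L1B f1 G1)|exact: L1D b1 (L1Z _ b2)|] => x.
  have -> : f x - G x = - (F n x - f x) + (F n x - G x) by ring.
  apply: le_trans (ler_normD _ _) _; rewrite normrN lerD2l GE /F -/(g x).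
  have ex (p q : R) : p <= n%:R -> q <= n%:R -> `|expR p - expR q| <= expR n%:R * `|q - p|.
    wlog pq : p q / p <= q.
      move=> H pn qn; have [h|h] := leP p q; first exact: H.
      by rewrite distrC (distrC q); apply: H => //; exact: ltW.
    move=> pn qn; rewrite ler0_norm ?subr_le0 ?ler_expR// opprB ger0_norm ?subr_ge0//.
    have := expR_ge1Dx (p - q); rewrite expRD expRN => h1.
    have h2 : expR q - expR p <= expR q * (q - p).
      have := ler_wpM2l (expR_ge0 q) h1; rewrite mulrCA mulfV ?lt0r_neq0 ?expR_gt0// mulr1; lra.
    apply: le_trans h2 _; apply: ler_wpM2r; [lra|by rewrite ler_expR].
  have -> : expR (g x) - 1 - (expR (conv (pois a) g x) - 1) = expR (g x) - expR (conv (pois a) g x) by ring.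
  apply: ex; first by have /andP[] := gb x.
  by apply: (conv_leM ka x g1) => y; have /andP[] := gb y.
apply: halves_le => //.
by rewrite mulrC -ler_pdivlMr ?expR_gt0.
Qed.

Lemma scheme_cauchy f (T e : R) : Lp f -> 0 < e -> 0 <= T -> exists L0 : nat, forall l i n : nat, (L0 <= l)%N -> (l <= i)%N ->
  n%:R * (dy i / 2) <= T ->
  \int[mu]_x `|U (dy i) f n x - U (dy l) f (n %/ 2 ^ (i - l))%N x| <= e.
Proof.
move=> hf e0 T0; have e3 : 0 < e / 3 by rewrite divr_gt0.
have [g [L [ng fg]]] := nice_dense hf e3.
have [K hK] := sup_small ng e3 T0; exists K => l i n Kl li nT.
have {}hK := hK l i n Kl li nT.
have [hg _ _] := ng.
have h0 := @dy_gt0 R i; have k0 := @dy_gt0 R l.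
have c1 := U_contr h0 hf n hg; have c2 := U_contr k0 hf (n %/ 2 ^ (i - l))%N hg.
have [a1 _] := U_Lp h0 hf n; have [a2 _] := U_Lp h0 hg n.
have [b1 _] := U_Lp k0 hf (n %/ 2 ^ (i - l))%N; have [b2 _] := U_Lp k0 hg (n %/ 2 ^ (i - l))%N.
have x1 := L1_abs (L1B a1 a2); have x2 := L1_abs (L1B a2 b2); have x3 := L1_abs (L1B b1 b2).
apply: (@le_trans _ _ (\int[mu]_x `|U (dy i) f n x - U (dy i) g n x| + \int[mu]_x `|U (dy i) g n x - U (dy l) g (n %/ 2 ^ (i - l))%N x| + \int[mu]_x `|U (dy l) f (n %/ 2 ^ (i - l))%N x - U (dy l) g (n %/ 2 ^ (i - l))%N x|)).
  rewrite -(I_D x1 x2) -(I_D (L1D x1 x2) x3); apply: I_le; [exact: L1_abs (L1B a1 b1)|exact: L1D (L1D x1 x2) x3|].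
  by move=> x; exact: tri_b.
move: (le_trans c1 fg) (le_trans c2 fg) hK; move: (\int[mu]_x _) (\int[mu]_x _) (\int[mu]_x _) => x y z; lra.
Qed.

End cauchy2.

(** * Functions that are piecewise constant in time *)

Section step.
Context {R : realType}.
Local Notation mu := (@lebesgue_measure R).

Lemma bool_meas d (T : measurableType d) (b : T -> bool) : mfun b ->
  mfun (fun t => (b t)%:R : R).
Proof.
move=> mb; rewrite (_ : (fun t => _) = (fun t => if b t then 1 else 0)); last by apply/funext => t; case: (b t).
by apply: measurable_fun_ifT => //; exact: measurable_cst.
Qed.

Lemma idx_meas d (T : measurableType d) (idx : T -> nat) (G : nat -> T -> R) :
  (forall n, measurable [set z | (idx z <= n)%N]) ->
  (forall n, mfun (G n)) -> mfun (fun z => G (idx z) z).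
Proof.
move=> mi mG _ Y mY; rewrite setTI.
have -> : (fun z => G (idx z) z) @^-1` Y = \bigcup_n ([set z | idx z = n] `&` G n @^-1` Y).
  by apply/seteqP; split => [z hz|z [n _ [/= <-]]]//; exists (idx z).
apply: bigcup_measurable => n _; apply: measurableI; last by rewrite -[X in measurable X]setTI; exact: mG.
case: n => [|n].
  rewrite (_ : [set z | _] = [set z | (idx z <= 0)%N]); first exact: mi.
  by apply/seteqP; split => z /=; rewrite leqn0 => /eqP.
rewrite (_ : [set z | _] = [set z | (idx z <= n.+1)%N] `\` [set z | (idx z <= n)%N]); first exact: measurableD.
apply/seteqP; split => z /=; first by move=> ->; rewrite ltnn.
by move=> [h1 /negP]; rewrite -ltnNge => h2; apply/eqP; rewrite eqn_leq h1.
Qed.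

Lemma truncn_set_meas (c : R) n : measurable [set t : R | (Num.truncn (t * c) <= n)%N].
Proof.
rewrite (_ : [set t | _] = (fun t => t * c) @^-1` [set x | x < n.+1%:R]); last first.
  by apply/seteqP; split => t /=; rewrite truncn_le_nat.
have m : mfun (fun t : R => t * c) by apply: measurable_funM.
rewrite -[X in measurable X]setTI; apply: m => //.
by rewrite (_ : [set x | _] = `]-oo, n.+1%:R[%classic) //; apply/seteqP; split => x /=; rewrite in_itv.
Qed.

Lemma truncn_set_meas2 (c : R) n : measurable [set z : R * R | (Num.truncn (z.2 * c) <= n)%N].
Proof.
rewrite (_ : [set z | _] = snd @^-1` [set t | (Num.truncn (t * c) <= n)%N])//.
rewrite -[X in measurable X]setTI; apply: measurable_snd => //; exact: truncn_set_meas.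
Qed.

Lemma step_meas (c : R) (F : nat -> R) : mfun (fun t : R => F (Num.truncn (t * c))).
Proof.
apply: (@idx_meas _ _ (fun t : R => Num.truncn (t * c)) (fun n _ => F n)) => n; first exact: truncn_set_meas.
exact: measurable_cst.
Qed.

Lemma step_meas2 (c : R) (G : nat -> R -> R) : (forall n, mfun (G n)) ->
  mfun (fun z : R * R => G (Num.truncn (z.2 * c)) z.1).
Proof.
move=> mG.
apply: (@idx_meas _ _ (fun z : R * R => Num.truncn (z.2 * c)) (fun n z => G n z.1)) => n; first exact: truncn_set_meas2.
exact: measurable_fst_comp.
Qed.

Lemma ico_meas (a b : R) : mfun (fun t : R => (a <= t < b)%R%:R : R).
Proof.
apply: bool_meas; apply: measurable_and; [exact: measurable_fun_ler|exact: measurable_fun_ltr].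
Qed.

Lemma ico_mu (a b : R) : a <= b -> mu (`[a, b[%classic : set R) = (b - a)%:E.
Proof.
move=> ab; rewrite lebesgue_measure_itv /= lte_fin.
case: ltP => h; first by rewrite -EFinB.
have -> : b = a by lra.
by rewrite subrr.
Qed.

Lemma Idist_sym (a b : R -> R) : \int[mu]_x `|a x - b x| = \int[mu]_x `|b x - a x|.
Proof. by apply: I_ext => x; rewrite distrC. Qed.

Lemma Idist_tri (a b c : R -> R) : L1 mu a -> L1 mu b -> L1 mu c ->
  \int[mu]_x `|a x - c x| <= \int[mu]_x `|a x - b x| + \int[mu]_x `|b x - c x|.
Proof.
move=> ha hb hc; have h1 := L1_abs (L1B ha hb); have h2 := L1_abs (L1B hb hc).
rewrite -(I_D h1 h2); apply: I_le; [exact: L1_abs (L1B ha hc)|exact: L1D|] => x.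
exact: ler_distD.
Qed.

Lemma unif_arith (z y1 y2 y3 y4 y5 b1 b2 b3 e d : R) :
  z <= y1 + b1 -> b1 <= y3 + b2 -> b2 <= y5 + b3 -> b3 <= y4 + y2 ->
  y1 <= 2 * d -> y2 <= 2 * d -> y3 <= e / 8 -> y4 <= e / 8 -> y5 <= e / 4 -> d <= e / 16 -> 0 < e -> z <= e.
Proof. lra. Qed.

Lemma mod_arith (x L e : R) : 0 < e -> 0 <= L -> x <= 2 * (e / (8 * (L + 1))) -> x * L <= e / 4.
Proof.
move=> e0 L0 h; have L1' : 0 < L + 1 by lra.
have -> : e / 4 = 2 * (e / (8 * (L + 1))) * (L + 1) by field; rewrite lt0r_neq0.
have q0 : 0 <= 2 * (e / (8 * (L + 1))) by rewrite mulr_ge0// divr_ge0 ?(ltW e0)// mulr_ge0// ltW.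
apply: le_trans (ler_wpM2r L0 h) _; apply: ler_wpM2l => //; lra.
Qed.

Lemma ts_arith (t s h q d : R) : t <= s + q -> 0 < h -> h <= d -> d <= q -> t - s + h / 2 <= 2 * q.
Proof. lra. Qed.

Lemma max0_le (a b : R) : 0 <= a -> `|a - Num.max 0 b| <= `|a - b|.
Proof. by move=> a0; case: (leP 0 b) => hb //; rewrite subr0 ger0_norm// ger0_norm; lra. Qed.

Lemma ico_I (a b : R) : a <= b -> L1 mu (fun t : R => (a <= t < b)%R%:R) /\
  \int[mu]_t ((a <= t < b)%R%:R : R) = b - a.
Proof.
move=> ab.
have E : (\int[mu]_t ((a <= t < b)%R%:R : R)%:E = (b - a)%:E)%E.
  rewrite (_ : (fun t => _) = (fun t => (\1_(`[a, b[%classic) t : R)%:E)); last first.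
    by apply/funext => t; rewrite indicE mem_setE in_itv.
  by rewrite integral_indic// setIT; exact: ico_mu.
have L : L1 mu (fun t : R => (a <= t < b)%R%:R : R).
  by apply/L1_ge0P => //; [exact: ico_meas|rewrite E ltry].
by split => //; move: E; rewrite L1_integralE// => -[].
Qed.

Lemma step_int (tau : R) (E : nat -> R) (N : nat) : 0 < tau -> (forall n, 0 <= E n) ->
  L1 mu (fun t : R => (0 <= t < N%:R * tau)%R%:R * E (Num.truncn (t / tau))) /\
  \int[mu]_t ((0 <= t < N%:R * tau)%R%:R * E (Num.truncn (t / tau))) = tau * \sum_(n < N) E n.
Proof.
move=> t0 E0.
have eq t : (0 <= t < N%:R * tau)%R%:R * E (Num.truncn (t / tau)) =
    \sum_(n < N) E n * (n%:R * tau <= t < n%:R * tau + tau)%R%:R.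
  case: (boolP (0 <= t < N%:R * tau)) => h; last first.
    rewrite mul0r big1// => n _; case: (boolP (_ <= t < _)) => h'; last by rewrite mulr0.
    exfalso; move: h; rewrite negb_and -ltNge -leNgt; case/andP: h' => h1 h2.
    have : 0 <= n%:R * tau by rewrite mulr_ge0// ltW.
    have : n.+1%:R * tau <= N%:R * tau by rewrite ler_pM2r// ler_nat.
    rewrite -natr1 mulrDl mul1r => h3 h4; case/orP; lra.
  rewrite mul1r; case/andP: h => h0 h1.
  have d0 : 0 <= t / tau by rewrite divr_ge0// ltW.
  have hN : (Num.truncn (t / tau) < N)%N by rewrite truncn_lt_nat// ltr_pdivrMr.
  rewrite (bigD1 (Ordinal hN)) //= big1 ?addr0; last first.
    move=> n nN; case: (boolP (_ <= t < _)) => h'; last by rewrite mulr0.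
    exfalso; move/eqP: nN; apply; apply: val_inj => /=; apply/esym/eqP; rewrite truncn_eq//.
    by rewrite ler_pdivlMr// ltr_pdivrMr// -natr1 mulrDl mul1r.
  have := truncn_itv d0; rewrite ler_pdivlMr// ltr_pdivrMr// -natr1 mulrDl mul1r => ->.
  by rewrite mulr1.
have J (n : nat) (h : n%:R * tau <= n%:R * tau + tau) := ico_I h.
have {}J (n : nat) : L1 mu (fun t : R => (n%:R * tau <= t < n%:R * tau + tau)%R%:R : R) /\ \int[mu]_t ((n%:R * tau <= t < n%:R * tau + tau)%R%:R : R) = tau.
  have [|a b] := J n; first by rewrite lerDl ltW.
  by split => //; rewrite b addrAC subrr add0r.
have LL (n : 'I_N) := L1Z (E n) (J n).1.
split; first by apply: L1_ext (L1_sum (index_enum 'I_N) LL) => t; rewrite eq.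
rewrite (@I_ext _ _ _ mu _ _ eq) (I_sum (index_enum 'I_N) LL) mulr_sumr; apply: eq_bigr => n _.
by rewrite (I_Z _ (J n).1) (J n).2 mulrC.
Qed.

End step.
(** * The limit of the scheme *)

Section limit.
Context {R : realType}.
Local Notation mu := (@lebesgue_measure R).
Variable f : R -> R.
Hypothesis hf : Lp f.

Definition tau (i : nat) : R := dy i / 2.

(** The index is 0 for t <= 0, so the interpolants are defined on the whole line and equal the datum
    there. *)
Definition idx (i : nat) (t : R) : nat := Num.truncn (t / tau i).

Definition ui (g : R -> R) (i : nat) (t : R) : R -> R := U (dy i) g (idx i t).

Lemma tau_gt0 i : 0 < tau i. Proof. by rewrite divr_gt0// dy_gt0. Qed.

Lemma tauE i l : (l <= i)%N -> tau l = (2 ^ (i - l))%N%:R * tau i.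
Proof.
move=> li; rewrite /tau mulrA; congr (_ / _).
exact: dy_pow.
Qed.

Lemma idx_itv i t : 0 <= t -> (idx i t)%:R * tau i <= t < (idx i t)%:R * tau i + tau i.
Proof.
move=> t0; have d0 : 0 <= t / tau i by rewrite divr_ge0// ltW// tau_gt0.
have := truncn_itv d0; rewrite ler_pdivlMr ?tau_gt0// ltr_pdivrMr ?tau_gt0//.
by rewrite -natr1 mulrDl mul1r.
Qed.

Lemma idx_eq i t n : 0 <= t -> n%:R * tau i <= t < n%:R * tau i + tau i -> idx i t = n.
Proof.
move=> t0; rewrite -[X in _ + X]mul1r -mulrDl natr1 => h; apply/eqP; rewrite truncn_eq; last first.
  by rewrite divr_ge0// ltW// tau_gt0.
by rewrite ler_pdivlMr ?tau_gt0// ltr_pdivrMr ?tau_gt0.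
Qed.

Lemma idx_neg i t : t <= 0 -> idx i t = 0%N.
Proof.
move=> t0; apply/eqP; rewrite -leqn0 truncn_le_nat; apply: le_lt_trans ltr01.
by rewrite ler_pdivrMr ?tau_gt0// mul0r.
Qed.

Lemma idxS i t : 0 <= t -> idx i (t + tau i) = (idx i t).+1.
Proof.
move=> t0; apply: idx_eq; first by rewrite addr_ge0// ltW// tau_gt0.
by have := idx_itv i t0; rewrite -natr1 mulrDl mul1r => /andP[h1 h2]; apply/andP; split; lra.
Qed.

Lemma idx_div i l t : (l <= i)%N -> 0 <= t -> idx l t = (idx i t %/ 2 ^ (i - l))%N.
Proof.
move=> li t0; set p := (2 ^ (i - l))%N; have p0 : (0 < p)%N by rewrite expn_gt0.
apply: idx_eq => //; rewrite (tauE li) -/p; have h := idx_itv i t0; have ti := tau_gt0 i.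
have -> : (idx i t %/ p)%N%:R * (p%:R * tau i) = (idx i t %/ p * p)%N%:R * tau i by rewrite natrM mulrA.
have h1 : (idx i t %/ p * p)%N%:R * tau i <= (idx i t)%:R * tau i by rewrite ler_pM2r// ler_nat leq_trunc_div.
have h2 : (idx i t).+1%:R * tau i <= ((idx i t %/ p).+1 * p)%N%:R * tau i by rewrite ler_pM2r// ler_nat ltn_ceil.
rewrite -natr1 mulrDl mul1r in h2; rewrite mulSn natrD mulrDl in h2.
by case/andP: h => h3 h4; apply/andP; split; lra.
Qed.

Lemma ui_Lp g i t : Lp g -> Lp (ui g i t). Proof. by move=> hg; apply: U_Lp => //; exact: dy_gt0. Qed.

Lemma ui_cauchy (T e : R) : 0 < e -> 0 <= T -> exists L0 : nat, forall l i t, (L0 <= l)%N -> (l <= i)%N -> t <= T ->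
  \int[mu]_x `|ui f i t x - ui f l t x| <= e.
Proof.
move=> e0 T0; have [L0 hL] := scheme_cauchy hf e0 T0; exists L0 => l i t Ll li tT.
have [t0|t0] := leP 0 t; last first.
  rewrite /ui !idx_neg ?(ltW t0)// I_zero ?(ltW e0)// => x.
  by rewrite subrr normr0.
rewrite /ui (idx_div li t0); apply: hL => //.
by have /andP[h _] := idx_itv i t0; exact: le_trans tT.
Qed.

(** Past level K j the interpolants agree with that of level K j up to [dy j] at all times at most
    j. Taking partial sums of the thresholds makes K monotone and at least j. *)
Lemma lev_ex : exists K : nat -> nat, [/\ (forall j, (j <= K j)%N), {homo K : a b / (a <= b)%N} &
  forall j i t, (K j <= i)%N -> t <= j%:R -> \int[mu]_x `|ui f i t x - ui f (K j) t x| <= dy j].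
Proof.
have H (j : nat) := ui_cauchy (@dy_gt0 R j) (ler0n R j).
have [L0 hL] := choice H.
exists (fun j => \sum_(m < j.+1) (L0 m).+1)%N.
have mono : {homo (fun j => \sum_(m < j.+1) (L0 m).+1)%N : a b / (a <= b)%N}.
  move=> a b ab; rewrite -(subnK ab); elim: (b - a)%N => [|n ih]; first by rewrite add0n.
  by apply: (leq_trans ih); rewrite addSn [X in (_ <= X)%N]big_ord_recr /= leq_addr.
split => //.
- elim=> [//|j ih]; rewrite big_ord_recr /= addnS ltnS; exact: leq_trans ih (leq_addr _ _).
- move=> j i t Ki tj; apply: hL => //.
  by rewrite big_ord_recr /= (leq_trans (leqnSn _))// leq_addl.
Qed.

Definition lev : nat -> nat := projT1 (cid lev_ex).

Lemma levP : [/\ (forall j, (j <= lev j)%N), {homo lev : a b / (a <= b)%N} &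
  forall j i t, (lev j <= i)%N -> t <= j%:R -> \int[mu]_x `|ui f i t x - ui f (lev j) t x| <= dy j].
Proof. exact: projT2 (cid lev_ex). Qed.

Lemma lev_ge j : (j <= lev j)%N. Proof. by have [h _ _] := levP. Qed.

Lemma lev_mono a b : (a <= b)%N -> (lev a <= lev b)%N. Proof. by have [_ h _] := levP; exact: h. Qed.

Lemma lev_cauchy j i t : (lev j <= i)%N -> t <= j%:R -> \int[mu]_x `|ui f i t x - ui f (lev j) t x| <= dy j.
Proof. by have [_ _ h] := levP; exact: h. Qed.

Definition vj (j : nat) (t : R) : R -> R := ui f (lev j) t.

(** The maximum with 0 gives nonnegativity at every point, also where [limfun] is not a limit. *)
Definition ut (t x : R) : R := Num.max 0 (limfun (fun j => vj j t) x).

Lemma vj_Lp j t : Lp (vj j t). Proof. exact: ui_Lp. Qed.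

Lemma ut_rate j t : t <= j%:R -> Lp (ut t) /\ \int[mu]_x `|vj j t x - ut t x| <= 2 * dy j.
Proof.
move=> tj.
have v1 n : L1 mu (vj n t) by case: (vj_Lp n t).
have rap n : (j <= n)%N -> \int[mu]_x `|vj n.+1 t x - vj n t x| <= 2^-1 ^+ n.
  move=> jn; apply: lev_cauchy; first exact: lev_mono.
  by apply: le_trans tj _; rewrite ler_nat.
have [l1 l2] := L1_rapid v1 rap.
have m : mfun (ut t) by apply: measurable_maxr; [exact: measurable_cst|exact: L1_meas l1].
have u1 : L1 mu (ut t).
  apply: (@L1_le _ _ _ mu (ut t) _ m (L1_abs l1)) => x; rewrite /ut.
  rewrite ger0_norm ?le_max ?lexx// ge_max normr_ge0 /=; exact: ler_norm.
split; first by split => // x; rewrite le_max lexx.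
apply: le_trans (l2 j (leqnn _)); apply: I_le; [exact: L1_abs (L1B (v1 j) u1)|exact: L1_abs (L1B (v1 j) l1)|] => x.
exact: max0_le ((vj_Lp j t).2 x).
Qed.

Lemma nat_ex (t : R) : exists j : nat, t <= j%:R.
Proof. by exists (Num.truncn t).+1; apply: ltW; exact: truncnS_gt. Qed.

Lemma ut_Lp t : Lp (ut t).
Proof. by have [j tj] := nat_ex t; have [] := ut_rate tj. Qed.

Lemma vj_meas2 j : mfun (fun z : R * R => vj j z.2 z.1).
Proof.
apply: (@step_meas2 _ (tau (lev j))^-1 (fun n => U (dy (lev j)) f n)) => n.
exact: L1_meas (U_Lp (@dy_gt0 R (lev j)) hf n).1.
Qed.

Lemma ut_meas2 : mfun (fun z : R * R => ut z.2 z.1).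
Proof.
apply: measurable_maxr; first exact: measurable_cst.
exact: (measurable_limfun vj_meas2).
Qed.

Lemma vj_ut_cvg t : \int[mu]_x `|vj j t x - ut t x| @[j --> \oo] --> (0 : R).
Proof.
have [j0 hj] := nat_ex t; apply/cvg0P => e e0.
have e2 : 0 < e / 2 by rewrite divr_gt0.
have [N hN] := dy_small e2; exists (maxn N j0) => n; rewrite geq_max => /andP[Nn jn].
rewrite ger0_norm; last by apply: I_ge0 => x; exact: normr_ge0.
have [|_ h] := @ut_rate n t; first by apply: le_trans hj _; rewrite ler_nat.
by apply: le_trans h _; have := hN n Nn; lra.
Qed.

Lemma ut0 : {ae mu, forall x, ut 0 x = f x}.
Proof.
have [f1 _] := hf; have [u1 _] := ut_Lp 0.
have d1 := L1_abs (L1B f1 u1).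
have v0 j : vj j 0 = f by rewrite /vj /ui idx_neg.
have : \int[mu]_x `|f x - ut 0 x| = 0.
  have E j : \int[mu]_x `|vj j 0 x - ut 0 x| = \int[mu]_x `|f x - ut 0 x| by rewrite v0.
  have := @vj_ut_cvg 0; rewrite (eq_cvg _ _ E) => c.
  exact: cvg_uniqR (cvg_cst _) c.
move=> /(I_eq0 d1) H; have {}H := H (fun x => normr_ge0 _).
by apply: filterS H => x /normr0P; rewrite subr_eq0 => /eqP.
Qed.

Lemma ui_lip g L i s t : nice g L -> 0 <= s -> s <= t ->
  \int[mu]_x `|ui g i t x - ui g i s x| <= (t - s + tau i) * L.
Proof.
move=> [hg _ hL] s0 st; have t0 : 0 <= t by exact: le_trans st.
have ti := tau_gt0 i; have h0 := @dy_gt0 R i.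
have L0 : 0 <= L.
  have := hL _ h0; have : 0 <= \int[mu]_x `|Sc (dy i) g x - g x| by apply: I_ge0 => x; exact: normr_ge0.
  rewrite -/(tau i) => a b; have := le_trans a b; rewrite pmulr_rge0//.
have /andP[a1 a2] := idx_itv i s0; have /andP[b1 b2] := idx_itv i t0.
have st' : (idx i s <= idx i t)%N.
  rewrite -ltnS -(ltr_nat R) -(ltr_pM2r ti) -natr1 mulrDl mul1r; lra.
rewrite /ui -(subnK st'); apply: le_trans (U_step h0 hg _ _) _.
apply: le_trans (ler_wpM2l (ler0n _ _) (hL _ h0)) _; rewrite mulrA; apply: ler_wpM2r => //.
rewrite natrB// mulrBl -/(tau i); lra.
Qed.

(** Equicontinuity passes from nice data to all data by contraction. The modulus is the same at all
    times, as the sampling in [bochner] and [Mj_close] require. *)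
Lemma ut_unif (e : R) : 0 < e -> exists2 d : R, 0 < d & forall s t, 0 <= s -> s <= t -> t <= s + d ->
  \int[mu]_x `|ut t x - ut s x| <= e.
Proof.
move=> e0; have e8 : 0 < e / 8 by rewrite divr_gt0.
have [g [L [ng fg]]] := nice_dense hf e8; have [hg _ hL] := ng.
have L0 : 0 <= L.
  have := hL _ ltr01; have : 0 <= \int[mu]_x `|Sc 1 g x - g x| by apply: I_ge0 => x; exact: normr_ge0.
  lra.
have q0 : 0 < e / (8 * (L + 1)) by rewrite divr_gt0// mulr_gt0//; lra.
exists (e / (8 * (L + 1))) => // s t s0 st tsd.
have [j0 hj0] := nat_ex t.
have [N1 hN1] := dy_small q0; have e16 : 0 < e / 16 by rewrite divr_gt0.
have [N2 hN2] := dy_small e16.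
pose j := maxn j0 (maxn N1 N2).
have tj : t <= j%:R by apply: le_trans hj0 _; rewrite ler_nat leq_maxl.
have sj : s <= j%:R by exact: le_trans tj.
have [[u1 _] r1] := ut_rate tj; have [[w1 _] r2] := ut_rate sj.
have h0 := @dy_gt0 R (lev j).
have c1 := U_contr h0 hf (idx (lev j) t) hg; have c2 := U_contr h0 hf (idx (lev j) s) hg.
have c3 := ui_lip (lev j) ng s0 st.
have [v1 _] := vj_Lp j t; have [v2 _] := vj_Lp j s.
have [g1 _] := ui_Lp (lev j) t hg; have [g2 _] := ui_Lp (lev j) s hg.
have t1 := Idist_tri u1 v1 w1; have t2 := Idist_tri v1 g1 w1; have t3 := Idist_tri g1 g2 w1; have t4 := Idist_tri g2 v2 w1.
rewrite (Idist_sym (ut t) (vj j t)) in t1; rewrite (Idist_sym (ui g (lev j) s) (vj j s)) in t4.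
have d1 := hN1 j (leq_trans (leq_maxl _ _) (leq_maxr _ _)).
have d2 := hN2 j (leq_trans (leq_maxr _ _) (leq_maxr _ _)).
have dl : dy (lev j) <= dy j :> R by apply: dy_mono; exact: lev_ge.
have c3' : (t - s + tau (lev j)) * L <= e / 4.
  by apply: mod_arith => //; exact: (ts_arith tsd h0 dl d1).
exact: (unif_arith t1 t2 t3 t4 r1 r2 (le_trans c1 fg) (le_trans c2 fg) (le_trans c3 c3') d2 e0).
Qed.

Lemma lgf_diff_L2 u v : Lp u -> Lp v -> \int[mu]_x ((lgf u x - lgf v x) ^+ 2) <= 4 * \int[mu]_x `|u x - v x|.
Proof.
move=> hu hv; have [u1 u0] := hu; have [v1 v0] := hv.
have [_ [_ d]] := L12B (lgf_L12 hu) (lgf_L12 hv); have uv := L1_abs (L1B u1 v1).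
by rewrite -(I_Z 4 uv); apply: I_le => //; [exact: L1Z|move=> x; exact: lg_diff_sq].
Qed.

Lemma w_cvg t : \int[mu]_x ((lgf (vj j t) x - lgf (ut t) x) ^+ 2) @[j --> \oo] --> (0 : R).
Proof.
apply: (@cvg0_le _ _ _ _ _ (fun j => 4 * \int[mu]_x `|vj j t x - ut t x|)).
  move=> j; rewrite ger0_norm; last by apply: I_ge0 => x; exact: sqr_ge0.
  by apply: lgf_diff_L2; [exact: vj_Lp|exact: ut_Lp].
by apply: cvg0_Zl; exact: vj_ut_cvg.
Qed.

Section energy_time.
Hypothesis fP : L1 mu (fun x => Phi (f x)).

Let P := \int[mu]_x Phi (f x).

Let P0 : 0 <= P. Proof. by apply: I_ge0 => x; apply: Phi_ge0; have [] := hf. Qed.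

(** The energy decreases and its time integral is bounded by the entropy, hence the decay like 1 /
    t. *)
Lemma vj_E j t : 0 < t -> Eh2 (dy (lev j)) (lgf (vj j t)) <= 2 * P / t.
Proof.
move=> t0; have h0 := @dy_gt0 R (lev j).
have := U_Ebnd h0 hf (idx (lev j) t) fP; rewrite -/(ui f (lev j) t) -/(vj j t) -/P -/(tau _) => H.
have E0 : 0 <= Eh2 (dy (lev j)) (lgf (vj j t)) by apply: Eh_ge0 => //; apply: lgf_L12; exact: vj_Lp.
rewrite ler_pdivlMr// mulrC; apply: le_trans H; apply: ler_wpM2r => //.
by rewrite -natr1 mulrDl mul1r; have /andP[_ h] := idx_itv (lev j) (ltW t0); exact: ltW.
Qed.

Lemma ut_FE t : 0 < t -> FE (lgf (ut t)) /\ (2 * pi)^-1 * EE2 (lgf (ut t)) <= 2 * P / t.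
Proof.
move=> t0; apply: (@FE_lsc _ lev (fun j => lgf (vj j t))).
- by move=> n; apply: lgf_L12; exact: vj_Lp.
- by apply: lgf_L12; exact: ut_Lp.
- exact: w_cvg.
- by move=> m; exists m => n mn; apply: leq_trans mn _; exact: lev_ge.
- by move=> n; exact: vj_E.
Qed.

End energy_time.
End limit.

(** * Integrals over time intervals and Bochner measurability *)

Section halfline.
Context {R : realType}.
Local Notation mu := (@lebesgue_measure R).

Lemma int_pos (F : R -> \bar R) :
  (\int[mu]_(t in `]0%R, +oo[) F t = \int[mu]_t (if (0 < t)%R then F t else 0))%E.
Proof.
rewrite integral_mkcond; apply: eq_integral => t _.
by rewrite patchE mem_setE in_itv /= andbT.
Qed.

Lemma int_ioo (T : R) (F : R -> \bar R) :
  (\int[mu]_(t in `]0%R, T[) F t = \int[mu]_t (if (0 < t < T)%R then F t else 0))%E.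
Proof.
rewrite integral_mkcond; apply: eq_integral => t _.
by rewrite patchE mem_setE in_itv.
Qed.

Lemma EFin_if (b : bool) (x : R) : ((if b then x%:E else 0) = (b%:R * x)%:E)%E.
Proof. by case: b; rewrite ?mul1r ?mul0r. Qed.

Lemma Lnorm1_I (g : R -> R) : L1 mu g -> ('N[mu]_1%E [(fun x => (g x)%:E)] = (\int[mu]_x `|g x|)%:E)%E.
Proof. by move=> hg; rewrite Lnorm1 -L1_integralE//; exact: L1_abs. Qed.

Lemma Hdot_norm_sqr v : L1 mu v -> FE v -> (Hdot_norm v ^+ 2 = ((2 * pi)^-1 * EE v v)%:E)%E.
Proof.
move=> hv fv; rewrite Hdot_normE// -EFin_expe sqr_sqrtr//.
by rewrite mulr_ge0 ?EE_ge0// ltW// ipi_gt0.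
Qed.

Lemma Hdot_cvg0 (v_ : nat -> R -> R) (e : nat -> R) : (forall n, L1 mu (v_ n)) -> (forall n, FE (v_ n)) ->
  (forall n, EE2 (v_ n) <= e n) -> e n @[n --> \oo] --> (0 : R) ->
  Hdot_norm (v_ n) @[n --> \oo] --> 0%E.
Proof.
move=> hv fv he ec.
rewrite (eq_cvg _ _ (fun n => Hdot_normE (hv n) (fv n))); apply: cvg_EFin; first exact: nearW.
rewrite -sqrtr0; apply: continuous_cvg; first exact: sqrt_continuous.
have P := @ipi_gt0 R.
apply: (@cvg0_le _ _ _ _ _ (fun n => (2 * pi)^-1 * e n)).
  move=> n; rewrite ger0_norm; last by rewrite mulr_ge0 ?EE_ge0// ltW.
  by rewrite ler_pM2l.
by apply: cvg0_Zl.
Qed.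

(** Since |xi| exp (- h |xi|) <= 1 / h. *)
Lemma FE_pois h v : 0 < h -> L12 v -> FE (conv (pois h) v) /\
  EE2 (conv (pois h) v) <= h^-1 * (2 * pi * \int[mu]_x (v x ^+ 2)).
Proof.
move=> h0 hv; have kk := pois_kernel h0; have [v1 v2] := hv.
have [c1 c2] := L12_conv kk hv.
have b xi : `|xi| * hart (conv (pois h) v) xi ^+ 2 <= h^-1 * hart v xi ^+ 2.
  rewrite hart_conv_pois// exprMn mulrA; apply: ler_wpM2r; first exact: sqr_ge0.
  have e0 := eabs_ge0 h xi; have e1 := eabs_le1 xi h0.
  have e2 : eabs h xi ^+ 2 <= eabs h xi by rewrite expr2 ler_piMr.
  apply: le_trans (ler_wpM2l (normr_ge0 xi) e2) _.
  rewrite /eabs expRN ler_pdivrMr ?expR_gt0// ler_pdivlMl//.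
  by have := expR_ge1Dx (h * `|xi|); lra.
have [_ hs] := L12_hart hv; have mh := hart_meas (L1_meas c1).
have F : FE (conv (pois h) v).
Transparent FE. rewrite /FE. Opaque FE.
  apply: (@L1_le _ _ _ mu (fun xi => `|xi| * hart (conv (pois h) v) xi ^+ 2) _ _ (L1Z h^-1 hs)).
    by apply: measurable_funM; [exact: norm_meas|exact: measurable_funX].
  by move=> xi; rewrite ger0_norm; [exact: b|apply: mulr_ge0; [exact: normr_ge0|exact: sqr_ge0]].
split => //; rewrite -(plancherel_sqr hv) -(I_Z _ hs).
Transparent EE. rewrite /EE. Opaque EE.
apply: I_le; [exact: EE_L1|exact: L1Z|] => xi.
by rewrite -mulrA -expr2.
Qed.

Lemma pois_EE_cvg v : L12 v -> FE v ->
  EE2 (fun x => v x - conv (pois (hn n)) v x) @[n --> \oo] --> (0 : R).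
Proof.
move=> hv fv; have [v1 v2] := hv; have h0 n := @hn_gt0 R n.
have E n : EE2 (fun x => v x - conv (pois (hn n)) v x) =
   \int[mu]_xi (((1 - eabs (hn n) xi) * (rxi xi * hart v xi)) ^+ 2).
  rewrite EEvv; apply: I_ext => xi.
  have c1 := conv_L1 (pois_kernel (h0 n)) v1.
  by rewrite hartB// hart_conv_pois//; ring.
have V2 := (FE_L2 (L1_meas v1)).1 fv.
rewrite (eq_cvg _ _ E); apply: (L2_dominated (C := 1) _ _ V2) => [n|xi|n xi].
- by apply: measurable_funM (L2_meas V2); apply: measurable_funB => //; exact: eabs_meas.
- apply: cvg0_Zr.
  by rewrite -(subrr 1); apply: cvgB; [exact: cvg_cst|exact: eabs_hn_cvg].
have e0 := eabs_ge0 (hn n) xi; have e1 := eabs_le1 xi (h0 n).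
by rewrite exprMn; apply: ler_wpM2r; [exact: sqr_ge0|rewrite expr_le1//; lra].
Qed.

Lemma sum_ico (d t : R) N (F : nat -> R) : 0 < d -> 0 <= t -> t < N%:R * d ->
  \sum_(i < N) \1_(`[i%:R * d, i%:R * d + d[%classic) t * F i = F (Num.truncn (t / d)).
Proof.
move=> d0 t0 tN; have td : 0 <= t / d by rewrite divr_ge0// ltW.
have hN : (Num.truncn (t / d) < N)%N by rewrite truncn_lt_nat// ltr_pdivrMr.
have I (i : nat) : (\1_(`[i%:R * d, i%:R * d + d[%classic) t : R) = (i == Num.truncn (t / d))%:R.
  rewrite indicE mem_setE in_itv /= eq_sym truncn_eq//.
  by rewrite ler_pdivlMr// ltr_pdivrMr// -natr1 mulrDl mul1r.
rewrite (bigD1 (Ordinal hN)) //= big1 ?addr0; last first.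
  by move=> n nN; rewrite I; case: eqP => e; [exfalso; move/eqP: nN; apply; exact: val_inj|rewrite mul0r].
by rewrite I eqxx mul1r.
Qed.

(** The simple functions are samples of w on a grid, smoothed by P_h with h = [hn n]: smoothing
    gives finite energy also to the sample at time 0. The mesh is chosen so that the squared L^2
    error is at most h^2, which beats the factor 1 / h of [FE_pois]. *)
Lemma bochner (w : R -> R -> R) (T : R) : (forall t, L12 (w t)) -> (forall t, 0 < t -> FE (w t)) ->
  (forall e : R, 0 < e -> exists2 d : R, 0 < d & forall s t, 0 <= s -> s <= t -> t <= s + d -> \int[mu]_x ((w t x - w s x) ^+ 2) <= e) ->
  exists2 s : nat -> R -> R -> R, (forall n, Hdot_simple (s n)) &
   forall t, 0 < t < T -> Hdot_norm (w t \- s n t) @[n --> \oo] --> 0%E.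
Proof.
move=> hw fw hu; have h0 n := @hn_gt0 R n.
have H (n : nat) : exists d : R, 0 < d /\ forall s t, 0 <= s -> s <= t -> t <= s + d -> \int[mu]_x ((w t x - w s x) ^+ 2) <= hn n ^+ 2.
  by have [d d0 hd] := hu _ (exprn_gt0 2 (h0 n)); exists d.
have [d hd] := choice H.
have d0 n : 0 < d n by have [] := hd n.
pose N n := (Num.truncn (T / d n)).+1.
pose psi n (i : nat) := conv (pois (hn n)) (w (i%:R * d n)).
pose A n (i : nat) : set R := `[i%:R * d n, i%:R * d n + d n[%classic.
exists (fun n t x => \sum_(i < N n) \1_(A n i) t * psi n i x).
  move=> n; exists (N n), (fun i : 'I_(N n) => A n i), (fun i : 'I_(N n) => psi n i); split => //.
  - by move=> i; exact: measurable_itv.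
  - move=> i; apply: in_Hdot_of; first by apply: L12_conv => //; exact: pois_kernel.
    by have [] := FE_pois (h0 n) (hw (i%:R * d n)).
move=> t /andP[t0 tT].
pose w' n := w ((Num.truncn (t / d n))%:R * d n).
have hw' n : L12 (fun x => w t x - w' n x) := L12B (hw t) (hw _).
have E n : (w t \- (fun x => \sum_(i < N n) \1_(A n i) t * psi n i x)) =
    (fun x => (w t x - conv (pois (hn n)) (w t) x) + conv (pois (hn n)) (fun y => w t y - w' n y) x).
  apply/funext => x /=.
  rewrite (@sum_ico (d n) t (N n) (fun i => psi n i x)) ?(ltW t0)//=; last first.
    by apply: lt_trans tT _; rewrite -ltr_pdivrMr//; exact: truncnS_gt.
  by rewrite (convB (pois_kernel (h0 n)) (L12_1 (hw t)) (L12_1 (hw _))) /psi /w'; ring.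
have close n : \int[mu]_x ((w t x - w' n x) ^+ 2) <= hn n ^+ 2.
  have td : 0 <= t / d n by rewrite divr_ge0 ?(ltW t0)// ltW.
  have := truncn_itv td; rewrite ler_pdivlMr// ltr_pdivrMr// -natr1 mulrDl mul1r => /andP[a b].
  have [_ h] := hd n; apply: h => //; [by rewrite mulr_ge0// ltW|exact: ltW].
have c1 := pois_EE_cvg (hw t) (fw t t0).
have F1 n : FE (fun x => w t x - conv (pois (hn n)) (w t) x).
  apply: FEB; [exact: L12_1|exact: (L12_1 (L12_conv (pois_kernel (h0 n)) (hw t)))|exact: fw|].
  by have [] := FE_pois (h0 n) (hw t).
have L1a n : L1 mu (fun x => w t x - conv (pois (hn n)) (w t) x).
  by apply: L1B; [exact: L12_1|exact: (L12_1 (L12_conv (pois_kernel (h0 n)) (hw t)))].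
have L1b n : L1 mu (conv (pois (hn n)) (fun y => w t y - w' n y)).
  exact: (L12_1 (L12_conv (pois_kernel (h0 n)) (hw' n))).
have F2 n := FE_pois (h0 n) (hw' n).
under eq_fun do rewrite E.
apply: (@Hdot_cvg0 _ (fun n => 2 * EE2 (fun x => w t x - conv (pois (hn n)) (w t) x) + 2 * (2 * pi * hn n))).
- by move=> n; exact: L1D (L1a n) (L1b n).
- by move=> n; exact: FED (L1a n) (L1b n) (F1 n) (F2 n).1.
- move=> n; apply: le_trans (EE_D_le (L1a n) (L1b n) (F1 n) (F2 n).1) _.
  rewrite lerD2l ler_pM2l//; apply: le_trans (F2 n).2 _.
  have P := @pi2_gt0 R.
  by rewrite ler_pdivrMl// mulrCA ler_pM2l// -expr2.
- have -> : 0 = 2 * 0 + 2 * (2 * pi * 0) :> R by rewrite !mulr0 addr0.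
  apply: cvgD; first by apply: cvgM => //; exact: cvg_cst.
  apply: cvgM; first exact: cvg_cst.
  by apply: cvgM; [exact: cvg_cst|exact: hn_cvg].
Qed.

End halfline.

(** * The energy of the limit, integrated in time *)

Section time_energy.
Context {R : realType}.
Local Notation mu := (@lebesgue_measure R).

Lemma EE_def (v w : R -> R) : EE v w = \int[mu]_xi (`|xi| * hart v xi * hart w xi).
Proof. Transparent EE. by rewrite /EE. Qed.

#[local] Opaque EE.

Lemma Eh_EE_cvg (v : R -> R) : L12 v -> FE v -> Eh (dy n) v v @[n --> \oo] --> (2 * pi)^-1 * EE v v.
Proof.
move=> hv fv; have h0 n := @dy_gt0 R n.
rewrite (eq_cvg _ _ (fun n => Eh_hart (h0 n) hv hv)).
apply: cvgM; first exact: cvg_cst.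
have [hm _] := L12_hart hv.
have G := EE_L1 (L12_1 hv) (L12_1 hv) fv fv.
have [] := @DCT _ _ _ mu (fun n xi => lam (dy n) xi * hart v xi * hart v xi) (fun xi => `|xi| * hart v xi * hart v xi) (fun xi => `|xi| * hart v xi * hart v xi) => //.
- by move=> n; apply: measurable_funM => //; apply: measurable_funM => //; exact: lam_meas.
- exact: L1_meas G.
- apply: aeW => xi; apply: cvgM; last exact: cvg_cst.
  by apply: cvgM; [exact: lam_cvg|exact: cvg_cst].
- move=> n xi; rewrite ger0_norm; first exact: mulHH_le (lam_le _ (h0 n)).
  by rewrite -mulrA mulr_ge0 ?lam_ge0// -expr2 sqr_ge0.
Qed.

Lemma mulb_meas (b : R -> bool) (g : R -> R) : mfun b -> mfun g ->
  mfun (fun t => (b t)%:R * g t).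
Proof. by move=> mb mg; apply: measurable_funM => //; exact: bool_meas. Qed.

Lemma gt0_bmeas : mfun (fun t : R => (0 < t)%R).
Proof. exact: measurable_fun_ltr. Qed.

Lemma itv_bmeas (T : R) : mfun (fun t : R => (0 < t < T)%R).
Proof. by apply: measurable_and; exact: measurable_fun_ltr. Qed.

Section sol.
Variable f : R -> R.
Hypothesis hf : Lp f.
Hypothesis fP : L1 mu (fun x => Phi (f x)).

Let P := \int[mu]_x Phi (f x).

Local Notation v := (vj hf).
Local Notation w := (fun t => lgf (ut hf t)).

Lemma w_L12 t : L12 (w t). Proof. exact: lgf_L12 (ut_Lp hf t). Qed.

Lemma v_L12 j t : L12 (lgf (v j t)). Proof. exact: lgf_L12 (vj_Lp hf j t). Qed.

Lemma w_FE t : 0 < t -> FE (w t). Proof. by move=> /(ut_FE hf fP)[]. Qed.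

Lemma EhM_vj_meas m j : mfun (fun t => Eh2 (dy m) (lgf (v j t))).
Proof.
exact: (@step_meas R (tau (lev hf j))^-1 (fun n => Eh2 (dy m) (lgf (U (dy (lev hf j)) f n)))).
Qed.

Lemma EhM_cvg m t : Eh2 (dy m) (lgf (v j t)) @[j --> \oo] --> Eh2 (dy m) (w t).
Proof.
apply: (@Eh_cvg _ (dy m) (fun j => lgf (v j t))); first exact: dy_gt0.
- by move=> n; exact: v_L12.
- exact: w_L12.
- exact: w_cvg.
Qed.

Lemma EhM_meas m : mfun (fun t => Eh2 (dy m) (w t)).
Proof. exact: (@measurable_fun_cvg _ _ R setT (fun j t => Eh2 (dy m) (lgf (v j t))) (fun t => Eh2 (dy m) (w t)) (fun j => EhM_vj_meas m j) (fun t _ => @EhM_cvg m t)). Qed.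

Definition et (t : R) := (0 < t)%R%:R * ((2 * pi)^-1 * EE2 (w t)).

Lemma et_ge0 t : 0 <= et t.
Proof. by rewrite /et !mulr_ge0 ?EE_ge0// ltW// ipi_gt0. Qed.

Lemma et_cvg t : (0 < t)%R%:R * Eh2 (dy m) (w t) @[m --> \oo] --> et t.
Proof.
rewrite /et; have [t0|t0] := ltP 0 t; last by rewrite mul0r; under eq_fun do rewrite mul0r; exact: cvg_cst.
by apply: cvgM; [exact: cvg_cst|apply: Eh_EE_cvg; [exact: w_L12|exact: w_FE]].
Qed.

Lemma et_meas : mfun et.
Proof.
have A (m : nat) : mfun (fun t : R => (0 < t)%R%:R * Eh2 (dy m) (w t)).
  by apply: mulb_meas; [exact: gt0_bmeas|exact: EhM_meas].
have C : forall t : R, [set: R] t -> (0 < t)%R%:R * Eh2 (dy m) (w t) @[m --> \oo] --> et t by move=> t _; exact: et_cvg.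
exact (measurable_fun_cvg A C).
Qed.

(** Fatou in j with m fixed. The shift to [j + m] puts the scheme at a level at least m, where
    [Eh_mono] compares with the energies summed in [U_sum]. *)
Lemma EhM_int m (T : R) : L1 mu (fun t => (0 < t < T)%R%:R * Eh2 (dy m) (w t)) /\
  \int[mu]_t ((0 < t < T)%R%:R * Eh2 (dy m) (w t)) <= 2 * P.
Proof.
have E0 m' t : 0 <= Eh2 (dy m') (w t) by apply: Eh_ge0 (w_L12 t); exact: dy_gt0.
have F0 m' j t : 0 <= Eh2 (dy m') (lgf (v j t)) by apply: Eh_ge0 (v_L12 j t); exact: dy_gt0.
apply: (@Fatou _ _ _ mu (fun j t => (0 < t < T)%R%:R * Eh2 (dy m) (lgf (v (j + m) t)))).
- by move=> j; apply: mulb_meas; [exact: itv_bmeas|exact: EhM_vj_meas].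
- by apply: mulb_meas; [exact: itv_bmeas|exact: EhM_meas].
- by move=> j t; rewrite mulr_ge0.
- by move=> t; rewrite mulr_ge0.
- apply: aeW => t; apply: cvgM; first exact: cvg_cst.
  exact: (@cvg_comp _ _ _ (addn^~ m) (fun j => Eh2 (dy m) (lgf (v j t))) _ _ _ (@cvg_addnr m) (@EhM_cvg m t)).
move=> j; pose l := lev hf (j + m); pose ta : R := tau l.
have ta0 : 0 < ta := @tau_gt0 R l.
pose N := (Num.truncn (T / ta)).+1.
have [S1 S2] := @step_int R ta (fun n => Eh2 (dy l) (lgf (U (dy l) f n))) N ta0 (fun n => Eh_ge0 (@dy_gt0 R l) (lgf_L12 (U_Lp (@dy_gt0 R l) hf n))).
have b t : (0 < t < T)%R%:R * Eh2 (dy m) (lgf (v (j + m) t)) <=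
  (0 <= t < N%:R * ta)%R%:R * Eh2 (dy l) (lgf (U (dy l) f (Num.truncn (t / ta)))).
  have [/andP[t0 tT]|_] := boolP (0 < t < T)%R; last first.
    rewrite mul0r mulr_ge0//; exact: (F0 l (j + m)%N t).
  have -> : (0 <= t < N%:R * ta)%R.
    by rewrite (ltW t0)/=; apply: lt_trans tT _; rewrite -ltr_pdivrMr//; exact: truncnS_gt.
  rewrite !mul1r; apply: Eh_mono (v_L12 _ t).
  by apply: leq_trans (lev_ge hf _); exact: leq_addl.
have L : L1 mu (fun t => (0 < t < T)%R%:R * Eh2 (dy m) (lgf (v (j + m) t))).
  apply: (@L1_le _ _ _ mu _ _ _ S1); first by apply: mulb_meas; [exact: itv_bmeas|exact: EhM_vj_meas].
  by move=> t; rewrite ger0_norm; [exact: b|rewrite mulr_ge0].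
rewrite L1_integralE// lee_fin; apply: le_trans (I_le L S1 b) _.
rewrite S2 mulr_sumr; exact: (U_sum (@dy_gt0 R l) hf N fP).
Qed.

Lemma et_int (T : R) : L1 mu (fun t => (0 < t < T)%R%:R * et t) /\ \int[mu]_t ((0 < t < T)%R%:R * et t) <= 2 * P.
Proof.
have E0 m' t : 0 <= Eh2 (dy m') (w t) by apply: Eh_ge0 (w_L12 t); exact: dy_gt0.
apply: (@Fatou _ _ _ mu (fun m t => (0 < t < T)%R%:R * Eh2 (dy m) (w t))).
- by move=> j; apply: mulb_meas; [exact: itv_bmeas|exact: EhM_meas].
- by apply: mulb_meas; [exact: itv_bmeas|exact: et_meas].
- by move=> j t; rewrite mulr_ge0.
- by move=> t; rewrite mulr_ge0// et_ge0.
- apply: aeW => t; have [/andP[t0 tT]|_] := boolP (0 < t < T)%R.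
    by apply: cvgM; [exact: cvg_cst|have := @et_cvg t; rewrite t0; under eq_fun do rewrite mul1r].
  by rewrite mul0r; under eq_fun do rewrite mul0r; exact: cvg_cst.
- by move=> m; have [L B] := EhM_int m T; rewrite L1_integralE// lee_fin.
Qed.

Definition uu (p : R * R) : R := ut hf p.2 p.1.

Lemma uu_in_C_L1 : in_C_L1 uu.
Proof.
have ul t := (ut_Lp hf t).1.
split=> [t _|t0 h0].
  by apply/(Lfun1_integrable mu); exact: (ul t).
rewrite (eq_cvg _ _ (fun t => Lnorm1_I (L1B (ul t) (ul t0)))).
apply: cvg_EFin; first exact: nearW.
apply/cvgr0Pnorm_le => e e0; have [d d0 hd] := ut_unif hf e0.
rewrite near_withinE; apply/nbhs_ballP; exists d => //= t; rewrite /ball /= => td; rewrite in_itv/= andbT => tp.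
rewrite ger0_norm; last by apply: I_ge0 => x; exact: normr_ge0.
have [le|/ltW le] := leP t0 t.
  by apply: hd => //; move: td; rewrite distrC ger0_norm ?subr_ge0//; lra.
have := hd _ _ tp le; rewrite Idist_sym; apply.
by move: td; rewrite ger0_norm ?subr_ge0//; lra.
Qed.

Lemma uu_in_L2_Hdot (T : R) : 0 < T -> in_L2_Hdot T (log1p uu).
Proof.
move=> T0; have wE t : log1p uu t = w t by [].
split.
- by apply: aeW => t /andP[t0 _]; apply: in_Hdot_of; [exact: w_L12|exact: w_FE].
- have [//||e e0|s hs cs] := @bochner R w T; [exact: w_L12|exact: w_FE| |by exists s => //; apply: aeW].
  have e4 : 0 < e / 4 by rewrite divr_gt0.
  have [d d0 hd] := ut_unif hf e4; exists d => // s t s0 st sd.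
  apply: le_trans (lgf_diff_L2 (ut_Lp hf t) (ut_Lp hf s)) _.
  by rewrite mulrC -ler_pdivlMr//; exact: hd.
- rewrite int_ioo; have [L _] := et_int T.
  rewrite [X in (X < _)%E](_ : _ = (\int[mu]_t ((0 < t < T)%R%:R * et t)%:E)%E).
    by rewrite L1_integralE// ltry.
  apply: eq_integral => t _; rewrite -EFin_if; case: ifPn => // /andP[t0 _].
  rewrite wE Hdot_norm_sqr; [|exact: L12_1 (w_L12 t)|exact: w_FE].
  by rewrite /et t0 mul1r.
Qed.

End sol.
End time_energy.
(** * The weak formulation *)

Section test_functions.
Context {R : realType}.
Local Notation mu := (@lebesgue_measure R).
Implicit Types phi g : R * R -> R.

Lemma dirxP phi (x t l : R) : is_derive ((x, t) : R * R) (1, 0) phi l <-> is_derive x 1 (fun y => phi (y, t)) l.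
Proof.
have E : (fun h : R => h^-1 *: (((fun y => phi (y, t)) \o shift x) (h *: 1) - phi (x, t))) =
    (fun h : R => h^-1 *: ((phi \o shift (x, t)) (h *: ((1, 0) : R * R)) - phi (x, t))).
  apply/funext => h; congr (_ *: (phi _ - _)).
  by apply: injective_projections => //=; rewrite scaler0 add0r.
by split=> -[d1 d2]; split; move: d1 d2; rewrite /derivable /derive E.
Qed.

Lemma dirtP phi (x t l : R) : is_derive ((x, t) : R * R) (0, 1) phi l <-> is_derive t 1 (fun s => phi (x, s)) l.
Proof.
have E : (fun h : R => h^-1 *: (((fun s => phi (x, s)) \o shift t) (h *: 1) - phi (x, t))) =
    (fun h : R => h^-1 *: ((phi \o shift (x, t)) (h *: ((0, 1) : R * R)) - phi (x, t))).
  apply/funext => h; congr (_ *: (phi _ - _)).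
  by apply: injective_projections => //=; rewrite scaler0 add0r.
by split=> -[d1 d2]; split; move: d1 d2; rewrite /derivable /derive E.
Qed.

Lemma cvg_pair2 (T : Type) (F : set_system T) (FF : Filter F) (k l : T -> R) (a b : R) :
  k @ F --> a -> l @ F --> b -> (k z, l z) @[z --> F] --> ((a, b) : R * R).
Proof. exact: cvg_pair. Qed.

Lemma cvg_comp2 (T : Type) (F : set_system T) (FF : Filter F) (k l : T -> R) (a b : R) g : continuous g ->
  k @ F --> a -> l @ F --> b -> g (k z, l z) @[z --> F] --> g (a, b).
Proof.
move=> cg ka lb; have H := @cvg_pair2 T F FF k l a b ka lb; have G : g p @[p --> ((a, b) : R * R)] --> g (a, b) by exact: cg.
exact: cvg_comp H G.
Qed.

Lemma sect_x_cont g t : continuous g -> continuous (fun x => g (x, t)).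
Proof. by move=> cg x; apply: (@cvg_comp2 R (nbhs x) _ (fun x => x) (fun=> t)) => //; exact: cvg_cst. Qed.

Lemma truncn_cvg (t : R) : 0 <= t -> (Num.truncn (t * n.+1%:R))%:R * (n.+1%:R)^-1 @[n --> \oo] --> t.
Proof.
move=> t0; apply: (@cvg_le _ _ _ _ _ (fun n => hn n)); last exact: hn_cvg.
move=> n; have n0 : (0 : R) < n.+1%:R by rewrite ltr0Sn.
have : 0 <= t * n.+1%:R by rewrite mulr_ge0.
move=> /truncn_itv/andP[a b]; rewrite distrC ger0_norm; last by rewrite subr_ge0 ler_pdivrMr.
by rewrite lerBlDr /hn -[X in X + _]mul1r -mulrDl ler_pdivlMr// addrC natr1 ltW.
Qed.

Lemma samp_cvg g (x t : R) : continuous g -> 0 <= t ->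
  g (x, (Num.truncn (t * n.+1%:R))%:R * (n.+1%:R)^-1) @[n --> \oo] --> g (x, t).
Proof. by move=> cg t0; apply: cvg_comp2 => //; [exact: cvg_cst|exact: truncn_cvg]. Qed.

(* Sections in x are continuous and dyadic-type sampling in t converges, so g is a Caratheodory function. *)
Lemma cont_meas2 g : continuous g -> (forall x t, t <= 0 -> g (x, t) = 0) -> mfun g.
Proof.
move=> cg g0.
have A (n : nat) : mfun (fun z : R * R => g (z.1, (Num.truncn (z.2 * n.+1%:R))%:R * (n.+1%:R)^-1)).
  by apply: (@step_meas2 R n.+1%:R (fun k x => g (x, k%:R * (n.+1%:R)^-1))) => k; apply: continuous_measurable_fun; exact: sect_x_cont.
apply: (measurable_fun_cvg A) => -[x t] _ /=.
have [t0|/ltW t0] := leP 0 t.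
  exact: samp_cvg.
have E (n : nat) : g (x, (Num.truncn (t * n.+1%:R))%:R * (n.+1%:R)^-1) = 0.
  have -> : Num.truncn (t * n.+1%:R) = 0%N by apply/eqP; rewrite -leqn0 truncn_le_nat (le_lt_trans _ ltr01)// mulr_le0_ge0.
  by rewrite mul0r g0.
by under eq_fun do rewrite E; rewrite g0//; exact: cvg_cst.
Qed.

(** What the limits use of a test function; it fits phi, its time derivative, the difference
    quotients [psi_] and indicators of rectangles alike. *)
Record rtest (N a b M : R) (g : R * R -> R) : Prop := RTest {
  rt_meas : mfun g;
  rt_bnd : forall x t, `|g (x, t)| <= M;
  rt_x : forall x t, N < `|x| -> g (x, t) = 0;
  rt_t : forall x t, ~~ (a <= t <= b) -> g (x, t) = 0 }.

Lemma cont_rtest (N a b : R) g : 0 < N -> 0 < a -> a <= b -> continuous g ->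
  (forall x t, N < `|x| -> g (x, t) = 0) -> (forall x t, ~~ (a <= t <= b) -> g (x, t) = 0) ->
  exists2 M, 0 < M & rtest N a b M g.
Proof.
move=> N0 a0 ab cg gx gt.
have cK : compact (`[- N, N]%classic `*` `[a, b]%classic) by apply: compact_setX; exact: segment_compact.
have /ex_strict_bound_gt0[M M0 hM] : bounded_set (g @` (`[- N, N]%classic `*` `[a, b]%classic)).
  by apply: compact_bounded; apply: continuous_compact => //; exact: continuous_subspaceT.
exists M => //; split => //.
- apply: cont_meas2 => // x t t0; apply: gt; rewrite negb_and -!ltNge; apply/orP; left; exact: le_lt_trans t0 a0.
- move=> x t; have [xN|/gx ->] := leP `|x| N; last by rewrite normr0 ltW.
  have [tab|/gt ->] := boolP (a <= t <= b); last by rewrite normr0 ltW.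
  by apply/ltW/hM; exists (x, t) => //; split => /=; rewrite in_itv /= -?ler_norml.
Qed.

Lemma supp_rect phi : supported_in_half_plane phi -> exists N a b : R, [/\ 0 < N, 0 < a, a <= b &
  (forall x t, N < `|x| -> phi (x, t) = 0) /\ (forall x t, ~~ (a <= t <= b) -> phi (x, t) = 0)].
Proof.
move=> [K [cK Kh K0]].
have [e|/set0P K1] := eqVneq K set0.
  exists 1, 1, 1; split => //; split => x t _; apply: K0; by rewrite e.
have [c cK1 hc] := @compact_EVT_min _ R (fun p : R * R => p.2) K K1 cK (continuous_subspaceT (fun p => cvg_snd)).
have [d dK1 hd] := @compact_EVT_max _ R (fun p : R * R => p.2) K K1 cK (continuous_subspaceT (fun p => cvg_snd)).
have [e eK1 he] := @compact_EVT_max _ R (fun p : R * R => `|p.1|) K K1 cK (continuous_subspaceT (fun p => continuous_comp cvg_fst (@norm_continuous _ R p.1))).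
exists (`|e.1| + 1), c.2, d.2; split.
- by rewrite ltr_pwDr.
- by apply: Kh; move: cK1; rewrite inE.
- exact: hc.
- split=> x t h; apply: K0 => Kp; have Kp' : (x, t) \in K by rewrite inE.
    by have := he _ Kp'; move: h => /=; lra.
  by move: h; have /= -> := hc _ Kp'; have /= -> := hd _ Kp'.
Qed.

Lemma test_ex phi : C01_half_plane phi -> exists N a b M : R, [/\ 0 < N, 0 < a, a <= b & 0 < M] /\
  [/\ rtest N a b M phi, rtest N a b M (dt phi),
    (forall x y t, `|phi (x, t) - phi (y, t)| <= M * `|x - y|),
    (forall x t s, `|phi (x, t) - phi (x, s)| <= M * `|t - s|) &
    (forall x t : R, is_derive t 1 (fun s => phi (x, s)) (dt phi (x, t)))].
Proof.
move=> [[d1 d2 c1 c2] /supp_rect[N [a [b [N0 a0 ab [sx st]]]]]].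
have D1 x t := (dirxP _ _ _ _).1 (@DeriveDef _ _ _ _ _ _ _ (d1 (x, t)) erefl); have D2 x t := (dirtP _ _ _ _).1 (@DeriveDef _ _ _ _ _ _ _ (d2 (x, t)) erefl).
have cx t := der_cont (fun x => D1 x t).
have z (k : R -> R) (x l : R) : is_derive x 1 k l -> (\forall y \near x, k y = 0) -> l = 0.
  move=> dk k0; have [_ <-] := dk; rewrite (@near_eq_derive _ _ _ k (cst 0)) ?derive_cst//.
have dtx x t : N < `|x| -> dt phi (x, t) = 0.
  move=> xN; apply: (z _ t _ (D2 x t)); near=> s; exact: sx.
have dxx x t : N < `|x| -> dx phi (x, t) = 0.
  move=> xN; apply: (z _ x _ (D1 x t)); near=> y; apply: sx; near: y.
  exact: (@cvgr_gt _ _ (nbhs x) _ (fun y : R => `|y|) `|x| (@norm_continuous _ R x) _ xN).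
have dxt x t : ~~ (a <= t <= b) -> dx phi (x, t) = 0.
  move=> tab; apply: (z _ x _ (D1 x t)); near=> s; exact: st.
have dtt x t : ~~ (a <= t <= b) -> dt phi (x, t) = 0.
  move=> tab; apply: (z _ t _ (D2 x t)).
  move: tab; rewrite negb_and -!ltNge => /orP[h|h]; near=> s; apply: st; rewrite negb_and -!ltNge; apply/orP; [left|right].
    by near: s; exact: lt_nbhsl.
  by near: s; exact: lt_nbhsr.
have [M2 m2 r2] := cont_rtest N0 a0 ab c2 dtx dtt.
have [M3 m3 r3] := cont_rtest N0 a0 ab c1 dxx dxt.
have Lx x y t : `|phi (x, t) - phi (y, t)| <= M3 * `|x - y|.
  have [c _ ->] := MVT_le y x (fun x => D1 x t); rewrite normrM; apply: ler_wpM2r => //.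
  exact: rt_bnd r3 c t.
have Lt x t s : `|phi (x, t) - phi (x, s)| <= M2 * `|t - s|.
  have [c _ ->] := MVT_le s t (fun t => D2 x t); rewrite normrM; apply: ler_wpM2r => //.
  exact: rt_bnd r2 x c.
have cphi : continuous phi.
  move=> [x t]; apply: (@cvg_le _ _ _ _ _ (fun p : R * R => M3 * `|p.1 - x| + M2 * `|p.2 - t|)).
    move=> [y s] /=; have -> : phi (y, s) - phi (x, t) = (phi (y, s) - phi (x, s)) + (phi (x, s) - phi (x, t)) by ring.
    by apply: le_trans (ler_normD _ _) _; exact: lerD (Lx _ _ _) (Lt _ _ _).
  have -> : 0 = M3 * `|x - x| + M2 * `|t - t| :> R by rewrite !subrr normr0 !mulr0 addr0.
  by apply: cvgD; apply: cvgM; [exact: cvg_cst|apply: cvg_norm; apply: cvgB; [exact: cvg_fst|exact: cvg_cst]|exact: cvg_cst|apply: cvg_norm; apply: cvgB; [exact: cvg_snd|exact: cvg_cst]].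
have [M1 m1 r1] := cont_rtest N0 a0 ab cphi sx st.
exists N, a, b, (M1 + M2 + M3); split; first by split => //; rewrite !addr_gt0.
have w g M M' : M <= M' -> rtest N a b M g -> rtest N a b M' g.
  by move=> h [? k ? ?]; split => // x t; exact: le_trans (k x t) h.
split => //.
- by apply: w r1; lra.
- by apply: w r2; lra.
- by move=> x y t; apply: le_trans (Lx x y t) _; apply: ler_wpM2r => //; lra.
- by move=> x t s; apply: le_trans (Lt x t s) _; apply: ler_wpM2r => //; lra.
Unshelve. all: by end_near.
Qed.

End test_functions.

(** * Tools for the passage to the limit in the identity *)

Section weak_identity.
Context {R : realType}.
Local Notation mu := (@lebesgue_measure R).

(** The square root of the symbol, which brings the form of the scheme, up to 2 pi, into the shape
    treated by [energy_weak]. *)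
Definition sl h (xi : R) := Num.sqrt (lam h xi).

Lemma sl_sqr h xi : 0 < h -> sl h xi ^+ 2 = lam h xi.
Proof. by move=> h0; rewrite sqr_sqrtr// lam_ge0. Qed.

Lemma sl_meas h : mfun (sl h).
Proof. by apply: measurableT_comp; [apply: continuous_measurable_fun; exact: sqrt_continuous|exact: lam_meas]. Qed.

Lemma sl_bnd h xi : 0 < h -> 0 <= sl h xi <= rxi xi.
Proof.
move=> h0; rewrite sqrtr_ge0 /= -(ger0_norm (rxi_ge0 xi)) -sqrtr_sqr rxi_sqr.
by rewrite ler_wsqrtr// lam_le.
Qed.

Lemma sl_cvg (k : nat -> nat) xi : (forall j, (j <= k j)%N) -> sl (dy (k j)) xi @[j --> \oo] --> rxi xi.
Proof.
move=> hk; have -> : rxi xi = Num.sqrt `|xi| by rewrite -rxi_sqr sqrtr_sqr ger0_norm ?rxi_ge0.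
apply: continuous_cvg; first exact: sqrt_continuous.
apply: (@cvg_le _ _ _ _ _ (fun j => dy j * xi ^+ 2)).
  move=> j; have h0 := @dy_gt0 R (k j).
  rewrite distrC ger0_norm ?subr_ge0 ?lam_le//.
  apply: le_trans (lam_sub _ h0) _; apply: ler_wpM2r; first exact: sqr_ge0.
  by apply: dy_mono; exact: hk.
by apply: cvg0_Zr; exact: dy_cvg.
Qed.

Lemma sl_L2 h v : 0 < h -> L12 v -> L2 mu (fun xi => sl h xi * hart v xi) /\
  \int[mu]_xi ((sl h xi * hart v xi) ^+ 2) = 2 * pi * Eh h v v.
Proof.
move=> h0 hv; have [hm _] := L12_hart hv.
have E : (fun xi => (sl h xi * hart v xi) ^+ 2) = (fun xi => lam h xi * hart v xi * hart v xi).
  by apply/funext => xi; rewrite exprMn sl_sqr// expr2 mulrA.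
rewrite /L2 E (Eh_hart h0 hv hv) mulVKf; last by rewrite mulf_neq0// gt_eqF// pi_gt0'.
split => //; split; last exact: lam_hart_L1.
by apply: measurable_funM => //; exact: sl_meas.
Qed.

Lemma Eh_sl h v w : 0 < h -> L12 v -> L12 w ->
  Eh h v w = (2 * pi)^-1 * \int[mu]_xi ((sl h xi * hart v xi) * (sl h xi * hart w xi)).
Proof.
move=> h0 hv hw; rewrite Eh_hart//; congr (_ * _); apply: I_ext => xi.
by rewrite -(sl_sqr xi h0); ring.
Qed.

Lemma sqrt_arith (p x y I : R) : 0 < p -> `|I| <= Num.sqrt (p * x) * Num.sqrt (p * y) ->
  `|p^-1 * I| <= Num.sqrt x * Num.sqrt y.
Proof.
move=> p0; rewrite !sqrtrM ?(ltW p0)// mulrACA -expr2 sqr_sqrtr ?(ltW p0)// => h.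
by rewrite normrM gtr0_norm ?invr_gt0// ler_pdivrMl.
Qed.

Lemma Eh_CS (h : R) v w : 0 < h -> L12 v -> L12 w -> `|Eh h v w| <= Num.sqrt (Eh h v v) * Num.sqrt (Eh h w w).
Proof.
move=> h0 hv hw; have [L1v e1] := sl_L2 h0 hv; have [L1w e2] := sl_L2 h0 hw.
rewrite (Eh_sl h0 hv hw); apply: sqrt_arith; first exact: pi2_gt0.
by rewrite -e1 -e2; exact: CS_abs.
Qed.

Lemma cvg_I_mul (v_ : nat -> R -> R) (v : R -> R) (g_ : nat -> R -> R) (g : R -> R) (M : R) : (forall n, L1 mu (v_ n)) -> L1 mu v ->
  \int[mu]_x `|v_ n x - v x| @[n --> \oo] --> (0 : R) -> (forall n, mfun (g_ n)) -> mfun g ->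
  (forall n x, `|g_ n x| <= M) -> (forall x, g_ n x @[n --> \oo] --> g x) ->
  \int[mu]_x (v_ n x * g_ n x) @[n --> \oo] --> \int[mu]_x (v x * g x).
Proof.
move=> hv_ hv c mg_ mg b cg.
have l1 n := bmul_L1 (L1B (hv_ n) hv) (mg_ n) (b n).
have l2 n := bmul_L1 hv (mg_ n) (b n).
have E n : \int[mu]_x (v_ n x * g_ n x) = \int[mu]_x ((v_ n x - v x) * g_ n x) + \int[mu]_x (v x * g_ n x).
  by rewrite -(I_D (l1 n) (l2 n)); apply: I_ext => x; ring.
rewrite (eq_cvg _ _ E) -[\int[mu]_x (v x * g x)]add0r; apply: cvgD.
  apply: (@cvg0_le _ _ _ _ _ (fun n => M * \int[mu]_x `|v_ n x - v x|)).
    move=> n; have d := L1_abs (L1B (hv_ n) hv); rewrite -(I_Z M d); apply: I_abs_le => //; first exact: L1Z.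
    by move=> x; rewrite normrM mulrC; apply: ler_wpM2r.
  by apply: cvg0_Zl.
have [] // := @DCT _ _ _ mu (fun n x => v x * g_ n x) (fun x => v x * g x) (fun x => M * `|v x|).
- by move=> n; exact: measurable_funM (L1_meas hv) (mg_ n).
- exact: measurable_funM (L1_meas hv) mg.
- by apply: aeW => x; apply: cvgM => //; exact: cvg_cst.
- exact: L1Z (L1_abs hv).
- by move=> n x; rewrite normrM mulrC; apply: ler_wpM2r.
Qed.

Lemma sectx_meas (g : R * R -> R) (t : R) : mfun g -> mfun (fun x => g (x, t)).
Proof. by move=> mg; apply: (measurableT_comp mg); exact: pair2_measurable. Qed.

Lemma der_seq (k : R -> R) (t l : R) (e : nat -> R) : is_derive t 1 k l -> (forall n, 0 < e n) -> e n @[n --> \oo] --> (0 : R) ->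
  (k t - k (t - e n)) / e n @[n --> \oo] --> l.
Proof.
move=> [dk dl] e0 ce.
have C : (fun h : R => h^-1 *: ((k \o shift t) (h *: (1 : R)) - k t)) @ 0^' --> l by rewrite -dl; exact: dk.
have H : (fun n => - e n) @ \oo --> (0 : R)^'.
  have c0 : (fun n => - e n) @ \oo --> (0 : R) by rewrite -oppr0; exact: cvgN.
  move=> A hA; have : \forall n \near \oo, - e n != 0 -> A (- e n) := c0 _ hA.
  apply: filterS => n; apply.
  by rewrite oppr_eq0 gt_eqF.
have E n : (k t - k (t - e n)) / e n = (- e n)^-1 *: ((k \o shift t) (- e n *: (1 : R)) - k t).
  by rewrite /= /GRing.scale /= mulr1 invrN mulNr -mulrN opprB mulrC (addrC _ t).
rewrite (eq_cvg _ _ E); exact: (@cvg_comp _ _ _ (fun n => - e n) (fun h : R => h^-1 *: ((k \o shift t) (h *: (1 : R)) - k t)) _ _ _ H C).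
Qed.

Lemma cc_bmeas (a b : R) : mfun (fun t : R => (a <= t <= b)%R).
Proof. by apply: measurable_and; exact: measurable_fun_ler. Qed.

Lemma cc_L1 (a b C : R) : L1 mu (fun t : R => C * (a <= t <= b)%R%:R).
Proof.
apply: L1Z; apply: (@L1_le _ _ _ mu _ _ (bool_meas (cc_bmeas a b)) (indic_itv_L1 (`|a| + `|b|))) => t.
rewrite indic_itv ger0_norm// ler_nat; case: (boolP (a <= t <= b)) => //= /andP[h1 h2].
suff -> : `|t| <= `|a| + `|b| by [].
by rewrite ler_norml; have := ler_norm (- a); have := ler_norm b; rewrite normrN; have := normr_ge0 a; have := normr_ge0 b; lra.
Qed.

Section pairing.
Variables (N a b M : R) (g : R * R -> R).
Hypothesis hg : rtest N a b M g.

Lemma pairing_L1 (Z : R -> R -> R) (C : R) : 0 <= C -> mfun (fun z : R * R => Z z.2 z.1) ->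
  (forall t, L1 mu (Z t)) -> (forall t, \int[mu]_x `|Z t x| <= C) ->
  (forall t, `|\int[mu]_x (Z t x * g (x, t))| <= M * C * (a <= t <= b)%R%:R) /\
  L1 mu (fun t => \int[mu]_x (Z t x * g (x, t))).
Proof.
move=> C0 mZ hZ bZ; have [mg gM _ gt] := hg.
have M0 : 0 <= M by exact: le_trans (normr_ge0 _) (gM 0 0).
have B t : `|\int[mu]_x (Z t x * g (x, t))| <= M * C * (a <= t <= b)%R%:R.
  have [_|tab] := boolP (a <= t <= b); last first.
    by rewrite mulr0 I_zero ?normr0// => x; rewrite gt// mulr0.
  rewrite mulr1; apply: le_trans (ler_wpM2l M0 (bZ t)).
  have d := L1_abs (hZ t); rewrite -(I_Z M d); apply: I_abs_le; [exact: bmul_L1 (hZ t) (sectx_meas t mg) (fun x => gM x t)|exact: L1Z|].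
  by move=> x; rewrite normrM mulrC; apply: ler_wpM2r.
split => //; apply: (@L1_le _ _ _ mu _ _ _ (cc_L1 a b (M * C)) B).
have mm : mfun (fun z : R * R => Z z.2 z.1 * g (z.1, z.2)).
  by apply: measurable_funM => //; rewrite (_ : (fun z => g (z.1, z.2)) = g)//; apply/funext => -[].
exact: (@measurable_I1 _ _ _ _ _ mu (fun z : R * R => Z z.2 z.1 * g (z.1, z.2)) mm).
Qed.

End pairing.
End weak_identity.

(** * The limit is a weak solution *)

Section weak_sol.
Context {R : realType}.
Local Notation mu := (@lebesgue_measure R).
Local Notation flap := (fracLap (2^-1 : R)).

Lemma shift_t_meas (c : R) (Z : R * R -> R) : mfun Z -> mfun (fun z : R * R => Z (z.1, z.2 + c)).
Proof.
move=> mZ; apply: (measurableT_comp mZ); apply: measurable_fun_pair => //; by apply: measurable_funD.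
Qed.

Lemma pinv_le (p e X : R) : 0 < p -> e <= p * X -> p^-1 * e <= X.
Proof. by move=> p0 h; rewrite ler_pdivrMl. Qed.

Section sol.
Variable f : R -> R.
Hypothesis hf : Lp f.
Local Notation v := (vj hf).
Local Notation w := (fun t => lgf (ut hf t)).
Local Notation h_ := (fun j => dy (lev hf j) : R).
Local Notation t_ := (fun j => tau (lev hf j) : R).

Let F := \int[mu]_x f x.

Lemma F_ge0 : 0 <= F. Proof. by apply: I_ge0; have [] := hf. Qed.

Lemma v_mass j t : \int[mu]_x `|v j t x| = F.
Proof.
have [_ p] := vj_Lp hf j t.
rewrite (@I_ext _ _ _ mu _ (v j t)); last by move=> x; rewrite ger0_norm.
exact: (U_mass (@dy_gt0 R _) hf).
Qed.

Lemma v_step j t x : 0 <= t -> v j t x - v j (t + t_ j) x = t_ j * Lam (h_ j) (lgf (v j t)) x.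
Proof.
move=> t0; rewrite /vj /ui idxS// US -opprB Sc_Lam ?opprK//; exact: dy_gt0.
Qed.

Lemma t_gt0 j : 0 < t_ j. Proof. exact: tau_gt0. Qed.

Lemma t_le j : t_ j <= dy j.
Proof.
have := @dy_mono R j (lev hf j) (lev_ge hf j); have := @dy_gt0 R (lev hf j); rewrite /tau; lra.
Qed.

Lemma t_cvg : t_ j @[j --> \oo] --> (0 : R).
Proof.
apply: (@cvg0_le _ _ _ _ _ (fun j => dy j)); last exact: dy_cvg.
by move=> j; rewrite gtr0_norm ?t_gt0//; exact: t_le.
Qed.

Section test.
Variables (phi : R * R -> R) (N a b M : R).
Hypotheses (N0 : 0 < N) (a0 : 0 < a) (ab : a <= b) (M0 : 0 < M).
Hypotheses (r1 : rtest N a b M phi) (r2 : rtest N a b M (dt phi)).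
Hypothesis lx : forall x y t, `|phi (x, t) - phi (y, t)| <= M * `|x - y|.
Hypothesis lt : forall x t s, `|phi (x, t) - phi (x, s)| <= M * `|t - s|.
Hypothesis dphi : forall x t : R, is_derive t 1 (fun s => phi (x, s)) (dt phi (x, t)).

(** A backward quotient: the shift t -> t - tau moves the forward time difference of the scheme onto
    the test function. *)
Definition psi_ j (p : R * R) := (phi p - phi (p.1, p.2 - t_ j)) / t_ j.

Lemma psi_meas j : mfun (psi_ j).
Proof.
have [mg _ _ _] := r1; apply: measurable_funM => //; apply: measurable_funB => //.
apply: (measurableT_comp mg); apply: measurable_fun_pair => //.
by apply: measurable_funB.
Qed.

Lemma psi_bnd j x t : `|psi_ j (x, t)| <= M.
Proof.
rewrite /psi_ /= normrM normfV (gtr0_norm (t_gt0 j)) ler_pdivrMr ?t_gt0//.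
by apply: le_trans (lt _ _ _) _; rewrite opprB addrCA subrr addr0 (gtr0_norm (t_gt0 j)).
Qed.

Lemma psi_rtest j : rtest N a (b + 1) M (psi_ j).
Proof.
split; [exact: psi_meas|exact: psi_bnd| |].
  by move=> x t xN; rewrite /psi_ /= !(rt_x r1)// subrr mul0r.
move=> x t; rewrite negb_and -!ltNge => h.
have d1 := le_trans (t_le j) (@dy_le1 R j); have d0 := t_gt0 j.
by rewrite /psi_ /= !(rt_t r1) ?subrr ?mul0r// negb_and -!ltNge; case/orP: h => h; apply/orP; [left|right|left|right]; lra.
Qed.

Lemma psi_cvg x t : psi_ j (x, t) @[j --> \oo] --> dt phi (x, t).
Proof. exact: (der_seq (dphi x t) t_gt0 t_cvg). Qed.

Let p_ j t := \int[mu]_x (v j t x * phi (x, t)).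

Let q_ j t := \int[mu]_x (v j (t + t_ j) x * phi (x, t)).

Definition Aj j t := \int[mu]_x (v j t x * psi_ j (x, t)).

Definition Aw t := \int[mu]_x (ut hf t x * dt phi (x, t)).

Definition Bj j t := Eh (h_ j) (lgf (v j t)) (fun x => phi (x, t)).

Let vphi j s t : L1 mu (fun x => v j s x * phi (x, t)).
Proof.
have [mg bg _ _] := r1; apply: (bmul_L1 (vj_Lp hf j s).1 (sectx_meas t mg)) => x; exact: bg.
Qed.

Let p_L1 j : L1 mu (p_ j).
Proof.
apply: (pairing_L1 r1 F_ge0 (vj_meas2 hf j) (fun t => (vj_Lp hf j t).1) _).2 => t; by rewrite v_mass.
Qed.

Let q_L1 j : L1 mu (q_ j).
Proof.
apply: (pairing_L1 (Z := fun t => v j (t + t_ j)) r1 F_ge0 _ _ _).2.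
- exact: (shift_t_meas (t_ j) (@vj_meas2 R f hf j)).
- by move=> t; exact: (vj_Lp hf j _).1.
- by move=> t; rewrite v_mass.
Qed.

Let AjE j t : Aj j t = (t_ j)^-1 * (p_ j t - q_ j (t - t_ j)).
Proof.
rewrite -(I_B (vphi _ _ _) (vphi _ _ _)) -(I_Z _ (L1B (vphi _ _ _) (vphi _ _ _))).
by apply: I_ext => x; rewrite /psi_ /= subrK; ring.
Qed.

Let BjE j t : Bj j t = (t_ j)^-1 * (p_ j t - q_ j t).
Proof.
have d := t_gt0 j.
rewrite -(I_B (vphi _ _ _) (vphi _ _ _)) -(I_Z _ (L1B (vphi _ _ _) (vphi _ _ _))).
apply: I_ext => x; have [t0|t0] := leP 0 t.
  by rewrite -mulrBl v_step// mulrA mulrA mulVf ?mul1r// gt_eqF.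
have -> : phi (x, t) = 0 by apply: (rt_t r1); rewrite negb_and -!ltNge (lt_trans t0 a0).
by rewrite !mulr0 subrr mulr0.
Qed.

(** Discrete integration by parts: the integral over the whole line is invariant under a shift by
    one time step, and [phi] vanishes at negative times, where the interpolants do not follow the
    scheme. *)
Lemma Aj_int j : \int[mu]_t Aj j t = \int[mu]_t Bj j t.
Proof.
have sq := L1_shift (- t_ j) (q_L1 j).
have -> : \int[mu]_t Aj j t = (t_ j)^-1 * (\int[mu]_t p_ j t - \int[mu]_t q_ j (t - t_ j)).
  by rewrite -(I_B (p_L1 j) sq) -(I_Z _ (L1B (p_L1 j) sq)); apply: I_ext => t; exact: AjE.
rewrite (I_shift (- t_ j) (q_L1 j)) -(I_B (p_L1 j) (q_L1 j)) -(I_Z _ (L1B (p_L1 j) (q_L1 j))).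
by apply: I_ext => t; rewrite BjE.
Qed.

Lemma Bj_meas j : mfun (Bj j).
Proof.
have := L1_meas (L1Z (t_ j)^-1 (L1B (p_L1 j) (q_L1 j))).
by apply: eq_measurable_fun => t _; rewrite BjE.
Qed.

Lemma Aj_bnd j t : `|Aj j t| <= M * F * (a <= t <= b + 1)%R%:R.
Proof.
apply: (pairing_L1 (psi_rtest j) F_ge0 (vj_meas2 hf j) (fun t => (vj_Lp hf j t).1) _).1 => s; by rewrite v_mass.
Qed.

Lemma Aj_meas j : mfun (Aj j).
Proof.
have H s : \int[mu]_x `|v j s x| <= F by rewrite v_mass.
exact: (L1_meas (pairing_L1 (psi_rtest j) F_ge0 (vj_meas2 hf j) (fun t => (vj_Lp hf j t).1) H).2).
Qed.

Lemma Aj_cvg t : Aj j t @[j --> \oo] --> Aw t.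
Proof.
apply: (@cvg_I_mul R (fun j => v j t) (ut hf t) (fun j x => psi_ j (x, t)) (fun x => dt phi (x, t)) M).
- by move=> j; exact: (vj_Lp hf j t).1.
- exact: (ut_Lp hf t).1.
- exact: vj_ut_cvg.
- by move=> j; exact: sectx_meas (psi_meas j).
- by apply: sectx_meas; have [] := r2.
- by move=> j x; exact: psi_bnd.
- by move=> x; exact: psi_cvg.
Qed.

Lemma Aw_int : L1 mu Aw /\ \int[mu]_t Aj j t @[j --> \oo] --> \int[mu]_t Aw t.
Proof.
have mA : mfun Aw by exact: (measurable_fun_cvg Aj_meas (fun t _ => @Aj_cvg t)).
have [] // := @DCT _ _ _ mu Aj Aw (fun t => M * F * (a <= t <= b + 1)%R%:R) Aj_meas mA.
- by apply: aeW => t; exact: Aj_cvg.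
- exact: cc_L1.
- exact: Aj_bnd.
Qed.

Lemma Aw_neg t : t <= 0 -> Aw t = 0.
Proof.
move=> t0; rewrite /Aw I_zero// => x.
by rewrite (rt_t r2) ?mulr0// negb_and -!ltNge (le_lt_trans t0 a0).
Qed.

Lemma phi_E t : [/\ L12 (fun x => phi (x, t)), FE (fun x => phi (x, t)) &
  EE2 (fun x => phi (x, t)) <= 2 * pi * (8 * M * N * M)].
Proof.
apply: lip_FE => //; first by apply: sectx_meas; have [] := r1.
- by move=> x; exact: rt_bnd r1 x t.
- by move=> x xN; exact: rt_x r1 x t xN.
Qed.

Hypothesis fP : L1 mu (fun x => Phi (f x)).

Let P := \int[mu]_x Phi (f x).

Definition Bw t := (0 < t)%R%:R * ((2 * pi)^-1 * EE (w t) (fun x => phi (x, t))).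

(** [phi] vanishes before time a > 0, so on its support the energy bound 2 P / t is at most 2 P /
    a. *)
Lemma Bj_bnd j t : `|Bj j t| <= Num.sqrt (2 * P / a) * Num.sqrt (8 * M * N * M) * (a <= t <= b)%R%:R.
Proof.
have [p1 p2 p3] := phi_E t; have h0 := @dy_gt0 R (lev hf j).
have [/andP[at' tb]|h] := boolP (a <= t <= b); last first.
  rewrite /Bj /Eh I_zero ?normr0 ?mulr0// => x.
  by rewrite (rt_t r1) ?mulr0.
rewrite mulr1; apply: le_trans (Eh_CS h0 (v_L12 hf j t) p1) _.
have t0 := lt_le_trans a0 at'.
apply: ler_pM; [exact: sqrtr_ge0|exact: sqrtr_ge0| |]; apply: ler_wsqrtr.
  apply: le_trans (vj_E hf fP j t0) _; apply: ler_wpM2l.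
    by rewrite mulr_ge0//; apply: I_ge0 => x; apply: Phi_ge0; have [] := hf.
  by rewrite lef_pV2.
apply: le_trans (Eh_le_EE h0 p1 p2) _; apply: pinv_le => //.
by rewrite mulr_gt0// pi_gt0'.
Qed.

Lemma Bj_cvg t : Bj j t @[j --> \oo] --> Bw t.
Proof.
have h0 j := @dy_gt0 R (lev hf j); have [p1 p2 p3] := phi_E t.
rewrite /Bw; have [t0|t0] := ltP 0 t; last first.
  rewrite mul0r; apply: (@cvg0_le _ _ _ _ _ (fun=> 0)); last exact: cvg_cst.
  move=> j; have := Bj_bnd j t; have -> : (a <= t <= b) = false by rewrite leNgt (le_lt_trans t0 a0).
  by rewrite mulr0.
rewrite mul1r (eq_cvg _ _ (fun j => Eh_sl (h0 j) (v_L12 hf j t) p1)).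
apply: cvgM; first exact: cvg_cst.
apply: (@energy_weak _ (fun j => sl (h_ j)) (fun j => lgf (v j t)) (w t) (fun x => phi (x, t)) (2 * pi * (2 * P / t))) => //.
- by move=> j; exact: sl_meas.
- by move=> j xi; exact: sl_bnd.
- by move=> xi; apply: sl_cvg => j; exact: lev_ge.
- by move=> j; exact: v_L12.
- exact: w_L12.
- exact: w_FE.
- exact: w_cvg.
- by move=> j; have [] := sl_L2 (h0 j) (v_L12 hf j t).
- move=> j; have [_ ->] := sl_L2 (h0 j) (v_L12 hf j t).
  by rewrite ler_pM2l ?mulr_gt0// ?pi_gt0'//; exact: vj_E.
Qed.

Lemma Bw_int : L1 mu Bw /\ \int[mu]_t Bj j t @[j --> \oo] --> \int[mu]_t Bw t.
Proof.
have mB : mfun Bw by exact: (measurable_fun_cvg Bj_meas (fun t _ => @Bj_cvg t)).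
have [] // := @DCT _ _ _ mu Bj Bw (fun t => Num.sqrt (2 * P / a) * Num.sqrt (8 * M * N * M) * (a <= t <= b)%R%:R) Bj_meas mB.
- by apply: aeW => t; exact: Bj_cvg.
- exact: cc_L1.
- exact: Bj_bnd.
Qed.

Lemma Aw_Bw : \int[mu]_t Aw t = \int[mu]_t Bw t.
Proof.
have [_ c1] := Aw_int; have [_ c2] := Bw_int.
by rewrite (eq_cvg _ _ Aj_int) in c1; exact: cvg_uniqR c1 c2.
Qed.

Lemma Aw_eint : (\int[mu]_(t in `]0%R, +oo[) \int[mu]_x (uu hf (x, t) * dt phi (x, t))%:E = (\int[mu]_t Aw t)%:E)%E.
Proof.
have [A1 _] := Aw_int; rewrite int_pos -L1_integralE//; apply: eq_integral => t _.
have [t0|t0] := ltP 0 t; last by rewrite Aw_neg.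
have [mg bg _ _] := r2; rewrite L1_integralE//.
by apply: (bmul_L1 (ut_Lp hf t).1 (sectx_meas t mg)) => x; exact: bg.
Qed.

Lemma Bw_eint : (\int[mu]_(t in `]0%R, +oo[) \int[mu]_x (flap (log1p (uu hf) t) x * flap (fun y => phi (y, t)) x)%:E = (\int[mu]_t Bw t)%:E)%E.
Proof.
have [B1 _] := Bw_int; rewrite int_pos -L1_integralE//; apply: eq_integral => t _.
rewrite /Bw; have [t0|t0] := ltP 0 t; last by rewrite mul0r.
have [p1 p2 p3] := phi_E t; have h1 := L12_1 (w_L12 hf t); have h2 := w_FE hf fP t0.
rewrite mul1r -(flap_pair h1 (L12_1 p1) h2 p2) L1_integralE//.
exact: (L2_mul (flap_L2 h1 h2) (flap_L2 (L12_1 p1) p2)).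
Qed.

End test.

Lemma uu_weak (fP : L1 mu (fun x => Phi (f x))) : weak_solution f (uu hf).
Proof.
split.
- split; first by move=> x t _; exact: (ut_Lp hf t).2.
  by apply: measurable_funS (ut_meas2 hf).
- by split; [exact: uu_in_C_L1|move=> T; exact: uu_in_L2_Hdot].
- move=> phi /test_ex[N [a [b [M [[N0 a0 ab M0] [r1 r2 lx lt d]]]]]].
  rewrite (Aw_eint a0 r1 r2 lt d) (Bw_eint N0 a0 M0 r1 lx fP).
  by rewrite (Aw_Bw N0 a0 M0 r1 r2 lx lt d fP) subee.
- exact: ut0.
Qed.

End sol.
End weak_sol.
(** * The time derivative *)

Section hull.
Context d (T : measurableType d) (R : realType).
Variable mu : {measure set T -> \bar R}.

(** The integral is a supremum over the simple functions below the integrand, hence monotone for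
    arbitrary functions. *)
Lemma ge0_le_int (f g : T -> \bar R) : (forall x, 0 <= f x)%E -> (forall x, f x <= g x)%E ->
  (\int[mu]_x f x <= \int[mu]_x g x)%E.
Proof.
move=> f0 fg; rewrite !ge0_integralTE//; last by move=> x; exact: le_trans (fg x).
by apply: le_ereal_sup => _ [k kf <-]; exists k => // x; exact: le_trans (kf x) (fg x).
Qed.

(** Dyadic convex combinations of the tail from [k] on: a set closed under midpoints, ready for the
    parallelogram identity. *)
Inductive hull (Y : nat -> T -> R) (k : nat) : (T -> R) -> Prop :=
| hull_base j : (k <= j)%N -> hull Y k (Y j)
| hull_mid a b : hull Y k a -> hull Y k b -> hull Y k (fun x => 2^-1 * a x + 2^-1 * b x).

Lemma hull_le Y k l z : (k <= l)%N -> hull Y l z -> hull Y k z.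
Proof.
move=> kl; elim=> [j lj|a b _ ha _ hb]; last exact: hull_mid.
by apply: hull_base; exact: leq_trans lj.
Qed.

Lemma parallelogram (a b : T -> R) : L2 mu a -> L2 mu b ->
  \int[mu]_x ((2^-1 * a x + 2^-1 * b x) ^+ 2) =
  (\int[mu]_x (a x ^+ 2)) / 2 + (\int[mu]_x (b x ^+ 2)) / 2 - (\int[mu]_x ((a x - b x) ^+ 2)) / 4.
Proof.
move=> ha hb; have [_ a1] := ha; have [_ b1] := hb; have [_ c1] := L2B ha hb.
have a2 := L1Z 2^-1 a1; have b2 := L1Z 2^-1 b1; have c2 := L1Z 4^-1 c1.
rewrite ![_ / _]mulrC -(I_Z 2^-1 a1) -(I_Z 2^-1 b1) -(I_Z 4^-1 c1) -(I_D a2 b2) -(I_B (L1D a2 b2) c2).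
by apply: I_ext => x; field.
Qed.

(** A weak limit by Mazur's device: elements of almost minimal norm in the hulls of the tails form a
    Cauchy sequence by the parallelogram identity, and a pairing that converges along [Y] has the
    same limit along the hulls. *)
Lemma L2_hull (Y : nat -> T -> R) (C : R) : (forall j, L2 mu (Y j)) -> (forall j, \int[mu]_x (Y j x ^+ 2) <= C) ->
  exists2 y, L2 mu y & forall (G : T -> R) c, L2 mu G ->
    \int[mu]_x (Y j x * G x) @[j --> \oo] --> c -> \int[mu]_x (y x * G x) = c.
Proof.
move=> hY bY.
have hL k z : hull Y k z -> L2 mu z.
  by elim=> [j _|a b _ ha _ hb]; [exact: hY|apply: L2D; exact: L2Z].
pose S k := [set r | exists2 z, hull Y k z & r = \int[mu]_x (z x ^+ 2)].
have sq0 (z : T -> R) : 0 <= \int[mu]_x (z x ^+ 2) by apply: I_ge0 => x; exact: sqr_ge0.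
have S0 k : S k !=set0 by exists (\int[mu]_x (Y k x ^+ 2)), (Y k) => //; exact: hull_base.
have Sl k : has_lbound (S k) by exists 0 => _ [z _ ->]; exact: sq0.
pose D := [set inf (S k) | k in [set: nat]].
have DC : has_ubound D.
  exists C => _ [k _ <-]; apply: le_trans (bY k); apply: ge_inf => //.
  by exists (Y k) => //; exact: hull_base.
have D0 : D !=set0 by exists (inf (S 0%N)), 0%N.
have zz k : exists z, hull Y k z /\ \int[mu]_x (z x ^+ 2) < inf (S k) + hn k.
  by have [_ [z hz ->] lz] := inf_adherent (@hn_gt0 R k) (conj (S0 k) (Sl k)); exists z.
have [z hz] := choice zz.
have z2 k : L2 mu (z k) by exact: hL (hz k).1.
have [||y [y2 cy]] := @L2_complete _ _ _ mu z => //.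
  move=> e e0; have e8 : 0 < e / 8 by rewrite divr_gt0.
  have [_ [K1 _ <-] hK1] := sup_adherent e8 (conj D0 DC).
  have [K2 hK2] := hn_small e8.
  exists (maxn K1 K2) => n m; rewrite !geq_max => /andP[n1 n2] /andP[m1 m2].
  have hn' := hull_le n1 (hz n).1; have hm := hull_le m1 (hz m).1.
  have mid : inf (S K1) <= \int[mu]_x ((2^-1 * z n x + 2^-1 * z m x) ^+ 2).
    by apply: ge_inf => //; exists (fun x => 2^-1 * z n x + 2^-1 * z m x) => //; exact: hull_mid.
  have u1 : inf (S n) <= sup D by apply: ub_le_sup => //; exists n.
  have u2 : inf (S m) <= sup D by apply: ub_le_sup => //; exists m.
  have v1 := hK2 n n2; have v2 := hK2 m m2; have [_ w1] := hz n; have [_ w2] := hz m.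
  move: mid; rewrite (parallelogram (z2 n) (z2 m)).
  move: u1 u2 v1 v2 w1 w2 hK1; clear.
  move: (inf (S n)) (inf (S m)) (inf (S K1)) (sup D) (hn n) (hn m) (\int[mu]_x (z n x ^+ 2)) (\int[mu]_x (z m x ^+ 2)) (\int[mu]_x ((z n x - z m x) ^+ 2)).
  by move=> *; lra.
exists y => // G c G2 hc; apply: (@cvg_uniqR R (fun k => \int[mu]_x (z k x * G x))).
  exact: L2cvg_ip.
apply/cvgrPdist_le => e e0; move/cvgrPdist_le: hc => /(_ _ e0) [K _ hK].
exists K => // k Kk /=.
have {}hz := (hz k).1; elim: hz => [j kj|a b ha ea hb eb]; first by apply: hK => /=; exact: leq_trans kj.
have a1 := L2_mul (hL _ _ ha) G2; have b1 := L2_mul (hL _ _ hb) G2.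
have -> : \int[mu]_x ((2^-1 * a x + 2^-1 * b x) * G x) = 2^-1 * \int[mu]_x (a x * G x) + 2^-1 * \int[mu]_x (b x * G x).
  by rewrite -(I_Z _ a1) -(I_Z _ b1) -(I_D (L1Z _ a1) (L1Z _ b1)); apply: I_ext => x; ring.
move: ea eb; move: (\int[mu]_x (a x * G x)) (\int[mu]_x (b x * G x)) => A B; rewrite !ler_norml.
by move=> /andP[? ?] /andP[? ?]; apply/andP; split; lra.
Qed.

End hull.

(** * The weighted difference quotients *)

Section strong_sol.
Context {R : realType}.
Local Notation mu := (@lebesgue_measure R).
Local Notation mu2 := (@lebesgue_measure R \x @lebesgue_measure R)%E.

Lemma sqrt_diff_sq (a b : R) : 0 <= a -> 0 <= b -> (Num.sqrt a - Num.sqrt b) ^+ 2 <= `|a - b|.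
Proof.
move=> a0 b0; have x0 := sqrtr_ge0 a; have y0 := sqrtr_ge0 b.
rewrite -{2}(sqr_sqrtr a0) -{2}(sqr_sqrtr b0) subr_sqr normrM (ger0_norm (addr_ge0 x0 y0)).
rewrite -[X in X <= _]ger0_norm ?sqr_ge0// normrX expr2; apply: ler_wpM2l => //.
by rewrite ler_norml; lra.
Qed.

Lemma max_diff (u a b : R) : `|u - Num.max a b| <= `|u - a| + `|u - b|.
Proof. by rewrite maxEle; case: ifP => _; rewrite ?lerDl ?lerDr. Qed.

Lemma Y_arith (t d dt X l : R) : 0 < dt -> 0 < X -> 0 <= t -> 0 <= l -> d ^+ 2 <= X * l ->
  (Num.sqrt t * (d / dt) / Num.sqrt X) ^+ 2 <= t / dt ^+ 2 * l.
Proof.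
move=> dt0 X0 t0 l0 h.
rewrite !exprMn !exprVn !sqr_sqrtr ?(ltW X0)// (mulrC (d ^+ 2)) mulrA -mulrA.
apply: ler_wpM2l; first by rewrite mulr_ge0// invr_ge0 sqr_ge0.
by rewrite ler_pdivrMr// mulrC.
Qed.

Section sol.
Variable f : R -> R.
Hypothesis hf : Lp f.
Hypothesis fP : L1 mu (fun x => Phi (f x)).

Let P := \int[mu]_x Phi (f x).

Local Notation v := (vj hf).
Local Notation h_ := (fun j => dy (lev hf j) : R).
Local Notation t_ := (fun j => tau (lev hf j) : R).

Let F := \int[mu]_x f x.

Definition Nj j := (Num.truncn (j%:R / tau (lev hf j) : R)).+1.

Definition dv j (p : R * R) := v j (p.2 + t_ j) p.1 - v j p.2 p.1.

Definition Xj j (p : R * R) := 1 + Num.max (v j p.2 p.1) (v j (p.2 + t_ j) p.1).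

(** Discrete version of sqrt t u_t / sqrt (1 + u). The larger of two successive values stands in the
    denominator, to match the factor 1 + max of [lg_prod_low]; the cut in time leaves finitely many
    steps. *)
Definition Yj j (p : R * R) := (0 <= p.2 < (Nj j)%:R * t_ j)%R%:R * (Num.sqrt p.2 * (dv j p / t_ j) / Num.sqrt (Xj j p)).

Lemma Xj_ge1 j p : 1 <= Xj j p.
Proof. by rewrite /Xj lerDl le_max (vj_Lp hf j _).2. Qed.

Lemma Nj_ge j t : t < j%:R -> t < (Nj j)%:R * t_ j.
Proof. by move=> h; apply: lt_trans h _; rewrite -ltr_pdivrMr ?tau_gt0//; exact: truncnS_gt. Qed.

Lemma vjs_meas j : mfun (fun p : R * R => v j (p.2 + t_ j) p.1).
Proof. exact: (shift_t_meas (t_ j) (@vj_meas2 R f hf j)). Qed.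

Lemma Xj_meas j : mfun (Xj j).
Proof. by apply: measurable_funD => //; apply: measurable_maxr; [exact: vj_meas2|exact: vjs_meas]. Qed.

Lemma sqrt_meas (g : R * R -> R) : mfun g -> mfun (fun p => Num.sqrt (g p)).
Proof. by move=> mg; apply: measurableT_comp mg; apply: continuous_measurable_fun; exact: sqrt_continuous. Qed.

Lemma snd_meas : mfun (fun p : R * R => p.2).
Proof. exact: measurable_snd. Qed.

Lemma inv_meas (g : R * R -> R) : (forall p, 0 <= g p) -> mfun g -> mfun (fun p => (g p)^-1).
Proof.
move=> g0 mg; have -> : (fun p => (g p)^-1) = (fun p => g p `^ (-1)) by apply/funext => p; rewrite powR_inv1.
by apply: (measurableT_comp (measurable_powR _)).
Qed.

Lemma Yj_meas j : mfun (Yj j).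
Proof.
apply: measurable_funM.
  exact: (measurableT_comp (@ico_meas R 0 ((Nj j)%:R * t_ j)) snd_meas).
apply: measurable_funM.
  apply: measurable_funM; first exact: sqrt_meas snd_meas.
  by apply: measurable_funM => //; apply: measurable_funB; [exact: vjs_meas|exact: vj_meas2].
by apply: inv_meas; [move=> p; exact: sqrtr_ge0|apply: sqrt_meas; exact: Xj_meas].
Qed.

Let dn j n := diss (h_ j) f n.

Lemma Yj_sect j t : L1 mu (fun x => Yj j (x, t) ^+ 2) /\
  \int[mu]_x (Yj j (x, t) ^+ 2) <= (0 <= t < (Nj j)%:R * t_ j)%R%:R * ((idx (lev hf j) t).+1%:R / t_ j * dn j (idx (lev hf j) t)).
Proof.
have h0 := @dy_gt0 R (lev hf j); have d0 := @tau_gt0 R (lev hf j).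
have mY : mfun (fun x => Yj j (x, t) ^+ 2).
  by apply: measurable_funX; exact: sectx_meas (@Yj_meas j).
have [/andP[t0 tN]|/negbTE hn] := boolP (0 <= t < (Nj j)%:R * t_ j); last first.
  have E : (fun x => Yj j (x, t) ^+ 2) = (fun=> 0) by apply/funext => x; rewrite /Yj /= hn mul0r expr0n.
  by rewrite E mul0r I_0; split => //; exact: L1_0.
set n := idx _ t; have [_ _ L] := dud_L1 h0 (U_Lp h0 hf n).
have c0 : 0 <= n.+1%:R / t_ j by rewrite divr_ge0 ?(ltW d0).
have b x : Yj j (x, t) ^+ 2 <= n.+1%:R / t_ j * ((lgf (Sc (h_ j) (U (h_ j) f n)) x - lgf (U (h_ j) f n) x) * (Sc (h_ j) (U (h_ j) f n) x - U (h_ j) f n x)).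
  have e1 : v j (t + t_ j) x = Sc (h_ j) (U (h_ j) f n) x by rewrite /vj /ui idxS.
  have e2 : v j t x = U (h_ j) f n x by [].
  have a0 := (vj_Lp hf j t).2 x; have b0 := (vj_Lp hf j (t + t_ j)).2 x.
  have l0 := lg_prod_ge0 b0 a0; have ll := lg_prod_low b0 a0.
  rewrite /Yj /= t0 tN mul1r.
  apply: le_trans (Y_arith d0 (lt_le_trans ltr01 (Xj_ge1 j (x, t))) t0 l0 _) _.
    by rewrite /dv /Xj /= maxC.
  rewrite e1 e2; apply: ler_wpM2r; first by move: l0; rewrite e1 e2.
  rewrite expr2 invfM mulrA; apply: ler_wpM2r; first by rewrite invr_ge0 ltW.
  rewrite ler_pdivrMr// -natr1 mulrDl mul1r; have /andP[_ h] := idx_itv (lev hf j) t0; exact: ltW.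
have L' := L1Z (n.+1%:R / t_ j) L.
have LY : L1 mu (fun x => Yj j (x, t) ^+ 2).
  apply: (@L1_le _ _ _ mu _ _ mY L') => x; rewrite ger0_norm; [exact: b|exact: sqr_ge0].
split => //; rewrite mul1r; apply: le_trans (I_le LY L' b) _.
by rewrite (I_Z _ L) /dn /diss US.
Qed.

(** Since t <= (n + 1) tau during step n, that step contributes at most (n + 1) times its
    dissipation, and [U_diss] sums these. *)
Lemma Yj_L2 j : L2 mu2 (Yj j) /\ \int[mu2]_p (Yj j p ^+ 2) <= 4 * P.
Proof.
have h0 := @dy_gt0 R (lev hf j); have d0 := @tau_gt0 R (lev hf j).
have en n : 0 <= n.+1%:R / t_ j * dn j n.
  by apply: mulr_ge0; [rewrite divr_ge0 ?(ltW d0)|exact: diss_ge0].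
have [S1 S2] := @step_int R (t_ j) (fun n => n.+1%:R / t_ j * dn j n) (Nj j) d0 en.
have mY2 : mfun (fun p => Yj j p ^+ 2) by apply: measurable_funX; exact: Yj_meas.
have L : L1 mu2 (fun p => Yj j p ^+ 2).
  apply: (@L1_prod2 _ _ _ _ _ mu mu (fun p => Yj j p ^+ 2) _ mY2 _ _ S1).
    by move=> t; have [] := Yj_sect j t.
  move=> t; have [_ /(le_trans _)] := Yj_sect j t; apply.
  rewrite (@I_ext _ _ _ mu (fun x => `|Yj j (x, t) ^+ 2|) (fun x => Yj j (x, t) ^+ 2)); first by [].
  by move=> x; rewrite ger0_norm// sqr_ge0.
split; first by split => //; exact: Yj_meas.
rewrite (I_prod2 L); apply: le_trans (I_le (L1_I1 L) S1 _) _.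
  by move=> t; have [_ ] := Yj_sect j t.
rewrite S2 mulr_sumr; have := U_diss h0 hf (Nj j) fP; apply: le_trans.
by apply: ler_sum => n _; rewrite /dn mulrA mulrCA mulfV ?mulr1// gt_eqF.
Qed.

End sol.
End strong_sol.

(** * Identification of the time derivative *)

Section strong_sol.
Context {R : realType}.
Local Notation mu := (@lebesgue_measure R).
Local Notation mu2 := (@lebesgue_measure R \x @lebesgue_measure R)%E.

Lemma G_arith (s1 s2 p t a M A : R) : 0 < a -> a <= t -> `|p| <= M -> (s1 - s2) ^+ 2 <= A ->
  ((s1 - s2) * p / Num.sqrt t) ^+ 2 <= M ^+ 2 / a * A.
Proof.
move=> a0 at' pM h; have t0 := lt_le_trans a0 at'.
rewrite !exprMn exprVn sqr_sqrtr ?(ltW t0)// -mulrA mulrC; apply: ler_pM => //.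
- by rewrite mulr_ge0 ?sqr_ge0// invr_ge0 ltW.
- exact: sqr_ge0.
apply: ler_pM; rewrite ?sqr_ge0// ?invr_ge0 ?(ltW t0)//; last by rewrite lef_pV2.
by rewrite -real_normK ?num_real// lerXn2r// nnegrE (le_trans (normr_ge0 _) pM).
Qed.

Lemma pair_arith (s x d l p u : R) : 0 < s -> 0 < x -> 0 < d -> u = - (d * l) ->
  (s * (u / d) / x) * (x * p / s) = - (l * p).
Proof.
move=> s0 x0 d0 ->; have ds : d / d = 1 by rewrite divff// gt_eqF.
have ss : s / s = 1 by rewrite divff// gt_eqF.
have xs : x / x = 1 by rewrite divff// gt_eqF.
have -> : s * (- (d * l) / d) / x * (x * p / s) = - (l * p) * (d / d) * (s / s) * (x / x) by ring.
by rewrite ds ss xs !mulr1.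
Qed.

Lemma close_arith (A B C D e z : R) : 0 < e -> A <= 2 * z -> B <= 2 * z -> C <= e / 4 -> z <= e / 8 -> D <= C + B -> A + D <= e.
Proof. by lra. Qed.

Section test.
Variables (phi : R * R -> R) (N a b M : R).
Hypotheses (N0 : 0 < N) (a0 : 0 < a) (r1 : rtest N a b M phi).

(** Undoes the weight of [Yj]: if [A] is the larger of two successive values, the product with [Yj]
    is the difference quotient times [phi]. With [A] = u it is the factor that goes with the weak
    limit. *)
Definition GA (A : R * R -> R) (p : R * R) := Num.sqrt (1 + A p) * phi p / Num.sqrt p.2.

Lemma GA_meas A : mfun A -> mfun (GA A).
Proof.
move=> mA; have [mp _ _ _] := r1; apply: measurable_funM; last first.
  by apply: inv_meas; [move=> p; exact: sqrtr_ge0|exact: sqrt_meas (@snd_meas R)].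
by apply: measurable_funM => //; apply: sqrt_meas; apply: measurable_funD.
Qed.

Lemma GA_diff_sq A B x t : (forall p, 0 <= A p) -> (forall p, 0 <= B p) ->
  (GA A (x, t) - GA B (x, t)) ^+ 2 <= (a <= t <= b)%R%:R * (M ^+ 2 / a * `|A (x, t) - B (x, t)|).
Proof.
move=> A0 B0; rewrite /GA; have [/andP[at' _]|h] := boolP (a <= t <= b); last first.
  by rewrite (rt_t r1)// !mulr0 !mul0r subrr expr0n.
rewrite mul1r -!mulrBl; apply: G_arith => //; first exact: rt_bnd r1 x t.
have d : `|A (x, t) - B (x, t)| = `|(1 + A (x, t)) - (1 + B (x, t))| by congr (`|_|); ring.
by rewrite d; apply: sqrt_diff_sq; rewrite addr_ge0.
Qed.

Lemma GA_sq A x t : (forall p, 0 <= A p) ->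
  GA A (x, t) ^+ 2 <= (a <= t <= b)%R%:R * (M ^+ 2 / a * (\1_(`[- N, N]%classic) x + A (x, t))).
Proof.
move=> A0; rewrite /GA; have [/andP[at' _]|h] := boolP (a <= t <= b); last first.
  by rewrite (rt_t r1)// !mulr0 !mul0r expr0n.
rewrite mul1r indic_itv; have [xN|xN] := leP `|x| N; last first.
  by rewrite (rt_x r1)// mulr0 mul0r expr0n /= mulr_ge0 ?addr_ge0 ?A0// divr_ge0 ?sqr_ge0// ltW.
have := @G_arith (Num.sqrt (1 + A (x, t))) 0 (phi (x, t)) t a M (1 + A (x, t)) a0 at' (rt_bnd r1 x t).
by rewrite subr0 sqr_sqrtr ?addr_ge0 ?A0//; apply.
Qed.

Lemma GA_L2 (A : R * R -> R) (C : R) : mfun A -> (forall p, 0 <= A p) -> (forall t, L1 mu (fun x => A (x, t))) ->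
  (forall t, \int[mu]_x A (x, t) <= C) -> L2 mu2 (GA A).
Proof.
move=> mA A0 LA AC; have mG := GA_meas mA; split => //.
have c0 : 0 <= M ^+ 2 / a by rewrite divr_ge0 ?sqr_ge0// ltW.
have L t : L1 mu (fun x => (a <= t <= b)%R%:R * (M ^+ 2 / a * (\1_(`[- N, N]%classic) x + A (x, t)))).
  by apply: L1Z; apply: L1Z; apply: L1D => //; exact: indic_itv_L1.
have LG t : L1 mu (fun x => GA A (x, t) ^+ 2).
  apply: (@L1_le _ _ _ mu _ _ _ (L t)); first by apply: measurable_funX; exact: sectx_meas.
  by move=> x; rewrite ger0_norm ?sqr_ge0//; exact: GA_sq.
apply: (@L1_prod2 _ _ _ _ _ mu mu (fun p => GA A p ^+ 2) (fun t => M ^+ 2 / a * (2 * N + C) * (a <= t <= b)%R%:R)) => //.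
- exact: measurable_funX.
- move=> t; rewrite (I_to (fun x => GA A (x, t) ^+ 2)); last by move=> x; rewrite ger0_norm// sqr_ge0.
  apply: le_trans (I_le (LG t) (L t) (fun x => GA_sq x t A0)) _.
  have i1 := indic_itv_L1 N; have L' := L1D i1 (LA t).
  rewrite (I_Z _ (L1Z _ L')) (I_Z _ L') (I_D i1 (LA t)) indic_itv_I ?(ltW N0)// mulrC.
  by apply: ler_wpM2r => //; apply: ler_wpM2l => //; rewrite lerD2l.
- exact: cc_L1.
Qed.

Lemma GA_diff_I (A B : R * R -> R) (e : R) : mfun A -> mfun B -> (forall p, 0 <= A p) -> (forall p, 0 <= B p) ->
  (forall t, L1 mu (fun x => A (x, t))) -> (forall t, L1 mu (fun x => B (x, t))) ->
  (forall t, a <= t <= b -> \int[mu]_x `|A (x, t) - B (x, t)| <= e) ->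
  L1 mu2 (fun p => (GA A p - GA B p) ^+ 2) ->
  \int[mu2]_p ((GA A p - GA B p) ^+ 2) <= M ^+ 2 / a * e * \int[mu]_t ((a <= t <= b)%R%:R : R).
Proof.
move=> mA mB A0 B0 LA LB h LG; rewrite (I_prod2 LG).
have c0 : 0 <= M ^+ 2 / a by rewrite divr_ge0 ?sqr_ge0// ltW.
have L t : L1 mu (fun x => (a <= t <= b)%R%:R * (M ^+ 2 / a * `|A (x, t) - B (x, t)|)).
  by apply: L1Z; apply: L1Z; exact: L1_abs (L1B (LA t) (LB t)).
have mG : mfun (fun p => (GA A p - GA B p) ^+ 2).
  by apply: measurable_funX; apply: measurable_funB; exact: GA_meas.
have LG1 t : L1 mu (fun x => (GA A (x, t) - GA B (x, t)) ^+ 2).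
  apply: (@L1_le _ _ _ mu _ _ _ (L t)); first exact: sectx_meas t mG.
  by move=> x; rewrite ger0_norm ?sqr_ge0//; exact: GA_diff_sq.
have c1 : L1 mu (fun t : R => ((a <= t <= b)%R%:R : R)).
  by apply: L1_ext (cc_L1 a b 1) => t; rewrite mul1r.
rewrite -(I_Z _ c1); apply: I_le; [exact: L1_I1 LG|exact: L1Z|] => t.
apply: le_trans (I_le (LG1 t) (L t) (fun x => GA_diff_sq x t A0 B0)) _.
have d := L1_abs (L1B (LA t) (LB t)).
rewrite (I_Z _ (L1Z _ d)) (I_Z _ d); have [tab|_] := boolP (a <= t <= b); last by rewrite mul0r mulr0.
by rewrite mul1r mulr1; apply: ler_wpM2l => //; exact: h.
Qed.

End test.
Section sol.
Variable f : R -> R.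
Hypothesis hf : Lp f.
Hypothesis fP : L1 mu (fun x => Phi (f x)).

Let P := \int[mu]_x Phi (f x).

Local Notation v := (vj hf).
Local Notation t_ := (fun j => tau (lev hf j) : R).

Let F := \int[mu]_x f x.

Lemma ut_mass t : \int[mu]_x ut hf t x = F.
Proof.
apply: (@cvg_uniqR R (fun j => \int[mu]_x v j t x)); last first.
  have E j : \int[mu]_x v j t x = F by exact: (U_mass (@dy_gt0 R _) hf).
  by rewrite (eq_cvg _ _ E); exact: cvg_cst.
apply: (@cvg_le _ _ _ _ _ (fun j => \int[mu]_x `|v j t x - ut hf t x|)); last exact: vj_ut_cvg.
move=> j; have [v1 _] := vj_Lp hf j t; have [u1 _] := ut_Lp hf t.
by rewrite -(I_B v1 u1); apply: I_abs; exact: L1B.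
Qed.

Definition Mj j (p : R * R) := Num.max (v j p.2 p.1) (v j (p.2 + t_ j) p.1).

Lemma Mj_meas j : mfun (Mj j).
Proof. by apply: measurable_maxr; [exact: vj_meas2|exact: vjs_meas]. Qed.

Lemma Mj_ge0 j p : 0 <= Mj j p.
Proof. by rewrite /Mj le_max (vj_Lp hf j _).2. Qed.

Lemma Mj_L1 j t : L1 mu (fun x => Mj j (x, t)) /\ \int[mu]_x Mj j (x, t) <= F + F.
Proof.
have [v1 v0] := vj_Lp hf j t; have [w1 w0] := vj_Lp hf j (t + t_ j).
have b x : Mj j (x, t) <= v j t x + v j (t + t_ j) x by rewrite /Mj /= ge_max lerDl lerDr v0 w0.
have L : L1 mu (fun x => Mj j (x, t)).
  apply: (@L1_le _ _ _ mu _ _ _ (L1D v1 w1)); first exact: sectx_meas t (@Mj_meas j).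
  by move=> x; rewrite ger0_norm ?Mj_ge0.
split => //; apply: le_trans (I_le L (L1D v1 w1) b) _; rewrite (I_D v1 w1).
by rewrite /vj /ui !(U_mass (@dy_gt0 R _) hf).
Qed.

Lemma Mj_close (b e : R) : 0 < e -> exists J, forall j, (J <= j)%N -> forall t, 0 <= t <= b ->
  \int[mu]_x `|ut hf t x - Mj j (x, t)| <= e.
Proof.
move=> e0; have e4 : 0 < e / 4 by rewrite divr_gt0.
have e8 : 0 < e / 8 by rewrite divr_gt0.
have [d d0 hd] := ut_unif hf e4.
have [n0 hn0] := @nat_ex R (b + 1); have [n1 h1] := @dy_small R _ e8; have [n2 h2] := @dy_small R _ d0.
exists (maxn n0 (maxn n1 n2)) => j; rewrite !geq_max => /and3P[j0 j1 j2] t /andP[t0 tb].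
have tj := t_le hf j; have tp := @tau_gt0 R (lev hf j); have dj1 := @dy_le1 R j.
have jn : b + 1 <= j%:R by apply: le_trans hn0 _; rewrite ler_nat.
have tl : t <= j%:R by lra.
have sl' : t + t_ j <= j%:R by lra.
have [[u1 _] r1] := ut_rate hf tl; have [[w1 _] r2] := ut_rate hf sl'.
have [v1 _] := vj_Lp hf j t; have [x1 _] := vj_Lp hf j (t + t_ j).
have st : t <= t + t_ j by rewrite lerDl ltW.
have sd : t + t_ j <= t + d by rewrite lerD2l (le_trans tj)// h2.
have r3 := hd _ _ t0 st sd.
have Lm := (Mj_L1 j t).1.
have g1 := L1_abs (L1B u1 v1); have g2 := L1_abs (L1B u1 x1).
apply: (@le_trans _ _ (\int[mu]_x `|ut hf t x - v j t x| + \int[mu]_x `|ut hf t x - v j (t + t_ j) x|)).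
  rewrite -(I_D g1 g2); apply: I_le; [exact: L1_abs (L1B u1 Lm)|exact: L1D|].
  by move=> x; exact: max_diff.
have r4 := Idist_tri u1 w1 x1; have d8 := h1 j j1.
rewrite (Idist_sym (v j t)) in r1; rewrite (Idist_sym (v j _)) in r2; rewrite Idist_sym in r3.
exact: close_arith e0 r1 r2 r3 d8 r4.
Qed.

Lemma uu_L1 t : L1 mu (fun x => uu hf (x, t)). Proof. exact: (ut_Lp hf t).1. Qed.

Lemma uu_ge0 p : 0 <= uu hf p. Proof. exact: (ut_Lp hf _).2. Qed.

Section test.
Variables (phi : R * R -> R) (N a b M : R).
Hypotheses (N0 : 0 < N) (a0 : 0 < a) (ab : a <= b) (M0 : 0 < M).
Hypotheses (r1 : rtest N a b M phi) (r2 : rtest N a b M (dt phi)).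
Hypothesis lt : forall x t s, `|phi (x, t) - phi (x, s)| <= M * `|t - s|.
Hypothesis dphi : forall x t : R, is_derive t 1 (fun s => phi (x, s)) (dt phi (x, t)).

Lemma GAu_L2 : L2 mu2 (GA phi (uu hf)).
Proof.
apply: (GA_L2 N0 a0 r1 (ut_meas2 hf) uu_ge0 uu_L1 (C := F)) => t.
by rewrite (ut_mass t).
Qed.

Lemma GAj_L2 j : L2 mu2 (GA phi (Mj j)).
Proof. exact: (GA_L2 N0 a0 r1 (@Mj_meas j) (@Mj_ge0 j) (fun t => (Mj_L1 j t).1) (fun t => (Mj_L1 j t).2)). Qed.

Lemma Yj_GAj j : b < j%:R -> \int[mu2]_p (Yj hf j p * GA phi (Mj j) p) = - \int[mu]_t Aj hf phi j t.
Proof.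
move=> bj; have [Y2 _] := Yj_L2 hf fP j; have L := L2_mul Y2 (GAj_L2 j).
have d0 := @tau_gt0 R (lev hf j).
rewrite (I_prod2 L) (Aj_int hf a0 r1).
have E t : \int[mu]_x (Yj hf j (x, t) * GA phi (Mj j) (x, t)) = - Bj hf phi j t.
  have [mp bp _ _] := r1.
  have LL := bmul_L1 (L12_1 (Lam_L12 (@dy_gt0 R (lev hf j)) (v_L12 hf j t))) (sectx_meas t mp) (fun x => bp x t).
  rewrite /Bj /Eh -(I_N LL); apply: I_ext => x; have [/andP[at' tb]|h] := boolP (a <= t <= b); last first.
    by rewrite /GA (rt_t r1)// !mulr0 mul0r mulr0 oppr0.
  have t0 := lt_le_trans a0 at'.
  rewrite /Yj /GA /= (ltW t0) (Nj_ge hf (le_lt_trans tb bj)) /= mul1r; apply: pair_arith => //.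
  - by rewrite sqrtr_gt0.
  - by rewrite sqrtr_gt0; exact: lt_le_trans ltr01 (Xj_ge1 hf j (x, t)).
  - by rewrite -(v_step hf j x (ltW t0)) /dv /= opprB.
have LB : L1 mu (Bj hf phi j) by apply: L1_ext (L1N (L1_I1 L)) => t; rewrite E opprK.
by rewrite -(I_N LB); apply: I_ext => t; exact: E.
Qed.

(** The multiplier of the limit is exchanged for the discrete one. They are close in L^2, because
    |sqrt a - sqrt b|^2 <= |a - b| turns L^1 closeness into L^2 closeness. *)
Lemma Yj_GAu_cvg : \int[mu2]_p (Yj hf j p * GA phi (uu hf) p) @[j --> \oo] --> - \int[mu]_t Aw hf phi t.
Proof.
have [_ cA] := Aw_int hf r1 r2 lt dphi.
have Y2 j := (Yj_L2 hf fP j).1; have LB j := L2B GAu_L2 (GAj_L2 j).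
have E j : \int[mu2]_p (Yj hf j p * GA phi (uu hf) p) = \int[mu2]_p (Yj hf j p * GA phi (Mj j) p) +
  \int[mu2]_p (Yj hf j p * (GA phi (uu hf) p - GA phi (Mj j) p)).
  rewrite -(I_D (L2_mul (Y2 j) (GAj_L2 j)) (L2_mul (Y2 j) (LB j))).
  by apply: I_ext => p; ring.
rewrite (eq_cvg _ _ E) -[- \int[mu]_t Aw hf phi t]addr0; apply: cvgD.
  have H : \forall j \near \oo, - (\int[mu]_t Aj hf phi j t) = \int[mu2]_p (Yj hf j p * GA phi (Mj j) p).
    have [n0 hn0] := @nat_ex R (b + 1); exists n0 => // j /= nj; apply/esym; apply: Yj_GAj.
    by have : (n0%:R : R) <= j%:R by [rewrite ler_nat]; lra.
  exact: (cvg_trans (near_eq_cvg H) (cvgN cA)).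
apply/cvg0P => e e0.
have P0 : 0 <= P by apply: I_ge0 => x; apply: Phi_ge0; have [] := hf.
pose K := \int[mu]_t ((a <= t <= b)%R%:R : R).
have K0 : 0 <= K by apply: I_ge0.
pose c := 4 * P * (M ^+ 2 / a * K).
have c0 : 0 <= c.
  by apply: mulr_ge0; [exact: mulr_ge0|apply: mulr_ge0 => //; rewrite divr_ge0 ?sqr_ge0// ltW].
have c1 : 0 < c + 1 by rewrite ltr_pwDr.
have e1 : 0 < e ^+ 2 / (c + 1) by rewrite divr_gt0// exprn_gt0.
have [J hJ] := Mj_close b e1; exists J => j Jj.
apply: le_trans (CS_abs (Y2 j) (LB j)) _.
have hJ' t : a <= t <= b -> \int[mu]_x `|uu hf (x, t) - Mj j (x, t)| <= e ^+ 2 / (c + 1).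
  by move=> /andP[h1 h2]; apply: hJ => //; rewrite h2 (le_trans (ltW a0) h1).
have d := @GA_diff_I phi N a b M a0 r1 (uu hf) (Mj j) _ (ut_meas2 hf) (@Mj_meas j) uu_ge0 (@Mj_ge0 j) uu_L1 (fun t => (Mj_L1 j t).1) hJ' (LB j).2.
rewrite -sqrtrM; last by apply: I_ge0 => p; exact: sqr_ge0.
rewrite -(ger0_norm (ltW e0)) -sqrtr_sqr; apply: ler_wsqrtr.
apply: (@le_trans _ _ (4 * P * (M ^+ 2 / a * (e ^+ 2 / (c + 1)) * K))).
  apply: ler_pM; [by apply: I_ge0 => p; exact: sqr_ge0|by apply: I_ge0 => p; exact: sqr_ge0|exact: (Yj_L2 hf fP j).2|].
  exact: d.
have -> : 4 * P * (M ^+ 2 / a * (e ^+ 2 / (c + 1)) * K) = c / (c + 1) * e ^+ 2.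
  by rewrite /c; move: (c + 1) => z; rewrite (mulrC (e ^+ 2)) ![_ / a]mulrC; ring.
by rewrite ler_piMl ?sqr_ge0// ler_pdivrMr// mul1r lerDl.
Qed.

End test.

Lemma compact_rect (K : set (R * R)) : compact K -> K `<=` half_plane -> exists N a b : R, [/\ 0 < N, 0 < a, a <= b &
  forall x t, K (x, t) -> `|x| <= N /\ a <= t <= b].
Proof.
move=> cK Kh; have : supported_in_half_plane (\1_K : R * R -> R).
  by exists K; split => // p nK; rewrite indicE memNset.
move=> /supp_rect[N [a [b [N0 a0 ab [sx st]]]]]; exists N, a, b; split => // x t Kp.
have k1 : \1_K (x, t) = 1 :> R by rewrite indicE mem_set.
split.
  by rewrite leNgt; apply/negP => /(sx x t)/eqP; rewrite k1 oner_eq0.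
by apply/negPn/negP => /(st x t)/eqP; rewrite k1 oner_eq0.
Qed.

Lemma uu_strong : exists2 w, L1loc_half_plane w & is_weak_dt (uu hf) w.
Proof.
have [Y Y2 hY] := @L2_hull _ _ R mu2 (Yj hf) (4 * P) (fun j => (Yj_L2 hf fP j).1) (fun j => (Yj_L2 hf fP j).2).
pose s (p : R * R) := Num.sqrt (1 + uu hf p) / Num.sqrt p.2.
have ms : mfun s.
  apply: measurable_funM; last by apply: inv_meas; [move=> p; exact: sqrtr_ge0|exact: sqrt_meas (@snd_meas R)].
  by apply: sqrt_meas; apply: measurable_funD => //; exact: ut_meas2.
have mw : mfun (fun p => Y p * s p) by apply: measurable_funM => //; exact: L2_meas Y2.
exists (fun p => Y p * s p).
  split; first exact: measurable_funS mw.
  move=> K cK Kh; have [N [a [b [N0 a0 ab hK]]]] := compact_rect cK Kh.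
  (* The indicator of a rectangle that contains K: on K the function [GA phi] of u is sqrt (1 + u) /
     sqrt t, and [GAu_L2] makes it square integrable. *)
  pose phi (p : R * R) : R := \1_(`[- N, N]%classic) p.1 * (a <= p.2 <= b)%R%:R.
  have mphi : mfun phi.
    apply: measurable_funM; first exact: (measurableT_comp (@indic_meas R N) measurable_fst).
    exact: (measurableT_comp (bool_meas (@cc_bmeas R a b)) measurable_snd).
  have r1 : rtest N a b 1 phi.
    split => //.
    - move=> x t; rewrite /phi /= indic_itv normrM; case: (`|x| <= N); case: (a <= t <= b); rewrite ?normr0 ?normr1 ?mul0r ?mulr0 ?mulr1//.
    - by move=> x t xN; rewrite /phi /= indic_itv leNgt xN mul0r.
    - by move=> x t /negbTE h; rewrite /phi /= h mulr0.
  have G2 := GAu_L2 N0 a0 r1.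
  have L := L1_abs (L2_mul Y2 G2).
  rewrite integral_mkcond; apply: le_lt_trans (_ : (\int[mu2]_p (`|Y p * GA phi (uu hf) p|%:E) < +oo)%E).
    apply: ge0_le_int => p; first by rewrite patchE; case: ifP => // _; rewrite lee_fin.
    rewrite patchE; case: ifPn => [/set_mem Kp|_]; last by rewrite lee_fin.
    rewrite lee_fin; have := hK p.1 p.2; case: p Kp => x t Kp /= /(_ Kp)[h1 h2].
    have -> : GA phi (uu hf) (x, t) = s (x, t) by rewrite /GA /phi /s /= indic_itv h1 h2 !mulr1.
    by [].
  by rewrite L1_integralE// ltry.
move=> phi [cphi sphi]; have C1 : C01_half_plane phi by split => //; exact: cphi.
have [N [a [b [M [[N0 a0 ab M0] [r1 r2 lx lt d]]]]]] := test_ex C1.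
rewrite (Aw_eint hf a0 r1 r2 lt d).
have G2 := GAu_L2 N0 a0 r1; have L := L2_mul Y2 G2.
have E p : Y p * s p * phi p = Y p * GA phi (uu hf) p by rewrite /GA /s; ring.
have I1 := hY _ _ G2 (Yj_GAu_cvg N0 a0 r1 r2 lt d).
suff -> : (\int[mu]_(t in `]0%R, +oo[) \int[mu]_x (Y (x, t) * s (x, t) * phi (x, t))%:E = (- \int[mu]_t Aw hf phi t)%:E)%E.
  by rewrite -EFinN opprK.
rewrite -I1 -(L1_integralE L) -(integral21_prod_meas1 L) int_pos; apply: eq_integral => t _.
have [t0|t0] := ltP 0 t; first by apply: eq_integral => x _; rewrite E.
rewrite /fubini_G /= integral0_eq// => x _.
by rewrite /GA (rt_t r1) ?mulr0 ?mul0r ?mulr0// negb_and -!ltNge (le_lt_trans t0 a0).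
Qed.

Lemma uu_strong_solution : strong_solution f (uu hf).
Proof. by split; [exact: uu_weak|exact: uu_strong]. Qed.

End sol.
End strong_sol.
Import HBNNSimple.
(** * Uniqueness *)

Section ae_int.
Context d (T : measurableType d) (R : realType).
Variable mu : {measure set T -> \bar R}.

Lemma ae_imp (P Q : T -> Prop) : (forall x, P x -> Q x) -> {ae mu, forall x, P x} -> {ae mu, forall x, Q x}.
Proof. by move=> h; apply: filterS. Qed.

Lemma ae_imp2 (P Q S : T -> Prop) : (forall x, P x -> Q x -> S x) -> {ae mu, forall x, P x} -> {ae mu, forall x, Q x} -> {ae mu, forall x, S x}.
Proof. by move=> h; apply: filterS2. Qed.

(** Stated for arbitrary functions because [fracLap] is chosen separately at each time, which gives
    no measurability in time. A simple function below [f] is set to 0 on the exceptional null set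
    without changing its integral. *)
Lemma ae_le_int (f g : T -> \bar R) : (forall x, 0 <= f x)%E -> (forall x, 0 <= g x)%E ->
  {ae mu, forall x, (f x <= g x)%E} -> (\int[mu]_x f x <= \int[mu]_x g x)%E.
Proof.
move=> f0 g0 [A [mA A0 hA]]; rewrite ge0_integralTE//.
apply: ge_ereal_sup => _ [h hf <-]; rewrite -integralT_nnsfun.
have E : (\int[mu]_x (h x)%:E = \int[mu]_x (h x * \1_(~` A) x)%:E)%E.
  apply: ae_eq_integral => //.
  - exact/measurable_EFinP.
  - by apply/measurable_EFinP; apply: measurable_funM => //; apply: measurable_indic; exact: measurableC.
  - exists A; split => // x /= nx; apply: contrapT => nA; apply: nx => _.
    by rewrite indicE mem_set// mulr1.
rewrite E; apply: ge0_le_int => x.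
  by rewrite lee_fin mulr_ge0// indicE.
rewrite indicE; case: (boolP (x \in ~` A)) => [/set_mem nA|_]; last by rewrite mulr0.
rewrite mulr1; apply: le_trans (hf x) _; apply: contrapT => h'; exact/nA/hA.
Qed.

Lemma ae_eq_int (f g : T -> \bar R) : {ae mu, forall x, f x = g x} -> (\int[mu]_x f x = \int[mu]_x g x)%E.
Proof.
move=> fg; rewrite integralE [RHS]integralE; congr (_ - _)%E; apply/eqP; rewrite eq_le; apply/andP; split.
- by apply: ae_le_int => //; apply: filterS fg => x; rewrite !funeposE => ->.
- by apply: ae_le_int => //; apply: filterS fg => x; rewrite !funeposE => ->.
- by apply: ae_le_int => //; apply: filterS fg => x; rewrite !funenegE => ->.
- by apply: ae_le_int => //; apply: filterS fg => x; rewrite !funenegE => ->.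
Qed.

End ae_int.

(** * Measurable curves of finite energy *)

Section paths.
Context {R : realType}.
Local Notation mu := (@lebesgue_measure R).

Definition jm (Z : R -> R -> R) := mfun (fun z : R * R => Z z.2 z.1).

Lemma hart_meas2 Z : jm Z -> mfun (fun p : R * R => hart (Z p.2) p.1).
Proof.
move=> mZ.
have m1 : mfun (fun q : R * (R * R) => (q.1, q.2.2)).
  apply: measurable_fun_pair; first exact: measurable_fst.
  exact: (measurableT_comp measurable_snd measurable_snd).
have m2 : mfun (fun q : R * (R * R) => (q.1, q.2.1)).
  apply: measurable_fun_pair; first exact: measurable_fst.
  exact: (measurableT_comp measurable_fst measurable_snd).
have mF : mfun (fun q : R * (R * R) => Z q.2.2 q.1 * cas (q.1 * q.2.1)).
  exact: measurable_funM (measurableT_comp mZ m1) (measurableT_comp (@cas2_meas R) m2).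
exact: (@measurable_I1 _ _ _ _ _ mu _ mF).
Qed.

Lemma EEs_meas2 Z : jm Z -> mfun (fun p : R * R => `|p.1| * hart (Z p.2) p.1 ^+ 2).
Proof.
move=> mZ; apply: measurable_funM; first exact: (measurableT_comp (@norm_meas R) measurable_fst).
by apply: measurable_funX; exact: hart_meas2.
Qed.

Lemma EE_meas Z psi : jm Z -> mfun psi -> mfun (fun s => EE (Z s) psi).
Proof.
move=> mZ mp.
have mF : mfun (fun p : R * R => `|p.1| * hart (Z p.2) p.1 * hart psi p.1).
  apply: measurable_funM; last exact: (measurableT_comp (hart_meas mp) measurable_fst).
  apply: measurable_funM; first exact: (measurableT_comp (@norm_meas R) measurable_fst).
  exact: hart_meas2.
have := @measurable_I1 _ _ _ _ _ mu _ mF.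
by apply: eq_measurable_fun => s _; rewrite EE_def.
Qed.

Lemma EEd_meas Z : jm Z -> mfun (fun s => EE2 (Z s)).
Proof.
move=> mZ; have := @measurable_I1 _ _ _ _ _ mu _ (EEs_meas2 mZ).
by apply: eq_measurable_fun => s _; rewrite EE_def; apply: I_ext => xi; rewrite expr2 mulrA.
Qed.

Lemma FE_def (v : R -> R) : FE v = L1 mu (fun xi => `|xi| * hart v xi ^+ 2).
Proof. Transparent FE. by rewrite /FE. Qed.

#[local] Opaque FE.

(** Finiteness of the energy, read off the extended integral, so that the times of finite energy
    form a measurable set. *)
Definition gd (Z : R -> R -> R) (s : R) : bool := (\int[mu]_xi (`|xi| * hart (Z s) xi ^+ 2)%:E < +oo)%E.

Lemma gdP Z s : L1 mu (Z s) -> gd Z s <-> FE (Z s).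
Proof.
move=> hZ; rewrite /gd FE_def L1_ge0P//.
  by apply: measurable_funM; [exact: norm_meas|apply: measurable_funX; exact: hart_meas (L1_meas hZ)].
by move=> xi; rewrite mulr_ge0// sqr_ge0.
Qed.

Lemma gd_meas Z : jm Z -> mfun (fun s => (gd Z s)%:R : R).
Proof.
move=> mZ; have me : mfun (fun s => \int[mu]_xi (`|xi| * hart (Z s) xi ^+ 2)%:E)%E.
  have mF : mfun (fun p : R * R => (`|p.1| * hart (Z p.2) p.1 ^+ 2)%:E) by apply/measurable_EFinP; exact: EEs_meas2.
  exact: (@emeasurable_int1 _ _ _ _ _ mu _ mF).
have mA := emeasurable_fun_infty_o measurableT me +oo%E.
have := @measurable_indic _ _ R setT _ mA; apply: eq_measurable_fun => s _.
by rewrite setTI indicE /gd; congr (_%:R); congr (nat_of_bool _); apply/idP/idP => [/set_mem//|h]; apply/mem_set.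
Qed.

Lemma hart_0 (xi : R) : hart (fun=> 0 : R) xi = 0.
Proof.
Transparent hart. rewrite /hart. Opaque hart.
by rewrite I_zero// => x; rewrite mul0r.
Qed.

Lemma FE_0 : FE (fun=> 0 : R).
Proof. by rewrite FE_def; apply: L1_ext (@L1_0 _ _ R mu) => xi; rewrite hart_0 expr0n mulr0. Qed.

Record path (T : R) (Z : R -> R -> R) : Prop := Path {
  p_jm : jm Z;
  p_L12 : forall t, L12 (Z t);
  p_FE : forall t, FE (Z t);
  p_E : L1 mu (fun t => EE2 (Z t));
  p_out : forall t, ~~ (0 < t < T) -> Z t = fun=> 0 }.

End paths.

(** * Weak solutions tested against products of functions of t and of x *)

Section weak_path.
Context {R : realType}.
Local Notation mu := (@lebesgue_measure R).
Local Notation flap := (fracLap (2^-1 : R)).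

Lemma cont_cc_bnd (k : R -> R) (a b : R) : continuous k -> (forall t, ~~ (a <= t <= b) -> k t = 0) ->
  exists2 C, 0 <= C & forall t, `|k t| <= C * (a <= t <= b)%R%:R.
Proof.
move=> ck k0; have /ex_strict_bound_gt0[C C0 hC] : bounded_set (k @` `[a, b]%classic).
  by apply: compact_bounded; apply: continuous_compact; [exact: continuous_subspaceT|exact: segment_compact].
exists C; first exact: ltW.
move=> t; have [h|h] := boolP (a <= t <= b); last by rewrite k0// normr0 mulr0.
by rewrite mulr1; apply/ltW/hC; exists t => //=; rewrite in_itv.
Qed.

Lemma cont_cc_L1 (k : R -> R) (a b : R) : continuous k -> (forall t, ~~ (a <= t <= b) -> k t = 0) -> L1 mu k.
Proof.
move=> ck k0; have [C C0 hC] := cont_cc_bnd ck k0.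
exact: (@L1_le _ _ _ mu _ _ (continuous_measurable_fun ck) (cc_L1 a b C) hC).
Qed.

Section time_test.
Variables (th th' : R -> R) (a b : R).
Hypotheses (a0 : 0 < a) (dth : forall t : R, is_derive t 1 th (th' t)) (cth : continuous th').
Hypotheses (t0 : forall t, ~~ (a <= t <= b) -> th t = 0) (t0' : forall t, ~~ (a <= t <= b) -> th' t = 0).

Lemma tensor_test psi : C0infty psi -> C01_half_plane (fun p => th p.2 * psi p.1) /\
  forall x t, dt (fun p => th p.2 * psi p.1) (x, t) = th' t * psi x.
Proof.
move=> [dpsi [K cK K0]].
have D (x : R) : is_derive x 1 psi (derive1 psi x) by rewrite derive1E; apply: derivableP; exact: (dpsi 0%N).
have D1 (x : R) : derivable (derive1 psi) x 1 by exact: (dpsi 1%N).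
have cpsi' : continuous (derive1 psi) by move=> x; apply: differentiable_continuous; apply/derivable1_diffP.
have cpsi := der_cont D; have ct := der_cont dth.
have e1 (x t : R) : is_derive ((x, t) : R * R) (1, 0) (fun p => th p.2 * psi p.1) (th t * derive1 psi x).
  by apply/dirxP => /=; exact: dZ.
have e2 (x t : R) : is_derive ((x, t) : R * R) (0, 1) (fun p => th p.2 * psi p.1) (th' t * psi x).
  apply/dirtP => /=; apply: deq (dM (dth t) (dcst (psi x) t)) _; by rewrite mulr0 add0r mulrC.
have E2 x t : dt (fun p => th p.2 * psi p.1) (x, t) = th' t * psi x by have [_] := e2 x t.
have E1 x t : dx (fun p => th p.2 * psi p.1) (x, t) = th t * derive1 psi x by have [_] := e1 x t.
have cc (k l : R -> R) : continuous k -> continuous l -> continuous (fun p : R * R => k p.2 * l p.1).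
  move=> ck cl p; apply: cvgM.
    by apply: (@continuous_comp _ _ _ (fun p : R * R => p.2) k); [exact: cvg_snd|exact: ck].
  by apply: (@continuous_comp _ _ _ (fun p : R * R => p.1) l); [exact: cvg_fst|exact: cl].
split => //; split; first split.
- by move=> [x t]; have [] := e1 x t.
- by move=> [x t]; have [] := e2 x t.
- have -> : dx (fun p => th p.2 * psi p.1) = (fun p => th p.2 * derive1 psi p.1) by apply/funext => -[x t]; exact: E1.
  exact: cc.
- have -> : dt (fun p => th p.2 * psi p.1) = (fun p => th' p.2 * psi p.1) by apply/funext => -[x t]; exact: E2.
  exact: cc.
exists (K `*` `[a, b]%classic); split.
- by apply: compact_setX => //; exact: segment_compact.
- by move=> [x t] [/= _]; rewrite in_itv /= => /andP[h _]; exact: lt_le_trans h.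
- move=> [x t] h /=; have [h'|h'] := boolP (a <= t <= b); last by rewrite t0// mul0r.
  by rewrite K0 ?mulr0// => Kx; apply: h; split => //=; rewrite in_itv.
Qed.

End time_test.

Lemma max0_lip (a b : R) : `|Num.max 0 a - Num.max 0 b| <= `|a - b|.
Proof.
have h1 := ler_norm (a - b); have h2 := ler_norm (b - a); rewrite distrC in h2.
by rewrite !maxEle; case: (leP 0 a) => ha; case: (leP 0 b) => hb; rewrite ler_norml; lra.
Qed.

Lemma sqrt_dbl (x y z : R) : 0 <= x -> 0 <= y -> `|z| <= Num.sqrt x * Num.sqrt y -> `|z| <= x + y.
Proof.
move=> x0 y0 zxy; apply: le_trans zxy _; have := dbl_bound (Num.sqrt x) (Num.sqrt y).
by rewrite !sqr_sqrtr//; apply: le_trans; exact: ler_norm.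
Qed.

Lemma the_arith (q C c x E p : R) : 0 <= c -> 0 <= q -> q <= C -> 0 <= x -> x <= E + p ->
  q * (c * x) <= C * c * E + C * c * p.
Proof.
move=> c0 q0 qC x0 h; rewrite -mulrDr -mulrA; apply: ler_pM => //; first exact: mulr_ge0.
exact: ler_wpM2l.
Qed.

Section sol.
Variables (f : R -> R) (u : R * R -> R).
Hypothesis hw : weak_solution f u.

(** Freezes u at its initial value for negative times, so that the curve is continuous in L^1 on the
    whole line. *)
Definition ub (t x : R) : R := u (x, Num.max 0 t).

Let max_ge0 (t : R) : 0 <= Num.max 0 t. Proof. by rewrite le_max lexx. Qed.

Lemma ub_Lp t : Lp (ub t).
Proof.
have [[p0 _] [[h _] _] _ _] := hw; split; last by move=> x; exact: p0.
by have /Lfun1_integrable := h _ (max_ge0 t).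
Qed.

Lemma ub_jm : jm ub.
Proof.
have [[_ mu_] _ _ _] := hw.
have m2 : mfun (fun z : R * R => (z.1, Num.max 0 z.2)).
  apply: measurable_fun_pair; first exact: measurable_fst.
  by apply: measurable_maxr => //; exact: measurable_snd.
have mS : measurable [set p : R * R | 0 <= p.2].
  have := @measurable_snd _ _ R R measurableT (`[0%R, +oo[%classic : set R) (measurable_itv _).
  rewrite setTI (_ : _ @^-1` _ = [set p : R * R | 0 <= p.2])//.
  by apply/seteqP; split => p /=; rewrite in_itv /= andbT.
by apply: (measurable_comp mS _ mu_ m2) => _ [z _ <-] /=; exact: max_ge0.
Qed.

Lemma ub_cont (t0 e : R) : 0 < e -> exists2 d, 0 < d & forall t, `|t0 - t| < d -> \int[mu]_x `|ub t x - ub t0 x| <= e.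
Proof.
move=> e0; have [_ [[_ h] _] _ _] := hw.
have {}h := h _ (max_ge0 t0).
have /h : nbhs (0%E : \bar R) [set x | (x < e%:E)%E].
  have : \forall r \near (0 : R), r < e by exact: lt_nbhsl.
  by apply: filterS => r /=; rewrite lte_fin.
move=> /nbhs_ballP[d d0 hd]; exists d => // t td.
have /hd/(_ _) : ball (Num.max 0 t0) d (Num.max 0 t).
  rewrite /ball /=; apply: le_lt_trans td.
  exact: max0_lip.
rewrite /= in_itv /= andbT => /(_ (max_ge0 t)).
by rewrite Lnorm1_I ?lte_fin; [exact: ltW|exact: L1B (ub_Lp t).1 (ub_Lp t0).1].
Qed.

Lemma ub0 : {ae mu, forall x, ub 0 x = f x}.
Proof. by have [_ _ _] := hw; apply: ae_imp => x; rewrite /ub maxxx. Qed.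

Lemma ub_log t : 0 <= t -> log1p u t = lgf (ub t).
Proof. by move=> t0; apply/funext => x; rewrite /log1p /lgf /lg /ub max_r. Qed.

Lemma w_jm : jm (fun t => lgf (ub t)).
Proof. exact: (measurableT_comp (@lg_meas R) ub_jm). Qed.

(** log (1 + u), replaced by 0 outside (0, T) and at the exceptional times of infinite energy, so
    that the energy is finite at every time. *)
Definition wg (T t x : R) : R := (0 < t < T)%R%:R * (gd (fun t => lgf (ub t)) t)%:R * lgf (ub t) x.

Lemma wg_ae T : 0 < T -> {ae mu, forall t, 0 < t < T -> FE (lgf (ub t)) /\ wg T t = lgf (ub t)}.
Proof.
move=> T0; have [_ [_ /(_ _ T0)[h _ _]] _ _] := hw.
apply: ae_imp h => t h h'; have /andP[p0 _] := h'.
have [_ F] := in_Hdot_FE (h h'); rewrite ub_log ?(ltW p0)// in F.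
split => //; apply/funext => x; rewrite /wg h'.
by rewrite (gdP (Z := fun t => lgf (ub t)) (lgf_L1 (ub_Lp t))).2// !mul1r.
Qed.

Lemma wg_path T : 0 < T -> path T (wg T).
Proof.
move=> T0; have j : jm (wg T).
  apply: measurable_funM; last exact: w_jm.
  apply: measurable_funM.
    exact: (measurableT_comp (bool_meas (@itv_bmeas R T)) measurable_snd).
  exact: (measurableT_comp (gd_meas w_jm) measurable_snd).
have l t : L12 (wg T t) by apply: L12Z; exact: lgf_L12 (ub_Lp t).
have F t : FE (wg T t).
  rewrite /wg; case: (boolP (gd _ t)) => [h|_].
    apply: FEZ; first exact: lgf_L1 (ub_Lp t).
    exact: (gdP (Z := fun t => lgf (ub t)) (lgf_L1 (ub_Lp t))).1.
  have -> : (fun x => (0 < t < T)%R%:R * false%:R * lgf (ub t) x) = (fun=> 0); last exact: FE_0.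
  by apply/funext => x; rewrite mulr0 mul0r.
split => //; last by move=> t /negbTE h; apply/funext => x; rewrite /wg h !mul0r.
have [_ [_ /(_ _ T0)[_ _ h]] _ _] := hw.
have P := @ipi_gt0 R.
have mE : mfun (fun t => EE2 (wg T t)) by exact: EEd_meas.
suff L : L1 mu (fun t => (2 * pi)^-1 * EE2 (wg T t)).
  by apply: L1_ext (L1Z (2 * pi) L) => t; rewrite mulrA mulfV ?mul1r// -invr_eq0 gt_eqF.
apply/L1_ge0P; first exact: measurable_funM.
  by move=> t; rewrite mulr_ge0 ?EE_ge0// ltW.
apply: le_lt_trans h; rewrite int_ioo; apply: ae_le_int.
- by move=> t; rewrite lee_fin mulr_ge0 ?EE_ge0// ltW.
- by move=> t; case: ifP => // _; rewrite expe_ge0// Lnorm_ge0.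
apply: ae_imp (wg_ae T0) => t h; case: ifPn => [h'|h'].
  have /andP[p0 _] := h'; have [h1 ->] := h h'.
  by rewrite (ub_log (ltW p0)) (Hdot_norm_sqr (lgf_L1 (ub_Lp t)) h1).
have -> : wg T t = (fun x => 0 * lgf (ub t) x) by apply/funext => x; rewrite /wg (negbTE h') !mul0r.
by rewrite lee_fin EE_def I_zero ?mulr0// => xi; rewrite hartZ ?mul0r ?mulr0//; exact: lgf_L1 (ub_Lp t).
Qed.

Section identity.
Variables (th th' psi : R -> R) (a b T B : R).
Hypotheses (a0 : 0 < a) (bT : b < T) (dth : forall t : R, is_derive t 1 th (th' t)) (cth : continuous th').
Hypotheses (t0 : forall t, ~~ (a <= t <= b) -> th t = 0) (t0' : forall t, ~~ (a <= t <= b) -> th' t = 0).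
Hypotheses (cpsi : C0infty psi) (bpsi : forall x, `|psi x| <= B) (psi1 : L1 mu psi) (psiF : FE psi).

Definition mom (t : R) := \int[mu]_x (ub t x * psi x).

Let mpsi : mfun psi. Proof. exact: L1_meas psi1. Qed.

Lemma mom_L1 t : L1 mu (fun x => ub t x * psi x).
Proof. exact: bmul_L1 (ub_Lp t).1 mpsi bpsi. Qed.

Lemma mom_cont : continuous mom.
Proof.
have B0 : 0 <= B by exact: le_trans (normr_ge0 _) (bpsi 0).
have B1 : 0 < B + 1 by rewrite ltr_pwDr.
move=> s; apply/cvgrPdist_le => e e0; have e1 : 0 < e / (B + 1) by rewrite divr_gt0.
have [d d0 hd] := ub_cont s e1; apply/nbhs_ballP; exists d => //= t ts.
rewrite distrC /mom -(I_B (mom_L1 t) (mom_L1 s)).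
have D := L1B (ub_Lp t).1 (ub_Lp s).1; have D' := L1_abs D.
apply: (@le_trans _ _ (B * \int[mu]_x `|ub t x - ub s x|)).
  rewrite -(I_Z B D'); apply: I_abs_le; [exact: L1B (mom_L1 t) (mom_L1 s)|exact: L1Z|].
  by move=> x; rewrite -mulrBl normrM mulrC; apply: ler_wpM2r.
apply: le_trans (ler_wpM2l B0 (hd t ts)) _.
by rewrite mulrA ler_pdivrMr// mulrC; apply: ler_wpM2l; [exact: ltW|rewrite lerDl].
Qed.

Lemma thm_L1 : L1 mu (fun t => th' t * mom t).
Proof.
apply: (@cont_cc_L1 _ a b) => [t|t h]; last by rewrite t0' ?mul0r.
by apply: cvgM; [exact: cth|exact: mom_cont].
Qed.

Let phi (p : R * R) : R := th p.2 * psi p.1.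

Lemma A_id : (\int[mu]_(t in `]0%R, +oo[) \int[mu]_x (u (x, t) * dt phi (x, t))%:E = (\int[mu]_t (th' t * mom t))%:E)%E.
Proof.
have [_ dE] := tensor_test a0 dth cth t0 cpsi.
rewrite int_pos -(L1_integralE thm_L1); apply: eq_integral => t _.
have [p0|p0] := ltP 0 t; last by rewrite t0' ?mul0r// negb_and -!ltNge (le_lt_trans p0 a0).
have L := L1Z (th' t) (mom_L1 t).
rewrite /mom -(I_Z _ (mom_L1 t)) -(L1_integralE L); apply: eq_integral => x _.
by rewrite dE /ub max_r ?(ltW p0)// mulrCA.
Qed.

Definition ee t := (2 * pi)^-1 * EE (wg T t) psi.

Lemma the_L1 : 0 < T -> L1 mu (fun t => th t * ee t).
Proof.
move=> T0'; have [C C0 hC] := cont_cc_bnd (der_cont dth) t0.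
have [j l F E o] := wg_path T0'.
have P := ltW (@ipi_gt0 R).
have G := L1D (L1Z (C * (2 * pi)^-1) E) (cc_L1 a b (C * (2 * pi)^-1 * EE psi psi)).
have m1 : mfun th by apply: continuous_measurable_fun; exact: der_cont dth.
have m2 : mfun ee by apply: measurable_funM => //; exact: EE_meas.
apply: (@L1_le _ _ _ mu _ _ (measurable_funM m1 m2) G) => t.
have c := EE_CS (L12_1 (l t)) psi1 (F t) psiF.
have E0 := EE_ge0 (wg T t); have p0 := EE_ge0 psi.
have c' := sqrt_dbl E0 p0 c.
rewrite /ee !normrM (ger0_norm P).
have [h|h] := boolP (a <= t <= b); last first.
  by rewrite t0// normr0 mul0r mulr0 addr0; exact: mulr_ge0 (mulr_ge0 C0 P) E0.
have := hC t; rewrite h !mulr1 => ht.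
exact: the_arith.
Qed.

Lemma B_id : 0 < T -> (\int[mu]_(t in `]0%R, +oo[) \int[mu]_x (flap (log1p u t) x * flap (fun y => phi (y, t)) x)%:E = (\int[mu]_t (th t * ee t))%:E)%E.
Proof.
move=> T0'; rewrite int_pos -(L1_integralE (the_L1 T0')); apply: ae_eq_int.
apply: ae_imp (wg_ae T0') => t h; have [p0|p0] := ltP 0 t; last first.
  by rewrite t0 ?mul0r// negb_and -!ltNge (le_lt_trans p0 a0).
have F2 := FEZ (th t) psi1 psiF; have l2 := L1Z (th t) psi1.
rewrite [X in (\int[mu]_x (_ * X x)%:E)%E](_ : _ = flap (fun y => th t * psi y))//.
have [tT|Tt] := ltP t T.
  have [F1 e] : FE (lgf (ub t)) /\ wg T t = lgf (ub t) by apply: h; rewrite p0.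
  have l1 := lgf_L1 (ub_Lp t).
  rewrite (ub_log (ltW p0)) L1_integralE; last exact: L2_mul (flap_L2 l1 F1) (flap_L2 l2 F2).
  rewrite (flap_pair l1 l2 F1 F2) /ee e EE_sym (EE_Zl (th t) psi1 l1 psiF F1) (EE_sym psi).
  by rewrite mulrCA.
have th0 : th t = 0 by apply: t0; rewrite negb_and -!ltNge (lt_le_trans bT Tt) orbT.
have -> : th t * ee t = 0 by rewrite th0 mul0r.
(* Here [flap] is applied to the zero function; the chosen value is known to vanish only almost
   everywhere, through its norm. *)
have P := flapP l2 F2; have [_] := is_fracLap_norm P.
have -> : EE2 (fun y => th t * psi y) = 0.
  by rewrite (EE_Zl (th t) psi1 l2 psiF F2) th0 mul0r.
rewrite mulr0 => z; have [_ z2] := flap_L2 l2 F2.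
have z0 := I_eq0 z2 (fun x => sqr_ge0 _) z.
rewrite (@ae_eq_int _ _ _ mu _ (fun=> 0)%E) ?integral0//.
by apply: ae_imp z0 => x /eqP; rewrite sqrf_eq0 => /eqP ->; rewrite mulr0.
Qed.

(** On (0, T) the moment of u against psi has the distributional derivative - [ee]. *)
Lemma weak_id : 0 < T -> \int[mu]_t (th' t * mom t) = \int[mu]_t (th t * ee t).
Proof.
move=> T0'; have [_ _ h _] := hw.
have [tt _] := tensor_test a0 dth cth t0 cpsi.
have := h _ tt; rewrite A_id (B_id T0') -EFinB => -[] /eqP; rewrite subr_eq0 => /eqP; exact.
Qed.

End identity.
End sol.
End weak_path.

(** * Localization in time *)

Section cutoff.
Context {R : realType}.
Local Notation mu := (@lebesgue_measure R).

(** The primitive of [k]; for a mollifier, a smoothed Heaviside function. *)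
Definition stepf (k : R -> R) (x : R) : R := \int[mu]_y ((y < x)%R%:R * k y).

Lemma bool_mul_norm (b : bool) (z : R) : `|b%:R * z| <= `|z|.
Proof. by case: b; rewrite ?mul1r// mul0r normr0. Qed.

Lemma bool_mul_le (b : bool) (z : R) : 0 <= z -> b%:R * z <= z.
Proof. by case: b; rewrite ?mul1r// mul0r. Qed.

Section kernel.
Variables (k : R -> R) (e L : R).
Hypotheses (kk : kernel k) (e0 : 0 < e) (ks : forall x, e < `|x| -> k x = 0) (kl : forall x y, `|k x - k y| <= L * `|x - y|).

Let mb (x : R) : mfun (fun y : R => (y < x)%R%:R : R).
Proof. by apply: bool_meas; exact: measurable_fun_ltr. Qed.

Let SL x : L1 mu (fun y => (y < x)%R%:R * k y).
Proof.
have k1 := kernel_L1 kk.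
apply: (@L1_le _ _ _ mu _ _ (measurable_funM (mb x) (L1_meas k1)) (L1_abs k1)) => y.
exact: bool_mul_norm.
Qed.

Lemma stepf_diff (a b c d : R) : a <= b -> (forall y, a <= y < b -> `|k y - c| <= d) ->
  `|stepf k b - stepf k a - (b - a) * c| <= d * (b - a).
Proof.
move=> ab h; have [i1 i2] := ico_I ab.
have E y : (y < b)%R%:R * k y - (y < a)%R%:R * k y - c * (a <= y < b)%R%:R = (a <= y < b)%R%:R * (k y - c).
  have [ya|ya] := ltP y a; first by rewrite (lt_le_trans ya ab) /=; ring.
  by case: (y < b) => /=; ring.
have D := L1B (SL b) (SL a); have G := L1B D (L1Z c i1).
rewrite /stepf -(I_B (SL b) (SL a)) mulrC -i2 -(I_Z c i1) -(I_B D (L1Z c i1)) -(I_Z d i1).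
apply: I_abs_le => //; first exact: L1Z.
move=> y; rewrite E normrM mulrC; case: (boolP (a <= y < b)) => hy; rewrite ?normr0 ?mulr0// normr1 !mulr1; exact: h.
Qed.

Lemma stepf_der (x : R) : is_derive x 1 (stepf k) (k x).
Proof.
apply: (is_derive_quad (C := L)) => h; have [h0|/ltW h0] := leP 0 h.
  have xh : x <= h + x by rewrite lerDr.
  have b y : x <= y < h + x -> `|k y - k x| <= L * h.
    move=> /andP[y1 y2]; apply: le_trans (kl y x) _.
    have L0 : 0 <= L by have := kl 1 0; rewrite subr0 normr1 mulr1; apply: le_trans.
    by apply: ler_wpM2l => //; rewrite ger0_norm; lra.
  have := stepf_diff xh b; rewrite addrK; by rewrite -mulrA -expr2.
have xh : h + x <= x by rewrite gerDr.
have b y : h + x <= y < x -> `|k y - k x| <= L * - h.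
  move=> /andP[y1 y2]; apply: le_trans (kl y x) _.
  have L0 : 0 <= L by have := kl 1 0; rewrite subr0 normr1 mulr1; apply: le_trans.
  by apply: ler_wpM2l => //; rewrite ler0_norm; lra.
have := stepf_diff xh b; rewrite -normrN.
have -> : - (stepf k x - stepf k (h + x) - (x - (h + x)) * k x) = stepf k (h + x) - stepf k x - h * k x by ring.
by have -> : L * - h * (x - (h + x)) = L * h ^+ 2 by ring.
Qed.

Lemma stepf_lo x : x < - e -> stepf k x = 0.
Proof.
move=> xe; rewrite /stepf I_zero// => y.
case: ltP => yx; last by rewrite mul0r.
rewrite ks ?mulr0//; have := ler_norm (- y); rewrite normrN; lra.
Qed.

Lemma stepf_hi x : e < x -> stepf k x = 1.
Proof.
move=> xe; apply: etrans (kernel_I kk); apply: I_ext => y.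
case: ltP => yx; first by rewrite mul1r.
by rewrite ks ?mulr0//; have := ler_norm y; lra.
Qed.

Lemma stepf_01 x : 0 <= stepf k x <= 1.
Proof.
have k0 := kernel_ge0 kk; apply/andP; split; first by apply: I_ge0 => y; rewrite mulr_ge0.
apply: le_trans (_ : \int[mu]_x k x <= 1); last by rewrite kernel_I.
apply: I_le; [exact: SL|exact: kernel_L1|] => y.
exact: bool_mul_le.
Qed.

Hypothesis ck : continuous k.

Lemma mean_L1 (m : R -> R) (c : R) : continuous m -> L1 mu (fun t => k (t - c) * m t).
Proof.
move=> cm; apply: (@cont_cc_L1 R _ (c - e) (c + e)).
  move=> t; apply: cvgM; last exact: cm.
  by apply: (@continuous_comp _ _ _ (fun t => t - c) k); [apply: cvgB; [exact: cvg_id|exact: cvg_cst]|exact: ck].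
move=> t ht; rewrite ks ?mul0r// ltNge; apply: contra ht.
by rewrite ler_norml => /andP[? ?]; apply/andP; split; lra.
Qed.

Lemma mean_close (m : R -> R) (c l d : R) : continuous m -> (forall t, `|t - c| <= e -> `|m t - l| <= d) ->
  `|\int[mu]_t (k (t - c) * m t) - l| <= d.
Proof.
move=> cm h; have k0 := kernel_ge0 kk; have LM := mean_L1 c cm.
have k1 : L1 mu (fun t => k (t - c)) := L1_shift (- c) (kernel_L1 kk).
have i1 : \int[mu]_t k (t - c) = 1 by rewrite (I_shift (- c) (kernel_L1 kk)) (kernel_I kk).
have G := L1Z l k1.
have -> : l = \int[mu]_t (l * k (t - c)) by rewrite (I_Z l k1) i1 mulr1.
rewrite -(I_B LM G) -[d]mulr1 -i1 -(I_Z d k1); apply: I_abs_le; [exact: L1B|exact: L1Z|] => t.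
rewrite (mulrC l) -mulrBr normrM (ger0_norm (k0 _)) (mulrC d).
have [ht|ht] := leP `|t - c| e; first by apply: ler_wpM2l => //; exact: h.
by rewrite ks// !mul0r.
Qed.

End kernel.

Lemma moll_lip (e : R) : 0 < e -> exists L, forall x y, `|moll e x - moll e y| <= L * `|x - y|.
Proof.
move=> e0; have [k' sk' dk] := Smc_der (moll_Smc e0); have [L L0 hL] := Smc_bounded e0 sk'.
exists L => x y; have [c _ ->] := MVT_le y x dk; rewrite normrM; exact: ler_wpM2r.
Qed.

Section localize.
Variables (m ev : R -> R) (T : R).
Hypotheses (cm : continuous m) (m0 : m 0 = 0) (ev1 : L1 mu ev).
Hypothesis id : forall (th th' : R -> R) (a b : R), 0 < a -> b < T -> (forall t : R, is_derive t 1 th (th' t)) -> continuous th' ->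
  (forall t, ~~ (a <= t <= b) -> th t = 0) -> (forall t, ~~ (a <= t <= b) -> th' t = 0) ->
  \int[mu]_t (th' t * m t) = \int[mu]_t (th t * ev t).

(** The test functions are differences of smoothed Heaviside functions that step at 2 e and at t1 -
    2 e. Their derivatives are mollifiers averaging m near 0 and near t1, so continuity of m gives
    its values at both ends as e tends to 0. *)
Lemma localize t1 : 0 < t1 -> t1 <= T -> m t1 = - \int[mu]_t ((0 < t < t1)%R%:R * ev t).
Proof.
move=> t10 t1T.
(* With 4 e <= t1 the two steps, of half-width e, are in order, and the test function is supported
   in [e, t1 - e], inside (0, T). *)
pose e n := t1 * hn n / 4.
have e0 n : 0 < e n by rewrite divr_gt0// mulr_gt0// hn_gt0.
have e4 n : 4 * e n <= t1.
  rewrite /e mulrC divfK// ler_piMr ?(ltW t10)//; rewrite /hn invf_le1 ?ltr0Sn// ler1n//.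
have ec : e @ \oo --> (0 : R).
  rewrite -(mul0r 4^-1) -(mulr0 t1); apply: cvgM; last exact: cvg_cst.
  by apply: cvgM; [exact: cvg_cst|exact: hn_cvg].
pose k n := moll (e n).
have kk n : kernel (k n) := moll_kernel (e0 n).
have ks n x : e n < `|x| -> k n x = 0 by have [_] := moll_Smc (e0 n); apply.
have kl n : exists L, forall x y, `|k n x - k n y| <= L * `|x - y| := moll_lip (e0 n).
pose th n t := stepf (k n) (t - 2 * e n) - stepf (k n) (t - (t1 - 2 * e n)).
pose th' n t := k n (t - 2 * e n) - k n (t - (t1 - 2 * e n)).
have I1 n : \int[mu]_t (th' n t * m t) = \int[mu]_t (th n t * ev t).
  have [L hL] := kl n; have en := e0 n; have e4n := e4 n.
  apply: (id (a := e n) (b := t1 - e n)) => //; first lra.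
  - move=> t; have ds (c : R) : is_derive t 1 (fun t => stepf (k n) (t - c)) (k n (t - c)).
      have D1 : is_derive (t - c) 1 (stepf (k n)) (k n (t - c)) by apply: (stepf_der (kk n) hL).
      have D2 := dB (did t) (dcst c t).
      by have := @dcomp R (stepf (k n)) (fun t : R => t - c) t _ _ D1 D2; rewrite subr0 mulr1.
    exact: dB (ds _) (ds _).
  - have ck : continuous (k n) by apply: Sm_cont; have [] := moll_Smc (e0 n).
    have cs (c : R) : continuous (fun t => k n (t - c)).
      move=> t; apply: (@continuous_comp _ _ _ (fun t => t - c) (k n)); last exact: ck.
      by apply: cvgB; [exact: cvg_id|exact: cvg_cst].
    by move=> t; apply: cvgB; exact: cs.
  - move=> t; rewrite negb_and -!ltNge => /orP[h|h]; rewrite /th.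
      by rewrite !(stepf_lo (ks n)) ?subrr//; lra.
    by rewrite !(stepf_hi (kk n) (ks n)) ?subrr//; lra.
  - move=> t; rewrite negb_and -!ltNge => /orP[h|h]; rewrite /th' !ks ?subrr//.
    + by have := ler_norm (- (t - (t1 - 2 * e n))); rewrite normrN; lra.
    + by have := ler_norm (- (t - 2 * e n)); rewrite normrN; lra.
    + by have := ler_norm (t - (t1 - 2 * e n)); lra.
    + by have := ler_norm (t - 2 * e n); lra.
have ck n : continuous (k n) by apply: Sm_cont; have [] := moll_Smc (e0 n).
have mc (c : nat -> R) (l : R) : (forall n, `|c n - l| <= 2 * e n) -> \int[mu]_t (k n (t - c n) * m t) @[n --> \oo] --> m l.
  move=> cle; apply/cvgrPdist_le => d d0.
  have /cvgrPdist_le /(_ _ d0) /nbhs_ballP[r r0 hr] := @cm l.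
  have r3 : 0 < r / 4 by rewrite divr_gt0.
  have /cvg0P /(_ _ r3) [N hN] := ec; exists N => // n /= Nn.
  rewrite distrC; apply: (mean_close (kk n) (ks n) (ck n) cm) => t ht.
  rewrite distrC; apply: hr; rewrite /ball /= distrC.
  have := hN n Nn; rewrite (ger0_norm (ltW (e0 n))) => he.
  have -> : t - l = (t - c n) + (c n - l) by ring.
  by apply: le_lt_trans (ler_normD _ _) _; have := cle n; lra.
have c1 : \int[mu]_t (th' n t * m t) @[n --> \oo] --> m 0 - m t1.
  have E n : \int[mu]_t (th' n t * m t) = \int[mu]_t (k n (t - 2 * e n) * m t) - \int[mu]_t (k n (t - (t1 - 2 * e n)) * m t).
    rewrite -(I_B (mean_L1 (ks n) (ck n) _ cm) (mean_L1 (ks n) (ck n) _ cm)).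
    by apply: I_ext => t; rewrite /th' mulrBl.
  rewrite (eq_cvg _ _ E); apply: cvgB; apply: mc => n; have := e0 n.
    by move=> ?; rewrite subr0 ger0_norm; lra.
  by move=> ?; rewrite ler0_norm; lra.
have c2 : \int[mu]_t (th n t * ev t) @[n --> \oo] --> \int[mu]_t ((0 < t < t1)%R%:R * ev t).
  have mth n : mfun (th n).
    have [L hL] := kl n; have ms : mfun (stepf (k n)).
      have D (x : R) : is_derive x 1 (stepf (k n)) (k n x) by apply: (stepf_der (kk n) hL).
      by apply: continuous_measurable_fun; exact: (der_cont D).
    apply: measurable_funB; apply: (measurableT_comp ms); exact: measurable_funB.
  have [] // := @DCT _ _ _ mu (fun n t => th n t * ev t) (fun t => (0 < t < t1)%R%:R * ev t) (fun t => `|ev t|).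
  - by move=> n; exact: measurable_funM (mth n) (L1_meas ev1).
  - exact: measurable_funM (bool_meas (@itv_bmeas R t1)) (L1_meas ev1).
  - apply: aeW => t; apply: cvgM; last exact: cvg_cst.
    suff [N hN] : exists N, forall n, (N <= n)%N -> th n t = (0 < t < t1)%R%:R.
      by apply: cvg_near_cst; exists N => // n /= /hN.
    have sm (r : R) : 0 < r -> exists N, forall n, (N <= n)%N -> 4 * e n <= r.
      move=> r0; have r4 : 0 < r / 4 by rewrite divr_gt0.
      have /cvg0P /(_ _ r4) [N hN] := ec; exists N => n /hN; rewrite (ger0_norm (ltW (e0 n))); lra.
    have [t0|t0] := leP t 0.
      by exists 0%N => n _; rewrite /th !(stepf_lo (ks n)) ?subrr//=; have := e0 n; have := e4 n; lra.
    have [tt|tt] := leP t1 t.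
      exists 0%N => n _; rewrite andbF /th !(stepf_hi (kk n) (ks n)) ?subrr//=; have := e0 n; have := e4 n; lra.
    have [N1 h1] := sm _ t0; have tt' : 0 < t1 - t by rewrite subr_gt0.
    have [N2 h2] := sm _ tt'; exists (maxn N1 N2) => n; rewrite geq_max => /andP[/h1 n1 /h2 n2].
    rewrite /th (stepf_hi (kk n) (ks n)) ?(stepf_lo (ks n)) ?subr0//; have := e0 n; lra.
  - exact: L1_abs.
  - move=> n t; rewrite normrM ler_piMl//.
    have /andP[? ?] := stepf_01 (kk n) (t - 2 * e n); have /andP[? ?] := stepf_01 (kk n) (t - (t1 - 2 * e n)).
    by rewrite /th ler_norml; lra.
rewrite (eq_cvg _ _ I1) in c1; have := cvg_uniqR c1 c2; rewrite m0 => <-.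
by rewrite sub0r opprK.
Qed.

End localize.
End cutoff.

(** * Positivity in time of the energy form *)

Section positivity.
Context {R : realType}.
Local Notation mu := (@lebesgue_measure R).
Local Notation mu2 := (@lebesgue_measure R \x @lebesgue_measure R)%E.

Lemma sectt_meas (g : R * R -> R) (x : R) : mfun g -> mfun (fun t => g (x, t)).
Proof. by move=> mg; apply: (measurableT_comp mg); exact: pair1_measurable. Qed.

Lemma prod_dom (G : R * R -> R) (a b : R -> R) : L1 mu a -> L1 mu b -> mfun G ->
  (forall x y, `|G (x, y)| <= a x * b y) -> L1 mu2 G.
Proof.
move=> a1 b1 mG h.
have L y : L1 mu (fun x => G (x, y)).
  apply: (@L1_le _ _ _ mu _ _ (sectx_meas y mG) (L1Z (b y) a1)) => x; rewrite mulrC; exact: h.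
apply: (@L1_prod2 _ _ _ _ _ mu mu G (fun y => (\int[mu]_x a x) * b y)) => //; last exact: L1Z.
move=> y; rewrite mulrC -(I_Z _ a1); apply: I_le; [exact: L1_abs|exact: L1Z|] => x; rewrite mulrC; exact: h.
Qed.

Lemma sqrt_le1D (x : R) : 0 <= x -> Num.sqrt x <= 1 + x.
Proof.
move=> x0; have y0 := sqrtr_ge0 x; rewrite -{2}(sqr_sqrtr x0).
by have := sqr_ge0 (Num.sqrt x - 1); move: (Num.sqrt x) y0 => y y0; rewrite !expr2; nra.
Qed.

Lemma ae_neq (t : R) : {ae mu, forall s, s <> t}.
Proof.
exists [set t]; split; [exact: measurable_set1|exact: lebesgue_measure_set1|].
by move=> s /= h; apply: contrapT => h'; apply: h => e; apply: h'; rewrite e.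
Qed.

Lemma eq_leR (x y : R) : x = y -> x <= y.
Proof. by move=> ->. Qed.

Lemma eq_mul_le (x y x' y' : R) : x = x' -> y = y' -> x * y <= y' * x'.
Proof. by move=> -> ->; rewrite mulrC. Qed.

Lemma two_half (x y : R) : 0 <= x -> x = y + y -> 0 <= y.
Proof. by move=> x0 e; rewrite e in x0; lra. Qed.

Lemma ind_split (s t z : R) : s <> t -> z = (s < t)%R%:R * z + (t < s)%R%:R * z.
Proof. by move=> st; case: (ltgtP s t) => h //; rewrite mul1r mul0r ?addr0 ?add0r. Qed.

Section posdef.
Variables (T C : R) (D : R -> R -> R).
Hypotheses (pD : path T D) (bC : forall s, \int[mu]_x `|D s x| <= C).

Let q (p : R * R) : R := rxi p.1 * hart (D p.2) p.1.

Let a (s : R) : R := Num.sqrt (EE2 (D s)).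

Let ind (s : R) : R := (0 < s < T)%R%:R.

(* A positive semidefinite kernel in (s, t): its double integral is the energy of the time integral of D. *)
Definition kk_ (s t : R) : R := EE (D s) (D t).

Let mq : mfun q.
Proof.
have [j _ _ _ _] := pD; apply: measurable_funM; last exact: hart_meas2.
exact: (measurableT_comp (@rxi_meas R) measurable_fst).
Qed.

Let qL2 s : L2 mu (fun xi => q (xi, s)) /\ \int[mu]_xi (q (xi, s) ^+ 2) = EE2 (D s).
Proof.
have [_ l F _ _] := pD; split; last by rewrite EEvv.
exact: (FE_L2 (L1_meas (L12_1 (l s)))).1 (F s).
Qed.

Let kE s t : kk_ s t = \int[mu]_xi (q (xi, s) * q (xi, t)).
Proof. by rewrite /kk_ EE_rxi. Qed.

Let a_out s : ~~ (0 < s < T) -> a s = 0.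
Proof.
move=> h; have [_ _ _ _ o] := pD; rewrite /a o//.
have := EE_Zl 0 (@L1_0 _ _ R mu) (@L1_0 _ _ R mu) (@FE_0 R) (@FE_0 R).
have -> : (fun x : R => 0 * (fun=> 0 : R) x) = (fun=> 0) by apply/funext => x; rewrite mul0r.
by move=> ->; rewrite mul0r sqrtr0.
Qed.

Let a_meas : mfun a.
Proof.
have [j _ _ _ _] := pD; apply: (measurableT_comp (continuous_measurable_fun (@sqrt_continuous R))).
exact: EEd_meas.
Qed.

Lemma ind_L1 : L1 mu ind.
Proof.
have mi : mfun ind by exact: bool_meas (@itv_bmeas R T).
apply: (@L1_le _ _ _ mu _ _ mi (cc_L1 0 T 1)) => s; rewrite mul1r ger0_norm// /ind ler_nat.
by case: (boolP (0 < s < T)%R) => // /andP[s0 sT]; rewrite (ltW s0) (ltW sT).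
Qed.

Lemma a_L1 : L1 mu a.
Proof.
have [_ _ _ E _] := pD.
apply: (@L1_le _ _ _ mu _ _ a_meas (L1D ind_L1 E)) => s; rewrite ger0_norm ?sqrtr_ge0//.
have E0 := EE_ge0 (D s); rewrite /ind; case: (boolP (0 < s < T)%R) => h; first exact: sqrt_le1D.
by rewrite a_out// add0r.
Qed.

Lemma kk_bnd s t : `|kk_ s t| <= a s * a t.
Proof. by have [_ l F _ _] := pD; exact: EE_CS (L12_1 (l s)) (L12_1 (l t)) (F s) (F t). Qed.

Lemma kk_meas : mfun (fun p : R * R => kk_ p.1 p.2).
Proof.
have m1 : mfun (fun z : R * (R * R) => (z.1, z.2.1)).
  apply: measurable_fun_pair; first exact: measurable_fst.
  exact: (measurableT_comp measurable_fst measurable_snd).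
have m2 : mfun (fun z : R * (R * R) => (z.1, z.2.2)).
  apply: measurable_fun_pair; first exact: measurable_fst.
  exact: (measurableT_comp measurable_snd measurable_snd).
have mF : mfun (fun z : R * (R * R) => q (z.1, z.2.1) * q (z.1, z.2.2)).
  exact: measurable_funM (measurableT_comp mq m1) (measurableT_comp mq m2).
have := @measurable_I1 _ _ _ _ _ mu _ mF.
by apply: eq_measurable_fun => p _; rewrite kE.
Qed.

Lemma kk_sym s t : kk_ s t = kk_ t s. Proof. exact: EE_sym. Qed.

Lemma kks_L1 t : L1 mu (fun s => kk_ s t).
Proof.
apply: (@L1_le _ _ _ mu _ _ (sectx_meas t kk_meas) (L1Z (a t) a_L1)) => s; rewrite mulrC; exact: kk_bnd.
Qed.

Let qint xi : L1 mu (fun s => q (xi, s)) /\ L2 mu (fun s => q (xi, s)).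
Proof.
have [_ l _ _ o] := pD.
have b s : `|q (xi, s)| <= rxi xi * (2 * C) * ind s.
  rewrite /ind; case: (boolP (0 < s < T)%R) => h; last first.
    rewrite mulr0 /q /= o//; by rewrite hart_0 mulr0 normr0.
  rewrite mulr1 normrM (ger0_norm (rxi_ge0 _)); apply: ler_wpM2l; first exact: rxi_ge0.
  apply: le_trans (hart_bound xi (L12_1 (l s))) _; exact: ler_wpM2l.
have L : L1 mu (fun s => q (xi, s)) by exact: (@L1_le _ _ _ mu _ _ (sectt_meas xi mq) (L1Z _ ind_L1) b).
split => //; apply: (L2_bounded (M := rxi xi * (2 * C)) L) => s; apply: le_trans (b s) _.
have C0 : 0 <= C by apply: le_trans (bC 0); apply: I_ge0.
by rewrite ler_piMr ?mulr_ge0 ?rxi_ge0// /ind; case: (_ && _).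
Qed.

Let K (xi : R) : R := \int[mu]_s q (xi, s).

Let q2_L1 : L1 mu2 (fun p => q p ^+ 2).
Proof.
have [_ _ _ E _] := pD.
apply: (@L1_prod2 _ _ _ _ _ mu mu (fun p => q p ^+ 2) (fun s => EE2 (D s))) => //.
- exact: measurable_funX.
- by move=> s; have [[]] := qL2 s.
- move=> s; apply: eq_leR; apply: etrans (qL2 s).2; apply: I_ext => x.
  by rewrite ger0_norm// sqr_ge0.
Qed.

Let K_L2 : L2 mu K.
Proof.
have mK : mfun K by exact: (@measurable_I2 _ _ _ _ _ mu q mq).
split => //; have i2 : L2 mu ind.
  by apply: (L2_bounded (M := 1) ind_L1) => s; rewrite /ind ger0_norm//; case: (_ && _).
apply: (@L1_le _ _ _ mu _ _ _ (L1Z (\int[mu]_s (ind s ^+ 2)) (L1_I2 q2_L1))); first exact: measurable_funX.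
move=> xi; rewrite ger0_norm ?sqr_ge0//.
have -> : K xi = \int[mu]_s (ind s * q (xi, s)).
  apply: I_ext => s; have [_ _ _ _ o] := pD.
  rewrite /ind; case: (boolP (0 < s < T)%R) => h; rewrite ?mul1r// mul0r /q /= o//.
  by rewrite hart_0 mulr0.
exact: CS i2 (qint xi).2.
Qed.

Let abs_CS (f g : R -> R) : L2 mu f -> L2 mu g -> \int[mu]_x `|f x * g x| <= Num.sqrt (\int[mu]_x (f x ^+ 2)) * Num.sqrt (\int[mu]_x (g x ^+ 2)).
Proof.
move=> hf hg.
have ab (z : R -> R) : L2 mu z -> L2 mu (fun x => `|z x|).
  move=> hz; apply: (L2_le _ hz); last by move=> x; rewrite normr_id.
  exact: (measurableT_comp (@norm_meas R) (L2_meas hz)).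
have sq (z : R -> R) : \int[mu]_x (`|z x| ^+ 2) = \int[mu]_x (z x ^+ 2).
  by apply: I_ext => x; rewrite -normrX ger0_norm// sqr_ge0.
have := CS_abs (ab _ hf) (ab _ hg); rewrite !sq; apply: le_trans; apply: le_trans (ler_norm _).
by apply: eq_leR; apply: I_ext => x; rewrite normrM.
Qed.

(** Fubini at each frequency: the double time integral is the integral of K^2, with [K] the time
    integral of [q]. *)
Lemma kk_int_ge0 : 0 <= \int[mu]_t \int[mu]_s kk_ s t.
Proof.
have E t : \int[mu]_s kk_ s t = \int[mu]_xi (K xi * q (xi, t)).
  have m1 : mfun (fun p : R * R => q p * q (p.1, t)).
    by apply: measurable_funM => //; exact: (measurableT_comp (sectx_meas t mq) measurable_fst).
  have L : L1 mu2 (fun p : R * R => q p * q (p.1, t)).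
    apply: (@L1_prod2 _ _ _ _ _ mu mu (fun p : R * R => q p * q (p.1, t)) (fun s => a t * a s)) => //.
    - by move=> s; exact: L2_mul (qL2 s).1 (qL2 t).1.
    - move=> s; apply: le_trans (abs_CS (qL2 s).1 (qL2 t).1) _.
      exact: eq_mul_le (congr1 Num.sqrt (qL2 s).2) (congr1 Num.sqrt (qL2 t).2).
    - exact: L1Z _ a_L1.
  transitivity (\int[mu]_s \int[mu]_xi (q (xi, s) * q (xi, t))); first by apply: I_ext => s; exact: kE.
  rewrite -(I_swap L); apply: I_ext => xi; rewrite /K mulrC -(I_Z _ (qint xi).1).
  by apply: I_ext => s; rewrite mulrC.
have m2 : mfun (fun p : R * R => K p.1 * q p).
  by apply: measurable_funM => //; exact: (measurableT_comp (L2_meas K_L2) measurable_fst).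
have L : L1 mu2 (fun p : R * R => K p.1 * q p).
  apply: (@L1_prod2 _ _ _ _ _ mu mu (fun p : R * R => K p.1 * q p) (fun t => Num.sqrt (\int[mu]_x (K x ^+ 2)) * a t)) => //.
  - by move=> s; exact: L2_mul K_L2 (qL2 s).1.
  - by move=> s; apply: le_trans (abs_CS K_L2 (qL2 s).1) _; rewrite (qL2 s).2.
  - exact: L1Z _ a_L1.
rewrite (I_to (fun t => \int[mu]_xi (K xi * q (xi, t))) E) -(I_swap L).
apply: I_ge0 => xi; rewrite /= (I_Z _ (qint xi).1) -/(K xi) -expr2; exact: sqr_ge0.
Qed.

Lemma half_meas : mfun (fun p : R * R => (p.1 < p.2)%R%:R : R).
Proof. by apply: bool_meas; apply: measurable_fun_ltr; [exact: measurable_fst|exact: measurable_snd]. Qed.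

Lemma half_bnd (b : bool) s t : `|b%:R * kk_ s t| <= a s * a t.
Proof. exact: le_trans (bool_mul_norm _ _) (kk_bnd s t). Qed.

Lemma half_L1 : L1 mu2 (fun p => (p.1 < p.2)%R%:R * kk_ p.1 p.2).
Proof. exact: prod_dom a_L1 a_L1 (measurable_funM half_meas kk_meas) (fun x y => half_bnd _ x y). Qed.

(** By symmetry the parts s < t and t < s have equal integrals, and the diagonal is null. The part s
    < t is the one that appears when the equation is integrated up to time t. *)
Lemma half_ge0 : 0 <= \int[mu]_t \int[mu]_s ((s < t)%R%:R * kk_ s t).
Proof.
have h := kk_int_ge0.
have L1s (t : R) : L1 mu (fun s => (s < t)%R%:R * kk_ s t).
  apply: (@L1_le _ _ _ mu _ _ (sectx_meas t (measurable_funM half_meas kk_meas)) (L1Z (a t) a_L1)) => s.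
  by rewrite mulrC; exact: half_bnd.
have L2s (t : R) : L1 mu (fun s => (t < s)%R%:R * kk_ s t).
  apply: (@L1_le _ _ _ mu _ _ _ (L1Z (a t) a_L1)).
    apply: measurable_funM; last exact: sectx_meas t kk_meas.
    exact: sectt_meas t half_meas.
  by move=> s; rewrite (mulrC (a t)); exact: half_bnd.
have S := I_swap half_L1.
have E : \int[mu]_t \int[mu]_s ((t < s)%R%:R * kk_ s t) = \int[mu]_t \int[mu]_s ((s < t)%R%:R * kk_ s t).
  rewrite -[RHS]S; apply: I_ext => t; apply: I_ext => s /=; by rewrite kk_sym.
have LA : L1 mu (fun t => \int[mu]_s ((s < t)%R%:R * kk_ s t)) := L1_I1 half_L1.
have LB : L1 mu (fun t => \int[mu]_s ((t < s)%R%:R * kk_ s t)).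
  apply: L1_ext (L1_I2 half_L1) => t; apply: I_ext => s /=; by rewrite kk_sym.
suff : \int[mu]_t \int[mu]_s kk_ s t = \int[mu]_t \int[mu]_s ((s < t)%R%:R * kk_ s t) + \int[mu]_t \int[mu]_s ((t < s)%R%:R * kk_ s t).
  by rewrite E; exact: two_half h.
rewrite -(I_D LA LB); apply: I_ext => t; rewrite -(I_D (L1s t) (L2s t)).
apply: ae_I.
- exact: sectx_meas t kk_meas.
- exact: L1_meas (L1D (L1s t) (L2s t)).
- apply: ae_imp (ae_neq t) => s; exact: ind_split.
Qed.

End posdef.
End positivity.

(** * Comparison of two weak solutions *)

Section uniqueness.
Context {R : realType}.
Local Notation mu := (@lebesgue_measure R).

Lemma EE_Bl (v w z : R -> R) : L1 mu v -> L1 mu w -> L1 mu z -> FE v -> FE w -> FE z ->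
  EE (fun x => v x - w x) z = EE v z - EE w z.
Proof.
move=> v1 w1 z1 fv fw fz; have w1' := L1Z (-1) w1; have fw' := FEZ (-1) w1 fw.
have -> : (fun x => v x - w x) = (fun x => v x + -1 * w x) by apply/funext => x; rewrite mulN1r.
by rewrite (EE_Dl v1 w1' z1 fv fw' fz) (EE_Zl (-1) w1 z1 fw fz) mulN1r.
Qed.

Lemma EE_B_le (v w : R -> R) : L1 mu v -> L1 mu w -> FE v -> FE w ->
  EE2 (fun x => v x - w x) <= 2 * EE v v + 2 * EE w w.
Proof.
move=> v1 w1 fv fw; have := EE_ge0 (fun x => v x + w x).
rewrite (EE_sqrD v1 w1 fv fw) (EE_sqrB v1 w1 fv fw).
by move: (EE v v) (EE v w) (EE w w) => a b c; lra.
Qed.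

Lemma ae_pick (P : R -> Prop) (a b : R) : {ae mu, forall s, P s} -> a < b -> exists s, a < s < b /\ P s.
Proof.
move=> [A [mA A0 hA]] ab; apply: contrapT => h.
have mid : a < (a + b) / 2 < b by apply/andP; split; lra.
have /andP[m1 m2] := mid.
have S : `[(a + b) / 2, b[%classic `<=` A.
  move=> s /=; rewrite in_itv /= => /andP[s1 s2]; apply: hA => /= Ps; apply: h; exists s; split => //.
  by rewrite (lt_le_trans m1 s1) s2.
have : (mu `[((a + b) / 2)%R, b[ <= mu A)%E by apply: le_measure; rewrite ?inE//; exact: measurable_itv.
by rewrite A0 ico_mu ?(ltW m2)// lee_fin; lra.
Qed.

Lemma tri4 (p q p' q' : R) : `|p - q| <= `|p' - q'| + (`|p' - p| + `|q' - q|).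
Proof.
have -> : p - q = (p' - q') - (p' - p) + (q' - q) by ring.
by apply: le_trans (ler_normD _ _) _; rewrite addrA lerD2r; exact: ler_normB.
Qed.

Lemma cvg_geC (w : nat -> R) (l C : R) : w n @[n --> \oo] --> l -> (forall n, C <= w n) -> C <= l.
Proof.
move=> c h; rewrite -lerN2; apply: (@cvg_leC R (fun n => - w n) _ _ 0%N); first exact: cvgN.
by move=> n _; rewrite lerN2.
Qed.

Lemma clip_pos (c y : R) : 1 <= c -> 0 <= y -> 0 <= clip 1 y <= clip c y.
Proof.
move=> c1 y0; apply/andP; split; first by rewrite le_max le_min ler01 y0 orbT.
rewrite ge_max !le_max !le_min !ge_min lexx orbT andbT; apply/andP; split; apply/orP; right.
  by apply/andP; split; lra.
by rewrite c1.
Qed.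

Lemma clip_neg (c y : R) : 1 <= c -> y <= 0 -> clip c y <= clip 1 y <= 0.
Proof.
move=> c1 y0; apply/andP; split; last by rewrite ge_max ge_min y0 orbT andbT oppr_le0 ler01.
rewrite ge_max !le_max !le_min !ge_min lexx orbT andbT lerN2 c1 /=; apply/orP; right; apply/orP; right; lra.
Qed.

(** Clipping keeps the sign of y, and its modulus grows with the clipping level. *)
Lemma clip_mono (n : nat) (x y : R) : (0 < n)%N -> 0 <= x * y -> 0 <= x * clip 1 y <= x * clip n%:R y.
Proof.
move=> n0 xy; have n1 : (1 : R) <= n%:R by rewrite ler1n.
have [x0|x0] := ltP x 0.
  have y0 : y <= 0 by rewrite leNgt; apply/negP => y0; move: xy; rewrite leNgt nmulr_rlt0// y0.
  by have /andP[a b] := clip_neg n1 y0; rewrite nmulr_rge0// b /= ler_nM2l.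
have [->|xn] := eqVneq x 0; first by rewrite !mul0r lexx.
have xp : 0 < x by rewrite lt_neqAle eq_sym xn.
have y0 : 0 <= y by rewrite leNgt; apply/negP => y0; move: xy; rewrite leNgt pmulr_rlt0// y0.
by have /andP[a b] := clip_pos n1 y0; rewrite pmulr_rge0// a /= ler_pM2l.
Qed.

Lemma clip1_eq0 (x : R) : clip 1 x = 0 -> x = 0.
Proof.
move=> e; have [x0|x0|//] := ltgtP x 0.
  have : clip 1 x < 0 by rewrite gt_max gt_min x0 orbT andbT oppr_lt0 ltr01.
  by rewrite e ltxx.
have : 0 < clip 1 x by rewrite lt_max lt_min x0 ltr01 orbT.
by rewrite e ltxx.
Qed.

Lemma lg_inj (b c : R) : 0 <= b -> 0 <= c -> lg b - lg c = 0 -> b - c = 0.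
Proof.
move=> b0 c0' h; have := lg_prod_low b0 c0'; rewrite h mul0r mulr0.
by move=> k; apply/eqP; rewrite -sqrf_eq0 eq_le k sqr_ge0.
Qed.

Section two.
Variables (f : R -> R) (u v : R * R -> R) (T : R).
Hypotheses (hu : weak_solution f u) (hv : weak_solution f v) (T0 : 0 < T).

Let z (t x : R) : R := ub u t x - ub v t x.

Let D (t x : R) : R := wg u T t x - wg v T t x.

Let z1 t : L1 mu (z t). Proof. exact: L1B (ub_Lp hu t).1 (ub_Lp hv t).1. Qed.

Lemma D_path : path T D.
Proof.
have [j1 l1 F1 E1 o1] := wg_path hu T0; have [j2 l2 F2 E2 o2] := wg_path hv T0.
have j : jm D := measurable_funB j1 j2.
split; first exact: j.
- by move=> t; exact: L12B (l1 t) (l2 t).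
- by move=> t; exact: FEB (L12_1 (l1 t)) (L12_1 (l2 t)) (F1 t) (F2 t).
- apply: (@L1_le _ _ _ mu _ _ (EEd_meas j) (L1D (L1Z 2 E1) (L1Z 2 E2))) => t.
  rewrite (ger0_norm (EE_ge0 (D t))); exact: EE_B_le (L12_1 (l1 t)) (L12_1 (l2 t)) (F1 t) (F2 t).
- by move=> t h; apply/funext => x; rewrite /D (o1 _ h) (o2 _ h) subrr.
Qed.

Lemma ub_mass (w : R * R -> R) : weak_solution f w -> exists C, forall t, 0 <= t <= T -> \int[mu]_x ub w t x <= C.
Proof.
move=> hw; have L t := (ub_Lp hw t).1.
have c : continuous (fun t => \int[mu]_x ub w t x).
  move=> s; apply/cvgrPdist_le => e e0; have [d d0 hd] := ub_cont hw s e0.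
  apply/nbhs_ballP; exists d => //= t ts.
  rewrite distrC -(I_B (L t) (L s)); apply: le_trans (I_abs (L1B (L t) (L s))) _; exact: hd.
have [t0 _ h] := EVT_max (ltW T0) (continuous_subspaceT c).
by exists (\int[mu]_x ub w t0 x) => t ht; apply: h; rewrite in_itv.
Qed.

(** Supplies the bound [bC], under which the transforms of D are integrable in time at each
    frequency. *)
Lemma D_mass : exists C, forall s, \int[mu]_x `|D s x| <= C.
Proof.
have [C1 h1] := ub_mass hu; have [C2 h2] := ub_mass hv.
have [_ l _ _ o] := D_path.
exists (`|C1| + `|C2|) => s; have [/andP[s0 sT]|h] := boolP (0 < s < T); last first.
  by rewrite o// I_zero ?addr_ge0// => x; rewrite normr0.
have hs : 0 <= s <= T by rewrite !ltW.
have [u1 u0] := ub_Lp hu s; have [v1 v0] := ub_Lp hv s.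
apply: (@le_trans _ _ (\int[mu]_x (ub u s x + ub v s x))).
  apply: I_le; [exact: L1_abs (L12_1 (l s))|exact: L1D|] => x.
  have k (w : R * R -> R) : Lp (ub w s) -> 0 <= wg w T s x <= ub w s x.
    move=> [_ w0]; have g0 : 0 <= lgf (ub w s) x by apply: lg_ge0.
    have gl : lgf (ub w s) x <= ub w s x by apply: lg_le.
    rewrite /wg -mulrA mulr_ge0 ?mulr_ge0//=.
    apply: le_trans gl; apply: le_trans (bool_mul_le _ _) (bool_mul_le _ _) => //; exact: mulr_ge0.
  have /andP[a1 a2] := k u (ub_Lp hu s); have /andP[b1 b2] := k v (ub_Lp hv s).
  by rewrite /D ler_norml; lra.
rewrite (I_D u1 v1); apply: lerD.
  exact: le_trans (h1 s hs) (ler_norm _).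
exact: le_trans (h2 s hs) (ler_norm _).
Qed.

Let c0 : 0 <= (2 * (pi : R))^-1. Proof. exact/ltW/ipi_gt0. Qed.

Let a (s : R) : R := Num.sqrt (EE2 (D s)).

Let aL : L1 mu a. Proof. exact: a_L1 D_path. Qed.

Lemma ED_bnd w s : L1 mu w -> FE w -> `|EE (D s) w| <= Num.sqrt (EE w w) * a s.
Proof. by move=> w1 fw; have [_ l F _ _] := D_path; rewrite mulrC; exact: EE_CS (L12_1 (l s)) w1 (F s) fw. Qed.

Lemma ED_L1 w : L1 mu w -> FE w -> L1 mu (fun s => EE (D s) w).
Proof.
move=> w1 fw; have [j _ _ _ _] := D_path.
apply: (@L1_le _ _ _ mu _ _ (EE_meas j (L1_meas w1)) (L1Z _ aL)) => s; exact: ED_bnd.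
Qed.

(** Both solutions start from f, so the initial moments cancel and [localize] integrates the
    equation for the difference from time 0. *)
Lemma diff_smooth psi (B t1 : R) : C0infty psi -> (forall x, `|psi x| <= B) -> L1 mu psi -> FE psi -> 0 < t1 -> t1 <= T ->
  \int[mu]_x (z t1 x * psi x) = - \int[mu]_t ((0 < t < t1)%R%:R * ((2 * pi)^-1 * EE (D t) psi)).
Proof.
move=> cp bp p1 fp t10 t1T.
have zE t : \int[mu]_x (z t x * psi x) = mom u psi t - mom v psi t.
  rewrite -(I_B (mom_L1 hu bp p1 t) (mom_L1 hv bp p1 t)); apply: I_ext => x; exact: mulrBl.
have [_ l1 F1 _ _] := wg_path hu T0; have [_ l2 F2 _ _] := wg_path hv T0.
have eE t : (2 * pi)^-1 * EE (D t) psi = ee u psi T t - ee v psi T t.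
  by rewrite /D (EE_Bl (L12_1 (l1 t)) (L12_1 (l2 t)) p1 (F1 t) (F2 t) fp) mulrBr.
rewrite zE; apply: (@localize R (fun t => mom u psi t - mom v psi t) (fun t => (2 * pi)^-1 * EE (D t) psi) T) => //.
- by move=> t; apply: cvgB; [exact: (mom_cont hu bp p1)|exact: (mom_cont hv bp p1)].
- rewrite -zE; transitivity (\int[mu]_x (0 : R)); last exact: I_0.
  apply: ae_I.
  + exact: L1_meas (bmul_L1 (z1 0) (L1_meas p1) bp).
  + exact: measurable_cst.
  + by apply: ae_imp2 (ub0 hu) (ub0 hv) => x; rewrite /z => -> ->; rewrite subrr mul0r.
- exact: L1Z (ED_L1 p1 fp).
- move=> th th' a' b a0 bT dth cth t0 t0'.
  have A1 := thm_L1 hu cth t0' bp p1; have A2 := thm_L1 hv cth t0' bp p1.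
  have B1 := the_L1 hu dth t0 p1 fp T0; have B2 := the_L1 hv dth t0 p1 fp T0.
  transitivity (\int[mu]_t (th' t * mom u psi t) - \int[mu]_t (th' t * mom v psi t)).
    by rewrite -(I_B A1 A2); apply: I_ext => t; exact: mulrBr.
  rewrite (weak_id hu a0 bT dth cth t0 t0' cp bp p1 fp T0) (weak_id hv a0 bT dth cth t0 t0' cp bp p1 fp T0).
  by rewrite -(I_B B1 B2); apply: I_ext => t; rewrite eE mulrBr.
Qed.

Definition gint (t1 : R) w := \int[mu]_t ((0 < t < t1)%R%:R * ((2 * pi)^-1 * EE (D t) w)).

Lemma gint_L1 t1 w : L1 mu w -> FE w -> L1 mu (fun t => (0 < t < t1)%R%:R * ((2 * pi)^-1 * EE (D t) w)).
Proof.
move=> w1 fw; have L := L1Z (2 * pi)^-1 (ED_L1 w1 fw).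
apply: (@L1_le _ _ _ mu _ _ _ (L1_abs L)); last by move=> t; exact: bool_mul_norm.
exact: measurable_funM (bool_meas (@itv_bmeas R t1)) (L1_meas L).
Qed.

Lemma gint_diff t1 w w' : L1 mu w -> FE w -> L1 mu w' -> FE w' ->
  `|gint t1 w - gint t1 w'| <= (2 * pi)^-1 * (\int[mu]_s a s) * Num.sqrt (EE2 (fun x => w x - w' x)).
Proof.
move=> w1 fw w1' fw'; have G := gint_L1 t1 w1 fw; have G' := gint_L1 t1 w1' fw'.
have d1 := L1B w1 w1'; have fd := FEB w1 w1' fw fw'.
set r := Num.sqrt _; have [_ l F _ _] := D_path.
rewrite /gint -(I_B G G').
have -> : (2 * pi)^-1 * (\int[mu]_s a s) * r = \int[mu]_s ((2 * pi)^-1 * r * a s) by rewrite (I_Z _ aL) mulrAC.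
apply: I_abs_le; [exact: L1B|exact: L1Z|] => s.
have e : EE (D s) w - EE (D s) w' = EE (D s) (fun x => w x - w' x).
  by rewrite !(EE_sym (D s)) (EE_Bl w1 w1' (L12_1 (l s)) fw fw' (F s)).
rewrite -mulrBr -mulrBr e; apply: le_trans (bool_mul_norm _ _) _.
by rewrite normrM ger0_norm// -mulrA; apply: ler_wpM2l => //; exact: ED_bnd.
Qed.

(** [dens] keeps the bound [B], which dominates the pairing with z in L^1, while [gint_diff]
    controls the other side by the energy. *)
Lemma diff_bounded w (B t1 : R) : L1 mu w -> (forall x, `|w x| <= B) -> FE w -> 0 < t1 -> t1 <= T ->
  \int[mu]_x (z t1 x * w x) = - gint t1 w.
Proof.
move=> w1 bw fw t10 t1T.
have [psi_ hp] := choice (fun n => dens w1 bw fw (@hn_gt0 R n)).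
have c1 : \int[mu]_x `|psi_ n x - w x| @[n --> \oo] --> (0 : R).
  apply: (@cvg0_le _ _ _ _ _ (fun n => hn n)); last exact: hn_cvg.
  by move=> n; rewrite ger0_norm ?I_ge0//; have [_ _ _ _ []] := hp n.
have p1 n : L1 mu (psi_ n) by have [] := hp n.
have [s [hs ae]] := L1_subseq_ae p1 w1 c1.
have bp n x : `|psi_ n x| <= B by have [_ h _ _ _] := hp n.
have l1 : \int[mu]_x (z t1 x * psi_ (s n) x) @[n --> \oo] --> \int[mu]_x (z t1 x * w x).
  have [] // := @DCT _ _ _ mu (fun n x => z t1 x * psi_ (s n) x) (fun x => z t1 x * w x) (fun x => B * `|z t1 x|).
  - by move=> n; exact: measurable_funM (L1_meas (z1 t1)) (L1_meas (p1 _)).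
  - exact: measurable_funM (L1_meas (z1 t1)) (L1_meas w1).
  - by apply: ae_imp ae => x h; apply: cvgM => //; exact: cvg_cst.
  - exact: L1Z (L1_abs (z1 t1)).
  - by move=> n x; rewrite normrM mulrC; apply: ler_wpM2r.
have l2 : - gint t1 (psi_ (s n)) @[n --> \oo] --> - gint t1 w.
  apply: cvgN; apply: (@cvg_le _ _ _ _ _ (fun n => (2 * pi)^-1 * (\int[mu]_s a s) * Num.sqrt (hn n))).
    move=> n; have [_ _ q1 fq [eq _]] := hp (s n).
    apply: le_trans (gint_diff t1 q1 fq w1 fw) _; apply: ler_wpM2l.
      by rewrite mulr_ge0//; apply: I_ge0 => x; exact: sqrtr_ge0.
    apply: ler_wsqrtr; apply: le_trans eq _; rewrite /hn lef_pV2 ?posrE ?ltr0Sn// ler_nat ltnS; exact: hs.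
  apply: cvg0_Zl.
  by apply: sqrt_cvg0; exact: hn_cvg.
apply: cvg_uniqR l1 _; have E n : \int[mu]_x (z t1 x * psi_ (s n) x) = - gint t1 (psi_ (s n)).
  by have [q0 q2 q1 fq _] := hp (s n); exact: diff_smooth q0 q2 q1 fq t10 t1T.
by rewrite (eq_cvg _ _ E).
Qed.

(** z D is not known to be integrable; clipping D at 1 makes the product integrable and keeps its
    zeros. *)
Let y (t : R) := \int[mu]_x (z t x * clip 1 (D t x)).

Let G (t : R) := \int[mu]_s ((s < t)%R%:R * kk_ D s t).

Lemma D_ae : {ae mu, forall t, 0 < t < T -> forall x, D t x = lgf (ub u t) x - lgf (ub v t) x}.
Proof.
by apply: ae_imp2 (wg_ae hu T0) (wg_ae hv T0) => t h1 h2 h x; have [_ e1] := h1 h; have [_ e2] := h2 h; rewrite /D e1 e2.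
Qed.

Lemma zD_ge0 t : (forall x, D t x = lgf (ub u t) x - lgf (ub v t) x) -> forall x, 0 <= z t x * D t x.
Proof.
move=> h x; rewrite h mulrC; apply: lg_prod_ge0; [exact: (ub_Lp hu t).2|exact: (ub_Lp hv t).2].
Qed.

(** Clipping D (t) at larger levels only increases the pairing with z; in the equation the clipped
    functions are bounded test functions that converge to D (t) in energy. *)
Lemma y_bnd t : 0 < t < T -> (forall x, D t x = lgf (ub u t) x - lgf (ub v t) x) -> 0 <= y t /\ y t <= - ((2 * pi)^-1 * G t).
Proof.
move=> ht h; have /andP[t0 tT] := ht; have zD := zD_ge0 h; have [_ l F _ o] := D_path.
have Lz (n : nat) : L1 mu (fun x => z t x * clip n%:R (D t x)).
  apply: (bmul_L1 (M := n%:R) (z1 t)); first by apply: clip_meas; exact: L1_meas (L12_1 (l t)).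
  by move=> x; exact: clip_abs.
have y0 : 0 <= y t by apply: I_ge0 => x; have /andP[] := clip_mono (ltn0Sn 0) (zD x).
split => //.
have cF (n : nat) := clip_FE (ler0n R n) (l t) (F t).
have c1 (n : nat) := L12_1 (clip_L12 (ler0n R n) (l t)).
have E n : y t <= - gint t (fun x => clip n.+1%:R (D t x)).
  rewrite -(diff_bounded (c1 n.+1) (fun x => clip_abs (D t x) (ler0n R n.+1)) (cF n.+1).1 t0 (ltW tT)).
  apply: I_le; [exact: (Lz 1%N)|exact: Lz|] => x.
  by have /andP[] := clip_mono (ltn0Sn n) (zD x).
have GE : (2 * pi)^-1 * G t = gint t (D t).
  have L : L1 mu (fun s => (s < t)%R%:R * kk_ D s t).
    have m := sectx_meas t (measurable_funM (@half_meas R) (kk_meas D_path)).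
    by apply: (@L1_le _ _ _ mu _ _ m (L1_abs (kks_L1 D_path t))) => s; exact: bool_mul_norm.
  rewrite /G -(I_Z _ L); apply: I_ext => s; rewrite mulrCA /kk_.
  have [s0|s0] := boolP (0 < s < T); first by move: s0 => /andP[-> _].
  have -> : EE (D s) (D t) = 0; last by rewrite !mulr0.
  by rewrite (o _ s0) EE_def I_zero// => xi; rewrite hart_0 mulr0 mul0r.
rewrite GE; apply: (@cvg_geC (fun n => - gint t (fun x => clip n.+1%:R (D t x))) _ _ _ E).
apply: cvgN; apply: (@cvg_le _ _ _ _ _ (fun n => (2 * pi)^-1 * (\int[mu]_s a s) * Num.sqrt (EE2 (fun x => clip n.+1%:R (D t x) - D t x)))).
  by move=> n; apply: gint_diff => //; [exact: (cF n.+1).1|exact: L12_1].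
apply: cvg0_Zl.
apply: (@sqrt_cvg0 _ (fun n => EE2 (fun x => clip n.+1%:R (D t x) - D t x))).
have c := clip_EE_cvg (l t) (F t).
by rewrite -(cvg_shiftS (fun n => EE2 (fun x => clip n%:R (D t x) - D t x))) in c.
Qed.

(** [y_bnd] makes [G] nonpositive almost everywhere, while [half_ge0] makes its integral
    nonnegative; so [G] vanishes, and with it [y]. *)
Lemma y_ae0 : {ae mu, forall t, 0 < t < T -> y t = 0}.
Proof.
have [C hC] := D_mass; have G0 := half_ge0 D_path hC; have GL : L1 mu G := L1_I1 (half_L1 D_path).
have p0 := @ipi_gt0 R.
have [_ l F _ o] := D_path.
have Gneg : {ae mu, forall t, G t <= 0}.
  apply: ae_imp D_ae => t h; have [ht|ht] := boolP (0 < t < T).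
    have [y0 /(le_trans y0)] := y_bnd ht (h ht); rewrite oppr_ge0 => k.
    by rewrite -(pmulr_rle0 _ p0).
  rewrite /G I_zero// => s; rewrite /kk_ (o _ ht) EE_def.
  by rewrite I_zero ?mulr0// => xi; rewrite hart_0 mulr0.
have GA := L1_abs GL.
have I0 : \int[mu]_t `|G t| = 0.
  have E : \int[mu]_t `|G t| = - \int[mu]_t G t.
    rewrite -(I_N GL); apply: ae_I; [exact: L1_meas GA|exact: L1_meas (L1N GL)|].
    by apply: ae_imp Gneg => t h; exact: ler0_norm.
  apply/eqP; rewrite eq_le I_ge0 ?andbT// E oppr_le0; exact: G0.
have Gz := I_eq0 GA (fun t => normr_ge0 _) I0.
apply: ae_imp2 Gz D_ae => t /eqP; rewrite normr_eq0 => /eqP g0 h ht.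
have [y0 y1] := y_bnd ht (h ht); rewrite g0 mulr0 oppr0 in y1.
by apply/eqP; rewrite eq_le y0 y1.
Qed.

Lemma z_ae0 : {ae mu, forall t, 0 < t < T -> \int[mu]_x `|z t x| = 0}.
Proof.
have [_ l F _ o] := D_path.
apply: ae_imp2 y_ae0 D_ae => t h1 h2 ht; have yt := h1 ht; have Dt := h2 ht; have zD := zD_ge0 Dt.
have L : L1 mu (fun x => z t x * clip 1 (D t x)).
  apply: (bmul_L1 (M := 1) (z1 t)); first by apply: clip_meas; exact: L1_meas (L12_1 (l t)).
  by move=> x; exact: clip_abs.
have n0 x : 0 <= z t x * clip 1 (D t x) by have /andP[] := clip_mono (ltn0Sn 0) (zD x).
have A := I_eq0 L n0 yt.
have ZA := L1_abs (z1 t).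
transitivity (\int[mu]_x (0 : R)); last exact: I_0.
apply: ae_I; [exact: L1_meas ZA|exact: measurable_cst|].
apply: ae_imp A => x /eqP; rewrite mulf_eq0 => /orP[/eqP ->|/eqP /clip1_eq0]; first by rewrite normr0.
by rewrite Dt => k; rewrite /z (lg_inj ((ub_Lp hu t).2 x) ((ub_Lp hv t).2 x) k) normr0.
Qed.

(** Continuity in L^1 carries the identity from almost every time to each time, with a good time
    just after t supplied by [ae_pick]. *)
Lemma z_all0 t : 0 <= t -> t < T -> {ae mu, forall x, ub u t x = ub v t x}.
Proof.
move=> t0 tT; have ZA s := L1_abs (z1 s).
have I0 : \int[mu]_x `|z t x| = 0.
  apply/eqP; rewrite eq_le I_ge0 ?andbT//; apply/ler_addgt0Pr => e e0; rewrite add0r.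
  have e2 : 0 < e / 2 by rewrite divr_gt0.
  have [d1 p1 h1] := ub_cont hu t e2; have [d2 p2 h2] := ub_cont hv t e2.
  have lt : t < Num.min T (Num.min (t + d1) (t + d2)) by rewrite !lt_min tT !ltrDl p1 p2.
  have [s [/andP[ts]]] := ae_pick z_ae0 lt; rewrite !lt_min => /and3P[sT s1 s2] hs.
  have {}hs := hs (introT andP (conj (le_lt_trans t0 ts) sT)).
  have k1 : `|t - s| < d1 by rewrite ltr0_norm; lra.
  have k2 : `|t - s| < d2 by rewrite ltr0_norm; lra.
  have {}h1 := h1 _ k1; have {}h2 := h2 _ k2.
  have q1 := L1_abs (L1B (ub_Lp hu s).1 (ub_Lp hu t).1); have q2 := L1_abs (L1B (ub_Lp hv s).1 (ub_Lp hv t).1).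
  apply: (@le_trans _ _ (\int[mu]_x `|z s x| + (\int[mu]_x `|ub u s x - ub u t x| + \int[mu]_x `|ub v s x - ub v t x|))).
    rewrite -(I_D q1 q2) -(I_D (ZA s) (L1D q1 q2)); apply: I_le => //; first exact: L1D (ZA s) (L1D q1 q2).
    move=> x; rewrite /z; exact: tri4.
  by rewrite hs add0r; exact: halves_le.
have A := I_eq0 (ZA t) (fun x => normr_ge0 _) I0.
by apply: ae_imp A => x /eqP; rewrite normr_eq0 subr_eq0 => /eqP.
Qed.

End two.

(** Nonnegativity of [Phi] says f <= (1 + f) log (1 + f), so data in X lie in L^1 and have finite
    entropy. *)
Lemma in_X_Lp (f : R -> R) : in_X f -> Lp f /\ L1 mu (fun x => Phi (f x)).
Proof.
move=> [f0 mf hf].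
have ml : mfun (fun x => lg (f x)) by exact: (measurableT_comp (@lg_meas R) mf).
have mg : mfun (fun x => (1 + f x) * lg (f x)).
  by apply: measurable_funM => //; exact: measurable_funD.
have L : L1 mu (fun x => (1 + f x) * lg (f x)).
  by apply/L1_ge0P => // x; rewrite mulr_ge0 ?addr_ge0// lg_ge0.
split; [split => //|].
  apply: (@L1_le _ _ _ mu _ _ mf L) => x; rewrite ger0_norm//.
  by have := Phi_ge0 (f0 x); rewrite /Phi subr_ge0.
apply: (@L1_le _ _ _ mu _ _ (measurable_funB mg mf) L) => x.
by rewrite ger0_norm; [rewrite lerBlDr lerDl|exact: Phi_ge0].
Qed.

End uniqueness.

Theorem theorem2p1 (R : realType) (f : R -> R) (hf : in_X f) :
  exists u : R * R -> R, strong_solution f u /\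
    forall v : R * R -> R, strong_solution f v ->
      forall t : R, 0 <= t ->
        {ae (@lebesgue_measure R), forall x, v (x, t) = u (x, t)}.
Proof.
have [hL hP] := in_X_Lp hf.
have hs := uu_strong_solution hL hP.
exists (uu hL); split => // v [hv _] t t0.
have T0 : 0 < t + 1 by rewrite ltr_wpDl.
have tT : t < t + 1 by rewrite ltrDl.
have := z_all0 hv hs.1 T0 t0 tT; apply: ae_imp => x.
by rewrite /ub max_r.
Qed.
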